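(* Let $A:\partial\Delta\to\mathcal{M}(m\times N,\mathbb{C})$ be a $C^\alpha$ map with $A(\zeta)$ of rank $m$ for every $\zeta\in\partial\Delta$. Let $x\in\Delta$. Then: (a) $W_x=\{c\in\mathbb{C}^N:\mathrm{Re}(\Psi_x(\gamma)c)=0\text{ for every }\gamma\in\mathcal{E}_A\}$; in other words $W_x=\{c\in\mathbb{C}^N:\mathrm{Re}(P(x)c)=0\}$. Consequently $W_x\cap iW_x$ coincides with the kernel of $P(x)$. (b) The real codimension of $W_x$ in $\mathbb{R}^{2N}=\mathbb{C}^N$ is $l$. (c) The complex codimension of $W_x\cap iW_x$ in $\mathbb{C}^N$ is $r$. (d) The complex codimension of $W_x+iW_x$ in $\mathbb{C}^N$ is $l-r$.
   Context: $\Delta=\{\zeta\in\mathbb{C}:|\zeta|<1\}$, $1\le m\le N$. $\alpha=k+\beta$ with $k\ge0$ an integer and $1/2<\beta<1$; $C^\alpha$ denotes maps $k$ times continuously differentiable with $k$-th derivatives Hölder of exponent $\beta$. ''Extends holomorphically to $\overline\Delta$'' means: has a continuous extension to $\overline\Delta$, holomorphic in $\Delta$. $\mathcal{O}^N_\alpha$ is the space of $C^\alpha$ maps $\partial\Delta\to\mathbb{C}^N$ which extend holomorphically to $\overline\Delta$; for $w\in\mathcal{O}^N_\alpha$ and $x\in\overline\Delta$, $w(x)$ denotes the value of the extension. $\mathcal{L}_A=\{w\in\mathcal{O}^N_\alpha:\mathrm{Re}(Aw)=0\text{ on }\partial\Delta\}$ and $W_x=\{w(x):w\in\mathcal{L}_A\}\subset\mathbb{C}^N$.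 $\mathcal{E}_A$ is the real vector space of $\gamma\in C^\alpha(\partial\Delta,\mathbb{R}^m)$ such that $\gamma^tA$ extends holomorphically to $\overline\Delta$; it has finite dimension $d$. $\mathcal{E}_A^{\mathbb{C}}$ is the complex vector space of $\delta\in C^\alpha(\partial\Delta,\mathbb{C}^m)$ with $\mathrm{Re}\,\delta,\mathrm{Im}\,\delta\in\mathcal{E}_A$. For $x\in\overline\Delta$, $\Psi_x:\mathcal{E}_A^{\mathbb{C}}\to\mathbb{C}^N$ sends $\delta$ to the value at $x$ of the holomorphic extension of $\delta^tA$ (a row vector). Fixing a basis $\gamma_1,\dots,\gamma_d$ of $\mathcal{E}_A$ over $\mathbb{R}$, $P(x)$ is the matrix with rows $\Psi_x(\gamma_1),\dots,\Psi_x(\gamma_d)$ (if $\mathcal{E}_A=0$, $P(x)$ is the zero $N\times N$ matrix). $l$ is the real dimension of $\Psi_x(\mathcal{E}_A)$, which is independent of $x\in\Delta$ (so $l=\dim_{\mathbb{R}}\Psi_0(\mathcal{E}_A)$), and $r$ is the complex dimension of $\Psi_x(\mathcal{E}_A^{\mathbb{C}})$, i.e. the rank of $P(x)$, which is independent of $x\in\overline\Delta$ (so $r=\operatorname{rank}P(0)$). *)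

(* Defs.v *)
From HB Require Import structures.
From mathcomp Require Import all_boot all_order all_algebra.
From mathcomp Require Import complex.
From mathcomp Require Import all_classical all_reals all_analysis.
Set Implicit Arguments.
Unset Strict Implicit.
Unset Printing Implicit Defensive.
Import Order.TTheory GRing.Theory Num.Theory.
Import numFieldNormedType.Exports.
Local Open Scope classical_set_scope.
Local Open Scope complex_scope.
Local Open Scope ring_scope.

Definition is_basis (K : fieldType) (V : lmodType K) (S : set V) (n : nat)
    (e : 'I_n -> V) : Prop :=
  (forall a : 'I_n -> K, \sum_i a i *: e i = 0 -> forall i, a i = 0) /\
  S = [set \sum_i a i *: e i | a in [set: 'I_n -> K]].

Definition has_dim (K : fieldType) (V : lmodType K) (S : set V) (n : nat) : Prop :=
  exists e : 'I_n -> V, is_basis S e.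

Definition is_subspace (K : fieldType) (V : lmodType K) (S : set V) : Prop :=
  S 0 /\ forall (a : K) (u v : V), S u -> S v -> S (a *: u + v).

(* The last clause says that the classes of the e i form a basis of V / S. *)
Definition has_codim (K : fieldType) (V : lmodType K) (S : set V) (n : nat) : Prop :=
  is_subspace S /\
  exists e : 'I_n -> V,
    forall v : V, exists! a : 'rV[K]_n, S (v - \sum_i a 0 i *: e i).

Section RestrictionOfScalars.
Context (R : realType) (V : lmodType R[i]).

Definition realified : Type := V.

HB.instance Definition _ := GRing.Zmodule.on realified.

Let scale (a : R) (v : realified) : realified := a%:C *: (v : V).

Let scaleA a b v : scale a (scale b v) = scale (a * b) v.
Proof. by rewrite /scale scalerA rmorphM. Qed.

Let scale1 : left_id 1 scale.
Proof. by move=> v; rewrite /scale rmorph1 scale1r. Qed.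

Let scaleDr : right_distributive scale +%R.
Proof. by move=> a u v; rewrite /scale scalerDr. Qed.

Let scaleDl v : {morph scale^~ v : a b / a + b}.
Proof. by move=> a b; rewrite /scale rmorphD scalerDl. Qed.

HB.instance Definition _ :=
  GRing.Zmodule_isLmodule.Build R realified scaleA scale1 scaleDr scaleDl.
End RestrictionOfScalars.

Definition circle (R : realType) : Type := {z : R[i] | `|z| == 1}.

Lemma norm_expi (R : realType) (t : R) : `|cos t +i* sin t| == 1.
Proof. by rewrite normc_def /= cos2Dsin2 sqrtr1. Qed.

Definition expi (R : realType) (t : R) : circle R :=
  exist (fun z : R[i] => `|z| == 1) (cos t +i* sin t) (norm_expi t).

(* Regularity on the circle is measured in the angular variable; since g o expi
   is 2 pi-periodic, a Hoelder estimate in the angle over all of R is equivalent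
   to one for the chordal distance on the circle. *)
Definition Calpha (R : realType) (k : nat) (beta : R) (g : circle R -> R) : Prop :=
  let h : R -> R := g \o @expi R in
  [/\ forall j : nat, (j < k)%N -> forall t : R, derivable (derive1n j h) t 1,
      continuous (derive1n k h)
    & exists M : R, forall s t : R,
        `|derive1n k h s - derive1n k h t| <= M * `|s - t| `^ beta].

Section Maps.
Context (R : realType) (p q : nat).
Local Notation C := R[i].

Definition Calpha_rmx (k : nat) (beta : R) (f : circle R -> 'M[R]_(p, q)) : Prop :=
  forall i j, Calpha k beta (fun z => f z i j).

Definition ReM (f : circle R -> 'M[C]_(p, q)) : circle R -> 'M[R]_(p, q) :=
  fun z => map_mx (@complex.Re R) (f z).

Definition ImM (f : circle R -> 'M[C]_(p, q)) : circle R -> 'M[R]_(p, q) :=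
  fun z => map_mx (@complex.Im R) (f z).

Definition cplx (f : circle R -> 'M[R]_(p, q)) : circle R -> 'M[C]_(p, q) :=
  fun z => map_mx (real_complex R) (f z).

Definition Calpha_cmx (k : nat) (beta : R) (f : circle R -> 'M[C]_(p, q)) : Prop :=
  Calpha_rmx k beta (ReM f) /\ Calpha_rmx k beta (ImM f).

(* The values of F outside the closed disc are irrelevant.  The alias C^o
   carries the topology of C as a normed space over itself, so that derivable
   means complex differentiable. *)
Definition is_hol_extension (f : circle R -> 'M[C]_(p, q))
    (F : C -> 'M[C]_(p, q)) : Prop :=
  [/\ forall z : circle R, F (sval z) = f z,
      forall i j, {within [set z : C^o | `|z| <= 1],
                     continuous (fun z : C^o => F z i j : C^o)}
    & forall i j (z : C^o), `|z| < 1 ->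
        derivable (fun z : C^o => F z i j : C^o) z 1].

Definition extends_hol (f : circle R -> 'M[C]_(p, q)) : Prop :=
  exists F, is_hol_extension f F.

(* Meaningful when extends_hol f and `|x| <= 1; the value is then unique by
   the maximum principle. *)
Definition hol_value (f : circle R -> 'M[C]_(p, q)) (x : C) : 'M[C]_(p, q) :=
  xget (fun=> 0) [set F | is_hol_extension f F] x.
End Maps.

Section RiemannHilbert.
Context (R : realType) (m N : nat) (k : nat) (beta : R).
Context (A : circle R -> 'M[R[i]]_(m, N)).
Local Notation C := R[i].

Definition Oalpha : set (circle R -> 'cV[C]_N) :=
  [set w | Calpha_cmx k beta w /\ extends_hol w].

Definition LA : set (circle R -> 'cV[C]_N) :=
  [set w | Oalpha w /\
           forall z : circle R, map_mx (@complex.Re R) (A z *m w z) = 0].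

Definition Wset (x : C) : set 'cV[C]_N := [set hol_value w x | w in LA].

Definition EA : set (circle R -> 'cV[R]_m) :=
  [set g | Calpha_rmx k beta g /\
           extends_hol (fun z => (cplx g z)^T *m A z)].

Definition EAC : set (circle R -> 'cV[C]_m) :=
  [set d | [/\ Calpha_cmx k beta d, EA (ReM d) & EA (ImM d)]].

Definition Psi (x : C) (d : circle R -> 'cV[C]_m) : 'rV[C]_N :=
  hol_value (fun z => (d z)^T *m A z) x.

(* For d = 0 this is the empty matrix, which has the same kernel and rank as
   the zero N x N matrix. *)
Definition Pmx (d : nat) (g : 'I_d -> circle R -> 'cV[R]_m) (x : C) : 'M[C]_(d, N) :=
  \matrix_(j < d) Psi x (cplx (g j)).

Definition PsiE (x : C) : set 'rV[C]_N := [set Psi x (cplx g) | g in EA].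

Definition PsiEC (x : C) : set 'rV[C]_N := [set Psi x d | d in EAC].
End RiemannHilbert.

Definition imul (R : realType) (N : nat) (S : set 'cV[R[i]]_N) : set 'cV[R[i]]_N :=
  [set (0 +i* 1) *: c | c in S].

Definition sumset (V : zmodType) (S T : set V) : set V :=
  [set u + v | u in S & v in T].

Definition real_dim (R : realType) (V : lmodType R[i]) (S : set V) (n : nat) : Prop :=
  @has_dim R (realified V) S n.

Definition real_codim (R : realType) (V : lmodType R[i]) (S : set V) (n : nat) : Prop :=
  @has_codim R (realified V) S n.

(* Main.v *)
Require Import Defs.
From HB Require Import structures.
From mathcomp Require Import all_boot all_order all_algebra.
From mathcomp Require Import complex.
From mathcomp Require Import all_classical all_reals all_analysis.
From mathcomp Require Import ring lra zify.
Import Order.TTheory GRing.Theory Num.Theory.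
Import numFieldNormedType.Exports.
Set Implicit Arguments.
Unset Strict Implicit.
Unset Printing Implicit Defensive.
Local Open Scope classical_set_scope.
Local Open Scope complex_scope.
Local Open Scope ring_scope.

(* The inclusion of W_x in the orthogonal space is the mean value property of
   the holomorphic function gamma^t A w, whose real part vanishes on the circle.
   Conversely, for c orthogonal to Psi_x(E_A) one looks for w = c + (zeta - x) v,
   that is, one solves Re (B v) = - Re (A c) with B = (zeta - x) A and v
   holomorphic. This real-linear operator has a right parametrix built from the
   Riesz projection and a right inverse of B; its remainder is a finite rank
   operator plus one of small norm, so the range is the annihilator of the real
   psi for which psi^t B has only positive frequencies. For such psi the function
   |zeta - x|^2 psi lies in E_A and the pairing of psi with Re (A c) is a positive
   multiple of Re (Psi_x(|zeta - x|^2 psi) c), so solvability follows.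
   Hoelder classes are handled through approximation by trigonometric
   polynomials: C^(k+beta) consists of the functions approximated at rate
   2^(-j(k+beta)) in degree 2^j.

   The ranks do not depend on x because multiplication by 1 - x conj(zeta) maps
   the kernel of Psi_0 on E_A^C isomorphically to the kernel of Psi_x, and
   |1 - x conj(zeta)|^2 does the same on E_A. The codimensions are then linear
   algebra: if E has R-independent rows and W = {Re (E c) = 0}, then
   W + iW = {conj(Z) E c = 0}, where the rows of Z span the left kernel of E. *)

(** Trigonometric polynomials are not dense in a Hoelder class, so the right inverse of B cannot be
    approximated by them in the norm of the class. This is why the Fredholm part carries two rates
    [q] < [q']: the tail of the right inverse is small only in the weaker norm of rate [q'];
    equations are solved there, and the solutions return to rate [q] because Hankel operators, and
    commutators with the Riesz projection, take functions of rate [q'] to the rate of their symbol.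
    No duality of Banach spaces is invoked: an explicit formula puts every datum in the range up to
    a correction in one fixed finite-dimensional space, and separation in finite dimension does the
    work of a closed range theorem. No integral appears either: means over the circle are limits of
    averages over roots of unity of order 2^J, and Cauchy's theorem is proved for trapezoidal sums.
    The Riesz projection is unbounded in the uniform norm but uniformly bounded on dyadic blocks of
    frequencies; geometric rates sum these blocks. *)

Section ComplexModulus.
Context (R : realType).
Local Notation C := R[i].
Implicit Types (z w : C).

(** The norm of [R[i]] takes its values in [R[i]], which is only partially ordered; a real-valued
    modulus lets estimates be closed by real arithmetic. *)
Definition cabs (z : C) : R := complex.Re `|z|.

Lemma cabsE z : `|z| = (cabs z)%:C.
Proof. by rewrite /cabs normc_def. Qed.

Lemma cabs_le z (M : R) : (`|z| <= M%:C) = (cabs z <= M).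
Proof. by rewrite cabsE lecR. Qed.

Lemma cabs_lt z (M : R) : (`|z| < M%:C) = (cabs z < M).
Proof. by rewrite cabsE ltcR. Qed.

Lemma cabs_ge0 z : 0 <= cabs z.
Proof. by rewrite -lecR -cabsE; exact: normr_ge0. Qed.

Lemma cabs0 : cabs (0 : C) = 0.
Proof. by apply: complexI; rewrite -cabsE normr0. Qed.

Lemma cabs1 : cabs (1 : C) = 1.
Proof. by apply: complexI; rewrite -cabsE normr1. Qed.

Lemma cabs_eq0 z : cabs z = 0 -> z = 0.
Proof. by move=> h; apply/eqP; rewrite -normr_eq0 cabsE h. Qed.

Lemma cabsD z w : cabs (z + w) <= cabs z + cabs w.
Proof. by rewrite -lecR rmorphD -!cabsE; exact: ler_normD. Qed.

Lemma cabsN z : cabs (- z) = cabs z.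
Proof. by apply: complexI; rewrite -!cabsE normrN. Qed.

Lemma cabsB z w : cabs (z - w) <= cabs z + cabs w.
Proof. by rewrite -(cabsN w) cabsD. Qed.

Lemma cabsC z w : cabs (z - w) = cabs (w - z).
Proof. by rewrite -cabsN opprB. Qed.

Lemma cabs_tri w z v : cabs (z - v) <= cabs (z - w) + cabs (w - v).
Proof. by rewrite -[X in cabs X](_ : (z - w) + (w - v) = _) ?cabsD // addrA subrK. Qed.

Lemma cabsM z w : cabs (z * w) = cabs z * cabs w.
Proof. by apply: complexI; rewrite rmorphM -!cabsE normrM. Qed.

Lemma cabsX z n : cabs (z ^+ n) = cabs z ^+ n.
Proof. by apply: complexI; rewrite rmorphXn -!cabsE normrX. Qed.

Lemma cabsV z : cabs z^-1 = (cabs z)^-1.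
Proof. by apply: complexI; rewrite fmorphV -!cabsE normfV. Qed.

Lemma cabs_real (x : R) : cabs x%:C = `|x|.
Proof. by rewrite /cabs normc_def /= expr0n addr0 sqrtr_sqr. Qed.

Lemma cabs_nat n : cabs (n%:R : C) = n%:R.
Proof. by rewrite -(rmorph_nat (real_complex R)) cabs_real ger0_norm. Qed.

Lemma cabs_conj z : cabs (conjc z) = cabs z.
Proof. by apply: complexI; rewrite -!cabsE normcJ. Qed.

Lemma cabs_sum (I : Type) (r : seq I) (P : pred I) (F : I -> C) :
  cabs (\sum_(i <- r | P i) F i) <= \sum_(i <- r | P i) cabs (F i).
Proof.
elim/big_ind2 : _ => //; first by rewrite cabs0.
by move=> a b c d ab cd; rewrite (le_trans (cabsD _ _)) // lerD.
Qed.

Lemma le_Re_cabs z : `|complex.Re z| <= cabs z.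
Proof. by rewrite -lecR -cabsE; exact: normc_ge_Re. Qed.

Lemma le_Im_cabs z : `|complex.Im z| <= cabs z.
Proof.
have := le_Re_cabs (z * 'i%C); rewrite ReiNIm normrN => /le_trans; apply.
by rewrite cabsM (_ : cabs 'i%C = 1) ?mulr1 // /cabs normc_def /= expr0n add0r expr1n sqrtr1.
Qed.

Lemma cabs_le_ReIm z : cabs z <= `|complex.Re z| + `|complex.Im z|.
Proof.
rewrite {1}(complexE z) (le_trans (cabsD _ _)) // cabsM !cabs_real.
by rewrite (_ : cabs 'i%C = 1) ?mul1r // /cabs normc_def /= expr0n add0r expr1n sqrtr1.
Qed.

(** Most identities between limits below are obtained in this way, from arbitrarily small bounds on
    a difference. *)
Lemma cabs_tiny z : (forall e : R, 0 < e -> cabs z <= e) -> z = 0.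
Proof.
move=> h; apply: cabs_eq0; apply/eqP; rewrite eq_le cabs_ge0 andbT.
by apply/ler_addgt0Pr => e e0; rewrite add0r h.
Qed.

Lemma cabs_sqr z : ((cabs z) ^+ 2)%:C = z * conjc z.
Proof. by rewrite rmorphXn /= -cabsE sqr_normc. Qed.

End ComplexModulus.

(** * Limits of complex sequences *)

Section Limits.
Context (R : realType).
Local Notation C := R[i].
Implicit Types (u v : nat -> C).

Definition is_clim u (l : C) : Prop :=
  forall e : R, 0 < e -> exists J, forall j, (J <= j)%N -> cabs (u j - l) <= e.

Definition clim u : C := xget 0 [set l | is_clim u l].

Lemma is_clim_unique u l l' : is_clim u l -> is_clim u l' -> l = l'.
Proof.
move=> ul ul'; apply/eqP; rewrite -subr_eq0; apply/eqP/cabs_tiny => e e0.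
have e2 : 0 < e / 2 by rewrite divr_gt0.
have [J HJ] := ul _ e2; have [J' HJ'] := ul' _ e2.
have /HJ h1 := leq_maxl J J'; have /HJ' h2 := leq_maxr J J'.
rewrite (le_trans (cabs_tri (u (maxn J J')) _ _)) // cabsC [leRHS]splitr.
exact: lerD.
Qed.

Lemma climP u l : is_clim u l -> clim u = l.
Proof.
move=> ul; rewrite /clim; case: xgetP => [x _ /= h|h]; last by case: (h l).
exact: is_clim_unique h ul.
Qed.

Lemma is_climD u v l l' : is_clim u l -> is_clim v l' ->
  is_clim (fun j => u j + v j) (l + l').
Proof.
move=> ul ul' e e0.
have e2 : 0 < e / 2 by rewrite divr_gt0.
have [J HJ] := ul _ e2; have [J' HJ'] := ul' _ e2.
exists (maxn J J') => j; rewrite geq_max => /andP[/HJ h1 /HJ' h2].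
by rewrite opprD addrACA (le_trans (cabsD _ _)) // [leRHS]splitr lerD.
Qed.

Lemma is_climZ (a : C) u l : is_clim u l -> is_clim (fun j => a * u j) (a * l).
Proof.
move=> ul e e0.
have a1 : 0 < cabs a + 1 by rewrite ltr_wpDl ?cabs_ge0.
have [J HJ] := ul (e / (cabs a + 1)) (divr_gt0 e0 a1).
exists J => j /HJ h; rewrite -mulrBr cabsM.
rewrite (@le_trans _ _ ((cabs a + 1) * (e / (cabs a + 1)))) //.
  by rewrite ler_pM ?cabs_ge0 // lerDl.
by rewrite mulrCA divff ?mulr1 // gt_eqF.
Qed.

Lemma is_clim_conj u l : is_clim u l -> is_clim (fun j => conjc (u j)) (conjc l).
Proof. by move=> ul e /ul [J HJ]; exists J => j /HJ; rewrite -rmorphB cabs_conj. Qed.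

Lemma is_clim_bound u l (M : R) :
  is_clim u l -> (forall j, cabs (u j) <= M) -> cabs l <= M.
Proof.
move=> ul uM; apply/ler_addgt0Pr => e /ul [J /(_ _ (leqnn J)) h].
by rewrite -(subrK (u J) l) (le_trans (cabsD _ _)) // addrC cabsC lerD.
Qed.

Lemma real_cauchy_lim (f : nat -> R) :
  (forall e, 0 < e -> exists J, forall i j, (J <= i)%N -> (J <= j)%N ->
     `|f i - f j| <= e) ->
  exists l, forall e, 0 < e -> exists J, forall j, (J <= j)%N -> `|f j - l| <= e.
Proof.
move=> h; have /cauchy_cvgP/cvg_ex[l /= fl] : cauchy (f @ \oo).
  apply/cauchy_ballP => e e0; have [J HJ] := h _ (divr_gt0 e0 (ltr0n _ 2)).
  near=> x => /=; rewrite /ball /=; near: x.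
  exists ([set f j | j in [set j | J <= j]%N], [set f j | j in [set j | J <= j]%N]).
    by split; exists J => // j /= Jj; exists j.
  move=> [a b] /= [[i Ji <-] [j Jj <-]].
  by rewrite (le_lt_trans (HJ _ _ Ji Jj)) // ltr_pdivrMr // ltr_pMr // ltr1n.
exists l => e e0; move/cvgrPdist_le : fl => /(_ e e0)[J _ HJ].
by exists J => j /HJ; rewrite distrC.
Unshelve. all: by end_near. Qed.

Lemma cauchy_clim u :
  (forall e, 0 < e -> exists J, forall i j, (J <= i)%N -> (J <= j)%N ->
     cabs (u i - u j) <= e) -> exists l, is_clim u l.
Proof.
move=> h.
have [|a ha] := @real_cauchy_lim (fun j => complex.Re (u j)).
  move=> e /h [J HJ]; exists J => i j Ji Jj.
  by rewrite (le_trans _ (HJ i j Ji Jj)) // -raddfB le_Re_cabs.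
have [|b hb] := @real_cauchy_lim (fun j => complex.Im (u j)).
  move=> e /h [J HJ]; exists J => i j Ji Jj.
  by rewrite (le_trans _ (HJ i j Ji Jj)) // -raddfB le_Im_cabs.
exists (a +i* b) => e e0.
have e2 : 0 < e / 2 by rewrite divr_gt0.
have [J HJ] := ha _ e2; have [J' HJ'] := hb _ e2.
exists (maxn J J') => j; rewrite geq_max => /andP[/HJ h1 /HJ' h2].
by rewrite (le_trans (cabs_le_ReIm _)) // !raddfB /= [leRHS]splitr lerD.
Qed.

End Limits.

(** * Trigonometric polynomials and Fourier coefficients *)

Section Exponentials.
Context (R : realType).
Local Notation C := R[i].

Lemma twopi_gt0 : 0 < pi *+ 2 :> R.
Proof. by rewrite pmulrn_lgt0 // pi_gt0. Qed.

Definition ei (t : R) : C := cos t +i* sin t.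

Lemma ei0 : ei 0 = 1.
Proof. by rewrite /ei cos0 sin0. Qed.

Lemma eiD s t : ei (s + t) = ei s * ei t.
Proof. by rewrite /ei cosD sinD; simpc; congr (_ +i* _); ring. Qed.

Lemma eiN t : ei (- t) = conjc (ei t).
Proof. by rewrite /ei cosN sinN. Qed.

Lemma cabs_ei t : cabs (ei t) = 1.
Proof. by rewrite /cabs normc_def /= cos2Dsin2 sqrtr1. Qed.

Lemma ei_neq0 t : ei t != 0.
Proof. by apply/eqP => h; have := cabs_ei t; rewrite h cabs0 => /eqP; rewrite eq_sym oner_eq0. Qed.

Lemma eiNV t : ei (- t) = (ei t)^-1.
Proof. by apply: (mulfI (ei_neq0 t)); rewrite -eiD subrr ei0 divff // ei_neq0. Qed.

Lemma eiX t n : ei t ^+ n = ei (n%:R * t).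
Proof.
elim: n => [|n IH]; first by rewrite mul0r ei0.
by rewrite exprS IH -eiD -natr1 mulrDl mul1r addrC.
Qed.

Lemma ei2pi : ei (pi *+ 2) = 1.
Proof. by rewrite /ei cos2pi sin2pi. Qed.

Lemma ei_nat2pi n : ei (n%:R * (pi *+ 2)) = 1.
Proof. by rewrite -eiX ei2pi expr1n. Qed.

Lemma ei_neq1 t : 0 < t < pi *+ 2 -> ei t != 1.
Proof.
move=> /andP[t0 t2]; apply/eqP => -[ct _].
(* The half angle lies strictly between 0 and pi, and 1 - cos t = 2 sin^2 (t / 2). *)
have : 0 < sin (t / 2) by rewrite sin_gt0_pi // divr_gt0 //= ltr_pdivrMr // mulr_natr.
have : cos (t / 2 + t / 2) = 1 by rewrite -splitr.
rewrite cosD -expr2 cos2sin2 => h s0.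
have : sin (t / 2) ^+ 2 = 0 by lra.
by move/eqP; rewrite expf_eq0 /= gt_eqF.
Qed.

Definition ek (k : int) (t : R) : C := ei (k%:~R * t).

Lemma ek0 t : ek 0 t = 1.
Proof. by rewrite /ek mul0r ei0. Qed.

Lemma ekD a b t : ek (a + b) t = ek a t * ek b t.
Proof. by rewrite /ek rmorphD mulrDl eiD. Qed.

Lemma ekN a t : ek (- a) t = conjc (ek a t).
Proof. by rewrite /ek rmorphN mulNr eiN. Qed.

Lemma ekVM a t : ek a t * ek (- a) t = 1.
Proof. by rewrite -ekD subrr ek0. Qed.

Lemma ek_trans a s t : ek a (s + t) = ek a s * ek a t.
Proof. by rewrite /ek mulrDr eiD. Qed.

Lemma cabs_ek a t : cabs (ek a t) = 1.
Proof. exact: cabs_ei. Qed.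

Lemma ek_nat (n : nat) t : ek n%:Z t = ei t ^+ n.
Proof. by rewrite eiX. Qed.

(* Riemann sums replace the integral over the circle: they are exact on
   trigonometric polynomials of degree below N. *)
Definition avg (N : nat) (h : R -> C) : C :=
  N%:R^-1 * \sum_(s < N) h (s%:R * (pi *+ 2) / N%:R).

Lemma avg_bound N h (M : R) : (0 < N)%N ->
  (forall t, cabs (h t) <= M) -> cabs (avg N h) <= M.
Proof.
move=> N0 hM; rewrite /avg cabsM cabsV cabs_nat ler_pdivrMl ?ltr0n //.
rewrite (le_trans (cabs_sum _ _ _)) // (@le_trans _ _ (\sum_(s < N) M)) //.
  exact: ler_sum.
by rewrite sumr_const card_ord mulr_natl.
Qed.

Lemma avgD N g h : avg N (fun t => g t + h t) = avg N g + avg N h.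
Proof. by rewrite /avg big_split mulrDr. Qed.

Lemma avgZ N a h : avg N (fun t => a * h t) = a * avg N h.
Proof. by rewrite /avg -mulr_sumr mulrCA. Qed.

Lemma avg_sum N (I : Type) (r : seq I) (P : pred I) (F : I -> R -> C) :
  avg N (fun t => \sum_(i <- r | P i) F i t) = \sum_(i <- r | P i) avg N (F i).
Proof. by rewrite /avg exchange_big /= mulr_sumr. Qed.

Lemma avg_conj N h : avg N (fun t => conjc (h t)) = conjc (avg N h).
Proof. by rewrite /avg rmorphM fmorphV rmorph_nat rmorph_sum. Qed.

Lemma eq_avg N g h : g =1 h -> avg N g = avg N h.
Proof. by move=> gh; rewrite /avg; congr (_ * _); apply: eq_bigr => i _. Qed.

Lemma avg_cst N (c : C) : (0 < N)%N -> avg N (fun=> c) = c.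
Proof.
move=> N0; rewrite /avg sumr_const card_ord -[c *+ N]mulr_natl mulKf //.
by rewrite pnatr_eq0 -lt0n.
Qed.

(** The samples of [ek k] are the powers of an N-th root of unity, which differs from 1 when 0 < |k|
    < N, so that the geometric sum vanishes. *)
Lemma avg_ek N (k : int) : (`|k| < N)%N -> avg N (ek k) = (k == 0)%:R.
Proof.
move=> kN; have N0 : (0 < N)%N by apply: leq_ltn_trans kN.
have NR : (N%:R : R) != 0 by rewrite pnatr_eq0 -lt0n.
case: (eqVneq k 0) => [->|k0].
  by rewrite (eq_avg N (h := fun=> 1)) ?avg_cst // => t; rewrite ek0.
pose w := ei (k%:~R * (pi *+ 2) / N%:R).
have Ew s : ek k (s%:R * (pi *+ 2) / N%:R) = w ^+ s.
  by rewrite /w eiX /ek; congr ei; ring.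
have wN : w ^+ N = 1.
  rewrite /w eiX mulrC divfK //.
  by case: (k) => n; rewrite ?NegzE ?rmorphN ?mulNr ?eiN ei_nat2pi ?conjc1.
have w1 : w != 1.
  have pos n : (0 < n)%N -> (n < N)%N -> ei (n%:R * (pi *+ 2) / N%:R) != 1.
    move=> n0 nN; apply: ei_neq1; rewrite divr_gt0 ?mulr_gt0 ?ltr0n ?twopi_gt0 //=.
    by rewrite ltr_pdivrMr ?ltr0n // mulrC ltr_pM2l ?ltr_nat ?twopi_gt0.
  move: k0 kN; rewrite /w; case: (k) => n n0 nN; first by rewrite pos // lt0n.
  have := pos n.+1 isT nN; apply: contraNneq => h; apply/eqP.
  by rewrite -[LHS]conjcK -eiN -mulNr -mulNr -conjc1 -h NegzE rmorphN.
rewrite /avg (eq_bigr (fun s : 'I_N => w ^+ s)); last by move=> s _; rewrite Ew.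
have := subrX1 w N; rewrite wN subrr => /esym/eqP.
by rewrite mulf_eq0 subr_eq0 (negbTE w1) /= => /eqP ->; rewrite mulr0.
Qed.

End Exponentials.
Arguments ei : simpl never.
Arguments ek : simpl never.

Section TrigPoly.
Context (R : realType).
Local Notation C := R[i].
Implicit Types (h g T : R -> C).

Definition isum (n : nat) (F : int -> C) : C := \sum_(i < n.*2.+1) F (i%:Z - n%:Z).

Lemma eq_isum n F G : (forall k, (`|k| <= n)%N -> F k = G k) -> isum n F = isum n G.
Proof. by move=> FG; apply: eq_bigr => i _; apply: FG; have := ltn_ord i; lia. Qed.

Lemma isumD n F G : isum n (fun k => F k + G k) = isum n F + isum n G.
Proof. exact: big_split. Qed.

Lemma isumZ n a F : isum n (fun k => a * F k) = a * isum n F.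
Proof. by rewrite /isum mulr_sumr. Qed.

Lemma isum0 n F : (forall k, (`|k| <= n)%N -> F k = 0) -> isum n F = 0.
Proof. by move=> F0; apply: big1 => i _; apply: F0; have := ltn_ord i; lia. Qed.

Lemma isum_pick n (k : int) F : isum n (fun j => (j == k)%:R * F j) = (`|k| <= n)%N%:R * F k.
Proof.
case: leqP => kn; last first.
  rewrite mul0r isum0 // => j jn; case: eqVneq => [jk|]; last by rewrite mul0r.
  by move: jn; rewrite jk leqNgt kn.
have hi : (absz (k + n%:Z)%R < n.*2.+1)%N by lia.
rewrite /isum (bigD1 (Ordinal hi)) //= (_ : (absz (k + n%:Z)%R)%:Z - n%:Z = k); last by lia.
rewrite eqxx /= !mul1r big1 ?addr0 // => i /eqP ih.
rewrite (_ : (_ == k) = false) ?mul0r //; apply/negP => /eqP ik; apply: ih; apply: val_inj => /=.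
by move: ik; lia.
Qed.

(** Trigonometric polynomials of degree at most [n]. The coefficient function is left existential;
    [tp_coefE] later recovers it as [coef T]. *)
Definition tp n T : Prop := exists c : int -> C, forall t, T t = isum n (fun k => c k * ek k t).

Lemma tpD n T T' : tp n T -> tp n T' -> tp n (fun t => T t + T' t).
Proof.
move=> [c Tc] [c' Tc']; exists (fun k => c k + c' k) => t.
by rewrite Tc Tc' -isumD; apply: eq_isum => k _; rewrite mulrDl.
Qed.

Lemma tpZ n a T : tp n T -> tp n (fun t => a * T t).
Proof.
move=> [c Tc]; exists (fun k => a * c k) => t.
by rewrite Tc -isumZ; apply: eq_isum => k _; rewrite mulrA.
Qed.

Lemma tpB n T T' : tp n T -> tp n T' -> tp n (fun t => T t - T' t).
Proof.
move=> hT hT'; have [c e] := tpD hT (tpZ (-1) hT').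
by exists c => t; rewrite -e mulN1r.
Qed.

Lemma tp0 n : tp n (fun=> 0).
Proof. by exists (fun=> 0) => t; rewrite isum0 // => k _; rewrite mul0r. Qed.

Lemma tp_sum n (I : Type) (r : seq I) (P : pred I) (F : I -> R -> C) :
  (forall i, P i -> tp n (F i)) -> tp n (fun t => \sum_(i <- r | P i) F i t).
Proof.
move=> hF; elim: r => [|i r [c hc]].
  by have [c hc] := tp0 n; exists c => t; rewrite big_nil -hc.
case Pi : (P i); last by exists c => t; rewrite big_cons Pi.
have [c' hc'] := tpD (hF i Pi) (ex_intro _ c hc : tp n _).
by exists c' => t; rewrite big_cons Pi -hc'.
Qed.

Lemma tp_ek n k : (`|k| <= n)%N -> tp n (ek k).
Proof.
move=> kn; exists (fun j => (j == k)%:R) => t.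
by rewrite isum_pick kn mul1r.
Qed.

Lemma eq_tp n T T' : T =1 T' -> tp n T -> tp n T'.
Proof. by move=> TT' [c hc]; exists c => t; rewrite -TT'. Qed.

Lemma tp_isum n m (F : int -> R -> C) : (forall k, (`|k| <= m)%N -> tp n (F k)) ->
  tp n (fun t => isum m (fun k => F k t)).
Proof. by move=> hF; apply: tp_sum => i _; apply: hF; have := ltn_ord i; lia. Qed.

Lemma tp_le n m T : (n <= m)%N -> tp n T -> tp m T.
Proof.
move=> nm [c hc]; apply: (eq_tp (fun t => esym (hc t))).
apply: (@tp_isum m n (fun k t => c k * ek k t)) => k kn.
by apply: tpZ; apply: tp_ek; lia.
Qed.

Lemma tpM n m T S : tp n T -> tp m S -> tp (n + m) (fun t => T t * S t).
Proof.
move=> [c hc] [d hd].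
have e t : T t * S t = isum n (fun k => isum m (fun l => c k * d l * ek (k + l) t)).
  rewrite hc hd [LHS]mulr_suml; apply: eq_bigr => i _; rewrite -isumZ.
  by apply: eq_isum => l _; rewrite (ekD _ l) mulrACA.
apply: (eq_tp (fun t => esym (e t))).
apply: (@tp_isum _ _ (fun k t => isum m (fun l => c k * d l * ek (k + l) t))) => k kn.
apply: (@tp_isum _ _ (fun l t => c k * d l * ek (k + l) t)) => l lm.
by apply: tpZ; apply: tp_ek; lia.
Qed.

Lemma tp_conj n T : tp n T -> tp n (fun t => conjc (T t)).
Proof.
move=> [c hc].
have e t : conjc (T t) = isum n (fun k => conjc (c k) * ek (- k) t).
  by rewrite hc rmorph_sum; apply: eq_bigr => i _; rewrite rmorphM ekN.
apply: (eq_tp (fun t => esym (e t))).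
apply: (@tp_isum _ _ (fun k t => conjc (c k) * ek (- k) t)) => k kn.
by apply: tpZ; apply: tp_ek; lia.
Qed.

Lemma tp_cst n a : tp n (fun=> a).
Proof.
apply: (@eq_tp _ (fun t => a * ek 0 t)) => [t|]; first by rewrite ek0 mulr1.
by apply: tpZ; apply: tp_ek.
Qed.

(** By the Weierstrass theorem these are the continuous functions of period 2 pi. Taken as a
    definition, the class has Fourier coefficients by finite averages alone. *)
Definition tlim h := forall e : R, 0 < e ->
  exists n T, tp n T /\ forall t, cabs (h t - T t) <= e.

Lemma tp_tlim n T : tp n T -> tlim T.
Proof. by move=> hT e e0; exists n, T; split=> // t; rewrite subrr cabs0 ltW. Qed.

Lemma tp_bounded n T : tp n T -> exists M, forall t, cabs (T t) <= M.
Proof.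
move=> [c hc]; exists (\sum_(i < n.*2.+1) cabs (c (i%:Z - n%:Z))) => t.
rewrite hc (le_trans (cabs_sum _ _ _)) // ler_sum // => i _.
by rewrite cabsM cabs_ek mulr1.
Qed.

Lemma tlim_bounded h : tlim h -> exists M, forall t, cabs (h t) <= M.
Proof.
move=> /(_ 1 ltr01)[n [T [/tp_bounded[M hM] hT]]]; exists (1 + M) => t.
by rewrite -(subrK (T t) (h t)) (le_trans (cabsD _ _)) // lerD.
Qed.

Lemma tlimD g h : tlim g -> tlim h -> tlim (fun t => g t + h t).
Proof.
move=> hg hh e e0; have e2 : 0 < e / 2 by rewrite divr_gt0.
have [n [T [hT gT]]] := hg _ e2; have [m [S [hS gS]]] := hh _ e2.
exists (n + m)%N, (fun t => T t + S t); split.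
  by apply: tpD; [apply: tp_le hT; rewrite leq_addr|apply: tp_le hS; rewrite leq_addl].
by move=> t; rewrite opprD addrACA (le_trans (cabsD _ _)) // [leRHS]splitr lerD.
Qed.

Lemma tlimM g h : tlim g -> tlim h -> tlim (fun t => g t * h t).
Proof.
move=> hg hh e e0.
have [Mg hMg] := tlim_bounded hg; have [Mh hMh] := tlim_bounded hh.
have Mg0 : 0 <= Mg := le_trans (cabs_ge0 _) (hMg 0).
have Mh0 : 0 <= Mh := le_trans (cabs_ge0 _) (hMh 0).
(* The bound 1 on [d] makes the product of the two errors at most [d], so that all three error terms
   are linear in [d]. *)
pose d := Num.min 1 (e / (Mg + Mh + 1)).
have D0 : 0 < Mg + Mh + 1 by lra.
have d0 : 0 < d by rewrite lt_min ltr01 divr_gt0.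
have d1 : d <= 1 by rewrite ge_min lexx.
have d2 : d * (Mg + Mh + 1) <= e by rewrite -ler_pdivlMr // ge_min lexx orbT.
have [n [T [hT gT]]] := hg _ d0; have [m [S [hS gS]]] := hh _ d0.
exists (n + m)%N, (fun t => T t * S t); split; first exact: tpM.
move=> t; rewrite (_ : _ - _ = (g t - T t) * h t + g t * (h t - S t) - (g t - T t) * (h t - S t)); last by ring.

apply: (le_trans (cabsB _ _)); apply: (le_trans (lerD (cabsD _ _) (lexx _))); rewrite !cabsM.
have a1 : cabs (g t - T t) * cabs (h t) <= d * Mh by rewrite ler_pM ?cabs_ge0.
have a2 : cabs (g t) * cabs (h t - S t) <= Mg * d by rewrite ler_pM ?cabs_ge0.
have a3 : cabs (g t - T t) * cabs (h t - S t) <= d * 1.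
  by rewrite ler_pM ?cabs_ge0 // (le_trans (gS t)).
by rewrite (le_trans _ d2) //; lra.
Qed.

Lemma tlim_conj h : tlim h -> tlim (fun t => conjc (h t)).
Proof.
move=> hh e /hh [n [T [hT gT]]]; exists n, (fun t => conjc (T t)); split.
  exact: tp_conj.
by move=> t; rewrite -rmorphB cabs_conj.
Qed.

Lemma tlim_lim h : (forall e : R, 0 < e ->
  exists g, tlim g /\ forall t, cabs (h t - g t) <= e) -> tlim h.
Proof.
move=> H e e0; have e2 : 0 < e / 2 by rewrite divr_gt0.
have [g [hg gh]] := H _ e2; have [n [T [hT gT]]] := hg _ e2.
exists n, T; split => // t.
by rewrite (le_trans (cabs_tri (g t) _ _)) // [leRHS]splitr lerD.
Qed.

Lemma tlimZ a h : tlim h -> tlim (fun t => a * h t).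
Proof. by move=> hh; apply: tlimM => //; apply: (@tp_tlim 0); exact: tp_cst. Qed.

Lemma tlimB g h : tlim g -> tlim h -> tlim (fun t => g t - h t).
Proof.
move=> hg hh; rewrite (_ : (fun t => _) = fun t => g t + (-1) * h t).
  by apply: tlimD => //; exact: tlimZ.
by apply/funext => t; rewrite mulN1r.
Qed.

Lemma tlim_ek k : tlim (ek k).
Proof. exact: (tp_tlim (@tp_ek `|k| k (leqnn _))). Qed.

Lemma tlim_sum (I : Type) (r : seq I) (P : pred I) (F : I -> R -> C) :
  (forall i, P i -> tlim (F i)) -> tlim (fun t => \sum_(i <- r | P i) F i t).
Proof.
move=> hF; elim: r => [|i r IH].
  under eq_fun do rewrite big_nil.
  by apply: (@tp_tlim 0); exact: tp0.
under eq_fun do rewrite big_cons.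
by case Pi : (P i) => //; apply: tlimD => //; exact: hF.
Qed.

Fact coef_key : unit. Proof. exact: tt. Qed.

(* Locked, like [vp] and [riesz] below: deciding the convertibility of two
   distinct limits would otherwise unfold the construction of the reals. *)
Definition coef : (R -> C) -> int -> C := locked_with coef_key
  (fun h k => clim (fun J => avg (2 ^ J) (fun t => h t * ek (- k) t))).

Lemma coefE h k : coef h k = clim (fun J => avg (2 ^ J) (fun t => h t * ek (- k) t)).
Proof. by rewrite /coef unlock. Qed.

Lemma avg_tp N n (c : int -> C) k : (n + `|k| < N)%N ->
  avg N (fun t => isum n (fun j => c j * ek j t) * ek (- k) t) = (`|k| <= n)%N%:R * c k.
Proof.
move=> nk; rewrite (_ : (fun t => _) =
  fun t => isum n (fun j => c j * ek (j - k) t)); last first.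
  apply/funext => t; rewrite mulr_suml; apply: eq_bigr => i _.
  by rewrite -mulrA -ekD.
rewrite avg_sum -isum_pick; apply: eq_bigr => i _; rewrite avgZ avg_ek.
  by rewrite subr_eq0 mulrC.
by have := ltn_ord i; lia.
Qed.

Lemma coef_tp n (c : int -> C) k :
  coef (fun t => isum n (fun j => c j * ek j t)) k = (`|k| <= n)%N%:R * c k.
Proof.
rewrite coefE; apply: climP => e e0; exists (n + `|k|).+1 => J hJ; rewrite avg_tp ?subrr ?cabs0 ?ltW //.
by apply: leq_ltn_trans (ltn_expl J (isT : 1 < 2)%N); lia.
Qed.

(** On a trigonometric polynomial of degree n the averages are constant as soon as 2^J exceeds n +
    |k|, and a uniform error changes every average by no more than itself; hence the averages form a
    Cauchy sequence. *)
Lemma coef_is_clim h k : tlim h ->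
  is_clim (fun J => avg (2 ^ J) (fun t => h t * ek (- k) t)) (coef h k).
Proof.
move=> hh; suff [l hl] : exists l, is_clim (fun J => avg (2 ^ J) (fun t => h t * ek (- k) t)) l.
  by rewrite coefE (climP hl).
apply: cauchy_clim => e e0; have e2 : 0 < e / 2 by rewrite divr_gt0.
have [n [T [[c hT] gT]]] := hh _ e2.
exists (n + `|k|).+1 => i j hi hj.
have key J : (n + `|k| < J)%N ->
    cabs (avg (2 ^ J) (fun t => h t * ek (- k) t) - (`|k| <= n)%N%:R * c k) <= e / 2.
  move=> hJ; rewrite -(@avg_tp (2 ^ J) n c k); last first.
    by apply: leq_ltn_trans (ltn_expl J (isT : 1 < 2)%N); lia.
  rewrite -[X in cabs (_ - X)]mul1r -mulNr -avgZ -avgD avg_bound ?expn_gt0 // => t.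
  by rewrite mulN1r -mulrBl -hT cabsM cabs_ek mulr1.
apply: (le_trans (cabs_tri ((`|k| <= n)%N%:R * c k) _ _)).
by rewrite [leRHS]splitr lerD ?key // cabsC key.
Qed.

Lemma coefD g h k : tlim g -> tlim h -> coef (fun t => g t + h t) k = coef g k + coef h k.
Proof.
move=> hg hh; rewrite [LHS]coefE; apply: climP; have := is_climD (coef_is_clim k hg) (coef_is_clim k hh).
move=> H e /H [J HJ]; exists J => j /HJ; rewrite -avgD.
by under eq_fun do rewrite -mulrDl.
Qed.

Lemma coefZ a h k : tlim h -> coef (fun t => a * h t) k = a * coef h k.
Proof.
move=> hh; rewrite [LHS]coefE; apply: climP; have := is_climZ a (coef_is_clim k hh).
move=> H e /H [J HJ]; exists J => j /HJ; rewrite -avgZ.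
by under eq_fun do rewrite mulrA.
Qed.

Lemma coefB g h k : tlim g -> tlim h -> coef (fun t => g t - h t) k = coef g k - coef h k.
Proof.
move=> hg hh; rewrite (_ : (fun t => _) = fun t => g t + (-1) * h t).
  by rewrite coefD ?coefZ ?mulN1r //; exact: tlimZ.
by apply/funext => t; rewrite mulN1r.
Qed.

Lemma coef0 k : coef (fun=> 0) k = 0.
Proof.
have h0 : tlim (fun=> 0 : C) by apply: (@tp_tlim 0); exact: tp0.
by have := coefB k h0 h0; under eq_fun do rewrite subrr; rewrite subrr.
Qed.

Lemma coef_sum (I : Type) (r : seq I) (P : pred I) (F : I -> R -> C) k :
  (forall i, P i -> tlim (F i)) ->
  coef (fun t => \sum_(i <- r | P i) F i t) k = \sum_(i <- r | P i) coef (F i) k.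
Proof.
move=> hF; elim: r => [|i r IH].
  by under eq_fun do rewrite big_nil; rewrite big_nil coef0.
under eq_fun do rewrite big_cons.
rewrite big_cons; case Pi : (P i) => //.
by rewrite coefD ?IH //; [exact: hF|exact: tlim_sum].
Qed.

Lemma coef_bound h k (M : R) : tlim h -> (forall t, cabs (h t) <= M) -> cabs (coef h k) <= M.
Proof.
move=> hh hM; apply: (is_clim_bound (coef_is_clim k hh)) => J.
by apply: avg_bound; rewrite ?expn_gt0 // => t; rewrite cabsM cabs_ek mulr1.
Qed.

Lemma coef_conj h k : tlim h -> coef (fun t => conjc (h t)) k = conjc (coef h (- k)).
Proof.
move=> hh; rewrite [LHS]coefE; apply: climP; have := is_clim_conj (coef_is_clim (- k) hh).
move=> H e /H [J HJ]; exists J => j /HJ; rewrite -avg_conj.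
rewrite (_ : (fun t => conjc _) = fun t => conjc (h t) * ek (- k) t) //.
by apply/funext => t; rewrite opprK rmorphM (ekN k).
Qed.

Lemma coef_shift h m k : coef (fun t => ek m t * h t) k = coef h (k - m).
Proof.
rewrite !coefE; congr clim; apply/funext => J; apply: eq_avg => t.
by rewrite opprB ekD [RHS]mulrCA mulrA.
Qed.

Lemma coef_ek m k : coef (ek m) k = (k == m)%:R.
Proof.
have := @coef_tp `|m| (fun j => (j == m)%:R) k.
rewrite (_ : (fun t => _) = ek m); last first.
  by apply/funext => t; rewrite isum_pick leqnn mul1r.
by move=> ->; case: eqVneq => [->|_]; rewrite ?leqnn ?mulr1 ?mulr0.
Qed.

Lemma tp_coefE n T : tp n T -> forall t, T t = isum n (fun k => coef T k * ek k t).
Proof.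
move=> [c hc] t; rewrite {1}hc; apply: eq_isum => k kn.
rewrite (_ : T = fun t => isum n (fun j => c j * ek j t)); last exact/funext.
by rewrite coef_tp kn mul1r.
Qed.

Lemma tp_coef0 n T k : tp n T -> (n < `|k|)%N -> coef T k = 0.
Proof.
move=> [c hc] kn; rewrite (_ : T = fun t => isum n (fun j => c j * ek j t)); last exact/funext.
by rewrite coef_tp leqNgt kn mul0r.
Qed.

(** Identities between the operators below are proved on trigonometric polynomials by comparing
    their multipliers; [tlim_ext] does the same for uniform limits. *)
Lemma tp_ext n m T S : tp n T -> tp m S -> (forall k, coef T k = coef S k) -> T =1 S.
Proof.
move=> /(tp_le (leq_maxl n m)) hT /(tp_le (leq_maxr n m)) hS TS t.
by rewrite (tp_coefE hT) (tp_coefE hS); apply: eq_isum => k _; rewrite TS.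
Qed.

End TrigPoly.

(** * Fejer and de la Vallee Poussin means *)

Section Fejer.
Context (R : realType).
Local Notation C := R[i].
Implicit Types (h g T : R -> C).

Lemma is_clim_bound_near (u : nat -> C) l (M : R) :
  is_clim u l -> (exists J, forall j, (J <= j)%N -> cabs (u j) <= M) -> cabs l <= M.
Proof.
move=> ul [J0 uM]; apply/ler_addgt0Pr => e /ul [J HJ].
have /HJ h1 := leq_maxl J J0; have /uM h2 := leq_maxr J J0.
by rewrite -(subrK (u (maxn J J0)) l) (le_trans (cabsD _ _)) // addrC cabsC lerD.
Qed.

Lemma is_clim_sum (I : Type) (r : seq I) (P : pred I) (F : I -> nat -> C) (l : I -> C) :
  (forall i, P i -> is_clim (F i) (l i)) ->
  is_clim (fun j => \sum_(i <- r | P i) F i j) (\sum_(i <- r | P i) l i).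
Proof.
move=> hF; elim: r => [|i r IH].
  by move=> e e0; exists 0%N => j _; rewrite !big_nil subrr cabs0 ltW.
rewrite big_cons; under eq_fun do rewrite big_cons.
by case Pi : (P i) => //; apply: is_climD => //; exact: hF.
Qed.

(** The squared modulus makes positivity evident, and positivity with mean 1 is what gives Fejer
    means norm 1. *)
Definition fejer_kernel n (t : R) : R := n%:R^-1 * (cabs (\sum_(a < n) ek a%:Z t)) ^+ 2.

Lemma fejer_kernel_ge0 n t : 0 <= fejer_kernel n t.
Proof. by rewrite mulr_ge0 ?invr_ge0 ?ler0n ?sqr_ge0. Qed.

Lemma fejer_kernelE n t : (fejer_kernel n t)%:C =
  n%:R^-1 * \sum_(a < n) \sum_(b < n) ek (a%:Z - b%:Z) t.
Proof.
rewrite rmorphM fmorphV rmorph_nat /= cabs_sqr rmorph_sum mulr_suml; congr (_ * _).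
apply: eq_bigr => a _; rewrite mulr_sumr; apply: eq_bigr => b _.
by rewrite ekD ekN.
Qed.

Lemma fejer_kernel_conv n s t : (fejer_kernel n (t - s))%:C =
  n%:R^-1 * \sum_(a < n) \sum_(b < n) ek (a%:Z - b%:Z) t * ek (- (a%:Z - b%:Z)) s.
Proof.
rewrite fejer_kernelE; congr (_ * _); apply: eq_bigr => a _; apply: eq_bigr => b _.
by rewrite ek_trans; congr (_ * _); rewrite /ek rmorphN mulrN mulNr.
Qed.

Lemma avg_fejer_kernel n N t : (0 < n <= N)%N ->
  avg N (fun s => (fejer_kernel n (t - s))%:C) = 1.
Proof.
move=> /andP[n0 nN]; under eq_fun do rewrite fejer_kernel_conv.
rewrite avgZ avg_sum (eq_bigr (fun=> 1)); last first.
  move=> a _; rewrite avg_sum (bigD1 a) //= big1 ?addr0 => [|b ba].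
    by rewrite avgZ subrr ek0 mul1r oppr0 avg_ek ?eqxx //= (leq_trans n0).
  rewrite avgZ avg_ek; last by have := ltn_ord a; have := ltn_ord b; lia.
  rewrite oppr_eq0 subr_eq0 (_ : (_ == _) = false) ?mulr0 //.
  by apply: contra_neqF ba => /eqP[/val_inj].
by rewrite sumr_const card_ord mulVf // pnatr_eq0 -lt0n.
Qed.

Lemma avg_ker_bound N (k : R -> R) (h : R -> C) (M : R) :
  (forall s, 0 <= k s) -> avg N (fun s => (k s)%:C) = 1 ->
  (forall s, cabs (h s) <= M) -> cabs (avg N (fun s => h s * (k s)%:C)) <= M.
Proof.
move=> k0 k1 hM; have M0 : 0 <= M := le_trans (cabs_ge0 _) (hM 0).
suff -> : M = N%:R^-1 * \sum_(s < N) M * k (s%:R * (pi *+ 2) / N%:R).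
  rewrite /avg cabsM cabsV cabs_nat ler_wpM2l ?invr_ge0 ?ler0n //.
  rewrite (le_trans (cabs_sum _ _ _)) // ler_sum // => s _.
  by rewrite cabsM cabs_real ger0_norm // ler_wpM2r.
apply: complexI; rewrite -mulr_sumr mulrCA rmorphM -[LHS]mulr1 -k1; congr (_ * _).
by rewrite rmorphM fmorphV rmorph_nat rmorph_sum.
Qed.

(** Convolution with the Fejer kernel, written through coefficients so that it is a trigonometric
    polynomial by construction. The convolution form is used only in [fejer_bound]. *)
Definition fejer n h t : C :=
  n%:R^-1 * \sum_(a < n) \sum_(b < n) ek (a%:Z - b%:Z) t * coef h (a%:Z - b%:Z).

Lemma fejer_bound n h (M : R) t : (0 < n)%N -> tlim h ->
  (forall t, cabs (h t) <= M) -> cabs (fejer n h t) <= M.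
Proof.
move=> n0 hh hM.
have H : is_clim (fun J => avg (2 ^ J) (fun s => h s * (fejer_kernel n (t - s))%:C)) (fejer n h t).
  rewrite (_ : (fun J => _) = fun J => n%:R^-1 * \sum_(a < n) \sum_(b < n)
    ek (a%:Z - b%:Z) t * avg (2 ^ J) (fun s => h s * ek (- (a%:Z - b%:Z)) s)).
    apply: is_climZ; apply: is_clim_sum => a _; apply: is_clim_sum => b _.
    by apply: is_climZ; exact: coef_is_clim.
  apply/funext => J.
  rewrite (@eq_avg _ _ _ (fun s => n%:R^-1 * \sum_(a < n) \sum_(b < n)
    ek (a%:Z - b%:Z) t * (h s * ek (- (a%:Z - b%:Z)) s))).
    rewrite avgZ avg_sum; congr (_ * _); apply: eq_bigr => a _.
    by rewrite avg_sum; apply: eq_bigr => b _; rewrite avgZ.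
  move=> s; rewrite fejer_kernel_conv mulrCA mulr_sumr; congr (_ * _).
  by apply: eq_bigr => a _; rewrite mulr_sumr; apply: eq_bigr => b _; rewrite mulrCA.
apply: (is_clim_bound_near H); exists n => J nJ; apply: avg_ker_bound => //.
  by move=> s; exact: fejer_kernel_ge0.
by rewrite avg_fejer_kernel // n0 (leq_trans nJ) // ltnW // ltn_expl.
Qed.

Lemma tp_fejer n h : tp n (fejer n h).
Proof.
apply: tpZ; apply: tp_sum => a _; apply: tp_sum => b _.
apply: (@eq_tp _ _ (fun t => coef h (a%:Z - b%:Z) * ek (a%:Z - b%:Z) t)) => [t|].
  by rewrite mulrC.
by apply: tpZ; apply: tp_ek; have := ltn_ord a; have := ltn_ord b; lia.
Qed.

Lemma sum_ord_eq n c : (\sum_(b < n) (b == c :> nat) = (c < n))%N.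
Proof.
case: ltnP => cn; last first.
  by rewrite big1 // => b _; case: eqP => // bc; have := ltn_ord b; lia.
rewrite (bigD1 (Ordinal cn)) //= eqxx big1 // => b /eqP bc.
by case: eqP => // e; case: bc; apply: val_inj.
Qed.

Lemma sum_ord_ge n K : (\sum_(a < n) (K <= a) = n - K)%N.
Proof.
elim: n => [|n IH]; first by rewrite big_ord0.
by rewrite big_ord_recr /= IH; case: leqP; lia.
Qed.

(** The numerator of the k-th Fejer weight, as the number of pairs with difference k; truncated
    subtraction gives 0 beyond the degree. *)
Lemma count_diff n (k : int) :
  (\sum_(a < n) \sum_(b < n) (k == (a%:Z - b%:Z)%R) = n - `|k|)%N.
Proof.
case: k => K /=.
  rewrite -sum_ord_ge; apply: eq_bigr => a _.
  case: leqP => Ka.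
    rewrite (eq_bigr (fun b : 'I_n => (b == (a - K)%N :> nat) : nat)).
      by rewrite sum_ord_eq (leq_ltn_trans (leq_subr _ _) (ltn_ord a)).
    by move=> b _; congr nat_of_bool; apply/eqP/eqP; lia.
  by rewrite big1 // => b _; case: eqP => //; lia.
rewrite exchange_big -sum_ord_ge; apply: eq_bigr => a _ /=.
case: (boolP (K.+1 <= a)%N) => Ka /=.
  rewrite (eq_bigr (fun b : 'I_n => (b == (a - K.+1)%N :> nat) : nat)).
    by rewrite sum_ord_eq (leq_ltn_trans (leq_subr _ _) (ltn_ord a)).
  by move=> b _; congr nat_of_bool; apply/eqP/eqP; lia.
by rewrite big1 // => b _; case: eqP => //; lia.
Qed.

Lemma coef_fejer n h k : coef (fejer n h) k = (n - `|k|)%:R / n%:R * coef h k.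
Proof.
have tl a b : tlim (fun t => ek (a - b) t * coef h (a - b)).
  by under eq_fun do rewrite mulrC; apply: tlimZ; exact: tlim_ek.
rewrite coefZ; last by apply: tlim_sum => a _; apply: tlim_sum => b _; exact: tl.
rewrite -(count_diff n k) coef_sum; last by move=> a _; apply: tlim_sum => b _; exact: tl.
rewrite mulrAC mulrC; congr (_ * _); rewrite natr_sum mulr_suml; apply: eq_bigr => a _.
rewrite coef_sum; last by move=> b _; exact: tl.
rewrite natr_sum mulr_suml; apply: eq_bigr => b _.
under eq_fun do rewrite mulrC.
rewrite coefZ; last exact: tlim_ek.
by rewrite coef_ek mulrC; case: eqVneq => [->|_]; rewrite ?mul1r ?mul0r.
Qed.

(* The de la Vallee Poussin means, which unlike the Fejer means reproduce
   trigonometric polynomials. *)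
Fact vp_key : unit. Proof. exact: tt. Qed.

Definition vp : nat -> (R -> C) -> R -> C := locked_with vp_key
  (fun n h t => 2%:R * fejer n.*2 h t - fejer n h t).

Lemma vpE n h : vp n h = fun t => 2%:R * fejer n.*2 h t - fejer n h t.
Proof. by rewrite /vp unlock. Qed.

Lemma tp_vp n h : tp n.*2 (vp n h).
Proof.
rewrite vpE; apply: tpB; first by apply: tpZ; exact: tp_fejer.
by apply: tp_le (tp_fejer n h); rewrite -addnn leq_addr.
Qed.

Lemma vp_bound n h (M : R) t : (0 < n)%N -> tlim h ->
  (forall t, cabs (h t) <= M) -> cabs (vp n h t) <= 3 * M.
Proof.
move=> n0 hh hM; rewrite vpE (le_trans (cabsB _ _)) // cabsM cabs_nat.
have n20 : (0 < n.*2)%N by rewrite double_gt0.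
have := fejer_bound t n0 hh hM; have := fejer_bound t n20 hh hM; lra.
Qed.

Lemma coef_vp n h k : coef (vp n h) k =
  (2%:R * ((n.*2 - `|k|)%:R / n.*2%:R) - (n - `|k|)%:R / n%:R) * coef h k.
Proof.
have tl m : tlim (fejer m h) by exact: (tp_tlim (tp_fejer m h)).
have -> : coef (vp n h) k = 2%:R * coef (fejer n.*2 h) k - coef (fejer n h) k.
  by rewrite vpE (coefB k (tlimZ 2%:R (tl n.*2)) (tl n)) (coefZ 2%:R k (tl n.*2)).
by rewrite !coef_fejer mulrBl !mulrA.
Qed.

Lemma coef_vp_low n h k : (0 < n)%N -> (`|k| <= n)%N -> coef (vp n h) k = coef h k.
Proof.
move=> n0 kn; rewrite coef_vp -[RHS]mul1r; congr (_ * _).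
rewrite !natrB //; last by rewrite (leq_trans kn) // -addnn leq_addr.
rewrite -muln2 natrM; have : (n%:R : C) != 0 by rewrite pnatr_eq0 -lt0n.
by move=> ?; field.
Qed.

Lemma coef_vp_high n h k : (n.*2 <= `|k|)%N -> coef (vp n h) k = 0.
Proof.
move=> kn; rewrite coef_vp (_ : (n.*2 - `|k|)%N = 0%N); last by lia.
by rewrite (_ : (n - `|k|)%N = 0%N) ?mul0r ?mulr0 ?subrr ?mul0r //; lia.
Qed.

Lemma vp_tp n T : (0 < n)%N -> tp n T -> vp n T =1 T.
Proof.
move=> n0 hT; apply: (tp_ext (tp_vp n T) hT) => k.
case: (leqP `|k| n) => kn; first by rewrite coef_vp_low.
by rewrite coef_vp (tp_coef0 hT kn) mulr0.
Qed.

Lemma eq_coef_fun h g : (forall k, coef h k = coef g k) -> forall n, fejer n h =1 fejer n g.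
Proof.
by move=> hg n t; rewrite /fejer; congr (_ * _); apply: eq_bigr => a _;
  apply: eq_bigr => b _; rewrite hg.
Qed.

Lemma vpB n h g t : tlim h -> tlim g -> vp n (fun t => h t - g t) t = vp n h t - vp n g t.
Proof.
move=> hh hg; apply: (tp_ext (tp_vp n _) (tpB (tp_vp n h) (tp_vp n g))) => k.
have tl f : tlim (vp n f) by exact: (tp_tlim (tp_vp n f)).
by rewrite (coefB k (tl h) (tl g)) !coef_vp coefB // mulrBr.
Qed.

(** Since [vp n] fixes T and has norm at most 3, the error h - T is multiplied by at most 1 + 3.
    Thus [vp n h] is as good as any approximation of degree n, up to the factor 4. *)
Lemma vp_close n h T (e : R) t : (0 < n)%N -> tlim h -> tp n T ->
  (forall t, cabs (h t - T t) <= e) -> cabs (h t - vp n h t) <= 4 * e.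
Proof.
move=> n0 hh hT he; have tT := tp_tlim hT.
have -> : h t - vp n h t = (h t - T t) - vp n (fun t => h t - T t) t.
  by rewrite vpB // (vp_tp n0 hT); ring.
have := vp_bound t n0 (tlimB hh tT) he; have := he t.
by have := cabsB (h t - T t) (vp n (fun t => h t - T t) t); lra.
Qed.

(** A de la Vallee Poussin mean depends on the Fourier coefficients only, and both functions are
    close to their common mean. *)
Lemma tlim_ext h g : tlim h -> tlim g -> (forall k, coef h k = coef g k) -> h =1 g.
Proof.
move=> hh hg H t; apply/eqP; rewrite -subr_eq0; apply/eqP/cabs_tiny => e e0.
have e8 : 0 < e / 8 by rewrite divr_gt0.
have [n [T [hT hTe]]] := hh _ e8; have [m [S [hS hSe]]] := hg _ e8.
pose N := (n + m).+1.
have h1 : cabs (h t - vp N h t) <= 4 * (e / 8).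
  by apply: vp_close hTe => //; apply: tp_le hT; rewrite /N; lia.
have h2 : cabs (g t - vp N g t) <= 4 * (e / 8).
  by apply: vp_close hSe => //; apply: tp_le hS; rewrite /N; lia.
have E : vp N h t = vp N g t by rewrite !vpE !(eq_coef_fun H).
have := cabs_tri (vp N h t) (h t) (g t); rewrite {2}E [cabs (vp N g t - _)]cabsC; lra.
Qed.

End Fejer.

(** * Approximation spaces and the Riesz projection *)

Section ApproximationSpaces.
Context (R : realType).
Local Notation C := R[i].
Implicit Types (h g T : R -> C).

Lemma geo_small (q M e : R) : 0 <= q < 1 -> 0 < e -> exists j, M * q ^+ j <= e.
Proof.
move=> /andP[q0 q1] e0.
have : (geometric `|M| q) @ \oo --> 0.
  by apply: cvg_geometric; rewrite ger0_norm.
move=> /cvgrPdist_le /(_ e e0) [J _ /(_ J (leqnn J))] /=.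
rewrite sub0r normrN normrM normr_id normrX (ger0_norm q0) => HJ; exists J.
by rewrite (le_trans _ HJ) // ler_wpM2r ?exprn_ge0 // ler_norm.
Qed.

Lemma geo_sum (q : R) n : 0 <= q < 1 -> \sum_(i < n) q ^+ i <= (1 - q)^-1.
Proof.
move=> /andP[q0 q1]; have q1' : 0 < 1 - q by rewrite subr_gt0.
rewrite -[leRHS]mul1r ler_pdivlMr // mulrC -opprB mulNr -subrX1 opprB lerBlDr lerDl.
exact: exprn_ge0.
Qed.

Lemma geo_clim (u : nat -> C) (A q : R) : 0 <= A -> 0 <= q < 1 ->
  (forall j, cabs (u j.+1 - u j) <= A * q ^+ j) ->
  is_clim u (clim u) /\ forall j, cabs (clim u - u j) <= A / (1 - q) * q ^+ j.
Proof.
move=> A0 q01 hu; have /andP[q0 q1] := q01.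
have q1' : 0 < 1 - q by rewrite subr_gt0.
have tail j n : cabs (u (j + n)%N - u j) <= A / (1 - q) * q ^+ j.
  rewrite (@le_trans _ _ (\sum_(i < n) A * q ^+ (j + i))) //.
    elim: n => [|n IH]; first by rewrite addn0 subrr cabs0 big_ord0.
    rewrite big_ord_recr /= addnS addrC.
    by rewrite (le_trans (cabs_tri (u (j + n)%N) _ _)) // lerD.
  under eq_bigr do rewrite exprD mulrA.
  by rewrite -mulr_sumr mulrAC ler_wpM2r ?exprn_ge0 // ler_wpM2l // geo_sum.
have [l hl] : exists l, is_clim u l.
  apply: cauchy_clim => e e0; have e2 : 0 < e / 2 by rewrite divr_gt0.
  have [J HJ] := geo_small (A / (1 - q)) q01 e2.
  exists J => i j /subnKC <- /subnKC <-.
  rewrite (le_trans (cabs_tri (u J) _ _)) // [leRHS]splitr lerD //.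
    exact: le_trans (tail _ _) HJ.
  by rewrite cabsC; exact: le_trans (tail _ _) HJ.
rewrite (climP hl); split => // j.
apply: (@is_clim_bound_near _ (fun n => u n - u j)).
  move=> e /hl [J HJ]; exists J => i /HJ.
  by rewrite (_ : u i - u j - (l - u j) = u i - l) //; ring.
by exists j => n /subnKC <-; exact: tail.
Qed.

Lemma vp_cvg h (e : R) : tlim h -> 0 < e ->
  exists N, forall n, (N < n)%N -> forall t, cabs (h t - vp n h t) <= e.
Proof.
move=> hh e0; have e4 : 0 < e / 4 by rewrite divr_gt0.
have [N [T [hT hTe]]] := hh _ e4; exists N => n Nn t.
rewrite (le_trans (@vp_close _ n h T (e / 4) t _ hh _ hTe)) //; last lra.
  by rewrite (leq_trans _ Nn).
exact: tp_le (ltnW Nn) hT.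
Qed.

Lemma coef_close h g k (e : R) : tlim h -> tlim g ->
  (forall t, cabs (h t - g t) <= e) -> cabs (coef h k - coef g k) <= e.
Proof. by move=> hh hg H; rewrite -coefB //; apply: coef_bound => //; exact: tlimB. Qed.

Lemma coef_tpM n m T S k (a b : int) : tp n T -> tp m S ->
  (forall k, k < a -> coef T k = 0) -> (forall k, k < b -> coef S k = 0) ->
  k < a + b -> coef (fun t => T t * S t) k = 0.
Proof.
move=> hT hS Ta Sb kab.
rewrite (_ : (fun t => _) = fun t => \sum_(i < n.*2.+1) \sum_(j < m.*2.+1)
    (coef T (i%:Z - n%:Z) * coef S (j%:Z - m%:Z)) * ek (i%:Z - n%:Z + (j%:Z - m%:Z)) t).
  have tl (c : C) l : tlim (fun t => c * ek l t) by apply: tlimZ; exact: tlim_ek.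
  rewrite coef_sum => [|i _]; last by apply: tlim_sum => j _.
  apply: big1 => i _; rewrite coef_sum //; apply: big1 => j _.
  rewrite coefZ; last exact: tlim_ek.
  rewrite coef_ek; case: (ltP (i%:Z - n%:Z) a) => [/Ta ->|ia]; first by rewrite !mul0r.
  case: (ltP (j%:Z - m%:Z) b) => [/Sb ->|jb]; first by rewrite mulr0 mul0r.
  by rewrite (_ : (k == _) = false) ?mulr0 //; lia.
apply/funext => t; rewrite {1}(tp_coefE hT t) {1}(tp_coefE hS t) mulr_suml.
apply: eq_bigr => i _; rewrite mulr_sumr; apply: eq_bigr => j _.
by rewrite (ekD (i%:Z - n%:Z)) mulrACA.
Qed.

Lemma prod_close (f g F G : C) (M M' e : R) : cabs f <= M -> cabs G <= M' ->
  cabs (f - F) <= e -> cabs (g - G) <= e -> cabs (f * g - F * G) <= (M + M') * e.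
Proof.
move=> fM GM fF gG; rewrite (_ : _ - _ = f * (g - G) + (f - F) * G); last by ring.
rewrite (le_trans (cabsD _ _)) // !cabsM mulrDl [M' * e]mulrC.
by rewrite lerD // ler_pM ?cabs_ge0.
Qed.

Lemma coef_vp_lt n h (a : int) : (forall k, k < a -> coef h k = 0) ->
  forall k, k < a -> coef (vp n h) k = 0.
Proof. by move=> ha k /ha hk; rewrite coef_vp hk mulr0. Qed.

(** Lower bounds of spectra add under multiplication. The passage from polynomials to uniform limits
    uses that [vp] creates no new frequency. *)
Lemma coefM_lt f g k (a b : int) : tlim f -> tlim g ->
  (forall k, k < a -> coef f k = 0) -> (forall k, k < b -> coef g k = 0) ->
  k < a + b -> coef (fun t => f t * g t) k = 0.
Proof.
move=> hf hg fa gb kab; apply: cabs_tiny => e e0.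
have [M fM] := tlim_bounded hf; have [M' gM] := tlim_bounded hg.
have M0 : 0 <= M := le_trans (cabs_ge0 _) (fM 0).
have M0' : 0 <= M' := le_trans (cabs_ge0 _) (gM 0).
have D0 : 0 < M + 3 * M' + 1 by lra.
have d0 : 0 < e / (M + 3 * M' + 1) by rewrite divr_gt0.
have [N1 H1] := vp_cvg hf d0; have [N2 H2] := vp_cvg hg d0.
pose n := (N1 + N2).+1.
have tf := tp_vp n f; have tg := tp_vp n g.
have E : coef (fun t => vp n f t * vp n g t) k = 0.
  by apply: (@coef_tpM _ _ _ _ k a b tf tg) => //; exact: coef_vp_lt.
rewrite -[X in cabs X]subr0 -E.
rewrite (@le_trans _ _ ((M + 3 * M') * (e / (M + 3 * M' + 1)))) //.
  apply: coef_close; [exact: tlimM|exact: (tp_tlim (tpM tf tg))|] => t.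
  apply: prod_close => //.
  - by apply: vp_bound.
  - by apply: H1; rewrite /n; lia.
  - by apply: H2; rewrite /n; lia.
rewrite mulrA ler_pdivrMr // mulrC ler_wpM2l ?ltW //; lra.
Qed.

Section Rate.
Context (q : R) (q01 : 0 < q < 1).

Let q0 : 0 < q. Proof. by case/andP: q01. Qed.
Let q1 : q < 1. Proof. by case/andP: q01. Qed.
Let q1' : 0 < 1 - q. Proof. by rewrite subr_gt0. Qed.
Let qw : 0 <= q < 1. Proof. by rewrite ltW. Qed.
Let qX j : 0 < q ^+ j. Proof. exact: exprn_gt0. Qed.
Let qX1 j : q ^+ j <= 1. Proof. by rewrite exprn_ile1 // ltW. Qed.

(* The norm of the space of functions approximated at the geometric rate q in
   dyadic degrees. *)
Definition yn h (M : R) : Prop :=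
  [/\ tlim h, forall t, cabs (h t) <= M &
      forall j t, cabs (h t - vp (2 ^ j) h t) <= M * q ^+ j].

Lemma yn_tlim h M : yn h M -> tlim h. Proof. by case. Qed.

Lemma yn_ge0 h M : yn h M -> 0 <= M.
Proof. by case=> _ /(_ 0) + _; apply: le_trans; exact: cabs_ge0. Qed.

Lemma yn_le h M M' : M <= M' -> yn h M -> yn h M'.
Proof.
move=> MM [hh hM hV]; split=> // [t|j t]; first exact: le_trans MM.
by rewrite (le_trans (hV j t)) // ler_wpM2r // ltW.
Qed.

(** By [vp_close] any approximants may be exchanged for the means [vp] at the price of a factor 4.
    Approximants of degree 2^(j+s) in place of 2^j cost q^-s more; for j < s the zero polynomial is
    good enough. *)
Lemma yn_approx s h M : (forall t, cabs (h t) <= M) ->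
  (forall j, exists T, tp (2 ^ (j + s)) T /\ forall t, cabs (h t - T t) <= M * q ^+ j) ->
  yn h (4 * M / q ^+ s).
Proof.
move=> hM H; have M0 : 0 <= M := le_trans (cabs_ge0 _) (hM 0).
have hh : tlim h.
  move=> e e0; have [j Hj] := geo_small M qw e0; have [T [hT TM]] := H j.
  by exists (2 ^ (j + s))%N, T; split=> // t; rewrite (le_trans (TM t)).
split=> // [t|j t].
  rewrite ler_pdivlMr // (le_trans (ler_pM (cabs_ge0 _) (ltW (qX s)) (hM t) (qX1 s))) //; lra.
have hj e T : tp (2 ^ j) T -> (forall t, cabs (h t - T t) <= e) -> cabs (h t - vp (2 ^ j) h t) <= 4 * e.
  by move=> ? ?; apply: (@vp_close _ _ _ T) => //; rewrite expn_gt0.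
rewrite mulrAC -2!mulrA.
case: (leqP s j) => sj.
  have [T [hT TM]] := H (j - s)%N; rewrite -exprB ?unitfE ?gt_eqF //.
  by apply: hj TM; rewrite subnK in hT.
rewrite (le_trans (hj M _ (@tp0 _ _) _)) // => [t'|]; first by rewrite subr0.
rewrite ler_wpM2l // -[leLHS]mulr1 ler_wpM2l // ler_pdivlMr // mul1r.
by rewrite ler_wiXn2l ?(ltW q0) ?(ltW q1) // ltnW.
Qed.

Lemma ynD h g M M' : yn h M -> yn g M' -> yn (fun t => h t + g t) (M + M').
Proof.
move=> [hh hM hV] [gg gM gV]; split=> [|t|j t]; first exact: tlimD.
  by rewrite (le_trans (cabsD _ _)) // lerD.
have -> : vp (2 ^ j) (fun t => h t + g t) t = vp (2 ^ j) h t + vp (2 ^ j) g t.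
  have tl f := tp_tlim (tp_vp (2 ^ j) f).
  apply: (tp_ext (tp_vp _ _) (tpD (tp_vp _ _) (tp_vp _ _))) => k.
  by rewrite coefD // !coef_vp coefD // mulrDr.
by rewrite opprD addrACA mulrDl (le_trans (cabsD _ _)) // lerD.
Qed.

Lemma ynZ a h M : yn h M -> yn (fun t => a * h t) (cabs a * M).
Proof.
move=> [hh hM hV]; split=> [|t|j t]; first exact: tlimZ.
  by rewrite cabsM ler_wpM2l ?cabs_ge0.
have -> : vp (2 ^ j) (fun t => a * h t) t = a * vp (2 ^ j) h t.
  apply: (tp_ext (tp_vp _ _) (tpZ a (tp_vp _ _))) => k.
  by rewrite coefZ ?coef_vp ?coefZ //; [rewrite mulrCA|exact: (tp_tlim (tp_vp _ _))].
by rewrite -mulrBr cabsM -mulrA ler_wpM2l ?cabs_ge0.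
Qed.

Lemma ynB h g M M' : yn h M -> yn g M' -> yn (fun t => h t - g t) (M + M').
Proof.
move=> hh /(ynZ (-1)); rewrite cabsN cabs1 mul1r => hg.
by have := ynD hh hg; under eq_fun do rewrite mulN1r.
Qed.

Lemma yn0 M : 0 <= M -> yn (fun=> 0) M.
Proof.
move=> M0; have t0 := @tp0 R; split=> [|t|j t]; rewrite ?cabs0 //.
  exact: (tp_tlim (t0 0%N)).
rewrite (vp_tp _ (t0 (2 ^ j)%N)) ?expn_gt0 // subrr cabs0.
by rewrite mulr_ge0 // ltW.
Qed.

Lemma yn_sum (I : Type) (r : seq I) (F : I -> R -> C) (M : I -> R) :
  (forall i, yn (F i) (M i)) -> yn (fun t => \sum_(i <- r) F i t) (\sum_(i <- r) M i).
Proof.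
move=> hF; elim: r => [|i r IH].
  by under eq_fun do rewrite big_nil; rewrite big_nil; exact: yn0.
by under eq_fun do rewrite big_cons; rewrite big_cons; exact: ynD.
Qed.

Lemma yn_tp n T : tp n T -> exists M, yn T M.
Proof.
move=> hT; have [M TM] := tp_bounded hT; exists (4 * M / q ^+ n).
apply: yn_approx => // j; exists T; split=> [|t]; last first.
  by rewrite subrr cabs0 mulr_ge0 ?(ltW (qX _)) // (le_trans (cabs_ge0 _) (TM 0)).
apply: tp_le hT; rewrite (leq_trans (ltnW (ltn_expl n (isT : 1 < 2)%N))) //.
by rewrite leq_exp2l // leq_addl.
Qed.

Lemma ynM h g M M' : yn h M -> yn g M' -> yn (fun t => h t * g t) (16 / q ^+ 2 * (M * M')).
Proof.
move=> hM gM'; have M0 := yn_ge0 hM; have M0' := yn_ge0 gM'.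
move: hM gM' => [hh hM hV] [gg gM gV].
(* The product of two means [vp (2 ^ j)] has degree at most 4 * 2^j, whence s = 2; its error is at
   most (1 + 3) M M' q^j, the 3 being the norm of [vp]. *)
rewrite (_ : 16 / q ^+ 2 * (M * M') = 4 * (4 * (M * M')) / q ^+ 2); last by ring.
apply: yn_approx => [t|j].
  rewrite cabsM (le_trans (ler_pM _ _ (hM t) (gM t))) ?cabs_ge0 //.
  by have := mulr_ge0 M0 M0'; lra.
exists (fun t => vp (2 ^ j) h t * vp (2 ^ j) g t); split.
  apply: tp_le (tpM (tp_vp _ _) (tp_vp _ _)).
  by rewrite addn2 !expnS; lia.
move=> t; have -> : h t * g t - vp (2 ^ j) h t * vp (2 ^ j) g t =
    h t * (g t - vp (2 ^ j) g t) + (h t - vp (2 ^ j) h t) * vp (2 ^ j) g t by ring.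
rewrite (le_trans (cabsD _ _)) // !cabsM.
have a1 : cabs (h t) * cabs (g t - vp (2 ^ j) g t) <= M * (M' * q ^+ j).
  by rewrite ler_pM ?cabs_ge0.
have a2 : cabs (h t - vp (2 ^ j) h t) * cabs (vp (2 ^ j) g t) <= (M * q ^+ j) * (3 * M').
  by rewrite ler_pM ?cabs_ge0 // vp_bound // expn_gt0.
by rewrite (le_trans (lerD a1 a2)) // le_eqVlt; apply/orP; left; apply/eqP; ring.
Qed.

Lemma yn_conj h M : yn h M -> yn (fun t => conjc (h t)) (4 * M / q ^+ 1).
Proof.
move=> [hh hM hV]; apply: yn_approx => [t|j]; first by rewrite cabs_conj.
exists (fun t => conjc (vp (2 ^ j) h t)); split.
  by apply: tp_conj; rewrite addn1 expnS mul2n; exact: tp_vp.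
by move=> t; rewrite -rmorphB cabs_conj.
Qed.

End Rate.
End ApproximationSpaces.

(** * The Riesz projection and Hankel operators *)

Section RieszProjection.
Context (R : realType).
Local Notation C := R[i].
Implicit Types (h g T : R -> C).

Definition pos (N : nat) h t : C := \sum_(a < N.+1) coef h a%:Z * ek a%:Z t.

Lemma tp_pos N h : tp N (pos N h).
Proof. by apply: tp_sum => a _; apply: tpZ; apply: tp_ek; have := ltn_ord a; lia. Qed.

Lemma coef_pos N h (k : int) : coef (pos N h) k = (0 <= k <= N%:Z)%R%:R * coef h k.
Proof.
have tl (a : nat) : tlim (fun t => coef h a%:Z * ek a%:Z t) by apply: tlimZ; exact: tlim_ek.
rewrite coef_sum // (eq_bigr (fun a : 'I_N.+1 => (k == (a : nat)%:Z)%:R * coef h k)); last first.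
  move=> a _; rewrite coefZ ?coef_ek; last exact: tlim_ek.
  by rewrite mulrC; case: eqVneq => [->|_]; rewrite ?mul0r.
rewrite -mulr_suml; congr (_ * _); case: k => K.
  rewrite -natr_sum (eq_bigr (fun a : 'I_N.+1 => (a == K :> nat) : nat)).
    by rewrite sum_ord_eq /= lez_nat.
  by move=> a _; congr nat_of_bool; apply/eqP/eqP; lia.
by rewrite big1.
Qed.

Fact riesz_key : unit. Proof. exact: tt. Qed.

Definition riesz : (R -> C) -> R -> C := locked_with riesz_key
  (fun h t => clim (fun j => pos (2 ^ j.+1) (vp (2 ^ j) h) t)).

Lemma rieszE h t : riesz h t = clim (fun j => pos (2 ^ j.+1) (vp (2 ^ j) h) t).
Proof. by rewrite /riesz unlock. Qed.

(** The block D has its frequencies in 2^j < |k| < 4 * 2^j. A shift by m = 3 * 2^j brings the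
    positive ones within 2^(j+1) of 0, where [vp (2 ^ j.+1)] is the identity, and the negative ones
    beyond 2^(j+2), where it vanishes. So on a dyadic block the projection is a shifted [vp], of
    norm at most 3. *)
Lemma riesz_step h j : tlim h ->
  let D := fun t => vp (2 ^ j.+1) h t - vp (2 ^ j) h t in
  forall t, pos (2 ^ j.+2) (vp (2 ^ j.+1) h) t - pos (2 ^ j.+1) (vp (2 ^ j) h) t =
    ek (3 * 2 ^ j)%:Z t * vp (2 ^ j.+1) (fun t => ek (- (3 * 2 ^ j)%:Z) t * D t) t.
Proof.
move=> hh D; set m : int := (3 * 2 ^ j)%:Z.
have p0 n : (0 < 2 ^ n)%N by rewrite expn_gt0.
have tV n : tlim (vp n h) := tp_tlim (tp_vp n h).
have tD : tlim D by exact: tlimB.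
have tmD : tlim (fun t => ek (- m) t * D t) by apply: tlimM => //; exact: tlim_ek.
have cD k : coef D k = coef (vp (2 ^ j.+1) h) k - coef (vp (2 ^ j) h) k by exact: coefB.
have tp1 := tp_le (n := 2 ^ j.+1) (m := 2 ^ j.+2) _ (tp_pos (2 ^ j.+1) (vp (2 ^ j) h)).
have tpm : tp `|m| (ek m : R -> C) by exact: tp_ek.
apply: (tp_ext (tpB (tp_pos _ _) (tp1 _)) (tpM tpm (tp_vp _ _))) => [|k].
  by rewrite leq_exp2l.
rewrite coef_shift (coefB k (tp_tlim (tp_pos _ _)) (tp_tlim (tp_pos _ _))) !coef_pos.
have E1 : (0 <= k <= (2 ^ j.+2)%:Z)%R%:R * coef (vp (2 ^ j.+1) h) k =
          (0 <= k)%R%:R * coef (vp (2 ^ j.+1) h) k.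
  case: (leqP (2 ^ j.+1).*2 `|k|) => kl; first by rewrite coef_vp_high // !mulr0.
  congr (_%:R * _); have : (`|k| <= 2 ^ j.+2)%N by rewrite expnS mul2n ltnW.
  by lia.
have E2 : (0 <= k <= (2 ^ j.+1)%:Z)%R%:R * coef (vp (2 ^ j) h) k =
          (0 <= k)%R%:R * coef (vp (2 ^ j) h) k.
  case: (leqP (2 ^ j).*2 `|k|) => kl; first by rewrite coef_vp_high // !mulr0.
  congr (_%:R * _); have : (`|k| <= 2 ^ j.+1)%N by rewrite expnS mul2n ltnW.
  by lia.
rewrite E1 E2 -mulrBr -cD.
have [D0|Dn0] := eqVneq (coef D k) 0.
  by rewrite D0 mulr0 coef_vp coef_shift opprK subrK D0 mulr0.
have k1 : (2 ^ j < `|k|)%N.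
  rewrite ltnNge; apply: contra_neqN Dn0 => kl; rewrite cD !coef_vp_low ?subrr //.
  by rewrite (leq_trans kl) // leq_exp2l.
have k2 : (`|k| < 2 ^ j.+2)%N.
  rewrite ltnNge; apply: contra_neqN Dn0 => kl; rewrite cD !coef_vp_high ?subrr //.
    by rewrite (leq_trans _ kl) // -mul2n -expnS leq_exp2l.
  by rewrite -mul2n -expnS.
have [k3|k3] := leP 0 k.
  rewrite mul1r coef_vp_low // ?coef_shift ?opprK ?subrK //.
  by move: k1 k2; rewrite /m !expnS; lia.
rewrite mul0r coef_vp_high //.
by move: k1 k2; rewrite /m !expnS; lia.
Qed.

Section Rate.
Context (q : R) (q01 : 0 < q < 1).

Let q0 : 0 < q. Proof. by case/andP: q01. Qed.
Let q1 : q < 1. Proof. by case/andP: q01. Qed.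
Let q1' : 0 < 1 - q. Proof. by rewrite subr_gt0. Qed.
Let qw : 0 <= q < 1. Proof. by rewrite ltW. Qed.
Let qX j : 0 < q ^+ j. Proof. exact: exprn_gt0. Qed.
Let qX1 j : q ^+ j <= 1. Proof. by rewrite exprn_ile1 // ltW. Qed.

Lemma yn_block h M j t : yn q h M -> cabs (vp (2 ^ j.+1) h t - vp (2 ^ j) h t) <= 2 * M * q ^+ j.
Proof.
move=> hM; have M0 := yn_ge0 hM; have [_ _ hV] := hM.
rewrite (le_trans (cabs_tri (h t) _ _)) //.
have := hV j t; have := hV j.+1 t; rewrite cabsC exprS => h1 h2.
have h3 : M * (q * q ^+ j) <= M * q ^+ j.
  by rewrite ler_wpM2l // -[leRHS]mul1r ler_wpM2r ?ltW.
lra.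
Qed.

Lemma yn_riesz_explicit h M : yn q h M ->
  yn q (riesz h) (4 * (9 * M + 6 * M / (1 - q)) / q ^+ 1) /\
  forall k, coef (riesz h) k = (0 <= k)%R%:R * coef h k.
Proof.
move=> hM; have M0 := yn_ge0 hM; have [hh hsup hV] := hM.
pose p j := pos (2 ^ j.+1) (vp (2 ^ j) h).
have tV n : tlim (vp n h) := tp_tlim (tp_vp n h).
have step t j : cabs (p j.+1 t - p j t) <= 6 * M * q ^+ j.
  rewrite riesz_step // cabsM cabs_ek mul1r.
  rewrite (_ : 6 * M * q ^+ j = 3 * (2 * M * q ^+ j)); last by ring.
  apply: vp_bound; rewrite ?expn_gt0 //.
    by apply: tlimM; [exact: tlim_ek|exact: tlimB].
  by move=> s; rewrite cabsM cabs_ek mul1r yn_block.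
have M6 : 0 <= 6 * M by rewrite mulr_ge0.
have A0 : 0 <= 6 * M / (1 - q) by rewrite divr_ge0 // ltW.
have lim t := geo_clim M6 qw (step t).
have close j t : cabs (riesz h t - p j t) <= 6 * M / (1 - q) * q ^+ j.
  by rewrite rieszE; have [_ H] := lim t; exact: H.
(* [p 0] has the three frequencies 0, 1, 2, with coefficients bounded by the bound 3 M of
   [vp 1 h]. *)
have p00 t : cabs (p 0%N t) <= 9 * M.
  rewrite (le_trans (cabs_sum _ _ _)) // (@le_trans _ _ (\sum_(a < 3) (3 * M))) //.
    apply: ler_sum => a _; rewrite cabsM cabs_ek mulr1.
    by apply: coef_bound => // s; apply: vp_bound.
  by rewrite sumr_const card_ord -mulr_natl; lra.
have yR : yn q (riesz h) (4 * (9 * M + 6 * M / (1 - q)) / q ^+ 1).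
  apply: (yn_approx q01) => [t|j].
    rewrite -(subrK (p 0%N t) (riesz h t)) (le_trans (cabsD _ _)) // addrC lerD //.
    by rewrite (le_trans (close 0%N t)) // expr0 mulr1.
  exists (p j); split; first by rewrite addn1; exact: tp_pos.
  move=> t; rewrite (le_trans (close j t)) // ler_wpM2r ?(ltW (qX j)) // lerDr.
  by rewrite mulr_ge0.
split=> // k; apply/eqP; rewrite -subr_eq0; apply/eqP/cabs_tiny => e e0.
have [j Hj] := geo_small (6 * M / (1 - q) + M) qw e0.
have tP : tlim (p j) := tp_tlim (tp_pos _ _).
rewrite (le_trans _ Hj) // (le_trans (cabs_tri (coef (p j) k) _ _)) // mulrDl lerD //.
  by apply: coef_close (close j); [exact: yn_tlim yR|].
have -> : coef (p j) k = (0 <= k)%R%:R * coef (vp (2 ^ j) h) k.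
  rewrite coef_pos; case: (leqP (2 ^ j).*2 `|k|) => kl; first by rewrite coef_vp_high // !mulr0.
  congr (_%:R * _); have : (`|k| <= 2 ^ j.+1)%N by rewrite expnS mul2n ltnW.
  by lia.
rewrite -mulrBr cabsM cabs_nat.
have H : cabs (coef (vp (2 ^ j) h) k - coef h k) <= M * q ^+ j.
  by apply: coef_close => // t; rewrite cabsC.
by case: (0 <= k); rewrite ?mul1r ?mul0r // mulr_ge0 // (ltW (qX j)).
Qed.

Lemma riesz_bounded : exists K, 0 <= K /\ forall h M, yn q h M -> yn q (riesz h) (K * M).
Proof.
exists (4 * (9 + 6 / (1 - q)) / q ^+ 1); split.
  by rewrite divr_ge0 ?exprn_ge0 ?ltW // mulr_gt0 // addr_gt0 // divr_gt0.
move=> h M /yn_riesz_explicit [H _].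
by rewrite (_ : _ * M = 4 * (9 * M + 6 * M / (1 - q)) / q ^+ 1) //; ring.
Qed.

Lemma coef_riesz h M k : yn q h M -> coef (riesz h) k = (0 <= k)%R%:R * coef h k.
Proof. by move=> /yn_riesz_explicit []. Qed.

(** Completeness, in the form that a Neumann series of ratio 1/2 requires. The rate passes to the
    limit because each fixed [vp (2 ^ j)] is bounded in the uniform norm. *)
Lemma yn_complete (u : nat -> R -> C) (M : R) : 0 <= M -> (forall j, yn q (u j) (M * 2^-1 ^+ j)) ->
  exists f, forall J, yn q (fun t => f t - \sum_(j < J) u j t) (2 * M * 2^-1 ^+ J).
Proof.
move=> M0 hu; have h2 : 0 <= (2^-1 : R) < 1 by apply/andP; split; lra.
have half2 : (1 - 2^-1)^-1 = 2 :> R by rewrite (_ : 1 - 2^-1 = 2^-1) ?invrK //; lra.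
pose s J t := \sum_(j < J) u j t.
have step t j : cabs (s j.+1 t - s j t) <= M * 2^-1 ^+ j.
  by rewrite /s big_ord_recr /= (addrC _ (u j t)) addrK; have [_ H _] := hu j; exact: H.
have lim t := geo_clim M0 h2 (step t).
pose f t := clim (fun J => s J t).
have close J t : cabs (f t - s J t) <= 2 * M * 2^-1 ^+ J.
  have [_ /(_ J)] := lim t; by rewrite half2 (mulrC M).
have ts J : tlim (s J) by apply: tlim_sum => j _; exact: yn_tlim (hu j).
have tf : tlim f.
  apply: tlim_lim => e e0; have [J HJ] := geo_small (2 * M) h2 e0.
  by exists (s J); split=> // t; rewrite (le_trans (close J t)).
exists f => J.
have ysK n : yn q (fun t => s (J + n)%N t - s J t) (2 * M * 2^-1 ^+ J).
  apply: (@yn_le _ _ q01 _ (\sum_(i < n) (M * 2^-1 ^+ (J + i)))).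
    under eq_bigr do rewrite exprD mulrA.
    rewrite -mulr_sumr [2 * M]mulrC -[leRHS]mulrA [2 * _]mulrC mulrA ler_wpM2l //.
      by rewrite mulr_ge0 // exprn_ge0; lra.
    by rewrite (le_trans (geo_sum _ h2)) // half2.
  rewrite (_ : (fun t => _) = fun t => \sum_(i < n) u (J + i)%N t).
    by apply: yn_sum => // i; exact: hu.
  apply/funext => t; rewrite /s; elim: n => [|n IH]; first by rewrite addn0 subrr big_ord0.
  by rewrite big_ord_recr /= addnS big_ord_recr /= addrAC IH.
split=> [|t|j t]; [exact: (tlimB tf (ts J))|exact: close|].
apply/ler_addgt0Pr => e e0.
(* The part of the series beyond n costs e / 4 by itself and 3 (e / 4) under [vp]. *)
have e5 : 0 < e / 4 by rewrite divr_gt0.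
have [n Hn] := geo_small (2 * M * 2^-1 ^+ J) h2 e5.
have cn x : cabs (f x - s (J + n)%N x) <= e / 4.
  by rewrite (le_trans (close _ x)) // (le_trans _ Hn) // exprD mulrA.
have [_ _ /(_ j t) Y] := ysK n.
have B := @vp_bound _ (2 ^ j) (fun x => f x - s (J + n)%N x) (e / 4) t _ _ cn.
have {}B : cabs (vp (2 ^ j) (fun x => f x - s (J + n)%N x) t) <= 3 * (e / 4).
  by apply: B; rewrite ?expn_gt0 //; exact: tlimB.
change (cabs (f t - s J t - vp (2 ^ j) (fun x => f x - s J x) t) <= 2 * M * 2^-1 ^+ J * q ^+ j + e).
move: Y B; rewrite !vpB // => Y B.
rewrite (_ : f t - s J t - (vp (2 ^ j) f t - vp (2 ^ j) (s J) t) = (f t - s (J + n)%N t) +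
  (s (J + n)%N t - s J t - (vp (2 ^ j) (s (J + n)%N) t - vp (2 ^ j) (s J) t)) -
  (vp (2 ^ j) f t - vp (2 ^ j) (s (J + n)%N) t)); last by ring.
have := cabsB (f t - s (J + n)%N t +
  (s (J + n)%N t - s J t - (vp (2 ^ j) (s (J + n)%N) t - vp (2 ^ j) (s J) t)))
  (vp (2 ^ j) f t - vp (2 ^ j) (s (J + n)%N) t).
have := cabsD (f t - s (J + n)%N t)
  (s (J + n)%N t - s J t - (vp (2 ^ j) (s (J + n)%N) t - vp (2 ^ j) (s J) t)).
have := cn t; lra.
Qed.

(* Splitting [c] into dyadic blocks and truncating [u] just above the
   frequencies of each block only discards products without negative
   frequencies, and what remains is approximated at the same rate as [c]. *)
Lemma hankel_smoothing c M u : yn q c M -> tlim u -> (forall k, k < 0 -> coef u k = 0) ->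
  exists f K, yn q f K /\ forall k, k < 0 -> coef f k = coef (fun t => c t * u t) k.
Proof.
move=> hc hu u0; have M0 := yn_ge0 hc; have [tc cM cV] := hc.
have [U uU] := tlim_bounded hu; have U0 : 0 <= U := le_trans (cabs_ge0 _) (uU 0).
pose d j t := if j is i.+1 then vp (2 ^ i.+1) c t - vp (2 ^ i) c t else vp 1 c t.
have tpd j : tp (2 ^ j.+1) (d j).
  case: j => [|i] /=; first exact: (tp_vp 1 c).
  apply: tpB; first by rewrite (expnS 2 i.+1) mul2n; exact: tp_vp.
  by apply: tp_le (tp_vp (2 ^ i) c); rewrite -mul2n -expnS leq_exp2l.
have dM j t : cabs (d j t) <= 3 * M / q * q ^+ j.
  case: j => [|i] /=.
    rewrite expr0 mulr1 (le_trans (@vp_bound _ 1 c M t _ tc cM)) //.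
    by rewrite ler_pdivlMr // ler_piMr // ?mulr_ge0 // ltW.
  rewrite exprS mulrA divfK ?gt_eqF // (le_trans (yn_block i t hc)) //.
  by rewrite ler_wpM2r ?(ltW (qX i)) //; lra.
pose A := 3 * U * (3 * M / q).
have A0 : 0 <= A by rewrite !mulr_ge0 // invr_ge0 ltW.
pose s J t := \sum_(j < J) vp (2 ^ j.+1) u t * d j t.
have step t j : cabs (s j.+1 t - s j t) <= A * q ^+ j.
  rewrite /s big_ord_recr /= (addrC _ (_ * d j t)) addrK cabsM /A -[leRHS]mulrA.
  by rewrite ler_pM ?cabs_ge0 // vp_bound // expn_gt0.
have lim t := geo_clim A0 qw (step t).
pose f t := clim (fun J => s J t).
have close J t : cabs (f t - s J t) <= A / (1 - q) * q ^+ J.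
  by have [_ H] := lim t; exact: H.
have A0' : 0 <= A / (1 - q) by rewrite divr_ge0 // ltW.
have tps J : tp (2 ^ (J + 3)) (s J).
  apply: tp_sum => j _; apply: tp_le (tpM (tp_vp _ _) (tpd j)).
  have : (2 ^ j <= 2 ^ J)%N by rewrite leq_exp2l // ltnW.
  by rewrite !addnS addn0 !expnS; lia.
have yf : yn q f (4 * (A / (1 - q)) / q ^+ 3).
  apply: (yn_approx q01) => [t|J].
    have := close 0%N t; rewrite expr0 mulr1; apply: le_trans.
    by rewrite /s big_ord0 subr0.
  by exists (s J).
exists f, (4 * (A / (1 - q)) / q ^+ 3); split=> // k k0.
have sd J t : \sum_(j < J.+1) d j t = vp (2 ^ J) c t.
  elim: J => [|J IH]; first by rewrite big_ord1.
  by rewrite big_ord_recr IH /= addrC subrK.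
have td j : tlim (d j) := tp_tlim (tpd j).
have tv n g : tlim (vp n g) := tp_tlim (tp_vp n g).
have cs J : coef (s J.+1) k = coef (fun t => vp (2 ^ J) c t * u t) k.
  have -> : (fun t => vp (2 ^ J) c t * u t) = fun t => \sum_(j < J.+1) d j t * u t.
    by apply/funext => t; rewrite -sd mulr_suml.
  rewrite !coef_sum; try by move=> j _; apply: tlimM.
  apply: eq_bigr => j _; apply/eqP; rewrite -subr_eq0 -coefB; try by apply: tlimM.
  rewrite (_ : (fun t => _) = fun t => d j t * (vp (2 ^ j.+1) u t - u t)); last first.
    by apply/funext => t; ring.
  apply/eqP; apply: (@coefM_lt _ _ _ _ (- (2 ^ j.+1)%:Z) ((2 ^ j.+1).+1%:Z)) => //.
  - exact: tlimB.
  - by move=> l hl; apply: (tp_coef0 (tpd j)); lia.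
  - move=> l hl; rewrite coefB //; case: (ltP l 0) => l0; first by rewrite coef_vp u0 // mulr0 subrr.
    by rewrite coef_vp_low ?expn_gt0 ?subrr //; lia.
  - by lia.
apply/eqP; rewrite -subr_eq0; apply/eqP/cabs_tiny => e e0.
have [J HJ] := geo_small (A / (1 - q) * q + M * U) qw e0.
have C1 : cabs (coef f k - coef (s J.+1) k) <= A / (1 - q) * q * q ^+ J.
  apply: coef_close; [exact: yn_tlim yf|exact: tp_tlim (tps _)|] => t.
  by rewrite -mulrA -exprS.
have C2 : cabs (coef (s J.+1) k - coef (fun t => c t * u t) k) <= M * U * q ^+ J.
  rewrite cs; apply: coef_close; [exact: tlimM|exact: tlimM|] => t.
  rewrite -mulrBl cabsM -mulrA [U * _]mulrC mulrA.
  by rewrite ler_pM ?cabs_ge0 // cabsC.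
rewrite (le_trans (cabs_tri (coef (s J.+1) k) _ _)) // (le_trans (lerD C1 C2)) //.
by rewrite -mulrDl.
Qed.

End Rate.
End RieszProjection.

(** * Commutators of the Riesz projection with multiplications *)

Section Commutators.
Context (R : realType).
Local Notation C := R[i].
Implicit Types (h g u c : R -> C).

Definition reg (q : R) h := exists M, yn q h M.

(** Real functions are kept complex-valued throughout, so that [coef] and [riesz] apply to them. *)
Definition reC h : R -> C := fun t => (complex.Re (h t))%:C.

Lemma reCE h t : reC h t = 2%:R^-1 * (h t + conjc (h t)).
Proof. by rewrite /reC ReJ_add mulrC. Qed.

Lemma reC_id h t : conjc (h t) = h t -> reC h t = h t.
Proof. by rewrite reCE => ->; field. Qed.

Lemma conj_reC h t : conjc (reC h t) = reC h t.
Proof. exact: conjc_real. Qed.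

Lemma coefM_gt f g k (a b : int) : tlim f -> tlim g ->
  (forall k, a < k -> coef f k = 0) -> (forall k, b < k -> coef g k = 0) ->
  a + b < k -> coef (fun t => f t * g t) k = 0.
Proof.
move=> hf hg fa gb kab.
have := @coefM_lt R _ _ (- k) (- a) (- b) (tlim_conj hf) (tlim_conj hg).
rewrite (_ : (fun t => conjc (f t) * conjc (g t)) = fun t => conjc (f t * g t)); last first.
  by apply/funext => t; rewrite rmorphM.
rewrite coef_conj ?opprK; last exact: tlimM.
move=> H; apply/eqP; rewrite -conjc_eq0; apply/eqP/H.
- by move=> l hl; rewrite coef_conj // fa ?conjc0 //; lia.
- by move=> l hl; rewrite coef_conj // gb ?conjc0 //; lia.
- by lia.
Qed.

Section Rate.
Context (q : R) (q01 : 0 < q < 1).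

Lemma reg_tlim h : reg q h -> tlim h.
Proof. by case=> M /yn_tlim. Qed.

Lemma regD h g : reg q h -> reg q g -> reg q (fun t => h t + g t).
Proof. by move=> [M hM] [M' gM]; eexists; exact: ynD hM gM. Qed.

Lemma regB h g : reg q h -> reg q g -> reg q (fun t => h t - g t).
Proof. by move=> [M hM] [M' gM]; eexists; exact: ynB hM gM. Qed.

Lemma regM h g : reg q h -> reg q g -> reg q (fun t => h t * g t).
Proof. by move=> [M hM] [M' gM]; eexists; exact: (ynM q01 hM gM). Qed.

Lemma regZ a h : reg q h -> reg q (fun t => a * h t).
Proof. by move=> [M hM]; eexists; exact: ynZ hM. Qed.

Lemma reg_conj h : reg q h -> reg q (fun t => conjc (h t)).
Proof. by move=> [M hM]; eexists; exact: (yn_conj q01 hM). Qed.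

Lemma reg_tp n h : tp n h -> reg q h.
Proof. exact: (yn_tp q01). Qed.

Lemma reg_sum (I : Type) (r : seq I) (P : pred I) (F : I -> R -> C) :
  (forall i, P i -> reg q (F i)) -> reg q (fun t => \sum_(i <- r | P i) F i t).
Proof.
move=> hF; elim: r => [|i r IH].
  by under eq_fun do rewrite big_nil; exact: (reg_tp (tp0 _ 0)).
under eq_fun do rewrite big_cons.
by case Pi : (P i) => //; apply: regD => //; exact: hF.
Qed.

Lemma reg_reC h : reg q h -> reg q (reC h).
Proof.
move=> hh; rewrite (_ : reC h = fun t => 2%:R^-1 * (h t + conjc (h t))).
  by apply: regZ; apply: regD => //; exact: reg_conj.
by apply/funext => t; exact: reCE.
Qed.

Lemma reg_riesz h : reg q h -> reg q (riesz h).
Proof. by move=> [M hM]; have [K [_ H]] := riesz_bounded q01; eexists; exact: H hM. Qed.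

Lemma coef_riesz_reg h k : reg q h -> coef (riesz h) k = (0 <= k)%R%:R * coef h k.
Proof. by move=> [M hM]; exact: (coef_riesz q01 k hM). Qed.

Lemma eq_reg h g : h =1 g -> reg q h -> reg q g.
Proof. by move=> /funext ->. Qed.

Lemma riesz_eq0 h : reg q h -> (forall k, 0 <= k -> coef h k = 0) -> riesz h =1 fun=> 0.
Proof.
move=> hh h0; apply: tlim_ext; [exact: reg_tlim (reg_riesz hh)| |] => [|k].
  exact: (tp_tlim (tp0 _ 0)).
by rewrite coef_riesz_reg // coef0; case: (leP 0 k) => k0; rewrite ?mul0r // h0 // mulr0.
Qed.

Lemma rieszD h g : reg q h -> reg q g ->
  riesz (fun t => h t + g t) =1 fun t => riesz h t + riesz g t.
Proof.
move=> hh hg; have hhg := regD hh hg.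
have [th tg] := (reg_tlim (reg_riesz hh), reg_tlim (reg_riesz hg)).
apply: tlim_ext; [exact: reg_tlim (reg_riesz hhg)|exact: tlimD|] => k.
rewrite coefD // !coef_riesz_reg // coefD; [|exact: reg_tlim..].
by rewrite mulrDr.
Qed.

Lemma rieszZ a h : reg q h -> riesz (fun t => a * h t) =1 fun t => a * riesz h t.
Proof.
move=> hh; have hah := regZ a hh; have th := reg_tlim (reg_riesz hh).
apply: tlim_ext; [exact: reg_tlim (reg_riesz hah)|exact: tlimZ|] => k.
by rewrite coefZ // !coef_riesz_reg // coefZ; [rewrite mulrCA|exact: reg_tlim].
Qed.

Lemma rieszB h g : reg q h -> reg q g ->
  riesz (fun t => h t - g t) =1 fun t => riesz h t - riesz g t.
Proof.
move=> hh hg t; rewrite -[riesz g t]mul1r -mulNr -rieszZ //.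
rewrite -rieszD //; last exact: regZ.
by under eq_fun do rewrite -mulN1r.
Qed.

Lemma riesz_sum (I : Type) (r : seq I) (F : I -> R -> C) : (forall i, reg q (F i)) ->
  riesz (fun t => \sum_(i <- r) F i t) =1 fun t => \sum_(i <- r) riesz (F i) t.
Proof.
move=> hF; elim: r => [|i r IH] t.
  under eq_fun do rewrite big_nil.
  rewrite big_nil riesz_eq0 //; first exact: (reg_tp (tp0 _ 0)).
  by move=> k _; rewrite coef0.
under eq_fun do rewrite big_cons.
by rewrite big_cons rieszD ?IH //; exact: reg_sum.
Qed.

(** The coefficients of a real function at k and -k are conjugate, so twice the real part of the
    analytic half restores it, with the mean counted twice. *)
Lemma riesz_real h t : reg q h -> (forall t, conjc (h t) = h t) ->
  2%:R * reC (riesz h) t = h t + coef h 0.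
Proof.
move=> hh hr; have th := reg_tlim hh; have rr := reg_riesz hh; have tr := reg_tlim rr.
have tc : tlim (fun=> coef h 0) by exact: (tp_tlim (tp_cst 0 _)).
rewrite reCE mulVKf ?pnatr_eq0 //; move: t.
apply: tlim_ext; [by apply: tlimD => //; exact: tlim_conj|exact: tlimD|] => k.
rewrite !coefD ?coef_conj //; last exact: tlim_conj.
rewrite !coef_riesz_reg // rmorphM rmorph_nat /=.
have -> : conjc (coef h (- k)) = coef h k.
  by rewrite -coef_conj //; congr coef; apply/funext.
have -> : coef (fun=> coef h 0) k = (k == 0)%:R * coef h k.
  rewrite (_ : (fun=> _) = fun t : R => coef h 0 * ek 0 t); last first.
    by apply/funext => t; rewrite ek0 mulr1.
  rewrite coefZ; last exact: tlim_ek.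
  by rewrite coef_ek mulrC; case: eqVneq => [->|]; rewrite ?mul0r.
rewrite oppr_ge0; have [k0|k0|k0] := ltgtP k 0.
- by rewrite !mul0r mul1r add0r addr0.
- by rewrite !mul0r mul1r.
- by rewrite k0 !mul1r.
Qed.

Definition comm c u t : C := riesz (fun t => c t * u t) t - c t * riesz u t.

Lemma reg_comm c u : reg q c -> reg q u -> reg q (comm c u).
Proof.
move=> hc hu; apply: regB; first by apply: reg_riesz; exact: regM.
by apply: regM => //; exact: reg_riesz.
Qed.

Lemma comm_bounded : exists K, 0 <= K /\ forall c u M M', yn q c M -> yn q u M' ->
  yn q (comm c u) (K * (M * M')).
Proof.
have [K [K0 HK]] := riesz_bounded q01; have q2 : 0 < q ^+ 2 by case/andP: q01 => *; exact: exprn_gt0.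
exists (K * (16 / q ^+ 2) + 16 / q ^+ 2 * K); split.
  by rewrite addr_ge0 // mulr_ge0 // divr_ge0 // ltW.
move=> c u M M' hc hu.
rewrite (_ : _ * _ = K * (16 / q ^+ 2 * (M * M')) + 16 / q ^+ 2 * (M * (K * M'))); last by ring.
by apply: ynB; [apply: HK; exact: ynM|apply: ynM => //; exact: HK].
Qed.

Lemma commDl c d u t : reg q c -> reg q d -> reg q u ->
  comm (fun t => c t + d t) u t = comm c u t + comm d u t.
Proof.
move=> hc hd hu; rewrite /comm.
under [X in riesz X]eq_fun do rewrite mulrDl.
by rewrite rieszD; [ring|exact: regM..].
Qed.

Lemma commBr c u v t : reg q c -> reg q u -> reg q v ->
  comm c (fun t => u t - v t) t = comm c u t - comm c v t.
Proof.
move=> hc hu hv; rewrite /comm.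
under [X in riesz X]eq_fun do rewrite mulrBr.
by rewrite !rieszB //; [ring|exact: regM..].
Qed.

(** Multiplication by c moves frequencies by at most n, too little to carry one beyond n across 0,
    so it commutes with the projection there. Hence the commutator with a trigonometric polynomial
    has finite rank. *)
Lemma comm_high c u n t : tp n c -> reg q u -> (forall k, (`|k| <= n)%N -> coef u k = 0) ->
  comm c u t = 0.
Proof.
move=> hc hu u0; have rc := reg_tp hc; have rp := reg_riesz hu; have tc := tp_tlim hc.
have [tu tru] := (reg_tlim hu, reg_tlim rp).
apply/eqP; rewrite /comm subr_eq0; apply/eqP; move: t.
apply: tlim_ext; [exact: reg_tlim (reg_riesz (regM rc hu))|exact: tlimM|] => k.
rewrite (coef_riesz_reg k (regM rc hu)).
case: (leP 0 k) => k0; last first.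
  rewrite mul0r; apply/esym/(@coefM_lt _ _ _ _ (- n%:Z) n.+1%:Z) => //; last lia.
    by move=> l hl; apply: (tp_coef0 hc); lia.
  move=> l hl; rewrite coef_riesz_reg //; case: (leP 0 l) => l0; last by rewrite mul0r.
  by rewrite u0 ?mulr0 //; lia.
rewrite mul1r; apply/eqP; rewrite -subr_eq0 -coefB; try exact: tlimM.
under eq_fun do rewrite -mulrBr.
apply/eqP/(@coefM_gt _ _ _ n%:Z (- n.+1%:Z)) => //; [exact: tlimB| | |lia].
  by move=> l hl; apply: (tp_coef0 hc); lia.
move=> l hl; rewrite coefB // coef_riesz_reg //.
case: (leP 0 l) => l0; first by rewrite mul1r subrr.
by rewrite u0 ?mulr0 ?subrr //; lia.
Qed.

(** For the bilinear mean the transpose of the projection on k >= 0 is the projection on k <= 0,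
    which is [riesz] conjugated. In each of the two comparisons the discarded product has
    frequencies of one strict sign, hence mean 0. *)
Lemma mean_riesz u v : reg q u -> reg q v ->
  coef (fun t => u t * riesz v t) 0 =
  coef (fun t => conjc (riesz (fun s => conjc (u s)) t) * v t) 0.
Proof.
move=> hu hv; pose Q t := conjc (riesz (fun s => conjc (u s)) t).
have hcu := reg_conj hu; have hQ : reg q Q by apply: reg_conj; exact: reg_riesz.
have rv := reg_riesz hv.
have [[tu tv] [tQ tr]] := (reg_tlim hu, reg_tlim hv, (reg_tlim hQ, reg_tlim rv)).
have cQ k : coef Q k = (k <= 0)%R%:R * coef u k.
  rewrite coef_conj ?coef_riesz_reg //; last exact: reg_tlim (reg_riesz hcu).
  by rewrite coef_conj // opprK oppr_ge0 rmorphM rmorph_nat /= conjcK.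
transitivity (coef (fun t => Q t * riesz v t) 0).
  apply/eqP; rewrite -subr_eq0 -coefB; try exact: tlimM.
  under eq_fun do rewrite -mulrBl.
  apply/eqP/(@coefM_lt _ _ _ _ 1 0) => //; first exact: tlimB.
    by move=> l hl; rewrite coefB // cQ (_ : l <= 0) ?mul1r ?subrr //; lia.
  by move=> l hl; rewrite coef_riesz_reg // leNgt hl mul0r.
apply/eqP; rewrite -subr_eq0 -coefB; try exact: tlimM.
under eq_fun do rewrite -mulrBr.
apply/eqP/(@coefM_gt _ _ _ 0 (-1)) => //; first exact: tlimB.
  by move=> l hl; rewrite cQ leNgt hl mul0r.
by move=> l hl; rewrite coefB // coef_riesz_reg // (_ : 0 <= l) ?mul1r ?subrr //; lia.
Qed.

(** Transposition reverses the order of the product in a commutator, which produces the sign. *)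
Lemma mean_comm c u v : reg q c -> reg q u -> reg q v ->
  coef (fun t => u t * comm c v t) 0 =
  - coef (fun t => conjc (comm (fun s => conjc (c s)) (fun s => conjc (u s)) t) * v t) 0.
Proof.
move=> hc hu hv; pose Q (w : R -> C) t := conjc (riesz (fun s => conjc (w s)) t).
have hQ w : reg q w -> reg q (Q w).
  by move=> hw; apply: reg_conj; apply: reg_riesz; exact: reg_conj.
have hcv := regM hc hv; have huc := regM hu hc; have hr := reg_riesz hv.
have tl w z : reg q w -> reg q z -> tlim (fun t => w t * z t).
  by move=> ? ?; apply: tlimM; exact: reg_tlim.
rewrite (_ : (fun t => u t * comm c v t) = fun t =>
  u t * riesz (fun t => c t * v t) t - u t * c t * riesz v t); last first.
  by apply/funext => t; rewrite /comm; ring.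
rewrite (_ : (fun t => conjc _ * v t) = fun t =>
  Q (fun t => u t * c t) t * v t - Q u t * (c t * v t)); last first.
  apply/funext => t; rewrite /comm /Q rmorphB rmorphM /= conjcK mulrBl.
  rewrite (_ : (fun s => conjc (c s) * conjc (u s)) = fun s => conjc (u s * c s)).
    by rewrite mulrA [conjc _ * c t]mulrC.
  by apply/funext => s; rewrite rmorphM mulrC.
rewrite coefB ?mean_riesz //; [|by apply: tl => //; exact: reg_riesz..].
rewrite coefB ?opprB //; [apply: tl|apply: tl] => //; exact: hQ.
Qed.

End Rate.

Section TwoRates.
Context (q q' : R) (q01 : 0 < q < 1) (q01' : 0 < q' < 1) (qq : q <= q').

Lemma yn_rate h M : yn q h M -> yn q' h M.
Proof.
move=> [hh hM hV]; split=> // j t; rewrite (le_trans (hV j t)) //.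
case/andP: q01 => q0 _; case/andP: q01' => q0' _.
have M0 := le_trans (cabs_ge0 _) (hM 0).
by rewrite ler_wpM2l // lerXn2r // nnegrE ltW.
Qed.

Lemma reg_rate h : reg q h -> reg q' h.
Proof. by move=> [M /yn_rate hM]; exists M. Qed.

(** [hankel_smoothing] supplies f of rate [q] with the negative coefficients of c u; the negative
    part of c u is therefore that of f, again of rate [q]. *)
Lemma hankel_reg c u : reg q c -> reg q' u -> (forall k, k < 0 -> coef u k = 0) ->
  reg q (fun t => c t * u t - riesz (fun t => c t * u t) t).
Proof.
move=> hc hu u0; have [M cM] := hc.
have [f [K [yf fE]]] := hankel_smoothing q01 cM (reg_tlim hu) u0.
have rf : reg q f by exists K.
have rcu := regM q01' (reg_rate hc) hu.
have H1 : reg q (fun t => f t - riesz f t) by apply: regB => //; exact: reg_riesz.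
apply: eq_reg H1; apply: tlim_ext.
- by apply: tlimB; [exact: reg_tlim rf|exact: reg_tlim (reg_riesz q01 rf)].
- by apply: tlimB; [exact: reg_tlim rcu|exact: reg_tlim (reg_riesz q01' rcu)].
move=> k; rewrite !coefB.
- rewrite (coef_riesz_reg q01) // (coef_riesz_reg q01') //.
  by case: (leP 0 k) => k0; [rewrite !mul1r !subrr|rewrite !mul0r !subr0 fE].
- exact: reg_tlim rcu.
- exact: reg_tlim (reg_riesz q01' rcu).
- exact: reg_tlim rf.
- exact: reg_tlim (reg_riesz q01 rf).
Qed.

(** With u = up + um split into frequencies k >= 0 and k < 0, the commutator is riesz (c um) - (c up
    - riesz (c up)). The second term is a Hankel operator with symbol c, the first becomes one after
    conjugation, and [hankel_reg] applies to both. *)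
Lemma comm_reg c u : reg q c -> reg q' u -> reg q (comm c u).
Proof.
move=> hc hu; have hc' := reg_rate hc.
pose up := riesz u; pose um t := u t - riesz u t.
have hup : reg q' up := reg_riesz q01' hu.
have hum : reg q' um by exact: regB.
have tu := reg_tlim hu.
have cup k : k < 0 -> coef up k = 0.
  by move=> k0; rewrite /up (coef_riesz_reg q01') // leNgt k0 mul0r.
have cum k : 0 <= k -> coef um k = 0.
  by move=> k0; rewrite (coefB k tu (reg_tlim hup)) /up (coef_riesz_reg q01') // k0 mul1r subrr.
have H1 := hankel_reg hc hup cup.
have hcm := reg_conj q01' hum.
have H2 := hankel_reg (reg_conj q01 hc) hcm _.
have {}H2 : reg q (fun t => conjc (c t) * conjc (um t) -
    riesz (fun t => conjc (c t) * conjc (um t)) t).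
  apply: H2 => k k0; rewrite coef_conj; last exact: reg_tlim hum.
  by rewrite cum ?conjc0 //; lia.
pose w t := c t * um t.
have hw : reg q' w by exact: regM.
have hwc : reg q' (fun t => conjc (w t)) by exact: reg_conj.
have Ew : (fun t => conjc (c t) * conjc (um t)) = fun t => conjc (w t).
  by apply/funext => t; rewrite rmorphM.
rewrite Ew in H2.
have E : (fun t => conjc (c t) * conjc (um t) - riesz (fun t => conjc (w t)) t) =
  fun t => conjc (w t) - riesz (fun t => conjc (w t)) t.
  by apply/funext => t; rewrite /w rmorphM.
rewrite E in H2.
have tw := reg_tlim hw; have twc := reg_tlim hwc.
have tg := reg_tlim H2.
have tcst : tlim (fun=> coef w 0) by exact: (tp_tlim (tp_cst 0 _)).
(* The frequency 0 belongs to the range of [riesz] before and after conjugation, so the mean of w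
   has to be added back. *)
have rw : reg q (riesz w).
  have := regD (reg_conj q01 H2) (reg_tp q01 (tp_cst 0 (coef w 0))).
  apply: eq_reg; apply: tlim_ext.
  - by apply: tlimD => //; exact: tlim_conj.
  - exact: reg_tlim (reg_riesz q01' hw).
  move=> k; rewrite coefD //; last exact: tlim_conj.
  rewrite coef_conj // coefB //; last exact: reg_tlim (reg_riesz q01' hwc).
  rewrite !(coef_riesz_reg q01') // coef_conj // opprK oppr_ge0.
  have -> : coef (fun=> coef w 0) k = (k == 0)%:R * coef w k.
    rewrite (_ : (fun=> _) = fun t : R => coef w 0 * ek 0 t); last first.
      by apply/funext => t; rewrite ek0 mulr1.
    rewrite coefZ; last exact: tlim_ek.
    by rewrite coef_ek mulrC; case: eqVneq => [->|]; rewrite ?mul0r.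
  have [k0|k0|k0] := ltgtP k 0.
  - by rewrite !mul1r !mul0r addr0 subrr conjc0.
  - by rewrite !mul1r !mul0r addr0 subr0 conjcK.
  - by rewrite k0 !mul1r subrr conjc0 add0r.
apply: (eq_reg _ (regB rw H1)) => t.
rewrite /comm /w (_ : (fun t => c t * u t) = fun t => c t * um t + c t * up t); last first.
  by apply/funext => s; rewrite -mulrDr subrK.
rewrite (rieszD q01'); [rewrite /up /um; ring|exact: regM|exact: regM].
Qed.

(* Subtracting a high de la Vallee Poussin mean makes a function of the
   faster rate [q] arbitrarily small in the norm of the slower rate [q']. *)
Lemma yn_tail c (d : R) : q < q' -> reg q c -> 0 < d ->
  exists n0, forall n, (n0 <= n)%N -> yn q' (fun t => c t - vp (2 ^ n) c t) d.
Proof.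
move=> qltq [M cM] d0; have M0 := yn_ge0 cM; have [tc _ cV] := cM.
case/andP: q01 => q0 q1; case/andP: q01' => q0' q1'.
have r01 : 0 <= q / q' < 1.
  by apply/andP; split; [rewrite divr_ge0 // ltW|rewrite ltr_pdivrMr // mul1r].
set r := q / q' in r01; have /andP[r0 r1] := r01.
have [n0 Hn0] := geo_small (4 * M / q') r01 d0.
exists n0 => n nn.
have qE j : q ^+ j = r ^+ j * q' ^+ j by rewrite -exprMn divfK ?gt_eqF.
have mon j i : (i <= j)%N -> M * (r ^+ j) <= M * r ^+ i.
  by move=> ij; rewrite ler_wpM2l // ler_wiXn2l // ltW.
have P0 j : 0 <= M * r ^+ j by rewrite mulr_ge0 // exprn_ge0.
have qX1 j : q' ^+ j <= 1 by rewrite exprn_ile1 // ltW.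
have qX0 j : 0 <= q' ^+ j by rewrite exprn_ge0 // ltW.
apply: (@yn_le _ _ q01' _ (4 * (M * r ^+ n) / q' ^+ 1)).
  rewrite (le_trans _ Hn0) // expr1 mulrA (mulrAC _ (r ^+ n)) ler_wpM2l //.
    by rewrite divr_ge0 ?mulr_ge0 // ltW.
  by rewrite ler_wiXn2l // ltW.
have sup t : cabs (c t - vp (2 ^ n) c t) <= M * r ^+ n * q' ^+ n.
  by rewrite (le_trans (cV n t)) // qE mulrA.
apply: (yn_approx q01') => [t|j].
  by rewrite (le_trans (sup t)) // ler_piMr.
case: (leqP n j) => nj; last first.
  exists (fun=> 0); split; first exact: tp0.
  move=> t; rewrite subr0 (le_trans (sup t)) // ler_wpM2l //.
  by rewrite ler_wiXn2l ?(ltW q0') ?(ltW q1') ?(ltnW nj).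
exists (fun t => vp (2 ^ j) c t - vp (2 ^ n) c t); split.
  rewrite addn1 expnS mul2n; apply: tpB; first exact: tp_vp.
  by apply: tp_le (tp_vp (2 ^ n) c); rewrite leq_double leq_exp2l.
move=> t; rewrite (_ : _ - _ = c t - vp (2 ^ j) c t); last by ring.
by rewrite (le_trans (cV j t)) // qE mulrA ler_wpM2r // mon.
Qed.

End TwoRates.
End Commutators.

(** * Fredholm theory of Riemann-Hilbert operators *)

Section Pairing.
Context (R : realType).
Local Notation C := R[i].
Implicit Types (h g u : R -> C).

Definition real_valued h := forall t, conjc (h t) = h t.

Lemma reC_D h g t : reC (fun t => h t + g t) t = reC h t + reC g t.
Proof. by rewrite /reC raddfD rmorphD. Qed.

Lemma mean_reC u g : tlim u -> tlim g -> real_valued u ->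
  coef (fun t => u t * reC g t) 0 = (complex.Re (coef (fun t => u t * g t) 0))%:C.
Proof.
move=> hu hg ur; have hug := tlimM hu hg.
rewrite (_ : (fun t => u t * reC g t) = fun t => 2%:R^-1 * (u t * g t + conjc (u t * g t))).
  rewrite coefZ ?coefD ?coef_conj //; last by apply: tlimD => //; exact: tlim_conj.
    by rewrite oppr0 ReJ_add mulrC.
  exact: tlim_conj.
by apply/funext => t; rewrite reCE rmorphM /= ur; ring.
Qed.

Lemma coef_real u k : real_valued u -> tlim u -> conjc (coef u (- k)) = coef u k.
Proof. by move=> ur hu; rewrite -coef_conj //; congr coef; apply/funext. Qed.

Lemma conj_vp n u t : tlim u -> conjc (vp n u t) = vp n (fun t => conjc (u t)) t.
Proof.
move=> hu; move: t; apply: (tp_ext (tp_conj (tp_vp n u)) (tp_vp n _)) => k.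
rewrite coef_conj; last exact: tp_tlim (tp_vp _ _).
rewrite !coef_vp coef_conj // rmorphM rmorphB !rmorphM !fmorphV !rmorph_nat /=.
by rewrite abszN.
Qed.

(** Expands a real polynomial in the real parts of s e^(ikt), with s = 1 or i, because the finite
    rank operators to come are only real-linear. The coefficients are written as pairings of u with
    real functions, the form in which they can be transposed; [w] is the multiplier of [vp D], moved
    onto the functional. *)
Lemma real_coordinates D u t : real_valued u -> tlim u ->
  vp D u t = \sum_(a < D.*2.*2.+1) \sum_(z : bool)
    let k := a%:Z - D.*2%:Z in
    let s := if z then 'i%C else 1 in
    let w := 2%:R * ((D.*2 - `|k|)%:R / D.*2%:R) - (D - `|k|)%:R / D%:R in
    coef (fun t => reC (fun t => conjc s * w * ek (- k) t) t * u t) 0 *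
    reC (fun t => s * ek k t) t.
Proof.
move=> ur hu; rewrite -[LHS]reC_id; last by rewrite conj_vp //; congr vp; apply/funext.
rewrite {1}/reC (tp_coefE (tp_vp D u)) raddf_sum rmorph_sum; apply: eq_bigr => a _ /=.
set k := a%:Z - D.*2%:Z.
have E (s : C) (w := 2%:R * ((D.*2 - `|k|)%:R / D.*2%:R) - (D - `|k|)%:R / D%:R) :
  coef (fun t => reC (fun t => conjc s * w * ek (- k) t) t * u t) 0 =
  (complex.Re (conjc s * coef (vp D u) k))%:C.
  under [X in coef X]eq_fun do rewrite mulrC.
  rewrite mean_reC //; last by apply: tlimZ; exact: tlim_ek.
  congr (_%:C); congr complex.Re.
  rewrite (_ : (fun t => _) = fun t => conjc s * w * (ek (- k) t * u t)); last first.
    by apply/funext => x; ring.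
  rewrite coefZ; last by apply: tlimM => //; exact: tlim_ek.
  by rewrite coef_shift sub0r opprK coef_vp [RHS]mulrA.
rewrite big_bool !E /reC; case: (coef (vp D u) k) => x y; case: (ek k t) => x' y' /=.
by apply/eqP; rewrite eq_complex /=; apply/andP; split; apply/eqP; ring.
Qed.

End Pairing.

(** * Neumann series *)

Section Neumann.
Context (R : realType) (q : R) (q01 : 0 < q < 1) (m : nat).
Local Notation C := R[i].
Local Notation fam := ('I_m -> R -> C).

Definition ynf (phi : fam) (M : R) := forall i, yn q (phi i) M.

Lemma ynf_reg (I : finType) (F : I -> R -> C) : (forall i, reg q (F i)) ->
  exists M, 0 <= M /\ forall i, yn q (F i) M.
Proof.
move=> /choice[M hM]; exists (\sum_i M i); have M0 i := yn_ge0 (hM i); split.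
  exact: sumr_ge0.
move=> i; apply: (yn_le q01) (hM i).
by rewrite (bigD1 i) //= lerDl sumr_ge0.
Qed.

(** The solution is the series of the (-Op)^j f. As [ynf] is a predicate and not a norm,
    compatibility with differences and halving of bounds are what stand for a linear contraction,
    and [yn_complete] sums the series. *)
Lemma neumann (Op : fam -> fam) :
  (forall phi phi' M M', ynf phi M -> ynf phi' M' -> forall i t,
     Op (fun i t => phi i t - phi' i t) i t = Op phi i t - Op phi' i t) ->
  (forall phi M, ynf phi M -> ynf (Op phi) (2^-1 * M)) ->
  forall f M, 0 <= M -> ynf f M ->
  exists phi M', ynf phi M' /\ forall i t, phi i t + Op phi i t = f i t.
Proof.
move=> hsub hbd f M M0 hf.
pose v := fix v (j : nat) : fam := if j is i.+1 then fun l t => - Op (v i) l t else f.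
have hv j : ynf (v j) (M * 2^-1 ^+ j).
  elim: j => [|j IH] i; first by rewrite expr0 mulr1; exact: hf.
  have := ynZ (-1) (hbd _ _ IH i); rewrite cabsN cabs1 mul1r exprS mulrCA.
  by under eq_fun do rewrite mulN1r.
pose s J : fam := fun i t => \sum_(j < J) v j i t.
have /choice[phi hphi] i := yn_complete q01 (u := fun j => v j i) M0 (fun j => hv j i).
have ys J : ynf (s J) (\sum_(j < J) M * 2^-1 ^+ j).
  by move=> i; apply: yn_sum => // j; exact: hv.
have Op0 i t : Op (fun _ _ => 0) i t = 0.
  have y0 : ynf (fun _ _ => 0) 0 by move=> l; exact: yn0.
  by have := hsub _ _ _ _ y0 y0 i t; under eq_fun do under eq_fun do rewrite subrr; rewrite subrr.
have yN (w : fam) M' : ynf w M' -> ynf (fun i t => - w i t) M'.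
  move=> hw i; have := ynZ (-1) (hw i); rewrite cabsN cabs1 mul1r.
  by under eq_fun do rewrite mulN1r.
have OpN (w : fam) M' i t : ynf w M' -> Op (fun i t => - w i t) i t = - Op w i t.
  move=> hw; have y0 : ynf (fun _ _ => 0) 0 by move=> l; exact: yn0.
  have := hsub _ _ _ _ y0 hw i t; rewrite Op0 sub0r => <-.
  by congr (Op _ i t); apply/funext => l; apply/funext => x; rewrite sub0r.
have Ops J i t : Op (s J) i t = f i t - s J.+1 i t.
  elim: J => [|J IH].
    rewrite (_ : s 0%N = fun _ _ => 0); first by rewrite Op0 /s big_ord1 subrr.
    by apply/funext => l; apply/funext => x; rewrite /s big_ord0.
  rewrite (_ : s J.+1 = fun i t => s J i t - (- v J i t)); last first.
    by apply/funext => l; apply/funext => x; rewrite /s big_ord_recr opprK.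
  rewrite (hsub _ _ _ _ (ys J) (yN _ _ (hv J))) (OpN _ _ _ _ (hv J)) IH.
  by rewrite /s [in RHS]big_ord_recr /= opprD addrA.
exists phi, (2 * M * 2^-1 ^+ 0); split=> [i|i t].
  by have := hphi i 0%N; under eq_fun do rewrite big_ord0 subr0.
apply/eqP; rewrite -subr_eq0; apply/eqP/cabs_tiny => e e0.
have h2 : 0 <= (2^-1 : R) < 1 by apply/andP; split; lra.
have [J HJ] := geo_small (4 * M) h2 e0.
have yphi : ynf phi (2 * M * 2^-1 ^+ 0).
  by move=> l; have := hphi l 0%N; under eq_fun do rewrite big_ord0 subr0.
have yd K : ynf (fun i t => phi i t - s K i t) (2 * M * 2^-1 ^+ K) by move=> l; exact: hphi.
have E : phi i t + Op phi i t - f i t =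
    (phi i t - s J.+1 i t) + Op (fun i t => phi i t - s J i t) i t.
  by rewrite (hsub _ _ _ _ yphi (ys J)) Ops; ring.
rewrite E (le_trans (cabsD _ _)) //.
have [_ /(_ t) b1 _] := yd J.+1 i; have [_ /(_ t) b2 _] := hbd _ _ (yd J) i.
rewrite (le_trans (lerD b1 b2)) // (le_trans _ HJ) // exprS.
have := exprn_ge0 J (_ : 0 <= (2^-1 : R)); move: (2^-1 ^+ J) => z H.
have {H} : 0 <= z by apply: H; lra.
by nra.
Qed.

End Neumann.

(** * The remainder operators and their transposes *)

Section RealLinearOperators.
Context (R : realType) (q : R) (q01 : 0 < q < 1) (m N : nat).
Local Notation C := R[i].
Local Notation fam := ('I_m -> R -> C).
Context (B : 'I_m -> 'I_N -> R -> C).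

Definition realf (phi : fam) := forall l, real_valued (phi l).

Definition pair (psi phi : fam) : C := \sum_l coef (fun t => psi l t * phi l t) 0.

(** The remainder of the right parametrix, with c in the place of the right inverse b. It is
    additive in c, so it splits along a decomposition of b into a polynomial and a small tail. *)
Definition cop (c : 'I_N -> 'I_m -> R -> C) (phi : fam) : fam := fun l t =>
  2%:R * reC (fun t => \sum_i \sum_j B l i t * comm (c i j) (phi j) t) t.

(** The transpose of [cop] for [pair], as [pair_cop] shows; sign and conjugations come from
    [mean_comm]. *)
Definition copT (c : 'I_N -> 'I_m -> R -> C) (psi : fam) : fam := fun j t =>
  - 2%:R * reC (fun t => \sum_l \sum_i
    comm (fun s => conjc (c i j s)) (fun s => conjc (psi l s * B l i s)) t) t.

Lemma real_cop c phi : realf (cop c phi).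
Proof. by move=> l t; rewrite /cop rmorphM rmorph_nat; congr (_ * _); exact: conj_reC. Qed.

Lemma real_copT c phi : realf (copT c phi).
Proof. by move=> l t; rewrite /copT rmorphM rmorphN rmorph_nat; congr (_ * _); exact: conj_reC. Qed.

Context (hB : forall l i, reg q (B l i)).

Lemma reg_cop_aux c (phi : fam) l : (forall i j, reg q (c i j)) -> (forall j, reg q (phi j)) ->
  reg q (fun t => \sum_i \sum_j B l i t * comm (c i j) (phi j) t).
Proof.
move=> hc hphi; apply: (reg_sum q01) => i _; apply: (reg_sum q01) => j _.
by apply: regM => //; exact: reg_comm.
Qed.

Lemma reg_cop c (phi : fam) l : (forall i j, reg q (c i j)) -> (forall j, reg q (phi j)) ->
  reg q (cop c phi l).
Proof. by move=> hc hphi; apply: regZ; apply: reg_reC => //; exact: reg_cop_aux. Qed.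

Lemma cop_sub c phi phi' l t : (forall i j, reg q (c i j)) ->
  (forall j, reg q (phi j)) -> (forall j, reg q (phi' j)) ->
  cop c (fun l t => phi l t - phi' l t) l t = cop c phi l t - cop c phi' l t.
Proof.
move=> hc h h'; rewrite /cop -mulrBr; congr (_ * _).
rewrite /reC -rmorphB -raddfB; congr (_%:C); congr complex.Re.
rewrite -sumrB; apply: eq_bigr => i _; rewrite -sumrB; apply: eq_bigr => j _.
by rewrite (commBr q01) // mulrBr.
Qed.

Lemma cop_addl c d phi l t : (forall i j, reg q (c i j)) -> (forall i j, reg q (d i j)) ->
  (forall j, reg q (phi j)) ->
  cop (fun i j t => c i j t + d i j t) phi l t = cop c phi l t + cop d phi l t.
Proof.
move=> hc hd h; rewrite /cop -mulrDr -reC_D; congr (_ * _).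
rewrite /reC; congr (_%:C); congr complex.Re.
rewrite -big_split; apply: eq_bigr => i _; rewrite -big_split; apply: eq_bigr => j _.
by rewrite (commDl q01) // mulrDr.
Qed.

Lemma copT_sub c phi phi' l t : (forall i j, reg q (c i j)) ->
  (forall j, reg q (phi j)) -> (forall j, reg q (phi' j)) ->
  copT c (fun l t => phi l t - phi' l t) l t = copT c phi l t - copT c phi' l t.
Proof.
move=> hc h h'; rewrite /copT -mulrBr; congr (_ * _).
rewrite /reC -rmorphB -raddfB; congr (_%:C); congr complex.Re.
rewrite -sumrB; apply: eq_bigr => i _; rewrite -sumrB; apply: eq_bigr => j _.
rewrite -(commBr q01); try by apply: (reg_conj q01); try exact: regM.
by congr (comm _ _ t); apply/funext => s; rewrite -rmorphB mulrBl.
Qed.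

Lemma yn_reC : exists K, 0 <= K /\ forall h M, yn q h M -> yn q (fun t => 2%:R * reC h t) (K * M).
Proof.
have q0 : 0 < q by case/andP: q01.
exists (1 + 4 / q ^+ 1); split; first by rewrite addr_ge0 // divr_ge0 // exprn_ge0 // ltW.
move=> h M hM; have := ynD hM (yn_conj q01 hM).
rewrite (_ : (1 + 4 / q ^+ 1) * M = M + 4 * M / q ^+ 1); last by ring.
rewrite (_ : (fun t => 2%:R * reC h t) = fun t => h t + conjc (h t)) //.
by apply/funext => t; rewrite reCE mulVKf // pnatr_eq0.
Qed.

(** The bound is linear in the size [d] of c with a constant independent of c: this is what makes a
    small tail of the right inverse a contraction. *)
Lemma cop_bounded : exists K, 0 <= K /\ forall c d phi M,
  0 <= d -> 0 <= M -> (forall i j, yn q (c i j) d) -> ynf q phi M -> ynf q (cop c phi) (K * d * M).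
Proof.
have q0 : 0 < q by case/andP: q01.
have [MB [MB0 hMB]] := ynf_reg q01 (fun x : 'I_m * 'I_N => hB x.1 x.2).
have [K1 [K10 hK1]] := yn_reC; have [K2 [K20 hK2]] := comm_bounded q01.
exists (K1 * (\sum_(i < N) \sum_(j < m) (16 / q ^+ 2 * (MB * K2)))).
split.
  rewrite mulr_ge0 //; apply: sumr_ge0 => i _; apply: sumr_ge0 => j _.
  by rewrite !mulr_ge0 // invr_ge0 exprn_ge0 // ltW.
move=> c d phi M d0 M0 hc hphi l.
rewrite (_ : _ * _ = K1 * (\sum_(i < N) \sum_(j < m) (16 / q ^+ 2 * (MB * (K2 * (d * M)))))).
  apply: (hK1 (fun t => \sum_i \sum_j B l i t * comm (c i j) (phi j) t)).
  apply: yn_sum => // i; apply: yn_sum => // j.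
  by apply: ynM => //; [exact: hMB (l, i)|exact: hK2].
rewrite -!mulrA; congr (_ * _); rewrite mulr_suml; apply: eq_bigr => i _.
by rewrite mulr_suml; apply: eq_bigr => j _; ring.
Qed.

Lemma copT_bounded : exists K, 0 <= K /\ forall c d phi M,
  0 <= d -> 0 <= M -> (forall i j, yn q (c i j) d) -> ynf q phi M -> ynf q (copT c phi) (K * d * M).
Proof.
have q0 : 0 < q by case/andP: q01.
have [MB [MB0 hMB]] := ynf_reg q01 (fun x : 'I_m * 'I_N => hB x.1 x.2).
have [K1 [K10 hK1]] := yn_reC; have [K2 [K20 hK2]] := comm_bounded q01.
pose G := 4 / q ^+ 1; pose L := 16 / q ^+ 2.
have G0 : 0 <= G by rewrite divr_ge0 // exprn_ge0 // ltW.
have L0 : 0 <= L by rewrite divr_ge0 // exprn_ge0 // ltW.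
exists (K1 * (\sum_(l < m) \sum_(i < N) (K2 * (G * (G * (L * MB)))))).
split.
  rewrite mulr_ge0 //; apply: sumr_ge0 => i _; apply: sumr_ge0 => j _.
  by rewrite ?mulr_ge0 // invr_ge0 exprn_ge0 // ltW.
move=> c d phi M d0 M0 hc hphi j.
rewrite (_ : _ * _ = K1 * (\sum_(l < m) \sum_(i < N) (K2 * ((4 * d / q ^+ 1) * (4 * (L * (M * MB)) / q ^+ 1))))).
  have H : yn q (fun t => \sum_l \sum_i comm (fun s => conjc (c i j s)) (fun s => conjc (phi l s * B l i s)) t)
     (\sum_(l < m) \sum_(i < N) (K2 * ((4 * d / q ^+ 1) * (4 * (L * (M * MB)) / q ^+ 1)))).
    apply: yn_sum => // l; apply: yn_sum => // i; apply: hK2; apply: yn_conj => //.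
    by apply: ynM => //; exact: hMB (l, i).
  have := ynZ (-1) (hK1 _ _ H); rewrite cabsN cabs1 mul1r.
  by under eq_fun do rewrite mulN1r -mulNr.
rewrite -!mulrA; congr (_ * _); rewrite mulr_suml; apply: eq_bigr => i _.
by rewrite mulr_suml; apply: eq_bigr => l _; rewrite /G; ring.
Qed.

Lemma pair_cop c psi phi : (forall i j, reg q (c i j)) ->
  (forall j, reg q (psi j)) -> (forall j, reg q (phi j)) -> realf psi -> realf phi ->
  pair psi (cop c phi) = pair (copT c psi) phi.
Proof.
move=> hc hpsi hphi rpsi rphi.
have tl h : reg q h -> tlim h by exact: reg_tlim.
have tM h g : reg q h -> reg q g -> tlim (fun t => h t * g t) by move=> *; apply: tlimM; exact: tl.
pose g l i j t := psi l t * (B l i t * comm (c i j) (phi j) t).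
have rg l i j : reg q (g l i j) by apply: regM => //; apply: regM => //; exact: reg_comm.
transitivity (2%:R * (complex.Re (\sum_l \sum_i \sum_j coef (g l i j) 0))%:C).
  rewrite /pair raddf_sum rmorph_sum mulr_sumr; apply: eq_bigr => l _.
  rewrite (_ : (fun t => psi l t * cop c phi l t) = fun t => 2%:R * (psi l t *
    reC (fun t => \sum_i \sum_j B l i t * comm (c i j) (phi j) t) t)); last first.
    by apply/funext => t; rewrite /cop mulrCA.
  have ra := reg_cop_aux l hc hphi.
  rewrite coefZ; last by apply: tM => //; exact: reg_reC.
  rewrite mean_reC; [|exact: tl|exact: tl|exact: rpsi]; congr (_ * (complex.Re _)%:C).
  rewrite (_ : (fun t => _) = fun t => \sum_i \sum_j g l i j t); last first.
    apply/funext => t; rewrite mulr_sumr; apply: eq_bigr => i _.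
    by rewrite mulr_sumr; apply: eq_bigr => j _.
  rewrite coef_sum => [|i _]; last by apply: tlim_sum => j _; exact: tl.
  by apply: eq_bigr => i _; rewrite coef_sum // => j _; exact: tl.
pose h l i j := comm (fun s => conjc (c i j s)) (fun s => conjc (psi l s * B l i s)).
have rh l i j : reg q (h l i j).
  by apply: reg_comm => //; apply: (reg_conj q01) => //; exact: regM.
have E l i j : coef (g l i j) 0 = - conjc (coef (fun t => phi j t * h l i j t) 0).
  rewrite (_ : g l i j = fun t => (psi l t * B l i t) * comm (c i j) (phi j) t); last first.
    by apply/funext => t; rewrite /g mulrA.
  rewrite (mean_comm q01) //; last exact: regM.
  rewrite -[X in conjc (coef _ X)]oppr0 -coef_conj; last exact: tM.
  congr (- coef _ 0); apply/funext => t; rewrite rmorphM /= rphi mulrC; congr (_ * conjc _).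
rewrite (eq_bigr (fun l => \sum_i \sum_j - conjc (coef (fun t => phi j t * h l i j t) 0))); last first.
  by move=> l _; apply: eq_bigr => i _; apply: eq_bigr => j _.
transitivity (2%:R * (- (complex.Re (\sum_l \sum_i \sum_j coef (fun t => phi j t * h l i j t) 0))%:C)).
  congr (_ * _); rewrite -rmorphN; congr (_%:C).
  transitivity (complex.Re (- conjc (\sum_l \sum_i \sum_j coef (fun t => phi j t * h l i j t) 0))).
    congr complex.Re; rewrite rmorph_sum -sumrN; apply: eq_bigr => l _.
    rewrite rmorph_sum -sumrN; apply: eq_bigr => i _.
    by rewrite rmorph_sum -sumrN.
  by case: (\sum_l _).
rewrite mulrN -mulNr /pair.
rewrite (eq_bigr (fun l => \sum_j \sum_i coef (fun t => phi j t * h l i j t) 0)); last first.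
  by move=> l _; rewrite exchange_big.
rewrite exchange_big raddf_sum rmorph_sum mulr_sumr; apply: eq_bigr => j _ /=.
have rsum : reg q (fun t => \sum_l \sum_i h l i j t).
  by apply: (reg_sum q01) => l _; apply: (reg_sum q01) => i _.
rewrite (_ : (fun t => copT c psi j t * phi j t) = fun t => - 2%:R * (phi j t *
   reC (fun t => \sum_l \sum_i h l i j t) t)); last first.
  by apply/funext => t; rewrite /copT -mulrA; congr (_ * _); rewrite mulrC.
rewrite coefZ; last by apply: tM => //; exact: reg_reC.
rewrite mean_reC; [|exact: tl|exact: tl|exact: rphi]; congr (_ * (complex.Re _)%:C).
rewrite (_ : (fun t => phi j t * _) = fun t => \sum_l \sum_i phi j t * h l i j t); last first.
  apply/funext => t; rewrite mulr_sumr; apply: eq_bigr => l _.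
  by rewrite mulr_sumr.
rewrite coef_sum => [|l _]; last by apply: tlim_sum => i _; exact: tM.
by apply: eq_bigr => l _; rewrite coef_sum // => i _; exact: tM.
Qed.

End RealLinearOperators.

(** * Separation in finite dimension *)

Section SeparateRows.
Context (K : fieldType) (p : nat).

(** Choose a matrix of maximal rank among those with rows in U; a vector of U outside its row space
    would raise the rank. *)
Lemma subspace_row_matrix (U : 'rV[K]_p -> Prop) :
  U 0 -> (forall a u v, U u -> U v -> U (a *: u + v)) ->
  exists A : 'M[K]_p, forall s, U s <-> (s <= A)%MS.
Proof.
move=> U0 Ulin.
have UA (A : 'M[K]_p) : (forall i, U (row i A)) -> forall s, (s <= A)%MS -> U s.
  move=> hA s /submxP[D ->]; rewrite mulmx_sum_row.
  apply: big_ind => // [x y hx hy|i _].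
    by rewrite -[x]scale1r; exact: Ulin.
  by rewrite -[_ *: _]addr0; exact: Ulin.
pose P (r : nat) := `[< exists A : 'M[K]_p, (forall i, U (row i A)) /\ \rank A = r >].
have exP : exists r, P r.
  exists 0%N; apply/asboolP; exists 0; split=> [i|]; last exact: mxrank0.
  by rewrite row0.
have maxP r : P r -> (r <= p)%N by move/asboolP => [A [_ <-]]; exact: rank_leq_row.
case: (ex_maxnP exP maxP) => r /asboolP[A [hA rA]] hmax.
exists A => s; split=> [Us|]; last exact: UA.
pose D := (A + s)%MS.
have hD i : U (row i D).
  have : (row i D <= A + s)%MS by rewrite row_sub.
  move/sub_addsmxP => [[u v] /= ->].
  rewrite -[u *m A]scale1r; apply: (Ulin); first exact: UA (submxMl _ _).
  by rewrite (mx11_scalar v) mul_scalar_mx -[_ *: _]addr0; exact: Ulin.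
have rD : (\rank D <= \rank A)%N by rewrite rA hmax //; apply/asboolP; exists D.
have sAD : (A <= D)%MS by exact: addsmxSl.
have /eqmxP e : (A == D)%MS by rewrite -(mxrank_leqif_eq sAD).2 eqn_leq rD mxrankS.
by rewrite e; exact: addsmxSr.
Qed.

(** The separating functional is a column of the cokernel matrix. It stands for the Hahn-Banach
    theorem in the proof of solvability. *)
Lemma separate_row (U : 'rV[K]_p -> Prop) (t : 'rV[K]_p) :
  U 0 -> (forall a u v, U u -> U v -> U (a *: u + v)) -> ~ U t ->
  exists mu : 'I_p -> K, (forall s, U s -> \sum_j s 0 j * mu j = 0) /\ \sum_j t 0 j * mu j != 0.
Proof.
move=> U0 Ulin Ut; have [A hA] := subspace_row_matrix U0 Ulin.
have : t *m cokermx A != 0 by apply: contra_notN Ut => h; apply/hA; rewrite submxE.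
case/rV0Pn => j hj; exists (fun i => cokermx A i j); split; last by rewrite mxE in hj.
by move=> s /hA; rewrite submxE => /eqP/rowP/(_ j); rewrite !mxE.
Qed.

End SeparateRows.

(** * Solvability of the Riemann-Hilbert problem *)

Section Fredholm.
Context (R : realType) (q q' : R) (q01 : 0 < q < 1) (q01' : 0 < q' < 1) (qltq' : q < q').
Context (m N : nat).
Local Notation C := R[i].
Local Notation fam := ('I_m -> R -> C).
Context (B : 'I_m -> 'I_N -> R -> C) (b : 'I_N -> 'I_m -> R -> C).
Context (hB : forall l i, reg q (B l i)) (hb : forall i j, reg q (b i j)).
Context (Bb : forall l j t, \sum_i B l i t * b i j t = (l == j)%:R).

Let qq : q <= q'. Proof. exact: ltW. Qed.
Let hB' l i : reg q' (B l i). Proof. exact: (reg_rate q01 q01' qq (hB l i)). Qed.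
Let hb' i j : reg q' (b i j). Proof. exact: (reg_rate q01 q01' qq (hb i j)). Qed.

Definition analytic (v : 'I_N -> R -> C) :=
  forall i, reg q (v i) /\ forall k, k < 0 -> coef (v i) k = 0.

Definition RHop (v : 'I_N -> R -> C) : fam := fun l => reC (fun t => \sum_i B l i t * v i t).

(** The frequency 0 is included in the condition because constants are among the analytic [v] that
    are tested. *)
Definition RHker (psi : fam) := [/\ forall l, reg q (psi l), realf psi &
  forall i k, k <= 0 -> coef (fun t => \sum_l psi l t * B l i t) k = 0].

(** Taking b out of the projection costs a commutator; what is left is twice the real part of B b
    riesz phi = riesz phi, which [riesz_real] evaluates. *)
Lemma right_parametrix (phi : fam) : (forall l, reg q (phi l)) -> realf phi ->
  let v i t := 2%:R * riesz (fun t => \sum_j b i j t * phi j t) t in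
  analytic v /\ forall l t, RHop v l t = phi l t + coef (phi l) 0 + cop B b phi l t.
Proof.
move=> hphi rphi v; split=> [i|l t].
  have rs : reg q (fun t => \sum_j b i j t * phi j t).
    by apply: (reg_sum q01) => j _; exact: regM.
  split=> [|k k0]; first by apply: regZ; exact: reg_riesz.
  rewrite coefZ; last exact: reg_tlim (reg_riesz q01 rs).
  by rewrite (coef_riesz_reg q01) // leNgt k0 mul0r mulr0.
rewrite -(riesz_real q01 t (hphi l) (rphi l)) /cop -mulrDr -reC_D.
transitivity (reC (fun t => 2%:R * (riesz (phi l) t + \sum_i \sum_j B l i t * comm (b i j) (phi j) t)) t).
  rewrite /RHop /reC; congr (_%:C); congr complex.Re.
  have -> : riesz (phi l) t = \sum_i \sum_j B l i t * (b i j t * riesz (phi j) t).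
    rewrite exchange_big (bigD1 l) //= [X in _ + X]big1 ?addr0 => [|j jl].
      under eq_bigr do rewrite mulrA.
      by rewrite -mulr_suml Bb eqxx mul1r.
    under eq_bigr do rewrite mulrA.
    by rewrite -mulr_suml Bb eq_sym (negbTE jl) mul0r.
  rewrite -big_split mulr_sumr; apply: eq_bigr => i _.
  rewrite /v mulrCA; congr (_ * _); rewrite (riesz_sum q01) //; last by move=> j; exact: regM.
  rewrite -big_split mulr_sumr; apply: eq_bigr => j _ /=.
  by rewrite -mulrDr /comm addrC subrK.
rewrite /reC; case: (_ + _) => x y /=; apply/eqP; rewrite eq_complex /=.
by apply/andP; split; apply/eqP; ring.
Qed.

Lemma tail_split : forall d : R, 0 < d -> exists D c e,
  [/\ (0 < D)%N, forall i j, yn q' (c i j) d, forall i j, reg q (c i j),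
      (forall i j, tp D.*2 (e i j)) & forall i j t, b i j t = c i j t + e i j t].
Proof.
move=> d d0; have H i j := yn_tail q01 q01' qltq' (hb i j) d0.
have /choice[n hn] : forall x : 'I_N * 'I_m, exists n0, forall n, (n0 <= n)%N ->
  yn q' (fun t => b x.1 x.2 t - vp (2 ^ n) (b x.1 x.2) t) d by move=> x; exact: H.
pose K := (\max_(x : 'I_N * 'I_m) n x)%N; pose D := (2 ^ K)%N.
exists D, (fun i j t => b i j t - vp D (b i j) t), (fun i j => vp D (b i j)); split.
- by rewrite expn_gt0.
- by move=> i j; apply: (hn (i, j)); exact: (leq_bigmax (i, j)).
- by move=> i j; apply: regB => //; apply: (reg_tp q01 (tp_vp _ _)).
- by move=> i j; exact: tp_vp.
- by move=> i j t; rewrite subrK.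
Qed.

Lemma solve_perturbed (Op : fam -> fam) :
  (forall phi phi', (forall l, reg q' (phi l)) -> (forall l, reg q' (phi' l)) -> forall l t,
    Op (fun l t => phi l t - phi' l t) l t = Op phi l t - Op phi' l t) ->
  (forall phi, realf (Op phi)) ->
  (forall phi M, 0 <= M -> ynf q' phi M -> ynf q' (Op phi) (2^-1 * M)) ->
  forall f, (forall l, reg q' (f l)) -> realf f ->
  exists phi, [/\ forall l, reg q' (phi l), realf phi & forall l t, phi l t + Op phi l t = f l t].
Proof.
move=> hsub hreal hbd f hf rf; have [M [M0 yM]] := ynf_reg q01' hf.
have ynr phi M' : ynf q' phi M' -> forall l, reg q' (phi l) by move=> h l; exists M'.
have [|phi M' h|phi [M' [yphi E]]] := @neumann R q' q01' m Op _ _ f M M0 yM.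
- by move=> phi phi' M1 M2 /ynr h1 /ynr h2; exact: hsub.
- move=> l; have M0' : 0 <= M' := yn_ge0 (h l); exact: hbd M0' h l.
exists phi; split=> //; first exact: ynr yphi.
move=> l t; rewrite (_ : phi l t = f l t - Op phi l t); last by rewrite -E addrK.
by rewrite rmorphB /= rf hreal.
Qed.

Lemma coef0_pairl (psi phi phi' : fam) : (forall l, reg q' (psi l)) ->
  (forall l, reg q' (phi l)) -> (forall l, reg q' (phi' l)) ->
  pair psi (fun l t => phi l t + phi' l t) = pair psi phi + pair psi phi'.
Proof.
move=> h1 h2 h3; rewrite /pair -big_split; apply: eq_bigr => l _ /=.
rewrite -coefD; [|apply: reg_tlim (regM q01' _ _) => //..].
by under eq_fun do rewrite mulrDr.
Qed.

Lemma pair_addl (psi psi' phi : fam) : (forall l, reg q' (psi l)) ->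
  (forall l, reg q' (psi' l)) -> (forall l, reg q' (phi l)) ->
  pair (fun l t => psi l t + psi' l t) phi = pair psi phi + pair psi' phi.
Proof.
move=> h1 h2 h3; rewrite /pair -big_split; apply: eq_bigr => l _ /=.
rewrite -coefD; [|apply: reg_tlim (regM q01' _ _) => //..].
by under eq_fun do rewrite mulrDl.
Qed.

Lemma pair_suml (I : finType) (a : I -> C) (psi : I -> fam) (phi : fam) :
  (forall i l, reg q' (psi i l)) -> (forall l, reg q' (phi l)) ->
  pair (fun l t => \sum_i a i * psi i l t) phi = \sum_i a i * pair (psi i) phi.
Proof.
move=> h1 h2; have tM i l := reg_tlim (regM q01' (h1 i l) (h2 l)).
rewrite /pair; under [RHS]eq_bigr do rewrite mulr_sumr.
rewrite exchange_big; apply: eq_bigr => l _ /=.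
under [X in coef X]eq_fun do rewrite mulr_suml.
rewrite coef_sum => [|i _]; last by under eq_fun do rewrite -mulrA; exact: tlimZ.
by apply: eq_bigr => i _; under eq_fun do rewrite -mulrA; rewrite coefZ.
Qed.

Lemma pair_sumr (I : finType) (a : I -> C) (psi : I -> fam) (phi : fam) :
  (forall i l, reg q' (psi i l)) -> (forall l, reg q' (phi l)) ->
  pair phi (fun l t => \sum_i a i * psi i l t) = \sum_i a i * pair phi (psi i).
Proof.
have sym f g : pair f g = pair g f.
  by apply: eq_bigr => l _; congr coef; apply/funext => t; rewrite mulrC.
by move=> h1 h2; rewrite sym pair_suml //; apply: eq_bigr => i _; rewrite sym.
Qed.

Lemma pair_real (psi phi : fam) : (forall l, reg q' (psi l)) ->
  (forall l, reg q' (phi l)) -> realf psi -> realf phi ->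
  (complex.Re (pair psi phi))%:C = pair psi phi.
Proof.
move=> h1 h2 r1 r2; rewrite /pair raddf_sum rmorph_sum; apply: eq_bigr => l _ /=.
rewrite -mean_reC; [|exact: reg_tlim (h1 l)|exact: reg_tlim (h2 l)|exact: r1].
by congr coef; apply/funext => t; rewrite (reC_id (r2 l t)).
Qed.

(** The mean and the commutators with polynomials of degree D do not see phi - vp D phi, by
    [comm_high]. So phi may be replaced by [vp D phi] and expanded with [real_coordinates]; the
    [g i] are the values at the basis functions and have rate [q] because B and e do. *)
Lemma cop_finite_rank D (e : 'I_N -> 'I_m -> R -> C) : (0 < D)%N -> (forall i j, tp D (e i j)) ->
  exists (I : finType) (beta g : I -> fam),
    [/\ forall i l, reg q' (beta i l), forall i, realf (beta i),
        forall i l, reg q (g i l), forall i, realf (g i) &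
        forall phi, (forall l, reg q' (phi l)) -> realf phi -> forall l t,
          coef (phi l) 0 + cop B e phi l t = \sum_i pair (beta i) phi * g i l t].
Proof.
move=> D0 he; have re i j : reg q (e i j) := reg_tp q01 (he i j).
have re' i j : reg q' (e i j) := reg_tp q01' (he i j).
pose I : finType := ('I_m * ('I_(D.*2.*2.+1) * bool))%type.
pose fr (a : 'I_(D.*2.*2.+1)) : int := a%:Z - D.*2%:Z.
pose sc (z : bool) : C := if z then 'i%C else 1.
pose w (k : int) : C := 2%:R * ((D.*2 - `|k|)%:R / D.*2%:R) - (D - `|k|)%:R / D%:R.
pose bt a z := reC (fun t => conjc (sc z) * w (fr a) * ek (- fr a) t).
pose tau a z := reC (fun t => sc z * ek (fr a) t).
pose F (phi : fam) : fam := fun l t => coef (phi l) 0 + cop B e phi l t.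
pose delta (h : R -> C) (j : 'I_m) : fam := fun l t => (l == j)%:R * h t.
have rek (r : R) (r01 : 0 < r < 1) (a : C) k : reg r (fun t => a * ek k t).
  by apply: regZ; exact: (reg_tp r01 (@tp_ek _ `|k| k (leqnn _))).
have rtau r (r01 : 0 < r < 1) a z : reg r (tau a z) by apply: reg_reC => //; exact: rek.
have rbt a z : reg q' (bt a z) by apply: reg_reC => //; exact: rek.
have rdelta r (r01 : 0 < r < 1) h j l : reg r h -> reg r (delta h j l) by move=> ?; exact: regZ.
have redelta h j : real_valued h -> realf (delta h j).
  by move=> rh l t; rewrite /delta rmorphM rmorph_nat; congr (_ * _); exact: rh.
have Freg phi : (forall l, reg q (phi l)) -> forall l, reg q (F phi l).
  move=> h l; apply: regD; first exact: (reg_tp q01 (tp_cst 0 _)).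
  exact: reg_cop.
have Freal phi : (forall l, reg q' (phi l)) -> realf phi -> realf (F phi).
  move=> h r l t; rewrite /F rmorphD; congr (_ + _); last exact: real_cop.
  by have := coef_real 0 (r l) (reg_tlim (h l)); rewrite oppr0.
have Fsub phi phi' : (forall l, reg q' (phi l)) -> (forall l, reg q' (phi' l)) -> forall l t,
    F (fun l t => phi l t - phi' l t) l t = F phi l t - F phi' l t.
  move=> h h' l t; rewrite /F (cop_sub q01' B) // coefB; [ring|exact: reg_tlim (h l)|exact: reg_tlim (h' l)].
have Flin (a : I -> R) (G : I -> fam) : (forall x l, reg q' (G x l)) -> forall l t,
    F (fun l t => \sum_x (a x)%:C * G x l t) l t = \sum_x (a x)%:C * F (G x) l t.
  move=> hG l t; rewrite /F; under [RHS]eq_bigr do rewrite mulrDr.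
  rewrite big_split; congr (_ + _).
    rewrite coef_sum => [|x _]; last by apply: tlimZ; exact: reg_tlim (hG x l).
    by apply: eq_bigr => x _; rewrite coefZ //; exact: reg_tlim (hG x l).
  rewrite /cop; under [RHS]eq_bigr do rewrite mulrCA.
  rewrite -mulr_sumr; congr (_ * _).
  have commE i j : comm (e i j) (fun t => \sum_x (a x)%:C * G x j t) t =
      \sum_x (a x)%:C * comm (e i j) (G x j) t.
    rewrite /comm (_ : (fun t => e i j t * _) = fun t => \sum_x (a x)%:C * (e i j t * G x j t)).
      rewrite !(riesz_sum q01'); try by move=> x; apply: regZ => //; exact: regM.
      rewrite mulr_sumr -sumrB; apply: eq_bigr => x _.
      by rewrite !(rieszZ q01') //; [ring|exact: regM].
    by apply/funext => s; rewrite mulr_sumr; apply: eq_bigr => x _; rewrite mulrCA.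
  rewrite /reC; under [RHS]eq_bigr do rewrite -rmorphM.
  rewrite -rmorph_sum; congr (_%:C).
  transitivity (\sum_x complex.Re ((a x)%:C * \sum_i \sum_j B l i t * comm (e i j) (G x j) t)); last first.
    by apply: eq_bigr => x _; case: (\sum_i _) => u v /=; rewrite mul0r subr0.
  rewrite -raddf_sum; congr complex.Re.
  under [RHS]eq_bigr do rewrite mulr_sumr.
  rewrite [RHS]exchange_big; apply: eq_bigr => i _ /=.
  under [RHS]eq_bigr do rewrite mulr_sumr.
  rewrite [RHS]exchange_big; apply: eq_bigr => j _ /=.
  by rewrite commE mulr_sumr; apply: eq_bigr => x _; rewrite mulrCA.
exists I, (fun x => delta (bt x.2.1 x.2.2) x.1), (fun x => F (delta (tau x.2.1 x.2.2) x.1)).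
split.
- by move=> i l; apply: rdelta.
- by move=> i; apply: redelta => t; exact: conj_reC.
- by move=> i l; apply: Freg => l'; apply: (rdelta q) => //; exact: rtau.
- move=> i; apply: Freal; first by move=> l; apply: rdelta => //; exact: rtau.
  by apply: redelta => t; exact: conj_reC.
move=> phi hphi rphi l t.
have tphi j : tlim (phi j) := reg_tlim (hphi j).
have rv j : reg q' (vp D (phi j)) := reg_tp q01' (tp_vp D (phi j)).
have -> : coef (phi l) 0 + cop B e phi l t = F (fun j => vp D (phi j)) l t.
  apply/eqP; rewrite -subr_eq0 -/(F phi l t) -(Fsub phi (fun j => vp D (phi j))) //.
  rewrite /F coefB //; last exact: reg_tlim (rv l).
  rewrite coef_vp_low // subrr add0r /cop /reC big1 ?mulr0 // => i _.
  apply: big1 => j _; rewrite (comm_high q01' t (he i j)) ?mulr0 //; first exact: regB.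
  by move=> k hk; rewrite coefB ?coef_vp_low ?subrr //; exact: reg_tlim (rv j).
pose a (x : I) := complex.Re (pair (delta (bt x.2.1 x.2.2) x.1) phi).
have aE x : (a x)%:C = pair (delta (bt x.2.1 x.2.2) x.1) phi.
  apply: pair_real => //; first by move=> l'; apply: rdelta.
  by apply: redelta => s; exact: conj_reC.
have vE : (fun j => vp D (phi j)) =
    fun j t => \sum_x (a x)%:C * delta (tau x.2.1 x.2.2) x.1 j t.
  apply/funext => j; apply/funext => s; rewrite (real_coordinates D s (rphi j) (tphi j)).
  rewrite -(pair_bigA _ (fun j0 y => (a (j0, y))%:C * delta (tau y.1 y.2) j0 j s)) /=.
  rewrite (bigD1 j) //= [X in _ = _ + X]big1 ?addr0; last first.
    by move=> j' jj; apply: big1 => y _; rewrite /delta eq_sym (negbTE jj) mul0r mulr0.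
  rewrite -(pair_bigA _ (fun x z => (a (j, (x, z)))%:C * delta (tau x z) j j s)) /=.
  apply: eq_bigr => x _; apply: eq_bigr => z _ /=; rewrite aE /delta eqxx mul1r; congr (_ * _).
  rewrite /pair (bigD1 j) //= big1 ?addr0 => [|l' lj].
    by congr coef; apply/funext => y; rewrite eqxx mul1r.
  by rewrite (negbTE lj); under eq_fun do rewrite !mul0r; rewrite coef0.
rewrite vE; under [RHS]eq_bigr do rewrite -aE.
have rG x l' : reg q' (delta (tau x.2.1 x.2.2) x.1 l') by apply: rdelta => //; exact: rtau.
exact: Flin.
Qed.


(** Split b = c + e and solve phi + cop c phi = f. The parametrix at phi gives f plus the finite
    rank part, whose coefficients are pairings of phi with the [beta i]. With psi + copT psi = beta
    these become pairings of psi with phi + cop c phi = f, that is, explicit functionals of the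
    datum. *)
Lemma range_decomposition : exists (I : finType) (psi e : I -> fam),
  [/\ forall i l, reg q' (psi i l), forall i, realf (psi i), forall i l, reg q (e i l),
      forall i, realf (e i) &
      forall f, (forall l, reg q (f l)) -> realf f ->
        exists v, analytic v /\
          forall l t, RHop v l t = f l t + \sum_i pair (psi i) f * e i l t].
Proof.
have [K1 [K10 HK1]] := cop_bounded q01' hB'.
have [K2 [K20 HK2]] := copT_bounded q01' hB'.
(* Small enough for both [cop B c] and its transpose to halve norms at rate [q']. *)
pose d := (2 * (K1 + K2 + 1))^-1.
have D0 : 0 < 2 * (K1 + K2 + 1) by lra.
have d0 : 0 < d by rewrite invr_gt0.
have dK K : 0 <= K -> K <= K1 + K2 -> K * d <= 2^-1.
  by move=> ? ?; rewrite /d ler_pdivrMr // mulKf ?pnatr_eq0 //; lra.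
have [D [c [e [Dpos yc rc te be]]]] := tail_split d0.
have D20 : (0 < D.*2)%N by rewrite double_gt0.
have [I [beta [g [rbeta realbeta rg realg gE]]]] := cop_finite_rank D20 te.
have rc' i j : reg q' (c i j) := reg_rate q01 q01' qq (rc i j).
have re i j : reg q (e i j) := reg_tp q01 (te i j).
have half (K : R) (phi : fam) M : 0 <= K -> K <= K1 + K2 -> 0 <= M ->
    ynf q' phi (K * d * M) -> ynf q' phi (2^-1 * M).
  by move=> h1 h2 M0 h l; apply: (yn_le q01') (h l); rewrite ler_wpM2r // dK.
have solve f (rf : forall l, reg q' (f l)) (realff : realf f) : exists phi,
    [/\ forall l, reg q' (phi l), realf phi & forall l t, phi l t + cop B c phi l t = f l t].
  apply: solve_perturbed => //.
  - by move=> phi phi' h1 h2 l t; exact: (cop_sub q01').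
  - by move=> phi; exact: real_cop.
  - move=> phi M M0 h; apply: (half K1) => //; first by rewrite lerDl.
    by apply: HK1 => //; exact: ltW.
have /choice[psi hpsi] : forall i : I, exists psi,
    [/\ forall l, reg q' (psi l), realf psi & forall l t, psi l t + copT B c psi l t = beta i l t].
  move=> i; apply: solve_perturbed => //.
  - by move=> phi phi' h1 h2 l t; exact: (copT_sub q01' hB').
  - by move=> phi; exact: real_copT.
  - move=> phi M M0 h; apply: (half K2) => //; first by rewrite lerDr.
    by apply: HK2 => //; exact: ltW.
exists I, psi, g; split=> //; try by move=> i; have [] := hpsi i.
move=> f rf realff.
have rf' l : reg q' (f l) := reg_rate q01 q01' qq (rf l).
have [phi [rphi' realphi phiE]] := solve f rf' realff.
(* So far phi is known at rate [q'] only; [comm_reg] puts [cop B c phi] at rate [q], hence also phi,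
   their sum being f. *)
have rphi l : reg q (phi l).
  have rcop : reg q (cop B c phi l).
    apply: regZ; apply: reg_reC => //; apply: (reg_sum q01) => i _; apply: (reg_sum q01) => j _.
    by apply: regM => //; exact: (comm_reg q01 q01' qq).
  by apply: eq_reg (regB (rf l) rcop) => t; rewrite -phiE addrK.
have [va vE] := right_parametrix rphi realphi.
set v := (fun _ => _) in va vE; exists v; split=> // l t; rewrite vE.
rewrite (_ : b = fun i j t => c i j t + e i j t); last first.
  by apply/funext => i; apply/funext => j; apply/funext => x; exact: be.
rewrite (cop_addl q01) // -phiE addrACA.
rewrite gE //; congr (_ + _); apply: eq_bigr => i _; congr (_ * _).
have [rpsi realpsi psiE] := hpsi i.
have rcop' l' : reg q' (cop B c phi l') by exact: reg_cop.
have rcopT' l' : reg q' (copT B c (psi i) l').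
  by apply: regZ; apply: reg_reC => //; apply: (reg_sum q01') => x _;
    apply: (reg_sum q01') => y _; apply: reg_comm => //; apply: (reg_conj q01') => //; exact: regM.
rewrite (_ : beta i = fun l t => psi i l t + copT B c (psi i) l t); last first.
  by apply/funext => x; apply/funext => y.
rewrite (_ : f = fun l t => phi l t + cop B c phi l t); last first.
  by apply/funext => x; apply/funext => y.
by rewrite pair_addl // coef0_pairl // (pair_cop q01' hB').
Qed.

Lemma pair_RHop psi v : (forall l, reg q' (psi l)) -> realf psi -> analytic v ->
  pair psi (RHop v) =
  (complex.Re (coef (fun t => \sum_i (\sum_l psi l t * B l i t) * v i t) 0))%:C.
Proof.
move=> hpsi rpsi hv.
have rv i : reg q' (v i) by have [h _] := hv i; exact: (reg_rate q01 q01' qq).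
have rBv l : reg q' (fun t => \sum_i B l i t * v i t).
  by apply: (reg_sum q01') => i _; exact: regM.
rewrite (_ : (fun t => _) = fun t => \sum_l psi l t * \sum_i B l i t * v i t); last first.
  apply/funext => t; under eq_bigr do rewrite mulr_suml.
  rewrite exchange_big; apply: eq_bigr => l _; rewrite mulr_sumr.
  by apply: eq_bigr => i _; rewrite mulrA.
rewrite coef_sum => [|l _]; last by apply: reg_tlim (regM q01' _ _).
rewrite raddf_sum rmorph_sum; apply: eq_bigr => l _ /=.
by rewrite -mean_reC //; exact: reg_tlim (_ : reg q' _).
Qed.

(** The function psi^t B v has only positive frequencies, hence mean 0. *)
Lemma RHker_annihilates psi v : RHker psi -> analytic v -> pair psi (RHop v) = 0.
Proof.
move=> [hpsi rpsi psi0] hv.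
have hpsi' l : reg q' (psi l) := reg_rate q01 q01' qq (hpsi l).
rewrite pair_RHop // (_ : coef _ 0 = 0) //.
have rH i : reg q (fun t => \sum_l psi l t * B l i t).
  by apply: (reg_sum q01) => l _; exact: regM.
rewrite coef_sum => [|i _]; last first.
  by apply: reg_tlim (regM q01 _ _) => //; have [] := hv i.
apply: big1 => i _; have [rv v0] := hv i.
apply: (@coefM_lt _ _ _ _ 1 0) => //; [exact: reg_tlim (rH i)|exact: reg_tlim rv|].
by move=> k k1; apply: psi0; lia.
Qed.

(** The functionals found above have rate [q'], while the kernel asks for rate [q]. Here psi = b^t h
    with h = psi^t B analytic, so the negative part of psi is a sum of Hankel operators with symbols
    b applied to h, of rate [q]; a real function is determined by its negative part and its mean. *)
Lemma annihilator_RHker (psi : fam) : (forall l, reg q' (psi l)) -> realf psi ->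
  (forall v, analytic v -> pair psi (RHop v) = 0) -> RHker psi.
Proof.
move=> hpsi rpsi H; pose h i t := \sum_l psi l t * B l i t.
have rh i : reg q' (h i) by apply: (reg_sum q01') => l _; exact: regM.
have h0 i k : k <= 0 -> coef (h i) k = 0.
  move=> k0.
  (* The pairing only yields real parts; a = 1 and a = i together recover the coefficient. *)
  have key (a : C) : complex.Re (a * coef (h i) k) = 0.
    pose v i' t := (i' == i)%:R * (a * ek (- k) t).
    have av : analytic v.
      move=> i'; split=> [|k' k'0].
        by do 2 apply: regZ; exact: (reg_tp q01 (@tp_ek _ `|(- k)| (- k) (leqnn _))).
      have te := @tlim_ek R (- k); rewrite (coefZ _ _ (tlimZ a te)) (coefZ _ _ te) coef_ek.
      by rewrite (_ : (k' == - k) = false) ?mulr0 //; lia.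
    have := H v av; rewrite pair_RHop //.
    rewrite (_ : (fun t => _) = fun t => a * (ek (- k) t * h i t)); last first.
      apply/funext => t; rewrite (bigD1 i) //= [X in _ + X]big1 ?addr0 => [|i' ii].
        by rewrite /v eqxx mul1r mulrC -mulrA.
      by rewrite /v (negbTE ii) mul0r mulr0.
    rewrite coefZ; last by apply: tlimM; [exact: tlim_ek|exact: reg_tlim (rh i)].
    by rewrite coef_shift sub0r opprK => /complexI.
  have := key 1; have := key 'i%C; rewrite mul1r.
  by case: (coef (h i) k) => x y /=; rewrite mul0r mul1r sub0r => /eqP; rewrite oppr_eq0 => /eqP -> ->.
split=> // l.
pose p t := \sum_i (b i l t * h i t - riesz (fun t => b i l t * h i t) t).
have rp : reg q p.
  apply: (reg_sum q01) => i _; apply: (hankel_reg q01 q01' qq) => // k k0.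
  by rewrite h0 // ltW.
have pE t : p t = psi l t - riesz (psi l) t.
  have E : psi l =1 fun t => \sum_i b i l t * h i t.
    move=> s; under eq_bigr => i _ do rewrite /h mulr_sumr.
    rewrite exchange_big (bigD1 l) //= [X in _ + X]big1 ?addr0 => [|j jl].
      under eq_bigr => i _ do rewrite mulrCA [b i l s * _]mulrC.
      by rewrite -mulr_sumr Bb eqxx mulr1.
    under eq_bigr => i _ do rewrite mulrCA [b i l s * _]mulrC.
    by rewrite -mulr_sumr Bb (negbTE jl) mulr0.
  rewrite /p sumrB {1}E; congr (_ - _).
  by rewrite {1}(funext E) (riesz_sum q01') // => i; exact: regM.
have tpsi := reg_tlim (hpsi l); have tr := reg_tlim (reg_riesz q01' (hpsi l)).
have cp k : coef p k = (k < 0)%R%:R * coef (psi l) k.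
  rewrite (funext pE) coefB // (coef_riesz_reg q01') //.
  by case: (leP 0 k) => k0; rewrite ?mul1r ?mul0r ?subrr ?subr0.
have := regD (regD rp (reg_conj q01 rp)) (reg_tp q01 (tp_cst 0 (coef (psi l) 0))).
have tp' := reg_tlim rp.
have tc : tlim (fun=> coef (psi l) 0) by exact: (tp_tlim (tp_cst 0 _)).
apply: eq_reg; apply: tlim_ext => //.
  by apply: tlimD => //; apply: tlimD => //; exact: tlim_conj.
move=> k; rewrite !coefD //; [|exact: tlim_conj|apply: tlimD => //; exact: tlim_conj].
rewrite coef_conj // !cp rmorphM rmorph_nat /= coef_real //.
have -> : coef (fun=> coef (psi l) 0) k = (k == 0)%:R * coef (psi l) k.
  rewrite (_ : (fun=> _) = fun t : R => coef (psi l) 0 * ek 0 t); last first.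
    by apply/funext => t; rewrite ek0 mulr1.
  rewrite coefZ; last exact: tlim_ek.
  by rewrite coef_ek mulrC; case: eqVneq => [->|]; rewrite ?mul0r.
rewrite oppr_lt0 -!mulrDl.
by have [k0|k0|k0] := ltgtP k 0; rewrite ?addr0 ?add0r mul1r.
Qed.

(** [U] is the space of coordinates whose combination of the [e] lies in the range; f lies in the
    range once its correction does. Otherwise a functional vanishing on [U] but not at f combines
    the [psi] into an element of the kernel that pairs nontrivially with f. *)
Theorem RH_solvable (f : fam) : (forall l, reg q (f l)) -> realf f ->
  (forall psi, RHker psi -> pair psi f = 0) ->
  exists v, analytic v /\ forall l t, RHop v l t = f l t.
Proof.
move=> rf realff H; have [I [psi [e [rpsi realpsi re reale dec]]]] := range_decomposition.
have reg' (g : fam) : (forall l, reg q (g l)) -> forall l, reg q' (g l).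
  by move=> h l; exact: (reg_rate q01 q01' qq).
have RHopZD (a : R) (v w : 'I_N -> R -> C) l t :
    RHop (fun i t => a%:C * v i t + w i t) l t = a%:C * RHop v l t + RHop w l t.
  rewrite /RHop /reC -rmorphM -rmorphD; congr (_%:C).
  rewrite (_ : \sum_i _ = a%:C * (\sum_i B l i t * v i t) + \sum_i B l i t * w i t); last first.
    by rewrite mulr_sumr -big_split; apply: eq_bigr => i _ /=; ring.
  by rewrite raddfD /=; case: (\sum_i _) => x y /=; rewrite mul0r subr0.
have anZD (a : C) (v w : 'I_N -> R -> C) : analytic v -> analytic w ->
    analytic (fun i t => a * v i t + w i t).
  move=> hv hw i; have [rv v0] := hv i; have [rw w0] := hw i.
  split=> [|k k0]; first by apply: regD => //; exact: regZ.
  have [tv tw] := (reg_tlim rv, reg_tlim rw).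
  by rewrite coefD ?coefZ //; [rewrite v0 // w0 // mulr0 addr0|exact: tlimZ].
pose ev (k : 'I_#|I|) := enum_val k.
pose U (s : 'rV[R]_#|I|) := exists v, analytic v /\
  forall l t, RHop v l t = \sum_k (s 0 k)%:C * e (ev k) l t.
have U0 : U 0.
  exists (fun _ _ => 0); split=> [i|l t].
    by split=> [|k _]; [exact: (reg_tp q01 (tp0 _ 0))|exact: coef0].
  rewrite /RHop /reC big1 => [|i _]; last by rewrite mulr0.
  rewrite big1 // => k _.
  by rewrite mxE mul0r.
have Ulin (a : R) u v : U u -> U v -> U (a *: u + v).
  move=> [x [ax xE]] [y [ay yE]]; exists (fun i t => a%:C * x i t + y i t); split.
    exact: anZD.
  move=> l t; rewrite RHopZD xE yE mulr_sumr -big_split; apply: eq_bigr => k _ /=.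
  by rewrite !mxE rmorphD rmorphM mulrDl mulrA.
pose s (g : fam) : 'rV[R]_#|I| := \row_k complex.Re (pair (psi (ev k)) g).
have sE g l t : (forall l, reg q (g l)) -> realf g ->
    \sum_i pair (psi i) g * e i l t = \sum_k (s g 0 k)%:C * e (ev k) l t.
  move=> hg rg; rewrite (reindex ev) /=; last exact: onW_bij (enum_val_bij _).
  apply: eq_bigr => k _; rewrite mxE; congr (_ * _); apply/esym.
  by apply: pair_real => //; exact: reg'.
have [Us|nUs] := pselect (U (s f)).
  have [v [av vE]] := dec f rf realff; have [w [aw wE]] := Us.
  exists (fun i t => (-1)%:C * w i t + v i t); split; first exact: anZD.
  by move=> l t; rewrite RHopZD vE wE sE // rmorphN1 mulN1r addrC addrK.
have [mu [muU mus]] := separate_row U0 Ulin nUs.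
pose Psi : fam := fun l t => \sum_k (mu k)%:C * psi (ev k) l t.
have rPsi l : reg q' (Psi l) by apply: (reg_sum q01') => k _; exact: regZ.
have realPsi : realf Psi.
  move=> l t; rewrite rmorph_sum; apply: eq_bigr => k _.
  by rewrite rmorphM; congr (_ * _); [exact: conjc_real|exact: realpsi].
have pPsi g : (forall l, reg q (g l)) -> realf g ->
    pair Psi g = (\sum_k s g 0 k * mu k)%:C.
  move=> hg rg; rewrite pair_suml //; last exact: reg'.
  rewrite rmorph_sum; apply: eq_bigr => k _; rewrite rmorphM mulrC mxE; congr (_ * _).
  by apply/esym/pair_real => //; exact: reg'.
have kPsi : RHker Psi.
  apply: annihilator_RHker => // v av.
  have rg l : reg q (RHop v l).
    apply: reg_reC => //; apply: (reg_sum q01) => i _; apply: regM => //.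
    by have [] := av i.
  have realg : realf (RHop v) by move=> l t; exact: conj_reC.
  (* When the datum is [RHop v], its correction is [RHop] of w - v, so its coordinates lie in [U],
     where mu vanishes. *)
  rewrite pPsi // muU //; have [w [aw wE]] := dec _ rg realg.
  exists (fun i t => (-1)%:C * v i t + w i t); split; first exact: anZD.
  by move=> l t; rewrite RHopZD wE sE // rmorphN1 mulN1r addrA addNr add0r.
have := H Psi kPsi; rewrite pPsi // => /complexI h0.
by rewrite h0 eqxx in mus.
Qed.

(** An element of the kernel annihilates the range, so if it also annihilates the [e i] it
    annihilates every datum f. Finite dimension of E_A will follow from this injectivity. *)
Theorem RHker_finite : exists (I : finType) (e : I -> fam),
  [/\ forall i l, reg q (e i l), forall i, realf (e i) &
  forall psi, RHker psi -> (forall i, pair psi (e i) = 0) -> forall l t, psi l t = 0].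
Proof.
have [I [phi [e [rphi realphi re reale dec]]]] := range_decomposition.
exists I, e; split=> // psi kpsi psie l t; have [rpsi realpsi psi0] := kpsi.
have reg' (g : fam) : (forall l, reg q (g l)) -> forall l, reg q' (g l).
  by move=> h l'; exact: (reg_rate q01 q01' qq).
have ann f : (forall l, reg q (f l)) -> realf f -> pair psi f = 0.
  move=> rf realff; have [v [av vE]] := dec f rf realff.
  have := RHker_annihilates kpsi av.
  rewrite (_ : RHop v = fun l t => f l t + \sum_i pair (phi i) f * e i l t); last first.
    by apply/funext => x; apply/funext => y; exact: vE.
  rewrite coef0_pairl; [|exact: reg'|exact: reg'|]; last first.
    by move=> l'; apply: (reg_sum q01') => i _; apply: regZ; exact: reg'.
  rewrite pair_sumr; [|by move=> i; exact: reg'|exact: reg'].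
  by rewrite [X in _ + X]big1 ?addr0 // => i _; rewrite psie mulr0.
move: t; apply: tlim_ext; [exact: reg_tlim (rpsi l)|exact: (tp_tlim (tp0 _ 0))|] => k.
rewrite coef0.
have key (a : C) : complex.Re (a * coef (psi l) k) = 0.
  pose f : fam := fun l' t => (l' == l)%:R * reC (fun t => a * ek (- k) t) t.
  have rek : reg q (fun t => a * ek (- k) t).
    by apply: regZ; exact: (reg_tp q01 (@tp_ek _ `|(- k)| (- k) (leqnn _))).
  have := ann f; rewrite /pair (bigD1 l) //= big1 ?addr0 => [|l' ll]; last first.
    by under eq_fun do rewrite /f (negbTE ll) mul0r mulr0; exact: coef0.
  rewrite (_ : (fun t => psi l t * f l t) = fun t => psi l t * reC (fun t => a * ek (- k) t) t); last first.
    by apply/funext => t; rewrite /f eqxx mul1r.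
  rewrite mean_reC; [|exact: reg_tlim (rpsi l)|exact: reg_tlim rek|exact: realpsi].
  rewrite (_ : (fun t => psi l t * (a * ek (- k) t)) = fun t => a * (ek (- k) t * psi l t)); last first.
    by apply/funext => t; ring.
  rewrite coefZ; last by apply: tlimM; [exact: tlim_ek|exact: reg_tlim (rpsi l)].
  rewrite coef_shift sub0r opprK => h; apply: complexI; apply: h.
    by move=> l'; apply: regZ; exact: reg_reC.
  by move=> l' t; rewrite /f rmorphM rmorph_nat; congr (_ * _); exact: conj_reC.
have := key 1; have := key 'i%C; rewrite mul1r.
by case: (coef (psi l) k) => x y /=; rewrite mul0r mul1r sub0r => /eqP; rewrite oppr_eq0 => /eqP -> ->.
Qed.

End Fredholm.

(** * Hoelder classes as approximation spaces *)

Section JacksonKernel.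
Context (R : realType).
Local Notation C := R[i].

(** A weak form of Jordan's inequality with a rational constant: where cos x >= 1/2 the mean value
    theorem gives x / 2, elsewhere sin x >= 1/2 >= x / 4. *)
Lemma sin_ge_quarter (x : R) : 0 <= x <= pi / 2 -> x / 4 <= sin x.
Proof.
move=> /andP[x0 xp].
have xp2 : x <= 2 by apply: (le_trans xp); exact/ltW/pihalf_lt2.
have p0 := pi_gt0 R; have xpi : x <= pi by lra.
have s0 : 0 <= sin x by apply: sin_ge0_pi; rewrite x0.
have c0 : 0 <= cos x by apply: cos_ge0_pihalf; rewrite xp andbT; lra.
have [c2|c2] := leP 2^-1 (cos x); last by have := cos2Dsin2 x; nra.
have [->|xn0] := eqVneq x 0; first by rewrite mul0r sin0.
have xpos : 0 < x by rewrite lt_neqAle eq_sym xn0.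
have [|c cx E] := @MVT R sin cos 0 x xpos (fun y _ => is_derive_sin y).
  by apply: continuous_subspaceT => y; exact: continuous_sin.
rewrite sin0 !subr0 in E; rewrite E.
move: cx; rewrite in_itv /= => /andP[c0' cx].
have : cos x < cos c by rewrite ltr_cos ?in_itv //=; apply/andP; split; lra.
nra.
Qed.

Lemma reduce_angle (x : R) : exists (k : nat) (u : R),
  (u = x - k%:R * (pi *+ 2) \/ u = x + k%:R * (pi *+ 2)) /\ `|u| <= pi.
Proof.
have p0 := pi_gt0 R; have P := twopi_gt0 R.
pose z := Num.floor ((x + pi) / (pi *+ 2)).
have /andP[z1 z2] := floor_itv ((x + pi) / (pi *+ 2)).
rewrite -/z ler_pdivlMr // in z1; rewrite -/z ltr_pdivrMr // intrD mulrDl mul1r in z2.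
have b : `|x - z%:~R * (pi *+ 2)| <= pi.
  by rewrite ler_norml; apply/andP; split; lra.
case: z z1 z2 b => k _ _ b; first by exists k, (x - k%:R * (pi *+ 2)); split; [left|].
exists k.+1, (x + k.+1%:R * (pi *+ 2)); split; [by right|].
by rewrite NegzE rmorphN mulNr opprK in b.
Qed.

Lemma sin_half_reduce (x u : R) (k : nat) :
  (u = x - k%:R * (pi *+ 2) \/ u = x + k%:R * (pi *+ 2)) -> sin (u / 2) ^+ 2 = sin (x / 2) ^+ 2.
Proof.
have step (y : R) (j : nat) : sin (y / 2 + j%:R * pi) ^+ 2 = sin (y / 2) ^+ 2.
  elim: j => [|j IH]; first by rewrite mul0r addr0.
  by rewrite -(natr1 j) mulrDl mul1r addrA sinDpi sqrrN.
case=> ->.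
  rewrite -(step (x - k%:R * (pi *+ 2)) k).
  by rewrite (_ : (x - k%:R * (pi *+ 2)) / 2 + k%:R * pi = x / 2) //; field.
by rewrite (_ : (x + k%:R * (pi *+ 2)) / 2 = x / 2 + k%:R * pi) ?step //; field.
Qed.

Lemma angle_le_sin (u : R) : `|u| <= pi -> u ^+ 2 <= 64 * sin (u / 2) ^+ 2.
Proof.
move=> up.
have H (v : R) : 0 <= v <= pi -> v ^+ 2 <= 64 * sin (v / 2) ^+ 2.
  move=> /andP[v0 vp]; have := @sin_ge_quarter (v / 2).
  have -> : 0 <= v / 2 <= pi / 2 by apply/andP; split; lra.
  by move=> /(_ isT) h; nra.
have [u0|u0] := leP 0 u; first by apply: H; rewrite u0 -(ger0_norm u0).
have := H (- u); rewrite sqrrN mulNr sinN sqrrN; apply.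
by rewrite -(ltr0_norm u0) normr_ge0.
Qed.

(** Multiplied by e^(it) - 1, the exponential sum telescopes to e^(int) - 1, of modulus at most 2,
    while |e^(it) - 1|^2 = 4 sin^2 (t / 2). *)
Lemma sin_fejer n t : (0 < n)%N -> sin (t / 2) ^+ 2 * fejer_kernel n t <= n%:R^-1 :> R.
Proof.
move=> n0; pose D := \sum_(a < n) ek a%:Z t : C.
have E1 : (cabs (ei t - 1)) ^+ 2 = 4 * sin (t / 2) ^+ 2.
  apply: complexI; rewrite cabs_sqr.
  have -> : conjc (ei t - 1) = ei (- t) - 1 by rewrite eiN rmorphB rmorph1.
  rewrite (_ : (ei t - 1) * (ei (- t) - 1) = 2 - (ei t + ei (- t))); last first.
    have : ei t * ei (- t) = 1 by rewrite -eiD subrr ei0.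
    by move=> h; rewrite mulrBl mulrBr h; ring.
  have -> : ei t + ei (- t) = (2 * cos t)%:C.
    rewrite /ei cosN sinN; apply/eqP; rewrite eq_complex /=.
    by apply/andP; split; apply/eqP; ring.
  rewrite -[2 : C](rmorph_nat (real_complex R) 2) -rmorphB; congr (_%:C).
  by rewrite {1}[t](splitr t) cosD -!expr2 cos2sin2; ring.
have E2 : cabs D * cabs (ei t - 1) <= 2.
  rewrite -cabsM (_ : D * _ = ei t ^+ n - 1).
    by rewrite (le_trans (cabsB _ _)) // eiX cabs_ei cabs1.
  rewrite subrX1 mulrC; congr (_ * _); apply: eq_bigr => a _; exact: ek_nat.
rewrite /fejer_kernel -/D mulrCA -[leRHS]mulr1 ler_wpM2l ?invr_ge0 ?ler0n //.
rewrite -(ler_pM2l (_ : 0 < 4 :> R)) // mulrA -E1 -exprMn mulrC.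
rewrite mulr1 (_ : 4 = 2 ^+ 2 :> R); last by ring.
by rewrite lerXn2r ?nnegrE ?mulr_ge0 ?cabs_ge0 // mulrC.
Qed.

Lemma coef_fejer_kernel n k :
  coef (fun t => (fejer_kernel n t)%:C : C) k = (n - `|k|)%:R / n%:R.
Proof.
have tl a b : tlim (ek (a - b) : R -> C) by exact: tlim_ek.
under [X in coef X]eq_fun do rewrite fejer_kernelE.
rewrite coefZ; last by apply: tlim_sum => a _; apply: tlim_sum => b _; exact: tl.
rewrite -(count_diff n k) coef_sum; last by move=> a _; apply: tlim_sum => b _; exact: tl.
rewrite mulrC; congr (_ * _); rewrite natr_sum; apply: eq_bigr => a _.
rewrite coef_sum; last by move=> b _; exact: tl.
by rewrite natr_sum; apply: eq_bigr => b _; rewrite coef_ek.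
Qed.

Lemma tp_fejer_kernel n : tp n (fun t => (fejer_kernel n t)%:C : C).
Proof.
apply: (eq_tp (fun t => esym (fejer_kernelE n t))).
apply: tpZ; apply: tp_sum => a _; apply: tp_sum => b _.
by apply: tp_ek; have := ltn_ord a; have := ltn_ord b; lia.
Qed.

Definition fejer_weight n (k : int) : R := (n - `|k|)%:R / n%:R.

Lemma fejer_kernel_isum n t :
  (fejer_kernel n t)%:C = isum n (fun k => (fejer_weight n k)%:C * ek k t) :> C.
Proof.
rewrite (tp_coefE (tp_fejer_kernel n)); apply: eq_isum => k _; congr (_ * _).
by rewrite coef_fejer_kernel /fejer_weight rmorphM fmorphV !rmorph_nat.
Qed.

(** Parseval's identity for a translated Fejer kernel; n + n < N makes the average exact on its
    square. *)
Lemma avg_sqr_fejer n N t : (n + n < N)%N ->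
  avg N (fun s => ((fejer_kernel n (t - s)) ^+ 2)%:C : C) =
  (\sum_(i < n.*2.+1) (fejer_weight n (i%:Z - n%:Z)) ^+ 2)%:C.
Proof.
move=> nN; pose T s := (fejer_kernel n (t - s))%:C : C.
pose c k := (fejer_weight n k)%:C * ek (- k) t : C.
have TE s : T s = isum n (fun k => c k * ek k s).
  rewrite /T -conjc_real fejer_kernel_isum rmorph_sum; apply: eq_bigr => i _.
  rewrite rmorphM -[RHS]mulrA; congr (_ * _); first exact: conjc_real.
  rewrite -[LHS]/(conjc _) -ekN /ek -eiD; congr ei; rewrite rmorphN; ring.
have TcE s : T s = isum n (fun k => conjc (c k) * ek (- k) s).
  rewrite /T -conjc_real -/(T s) TE rmorph_sum; apply: eq_bigr => i _.
  by rewrite rmorphM ekN.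
rewrite (@eq_avg _ _ _ (fun s => isum n (fun k =>
    conjc (c k) * (isum n (fun j => c j * ek j s) * ek (- k) s)))); last first.
  move=> s; rewrite rmorphXn /= -/(T s) expr2 {1}TcE mulr_suml; apply: eq_bigr => i _.
  by rewrite -TE -mulrA; congr (_ * _); rewrite mulrC.
rewrite avg_sum rmorph_sum; apply: eq_bigr => i _; rewrite avgZ.
have ib : (`|(i%:Z - n%:Z)%R| <= n)%N by have := ltn_ord i; lia.
rewrite (avg_tp (N := N)); last by lia.
rewrite ib mul1r mulrC -cabs_sqr /c cabsM cabs_ek mulr1 cabs_real.
by rewrite real_normK ?num_real // rmorphXn.
Qed.

Lemma sum_sqr_fejer n : (0 < n)%N ->
  n%:R / 3 <= \sum_(i < n.*2.+1) (fejer_weight n (i%:Z - n%:Z)) ^+ 2.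
Proof.
move=> n0; have n1 : (1 : R) <= n%:R by rewrite ler1n.
have S : \sum_(i < n.*2.+1) fejer_weight n (i%:Z - n%:Z) = n%:R.
  apply: complexI; rewrite rmorph_sum.
  transitivity ((fejer_kernel n 0)%:C : C).
    rewrite fejer_kernel_isum; apply: eq_bigr => i _.
    by rewrite /ek mulr0 ei0 mulr1.
  rewrite fejer_kernelE (eq_bigr (fun=> n%:R)) => [|a _].
    by rewrite sumr_const card_ord -[n%:R *+ n]mulr_natl mulKf ?rmorph_nat // pnatr_eq0 -lt0n.
  rewrite (eq_bigr (fun=> 1)) ?sumr_const ?card_ord // => b _.
  by rewrite /ek mulr0 ei0.
(* The parabola w^2 lies above its tangent 2 w / 3 - 1 / 9 at 1/3, and the weights sum to n; the
   lower bound is (4 n - 1) / 9 >= n / 3. *)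
apply: (@le_trans _ _ (\sum_(i < n.*2.+1) (2 / 3 * fejer_weight n (i%:Z - n%:Z) - 1 / 9))).
  have E : n.*2.+1%:R = 2 * n%:R + 1 :> R by rewrite -(natr1 n.*2) -muln2 natrM mulrC.
  rewrite sumrB -mulr_sumr S sumr_const card_ord -[_ *+ n.*2.+1]mulr_natr E; lra.
by apply: ler_sum => i _; have := sqr_ge0 (fejer_weight n (i%:Z - n%:Z) - 1 / 3); nra.
Qed.

(* The squared Fejer kernel: the second moment [sin^2 * F^2] is controlled by
   [sin^2 * F <= 1/n], so no integral has to be estimated. *)
Lemma jackson_kernel n : (0 < n)%N -> exists N (k : R -> R),
  [/\ (0 < N)%N, forall s, 0 <= k s, tp n.*2 (fun s => (k s)%:C : C),
      forall t, avg N (fun s => (k (t - s))%:C) = 1 :> C &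
      forall t, cabs (avg N (fun s => (sin ((t - s) / 2) ^+ 2 * k (t - s))%:C : C)) <= 3 / n%:R ^+ 2].
Proof.
move=> n0; have nR : 0 < n%:R :> R by rewrite ltr0n.
set mu := \sum_(i < n.*2.+1) (fejer_weight n (i%:Z - n%:Z)) ^+ 2.
have mu0 : n%:R / 3 <= mu by exact: sum_sqr_fejer.
have mupos : 0 < mu by rewrite (lt_le_trans _ mu0) // divr_gt0.
exists (n + n).+1, (fun t => fejer_kernel n t ^+ 2 / mu); split=> //.
- by move=> s; rewrite divr_ge0 ?sqr_ge0 // ltW.
- apply: (@eq_tp _ _ (fun s => (mu^-1)%:C * ((fejer_kernel n s)%:C * (fejer_kernel n s)%:C))).
    by move=> s; rewrite -!rmorphM expr2 mulrC.
  by apply: tpZ; rewrite -addnn; apply: tpM; exact: tp_fejer_kernel.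
- move=> t; rewrite (@eq_avg _ _ _ (fun s => (mu^-1)%:C * ((fejer_kernel n (t - s)) ^+ 2)%:C)).
    by rewrite avgZ avg_sqr_fejer // -rmorphM mulVf ?rmorph1 // gt_eqF.
  by move=> s; rewrite -rmorphM mulrC.
move=> t; apply: (@le_trans _ _ (mu^-1 * n%:R^-1)).
  rewrite (@eq_avg _ _ _ (fun s => (sin ((t - s) / 2) ^+ 2 * fejer_kernel n (t - s) / mu)%:C *
    (fejer_kernel n (t - s))%:C)); last first.
    by move=> s; rewrite -rmorphM; congr (_%:C); rewrite expr2; ring.
  apply: avg_ker_bound => [s||s].
  - exact: fejer_kernel_ge0.
  - by rewrite avg_fejer_kernel // n0 /= leqW // leq_addr.
  rewrite cabs_real ger0_norm; last first.
    by rewrite divr_ge0 ?(ltW mupos) // mulr_ge0 ?sqr_ge0 ?fejer_kernel_ge0.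
  by rewrite mulrC ler_wpM2l ?invr_ge0 ?(ltW mupos) // sin_fejer.
rewrite expr2 invfM mulrA ler_wpM2r ?invr_ge0 ?(ltW nR) //.
by rewrite -[3 / _]invf_div lef_pV2 // ?posrE ?divr_gt0.
Qed.

(** The modulus of continuity enters through a quadratic majorant because the second moment is what
    [jackson_kernel] controls; Hoelder and Lipschitz moduli both fit. The constant is 193 = 1 + 64 *
    3, from mass 1, the factor 64 of [angle_le_sin] and the moment 3 / n^2. *)
Lemma jackson_approximation n (g : R -> C) (E : R) : (0 < n)%N -> 0 <= E ->
  (forall t, g (t + pi *+ 2) = g t) ->
  (forall s t, cabs (g s - g t) <= E * (1 + n%:R ^+ 2 * (s - t) ^+ 2)) ->
  exists T, tp n.*2 T /\ forall t, cabs (g t - T t) <= 193 * E.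
Proof.
move=> n0 E0 per mod; have nR : 0 < n%:R :> R by rewrite ltr0n.
have perN t k : g (t + k%:R * (pi *+ 2)) = g t.
  elim: k => [|k IH]; first by rewrite mul0r addr0.
  by rewrite -(natr1 k) mulrDl mul1r addrA per.
have perB t k : g (t - k%:R * (pi *+ 2)) = g t by rewrite -[LHS](perN _ k) subrK.
have mod' s t : cabs (g s - g t) <= E * (1 + 64 * n%:R ^+ 2 * sin ((t - s) / 2) ^+ 2).
  have [k [u [ku up]]] := reduce_angle (t - s).
  rewrite -(sin_half_reduce ku).
  have -> : g t = g (s + u).
    case: ku => ->; first by rewrite addrA [s + _]addrC subrK perB.
    by rewrite addrA [s + _]addrC subrK perN.
  rewrite (le_trans (mod _ _)) // ler_wpM2l // lerD2l opprD addNKr sqrrN.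
  rewrite (_ : 64 * n%:R ^+ 2 * sin (u / 2) ^+ 2 = n%:R ^+ 2 * (64 * sin (u / 2) ^+ 2)); last by ring.
  by apply: ler_wpM2l; [exact: sqr_ge0|exact: angle_le_sin].
have [N [k [N0 k0 tpk k1 k2]]] := jackson_kernel n0.
pose T t := avg N (fun s => g s * (k (t - s))%:C).
exists T; split.
  rewrite /T /avg; apply: tpZ; apply: tp_sum => s _; apply: tpZ.
  have [c hc] := tpk; exists (fun j => c j * ek (- j) (s%:R * (pi *+ 2) / N%:R)) => t.
  rewrite hc; apply: eq_isum => j _; rewrite ek_trans [RHS]mulrAC -[RHS]mulrA.
  by congr (_ * (_ * _)); rewrite /ek rmorphN mulrN mulNr.
move=> t.
have -> : g t - T t = avg N (fun s => (g t - g s) * (k (t - s))%:C).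
  rewrite -[g t in LHS]mulr1 -(k1 t) -avgZ /T.
  rewrite -[avg N (fun s => g s * _)]mul1r -mulNr -avgZ -avgD.
  by apply: eq_avg => s; ring.
have avg_le (f : R -> C) (h : R -> R) : (forall s, cabs (f s) <= h s) ->
    cabs (avg N f) <= cabs (avg N (fun s => (h s)%:C)).
  move=> fh; rewrite (_ : avg N (fun s => (h s)%:C) =
     (N%:R^-1 * \sum_(s < N) h (s%:R * (pi *+ 2) / N%:R))%:C); last first.
    by rewrite rmorphM fmorphV rmorph_nat rmorph_sum.
  rewrite cabs_real ger0_norm; last first.
    by rewrite mulr_ge0 ?invr_ge0 ?ler0n // sumr_ge0 // => s _; rewrite (le_trans (cabs_ge0 _) (fh _)).
  rewrite /avg cabsM cabsV cabs_nat ler_wpM2l ?invr_ge0 ?ler0n //.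
  by rewrite (le_trans (cabs_sum _ _ _)) // ler_sum.
have H s : cabs ((g t - g s) * (k (t - s))%:C) <=
    E * k (t - s) + 64 * n%:R ^+ 2 * E * (sin ((t - s) / 2) ^+ 2 * k (t - s)).
  rewrite cabsM cabs_real ger0_norm // cabsC.
  rewrite (le_trans (ler_wpM2r (k0 _) (mod' s t))) // le_eqVlt; apply/orP; left; apply/eqP; ring.
rewrite (le_trans (avg_le _ _ H)) //.
rewrite (@eq_avg _ _ _ (fun s => E%:C * (k (t - s))%:C +
   (64 * n%:R ^+ 2 * E)%:C * (sin ((t - s) / 2) ^+ 2 * k (t - s))%:C)); last first.
  by move=> s; rewrite -!rmorphM -rmorphD.
rewrite avgD !avgZ k1 mulr1 (le_trans (cabsD _ _)) // cabsM !cabs_real !ger0_norm //; last first.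
  by rewrite !mulr_ge0 // exprn_ge0 // ltW.
have := k2 t; set a := cabs _ => ha.
have : 64 * n%:R ^+ 2 * E * a <= 64 * n%:R ^+ 2 * E * (3 / n%:R ^+ 2).
  by rewrite ler_wpM2l // !mulr_ge0 // exprn_ge0 // ltW.
rewrite (_ : 64 * n%:R ^+ 2 * E * (3 / n%:R ^+ 2) = 192 * E); first by move=> ?; lra.
by field; rewrite gt_eqF.
Qed.

End JacksonKernel.

(** * Bernstein's inequality *)

Section TrigDerivative.
Context (R : realType).
Local Notation C := R[i].

Definition cpx (h : R -> R) : R -> C := fun t => (h t)%:C.

Lemma is_derive_term (c : C) (k : int) (t : R) :
  is_derive t (1 : R) (fun t => complex.Re (c * ek k t)) (complex.Re ('i%C * k%:~R * c * ek k t)).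
Proof.
case: c => a b; pose K : R := k%:~R.
rewrite (_ : (fun t => _) = fun t => a * cos (K * t) - b * sin (K * t)); last first.
  by apply/funext => s; rewrite /ek /ei /=.
have dK : is_derive t (1 : R) (fun t => K * t) K.
  by apply: is_derive_eq; rewrite /GRing.scale /= mulr1.
have dc : is_derive t (1 : R) (fun t => cos (K * t)) (- sin (K * t) * K).
  exact: (is_derive1_comp (is_derive_cos (K * t)) dK).
have ds : is_derive t (1 : R) (fun t => sin (K * t)) (cos (K * t) * K).
  exact: (is_derive1_comp (is_derive_sin (K * t)) dK).
apply: is_derive_eq; rewrite /GRing.scale /=.
have -> : (k%:~R : C) = K%:C by rewrite rmorph_int.
rewrite /ek /ei /=; rewrite -/K; ring.
Qed.

Definition dtp n (T : R -> C) (t : R) : C := isum n (fun k => 'i%C * k%:~R * coef T k * ek k t).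

Lemma tp_dtp n T : tp n (dtp n T).
Proof.
apply: (@tp_isum _ _ _ (fun k t => 'i%C * k%:~R * coef T k * ek k t)) => k kn.
by apply: tpZ; exact: tp_ek.
Qed.

Lemma coef_dtp n T k : tp n T -> coef (dtp n T) k = 'i%C * k%:~R * coef T k.
Proof.
move=> hT; rewrite (coef_tp n (fun k => 'i%C * k%:~R * coef T k)).
by case: leqP => kn; [rewrite mul1r|rewrite (tp_coef0 hT kn) !mulr0].
Qed.

Lemma is_derive_tp n T t : tp n T ->
  is_derive t (1 : R) (fun t => complex.Re (T t)) (complex.Re (dtp n T t)).
Proof.
move=> hT.
rewrite (_ : (fun t => _) = \sum_(i < n.*2.+1) (fun t =>
   complex.Re (coef T (i%:Z - n%:Z) * ek (i%:Z - n%:Z) t))); last first.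
  by apply/funext => s; rewrite fct_sumE (tp_coefE hT) raddf_sum.
rewrite /dtp /isum raddf_sum.
apply: is_derive_sum => i; exact: is_derive_term.
Qed.

(** On |k| <= n the multiplier k is the difference of two triangles of height n, centred at n and
    -n, and each is a modulated Fejer mean. This yields the constant 2 instead of the sharp 1.
    Truncated subtraction makes each triangle vanish outside its support. *)
Lemma bernstein n T (M : R) t : (0 < n)%N -> tp n T -> (forall t, cabs (T t) <= M) ->
  cabs (dtp n T t) <= 2 * n%:R * M.
Proof.
move=> n0 hT TM; have tT := tp_tlim hT.
pose sh (m : int) s := ek m s * fejer n (fun x => ek (- m) x * T x) s.
have tpsh m : tp (`|m| + n) (sh m) by apply: tpM; [exact: tp_ek|exact: tp_fejer].
have shM m s : cabs (sh m s) <= M.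
  rewrite cabsM cabs_ek mul1r; apply: fejer_bound => //; first by apply: tlimM => //; exact: tlim_ek.
  by move=> x; rewrite cabsM cabs_ek mul1r.
have csh m k : coef (sh m) k = (n - `|k - m|)%:R / n%:R * coef T k.
  by rewrite coef_shift coef_fejer coef_shift opprK subrK.
have E : dtp n T =1 fun s => 'i%C * n%:R * (sh n%:Z s - sh (- n%:Z) s).
  apply: (tp_ext (tp_dtp n T) (tpZ _ (tpB (tp_le _ (tpsh _)) (tp_le _ (tpsh _))))) => [||k].
  - exact: leqnn.
  - by rewrite abszN.
  rewrite coef_dtp // coefZ; last by apply: tlimB; exact: tp_tlim (tpsh _).
  rewrite coefB ?csh; try exact: tp_tlim (tpsh _).
  have [kn|kn] := leqP `|k| n; last by rewrite (tp_coef0 hT kn) !mulr0 subrr mulr0.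
  have nn : (n%:R : C) != 0 by rewrite pnatr_eq0 -lt0n.
  suff key : k%:~R = (n - `|(k - n%:Z)%R|)%N%:R - (n - `|(k - - n%:Z)%R|)%N%:R :> C.
    by rewrite key; field.
  have [k0|k0] := leP 0 k.
    have -> : (n - `|(k - n%:Z)%R|)%N = `|k|%N by lia.
    have -> : (n - `|(k - - n%:Z)%R|)%N = 0%N by lia.
    by rewrite subr0 -[in LHS](gez0_abs k0).
  have -> : (n - `|(k - n%:Z)%R|)%N = 0%N by lia.
  have -> : (n - `|(k - - n%:Z)%R|)%N = `|k|%N by lia.
  by rewrite sub0r -[in LHS](opprK k) -(ltz0_abs k0) rmorphN.
rewrite E !cabsM cabs_nat (_ : cabs 'i%C = 1) ?mul1r; last first.
  by rewrite /cabs normc_def /= expr0n add0r expr1n sqrtr1.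
rewrite [2 * _]mulrC -mulrA ler_wpM2l ?ler0n // (le_trans (cabsB _ _)) //.
by have := shM n%:Z t; have := shM (- n%:Z) t; lra.
Qed.

Lemma lipschitz_of_derive (f f' : R -> R) (M : R) : (forall t, is_derive t (1 : R) f (f' t)) ->
  (forall t, `|f' t| <= M) -> forall s t, `|f s - f t| <= M * `|s - t|.
Proof.
move=> df fM.
have cf : continuous f.
  by move=> t; apply: differentiable_continuous; apply/derivable1_diffP; have [] := df t.
have H s t : s < t -> `|f s - f t| <= M * `|s - t|.
  move=> st; have [|c _ E] := @MVT R f f' s t st (fun x _ => df x).
    exact: continuous_subspaceT.
  by rewrite distrC E normrM [`|t - s|]distrC ler_wpM2r.
move=> s t; have [st|st|->] := ltgtP s t; first exact: H.
  by rewrite distrC [`|s - t|]distrC H.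
by rewrite !subrr !normr0 mulr0.
Qed.

End TrigDerivative.

Section DerivativeEpsilon.
Context (K : numFieldType) (V : normedModType K).

Lemma is_derive_eps (f : K^o -> V) (t : K) (l : V) :
  (forall e : K, 0 < e -> exists2 d : K, 0 < d & forall x, `|x| < d ->
     `|f (x + t) - f t - x *: l| <= e * `|x|) -> is_derive (t : K^o) 1 f l.
Proof.
move=> H.
have C : h^-1 *: ((f \o shift (t : K^o)) (h *: (1 : K^o)) - f t) @[h --> 0^'] --> l.
  apply/cvgrPdist_le => e e0; have [d d0 Hd] := H e e0.
  near=> h.
  have hn : h != 0 by near: h; exact: nbhs_dnbhs_neq.
  have hd : `|h| < d by near: h; apply: dnbhs0_lt.
  rewrite /= /GRing.scale /= mulr1.
  rewrite -[l in X in X <= _](scalerK hn) -scalerBr normrZ normfV ler_pdivrMl ?normr_gt0 //.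
  by rewrite distrC mulrC; exact: Hd.
by apply: DeriveDef; [apply/cvg_ex; exists l|exact/cvg_lim].
Unshelve. all: by end_near. Qed.

Lemma derive_eps (f : K^o -> V) (t : K) (l : V) : is_derive (t : K^o) 1 f l ->
  forall e : K, 0 < e -> exists2 d : K, 0 < d & forall x, `|x| < d ->
     `|f (x + t) - f t - x *: l| <= e * `|x|.
Proof.
move=> [df fl] e e0.
have : h^-1 *: ((f \o shift (t : K^o)) (h *: (1 : K^o)) - f t) @[h --> 0^'] --> l.
  by rewrite -fl; exact: df.
move=> /cvgrPdist_le /(_ e e0).
rewrite near_withinE => /nbhs_ballP[d /= d0 Hd].
exists d => // x xd.
have [->|xn] := eqVneq x 0; first by rewrite add0r subrr scale0r subrr !normr0 mulr0.
have := Hd x; rewrite /ball /= sub0r normrN => /(_ xd xn).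
rewrite /GRing.scale /= mulr1.
rewrite -[l in X in X <= _ -> _](scalerK xn) -scalerBr normrZ normfV ler_pdivrMl ?normr_gt0 //.
by rewrite distrC mulrC.
Qed.

End DerivativeEpsilon.

(** * From approximation rates to derivatives and Hoelder estimates *)

Section Smoothness.
Context (R : realType).
Local Notation C := R[i].
Implicit Types (h : R -> R).

Lemma tp_reC n (T : R -> C) : tp n T -> tp n (reC T).
Proof.
move=> hT; apply: (eq_tp (fun t => esym (reCE T t))).
by apply: tpZ; apply: tpD => //; exact: tp_conj.
Qed.

Section VPDerivative.
Context (q : R) (q01 : 0 < q < 1) (h : R -> R) (M : R) (hM : yn q (cpx h) M).

Definition vpd j : R -> C := dtp (2 ^ j.+1) (vp (2 ^ j) (cpx h)).

Let tV j : tp (2 ^ j.+1) (vp (2 ^ j) (cpx h)).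
Proof. by rewrite expnS mul2n; exact: tp_vp. Qed.

Lemma tp_vpd j : tp (2 ^ j.+1) (vpd j).
Proof. exact: tp_dtp. Qed.

Lemma vpd_step t j : cabs (vpd j.+1 t - vpd j t) <= 16 * M * (2 * q) ^+ j.
Proof.
pose D t := vp (2 ^ j.+1) (cpx h) t - vp (2 ^ j) (cpx h) t.
have le2 : (2 ^ j.+1 <= 2 ^ j.+2)%N by rewrite leq_exp2l.
have tD : tp (2 ^ j.+2) D by apply: tpB => //; exact: tp_le (tV j).
have -> : vpd j.+1 t - vpd j t = dtp (2 ^ j.+2) D t.
  move: t; apply: (tp_ext (tpB (tp_vpd j.+1) (tp_le le2 (tp_vpd j))) (tp_dtp _ _)) => k.
  rewrite coefB; try exact: tp_tlim (tp_vpd _).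
  rewrite !coef_dtp // /D coefB; try exact: tp_tlim (tV _).
  by rewrite mulrBr.
(* Bernstein's inequality in degree 2^(j+2), for a block of size at most 2 M q^j. *)
rewrite (_ : 16 * M * (2 * q) ^+ j = 2 * (2 ^ j.+2)%:R * (2 * M * q ^+ j)).
  apply: bernstein => //; first by rewrite expn_gt0.
  by move=> s; exact: yn_block hM.
by rewrite !expnS !natrM natrX exprMn; ring.
Qed.

Lemma is_derive_vpd j t :
  is_derive t (1 : R) (fun t => complex.Re (vp (2 ^ j) (cpx h) t)) (complex.Re (vpd j t)).
Proof. exact: is_derive_tp. Qed.

Lemma vp_cpx_close j t : `|h t - complex.Re (vp (2 ^ j) (cpx h) t)| <= M * q ^+ j.
Proof.
have [_ _ /(_ j t)] := hM; apply: le_trans.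
rewrite -[X in _ <= X]/(cabs ((h t)%:C - _)).
by apply: le_trans (le_Re_cabs _); rewrite raddfB.
Qed.

End VPDerivative.

(** Differentiation multiplies the j-th dyadic block by about 2^j, so the derivatives of the means
    converge at rate 2 q. *)
Lemma reg_derive (q : R) h : 0 < q -> 2 * q < 1 -> reg q (cpx h) ->
  exists g, (forall t, is_derive t (1 : R) h (g t)) /\ reg (2 * q) (cpx g).
Proof.
move=> q0 q2 [M hM]; have q01 : 0 < q < 1 by apply/andP; split => //; lra.
have q201 : 0 < 2 * q < 1 by apply/andP; split => //; lra.
have qw2 : 0 <= 2 * q < 1 by apply/andP; split => //; lra.
have qw : 0 <= q < 1 by apply/andP; split => //; lra.
have M0 := yn_ge0 hM; have M16 : 0 <= 16 * M by rewrite mulr_ge0.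
have lim t := geo_clim M16 qw2 (vpd_step q01 hM t).
pose A := 16 * M / (1 - 2 * q).
have A0 : 0 <= A by rewrite divr_ge0 //; lra.
pose g t := complex.Re (clim (fun j => vpd h j t)).
have close j t : `|g t - complex.Re (vpd h j t)| <= A * (2 * q) ^+ j.
  by have [_ /(_ j)] := lim t; apply: le_trans; rewrite -raddfB le_Re_cabs.
have qX j : 0 <= (2 * q) ^+ j by rewrite exprn_ge0 //; lra.
have mono j J : (j <= J)%N -> (2 * q) ^+ J <= (2 * q) ^+ j.
  by move=> jJ; rewrite ler_wiXn2l //; lra.
exists g; split; last first.
  have [B hB] := tp_bounded (tp_vpd h 0).
  have B0 := le_trans (cabs_ge0 _) (hB 0).
  exists (4 * (B + A) / (2 * q) ^+ 1); apply: (yn_approx q201) => [t|j].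
    rewrite cabs_real -(subrK (complex.Re (vpd h 0 t)) (g t)) (le_trans (ler_normD _ _)) //.
    rewrite addrC lerD //; first by rewrite (le_trans (le_Re_cabs _)).
    by rewrite (le_trans (close 0%N t)) // expr0 mulr1.
  exists (reC (vpd h j)); split; first by rewrite addn1; apply: tp_reC; exact: tp_vpd.
  move=> t; rewrite /cpx /reC -rmorphB cabs_real (le_trans (close j t)) //.
  by rewrite ler_wpM2r // lerDr.
pose S j t := complex.Re (vp (2 ^ j) (cpx h) t).
(* The remainder h - S j is Lipschitz with a small constant, as the limit of the S J - S j, whose
   derivatives are small. Differentiability at a point thus passes from S j to h. *)
have rem j s t : `|(h s - S j s) - (h t - S j t)| <= 2 * A * (2 * q) ^+ j * `|s - t|.
  apply/ler_addgt0Pr => e e0.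
  have [J0 HJ0] := geo_small (2 * M) qw e0; pose J := maxn j J0.
  have HJ : 2 * M * q ^+ J <= e.
    rewrite (le_trans _ HJ0) // ler_wpM2l ?mulr_ge0 // ler_wiXn2l ?leq_maxr //; lra.
  have dS x : is_derive x (1 : R) (S J - S j) (complex.Re (vpd h J x) - complex.Re (vpd h j x)).
    by apply: is_deriveB; exact: is_derive_vpd.
  have bd x : `|complex.Re (vpd h J x) - complex.Re (vpd h j x)| <= 2 * A * (2 * q) ^+ j.
    have c1 := close J x; have c2 := close j x.
    have c3 : A * (2 * q) ^+ J <= A * (2 * q) ^+ j by rewrite ler_wpM2l // mono // leq_maxl.
    have := ler_distD (g x) (complex.Re (vpd h J x)) (complex.Re (vpd h j x)).
    by rewrite [`|_ - g x|]distrC; lra.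
  have := lipschitz_of_derive dS bd s t; rewrite !fctE => L.
  have := vp_cpx_close hM J s; have := vp_cpx_close hM J t; rewrite -/(S J s) -/(S J t) => e1 e2.
  rewrite (_ : _ - _ = (h s - S J s) + (S J s - S j s - (S J t - S j t)) - (h t - S J t)); last by ring.
  have := ler_normB (h s - S J s + (S J s - S j s - (S J t - S j t))) (h t - S J t).
  have := ler_normD (h s - S J s) (S J s - S j s - (S J t - S j t)).
  lra.
move=> t; apply: is_derive_eps => e e0; have e2 : 0 < e / 2 by rewrite divr_gt0.
have [j Hj] := geo_small (3 * A) qw2 e2.
have [d d0 Hd] := derive_eps (is_derive_vpd h j t) e2.
exists d => // x /Hd; rewrite -/(S j (x + t)) -/(S j t) /GRing.scale /= => H.
rewrite (_ : _ - _ = ((h (x + t) - S j (x + t)) - (h t - S j t)) +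
  (S j (x + t) - S j t - x * complex.Re (vpd h j t)) - x * (g t - complex.Re (vpd h j t))); last by ring.
have := rem j (x + t) t; rewrite addrK => r1.
have r2 : `|x * (g t - complex.Re (vpd h j t))| <= `|x| * (A * (2 * q) ^+ j).
  by rewrite normrM ler_wpM2l.
set a := (h (x + t) - _ - _) in r1 *; set b := (S j (x + t) - _ - _) in H *.
set c := x * (g t - _) in r2 *.
have := ler_normB (a + b) c; have := ler_normD a b.
have : 3 * A * (2 * q) ^+ j * `|x| <= e / 2 * `|x| by rewrite ler_wpM2r.
move: r1 r2 H; nra.
Qed.

Section Hoelder.
Context (beta : R) (b01 : 0 < beta < 1).

(* 2^-(k + beta), the approximation rate of C^(k+beta). *)
Definition hrate (k : nat) : R := 2^-1 ^+ k * 2^-1 `^ beta.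

Let half_gt0 : 0 < 2^-1 :> R. Proof. by rewrite invr_gt0. Qed.

Lemma hrate0 : 2^-1 < hrate 0 < 1.
Proof.
rewrite /hrate expr0 mul1r; case/andP: b01 => b0 b1.
have p01 : 0 < (2^-1 : R) <= 1 by apply/andP; split; lra.
have p0 : 0 < 2^-1 `^ beta :> R by exact: powR_gt0.
have l1 := ger_powR p01 (ltW b1); rewrite (powRr1 (ltW half_gt0)) in l1.
have l2 := ger_powR p01 (ltW b0); rewrite powRr0 in l2.
have n1 (r : R) : 0 < r -> 2^-1 `^ r != 1 :> R.
  move=> r0; rewrite powR_eq1; apply/negP => /or3P[/eqP|h|/eqP]; lra.
rewrite !lt_neqAle l1 l2 n1 // !andbT; apply/eqP => E.
have := n1 (1 - beta); rewrite subr_gt0 => /(_ b1) /eqP; apply.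
rewrite powRB; last by apply/implyP => _; exact: lt0r_neq0.
by rewrite (powRr1 (ltW half_gt0)) -E divff // lt0r_neq0.
Qed.

Lemma hrateS k : hrate k = 2 * hrate k.+1.
Proof. by rewrite /hrate exprS mulrA mulrA divff ?mul1r // pnatr_eq0. Qed.

Lemma hrate01 k : 0 < hrate k < 1.
Proof.
have /andP[h0 h1] := hrate0; have p0 : 0 < hrate 0 by lra.
elim: k => [|k /andP[a b]]; first by rewrite p0.
by have := hrateS k => E; apply/andP; split; lra.
Qed.

Lemma hrate_exp j : hrate 0 ^+ j = (2^-1 ^+ j) `^ beta.
Proof.
elim: j => [|j IH]; first by rewrite !expr0 powR1.
by rewrite !exprS IH powRM ?exprn_ge0 ?(ltW half_gt0) // /hrate expr0 mul1r.
Qed.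

(** At level j the error is of order q^j and the mean has Lipschitz constant of order (2 q)^j, a
    growing sequence since beta < 1; both terms are comparable to |s - t|^beta when 2^-j is
    comparable to |s - t|. *)
Lemma hoelder_of_reg h : reg (hrate 0) (cpx h) ->
  exists K, forall s t, `|h s - h t| <= K * `|s - t| `^ beta.
Proof.
move=> [M hM]; have M0 := yn_ge0 hM; have q01 := hrate01 0.
set q := hrate 0 in hM q01 *; have /andP[qh q1] := hrate0; rewrite -/q in qh q1.
have [B hB] := tp_bounded (tp_vpd h 0); have B0 := le_trans (cabs_ge0 _) (hB 0).
have q2 : 0 < 2 * q - 1 by lra.
pose L := B + 16 * M / (2 * q - 1).
have L0 : 0 <= L by rewrite addr_ge0 // divr_ge0 ?mulr_ge0 // ltW.
have Q1 j : 1 <= (2 * q) ^+ j by rewrite exprn_ege1 //; lra.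
have dV j t : cabs (vpd h j t) <= B + 16 * M / (2 * q - 1) * ((2 * q) ^+ j - 1).
  elim: j => [|j IH]; first by rewrite expr0 subrr mulr0 addr0.
  rewrite -(subrK (vpd h j t) (vpd h j.+1 t)) (le_trans (cabsD _ _)) // addrC.
  rewrite (le_trans (lerD IH (vpd_step q01 hM t j))) // -addrA lerD2l.
  rewrite le_eqVlt; apply/orP; left; apply/eqP; rewrite exprS; field; exact: lt0r_neq0.
have dVL j t : `|complex.Re (vpd h j t)| <= L * (2 * q) ^+ j.
  apply: (le_trans (le_Re_cabs _)); apply: (le_trans (dV j t)); rewrite [L * _]mulrDl; apply: lerD.
    by rewrite ler_peMr.
  by rewrite ler_wpM2l ?divr_ge0 ?mulr_ge0 ?(ltW q2) // gerBl.
have key j s t : `|h s - h t| <= 2 * M * q ^+ j + L * (2 * q) ^+ j * `|s - t|.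
  have lip := lipschitz_of_derive (is_derive_vpd h j) (dVL j) s t.
  have e1 := vp_cpx_close hM j s; have e2 := vp_cpx_close hM j t.
  pose S x := complex.Re (vp (2 ^ j) (cpx h) x); rewrite -/(S s) in e1; rewrite -/(S t) in e2.
  rewrite -/(S s) -/(S t) in lip.
  rewrite (_ : h s - h t = (h s - S s) + (S s - S t) - (h t - S t)); last by ring.
  have := ler_normB (h s - S s + (S s - S t)) (h t - S t).
  have := ler_normD (h s - S s) (S s - S t).
  lra.
exists (2 * (2 * M + L) + 2 * M) => s t.
have [->|st] := eqVneq s t.
  by rewrite !subrr normr0 powR0 ?mulr0 // gt_eqF //; case/andP: b01.
set u := `|s - t|; have u0 : 0 < u by rewrite normr_gt0 subr_eq0.
have b0 : 0 <= beta by case/andP: b01 => /ltW.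
have b1 : beta <= 1 by case/andP: b01 => _ /ltW.
have [u1|u1] := leP 1 u.
  have p1 : 1 <= u `^ beta.
    by have := ge0_ler_powR b0 (_ : 1 \in Num.nneg) (_ : u \in Num.nneg) u1; rewrite powR1 !nnegrE ler01 (ltW u0) => ->.
  have [_ hsup _] := hM.
  have a1 : `|h s| <= M by have := hsup s; rewrite cabs_real.
  have a2 : `|h t| <= M by have := hsup t; rewrite cabs_real.
  rewrite (le_trans (ler_normB _ _)) //.
  have : 0 <= 2 * (2 * M + L) by rewrite mulr_ge0 // addr_ge0 // mulr_ge0.
  nra.
have h2 : 0 <= (2^-1 : R) < 1 by apply/andP; split; lra.
have exj : exists j, 2^-1 ^+ j < u.
  have u2 : 0 < u / 2 by rewrite divr_gt0.
  by have [j] := geo_small 1 h2 u2; rewrite mul1r => Hj; exists j; lra.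
(* The scale with 2^-(j+1) < u <= 2^-j; the least exponent is not 0 because u < 1. *)
case: (ex_minnP exj) => -[|j] Hj jmin; first by rewrite expr0 in Hj; lra.
have uj : u <= 2^-1 ^+ j by rewrite leNgt; apply/negP => /jmin; rewrite ltnn.
have qu : q ^+ j <= 2 * u `^ beta.
  rewrite /q hrate_exp.
  have h2u : 2^-1 ^+ j <= 2 * u by rewrite exprS in Hj; lra.
  have := ge0_ler_powR b0 _ _ h2u; rewrite !nnegrE exprn_ge0 ?(ltW half_gt0) // mulr_ge0 ?(ltW u0) //.
  move=> /(_ isT isT) /le_trans; apply; rewrite powRM ?(ltW u0) // ler_wpM2r ?powR_ge0 //.
  by rewrite ler1_powR // ler1n.
have qju : (2 * q) ^+ j * u <= q ^+ j.
  rewrite exprMn mulrAC ler_piMl ?exprn_ge0 //; first by case/andP: q01 => /ltW.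
  rewrite (le_trans (ler_wpM2l _ uj)) ?exprn_ge0 // -exprMn divff ?expr1n // pnatr_eq0.
have := key j s t; rewrite -/u.
have : L * ((2 * q) ^+ j * u) <= L * q ^+ j by rewrite ler_wpM2l.
have := powR_ge0 u beta.
have : (2 * M + L) * q ^+ j <= (2 * M + L) * (2 * u `^ beta).
  by rewrite ler_wpM2l // addr_ge0 // mulr_ge0.
nra.
Qed.

End Hoelder.
End Smoothness.

(** * Equivalence of C^(k+beta) with an approximation rate *)

Section HoelderClasses.
Context (R : realType) (beta : R) (b01 : 0 < beta < 1).
Local Notation C := R[i].
Implicit Types (h : R -> R).

Definition Ck (k : nat) h : Prop :=
  [/\ forall j : nat, (j < k)%N -> forall t : R, derivable (derive1n j h) t 1,
      continuous (derive1n k h)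
    & exists M : R, forall s t : R,
        `|derive1n k h s - derive1n k h t| <= M * `|s - t| `^ beta].

Lemma Ck_S k h : Ck k.+1 h <-> (forall t, derivable h t 1) /\ Ck k h^`()%classic.
Proof.
split=> [[d c H]|[d [d' c H]]].
  split; first exact: (d 0%N).
  split; [|by rewrite -derive1Sn|by rewrite -derive1Sn].
  by move=> j jk; rewrite -derive1Sn; exact: d.
split; [|by rewrite derive1Sn|by rewrite derive1Sn].
by move=> [|j] jk //; rewrite derive1Sn; exact: d'.
Qed.

Lemma continuous_reg (q : R) h : 0 < q < 1 -> reg q (cpx h) -> continuous h.
Proof.
move=> q01 [M hM] t; have qw : 0 <= q < 1 by case/andP: q01 => /ltW -> ->.
apply/cvgrPdist_le => e e0; have e3 : 0 < e / 3 by rewrite divr_gt0.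
have [j Hj] := geo_small M qw e3.
pose S x := complex.Re (vp (2 ^ j) (cpx h) x).
have cS : {for t, continuous S}.
  apply: differentiable_continuous; apply/derivable1_diffP.
  by have [] := is_derive_vpd h j t.
have close x : `|h x - S x| <= e / 3 by exact: le_trans (vp_cpx_close hM j x) Hj.
near=> s.
have H : `|S t - S s| <= e / 3 by near: s; move/cvgrPdist_le : cS => /(_ _ e3).
rewrite (_ : h t - h s = (h t - S t) + (S t - S s) - (h s - S s)); last by ring.
have := ler_normB (h t - S t + (S t - S s)) (h s - S s).
have := ler_normD (h t - S t) (S t - S s); have := close t; have := close s.
lra.
Unshelve. all: by end_near. Qed.

Lemma Ck_of_reg k h : reg (hrate beta k) (cpx h) -> Ck k h.
Proof.
elim: k h => [|k IH] h hh.
  split=> //; first exact: continuous_reg (hrate01 b01 0) hh.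
  exact: hoelder_of_reg b01 h hh.
have /andP[q0 q1] := hrate01 b01 k.+1; have /andP[_ q2] := hrate01 b01 k.
rewrite hrateS in q2.
have [g [hg rg]] := reg_derive q0 q2 hh.
apply/Ck_S; split=> [t|]; first by have [] := hg t.
apply: IH; rewrite hrateS (_ : h^`()%classic = g) //.
by apply/funext => t; rewrite derive1E; exact: derive_val.
Qed.

Definition periodic h := forall t, h (t + pi *+ 2) = h t.

Lemma periodic_derive1 h : periodic h -> periodic h^`()%classic.
Proof.
move=> ph t; rewrite !derive1E /derive; congr (lim _).
rewrite (_ : (fun x : R => _) = (fun x : R => x^-1 *: ((h \o shift t) (x *: 1) - h t))) //.
by apply/funext => x /=; rewrite addrA !ph.
Qed.

Lemma tp_bounded_approx (E : R) n (g T : R -> C) : tp n T -> (forall t, cabs (g t - T t) <= E) ->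
  exists B, forall t, cabs (g t) <= B.
Proof.
move=> /tp_bounded[B hB] H; exists (E + B) => t.
by rewrite -(subrK (T t) (g t)) (le_trans (cabsD _ _)) // lerD.
Qed.

Lemma reg_of_approx (q K : R) (g : R -> C) : 0 < q < 1 ->
  (forall j, exists T, tp (2 ^ j.+1) T /\ forall t, cabs (g t - T t) <= K * q ^+ j) -> reg q g.
Proof.
move=> q01 H; have [T0 [tT0 HT0]] := H 0%N.
have [B hB] := tp_bounded_approx tT0 HT0.
exists (4 * (Num.max B K) / q ^+ 1); apply: (yn_approx q01) => [t|j].
  by rewrite (le_trans (hB t)) // le_max lexx.
have [T [tT HT]] := H j; exists T; rewrite addn1; split=> // t.
rewrite (le_trans (HT t)) // ler_wpM2r ?exprn_ge0 //; first by case/andP: q01 => /ltW.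
by rewrite le_max lexx orbT.
Qed.

Lemma reg_hoelder h (M : R) : periodic h ->
  (forall s t, `|h s - h t| <= M * `|s - t| `^ beta) -> reg (hrate beta 0) (cpx h).
Proof.
move=> ph hM; pose K := `|M|.
apply: (@reg_of_approx _ (193 * K)); first exact: hrate01.
move=> j; rewrite -mulrA; have qX : 0 <= hrate beta 0 ^+ j.
  by rewrite exprn_ge0 //; case/andP: (hrate01 b01 0) => /ltW.
rewrite expnS mul2n; apply: jackson_approximation; first by rewrite expn_gt0.
- by rewrite mulr_ge0 // normr_ge0.
- by move=> t; rewrite /cpx ph.
move=> s t; rewrite /cpx -rmorphB cabs_real (le_trans (hM s t)) // -mulrA.
apply: (@le_trans _ _ (K * `|s - t| `^ beta)); first by rewrite ler_wpM2r ?powR_ge0 ?ler_norm.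
rewrite /K ler_wpM2l ?normr_ge0 // (hrate_exp beta).
set n : R := (2 ^ j)%:R; have n0 : 0 < n by rewrite ltr0n expn_gt0.
have nE : (2^-1 ^+ j : R) = n^-1 by rewrite /n natrX exprVn.
pose x := n * `|s - t|; have x0 : 0 <= x by rewrite mulr_ge0 ?(ltW n0).
have -> : `|s - t| = n^-1 * x by rewrite /x mulKf // gt_eqF.
have -> : (s - t) ^+ 2 = `|s - t| ^+ 2 by rewrite real_normK ?num_real.
rewrite -exprMn -/x nE powRM ?invr_ge0 ?(ltW n0) // ler_wpM2l ?powR_ge0 //.
(* What remains is x^beta <= 1 + x^2: the left side is at most 1 for x <= 1 and at most x beyond. *)
case/andP: b01 => b0 b1; have [x1|x1] := leP x 1.
  have := ge0_ler_powR (ltW b0) _ _ x1; rewrite !nnegrE x0 ler01 powR1 => /(_ isT isT).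
  by have := sqr_ge0 x; lra.
have := ler1_powR (ltW x1) (ltW b1); nra.
Qed.

(** Subtract from h a trigonometric primitive of a good approximant of g without its mean. The
    difference is Lipschitz with constant 2 E, so Jackson's theorem in degree of order N = 2^j gains
    the factor 1 / N; whence 386 = 2 * 193. *)
Lemma reg_primitive (q : R) h g : 0 < q -> 2 * q < 1 -> periodic h ->
  (forall t, is_derive t (1 : R) h (g t)) -> reg (2 * q) (cpx g) -> reg q (cpx h).
Proof.
move=> q0 q2 ph dh [M hM]; have M0 := yn_ge0 hM.
have q01 : 0 < q < 1 by apply/andP; split=> //; lra.
have q201 : 0 < 2 * q < 1 by apply/andP; split=> //; lra.
have [tg _ gV] := hM.
apply: (@reg_of_approx _ (386 * M)) => // j.
set N := (2 ^ j)%N; have N0 : (0 < N)%N by rewrite expn_gt0.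
pose T := vp N (cpx g); have tT : tp (2 ^ j.+1) T by rewrite expnS mul2n; exact: tp_vp.
pose E := M * (2 * q) ^+ j.
have E0 : 0 <= E by rewrite mulr_ge0 ?exprn_ge0 //; lra.
have gT t : `|g t - complex.Re (T t)| <= E.
  by have := vp_cpx_close hM j t.
pose m := (2 ^ j.+1)%N.
pose d (k : int) : C := if k == 0 then 0 else coef T k / ('i%C * k%:~R).
pose S t : C := isum m (fun k => d k * ek k t).
have tS : tp m S by exists d.
pose c0 := complex.Re (coef T 0).
have dS t : is_derive t (1 : R) (fun t => complex.Re (S t)) (complex.Re (T t) - c0).
  apply: is_derive_eq; first exact: is_derive_tp tS.
  rewrite /c0 -raddfB; congr complex.Re.
  have tc : tp m (fun=> coef T 0) by exact: tp_cst.
  move: t; apply: (tp_ext (tp_dtp m S) (tpB tT tc)) => k.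
  rewrite coef_dtp // coefB; [|exact: tp_tlim tT|exact: tp_tlim tc].
  rewrite (coef_tp m d) (_ : (fun=> coef T 0) = fun t => coef T 0 * ek 0 t); last first.
    by apply/funext => t; rewrite ek0 mulr1.
  rewrite coefZ; last exact: tlim_ek.
  rewrite coef_ek /d; case: eqVneq => [->|k0].
    by rewrite !mulr0 mulr1 subrr.
  rewrite mulr0 subr0; case: leqP => km; last by rewrite (tp_coef0 tT km) mul0r mulr0.
  rewrite mul1r mulrC divfK // mulf_neq0 //; last by rewrite intr_eq0.
  by rewrite eq_complex /= oner_eq0 andbF.
pose f t := h t - complex.Re (S t).
have df t : is_derive t (1 : R) f (g t - (complex.Re (T t) - c0)).
  exact: (is_deriveB (dh t) (dS t)).
have pS t : S (t + pi *+ 2) = S t.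
  rewrite /S; apply: eq_isum => k _; rewrite ek_trans; congr (_ * _).
  rewrite -[RHS]mulr1; congr (_ * _); rewrite /ek.
  by case: k => k; [|rewrite NegzE rmorphN mulNr eiN];
    rewrite ei_nat2pi // conjc1.
have pf : periodic f by move=> t; rewrite /f ph pS.
(* The mean of a derivative of a periodic function is 0, so that of its approximant is small. Over
   one period f - c0 t changes by 2 pi c0 in modulus, while its derivative is bounded by E. *)
have c0E : `|c0| <= E.
  pose G t := f t - c0 * t.
  have dG t : is_derive t (1 : R) G (g t - complex.Re (T t)).
    have dl : is_derive t (1 : R) (fun t => c0 * t) c0.
      by apply: is_derive_eq; rewrite /GRing.scale /= mulr1.
    rewrite (_ : g t - _ = g t - (complex.Re (T t) - c0) - c0); last by ring.
    exact: (is_deriveB (df t) dl).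
  have := lipschitz_of_derive dG gT (pi *+ 2) 0; rewrite subr0.
  rewrite /G -[X in f X - _]add0r pf mulr0 subr0 addrAC subrr add0r normrN normrM.
  by rewrite ler_pM2r // normr_gt0 gt_eqF // twopi_gt0.
have fE t : `|g t - (complex.Re (T t) - c0)| <= 2 * E.
  rewrite opprB addrCA addrC; have := ler_normD (g t - complex.Re (T t)) c0.
  by have := gT t; lra.
have lip := lipschitz_of_derive df fE.
have nR : 0 < N%:R :> R by rewrite ltr0n.
have [|||U [tU HU]] := @jackson_approximation R N (cpx f) (2 * E / N%:R) N0.
- by apply: divr_ge0; [rewrite mulr_ge0|exact: ltW].
- by move=> t; rewrite /cpx pf.
- move=> s t; rewrite /cpx -rmorphB cabs_real (le_trans (lip s t)) // -[leRHS]mulrA.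
  apply: ler_wpM2l; first by rewrite pmulr_rge0.
  rewrite ler_pdivlMl // -exprMn -(real_normK (num_real (N%:R * (s - t)))) normrM.
  rewrite ger0_norm ?(ltW nR) //; set x := _ * _.
  by have := sqr_ge0 (x - 2^-1); rewrite sqrrB; nra.
exists (fun t => reC S t + U t); split.
  by apply: tpD; [exact: tp_reC|rewrite expnS mul2n].
move=> t; rewrite (_ : cpx h t - _ = cpx f t - U t); last first.
  by rewrite /cpx /f /reC rmorphB opprD addrA.
rewrite (le_trans (HU t)) // le_eqVlt; apply/orP; left; apply/eqP.
rewrite /E exprMn /N natrX; field.
by rewrite expf_neq0 // pnatr_eq0.
Qed.

Lemma reg_of_Ck k h : periodic h -> Ck k h -> reg (hrate beta k) (cpx h).
Proof.
elim: k h => [|k IH] h ph; first by case=> _ _ [M hM]; exact: (reg_hoelder ph hM).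
move=> /Ck_S[dh ch].
have /andP[q0 q1] := hrate01 b01 k.+1; have /andP[_ q2] := hrate01 b01 k.
rewrite hrateS in q2.
apply: (@reg_primitive _ h h^`()%classic) => //.
  by move=> t; rewrite derive1E; apply/derivableP; exact: dh.
by rewrite -hrateS; apply: IH => //; exact: periodic_derive1.
Qed.


End HoelderClasses.

(** * Inverses in Hoelder classes *)

Section Inverse.
Context (R : realType).
Local Notation C := R[i].

Lemma tlim_periodic (g : R -> C) t : tlim g -> g (t + pi *+ 2) = g t.
Proof.
move=> hg; apply/eqP; rewrite -subr_eq0; apply/eqP/cabs_tiny => e e0.
have e2 : 0 < e / 2 by rewrite divr_gt0.
have [n [T [[c hc] HT]]] := hg _ e2.
have pT : T (t + pi *+ 2) = T t.
  rewrite !hc; apply: eq_isum => k _; rewrite ek_trans; congr (_ * _).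
  rewrite -[RHS]mulr1; congr (_ * _); rewrite /ek.
  by case: k => k; [|rewrite NegzE rmorphN mulNr eiN]; rewrite ei_nat2pi // conjc1.
apply: (le_trans (cabs_tri (T t) _ _)); rewrite -{1}pT [leRHS]splitr lerD //.
by rewrite cabsC.
Qed.

Section Beta.
Context (beta : R) (b01 : 0 < beta < 1).

Lemma positive_lower_bound (h : R -> R) : continuous h -> periodic h -> (forall t, 0 < h t) ->
  exists2 c, 0 < c & forall t, c <= h t.
Proof.
move=> ch ph h0; have p0 := pi_gt0 R.
have [|c hc Hc] := @EVT_min R h (- pi) pi _ (continuous_subspaceT ch); first by lra.
exists (h c) => // t; have [k [u [ku up]]] := reduce_angle t.
have phn x n : h (x + n%:R * (pi *+ 2)) = h x.
  elim: n => [|n IH]; first by rewrite mul0r addr0.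
  by rewrite -(natr1 n) mulrDl mul1r addrA ph.
have -> : h t = h u.
  by case: ku => ->; [rewrite -(phn (t - _) k) subrK|rewrite phn].
by apply: Hc; rewrite in_itv /= -ler_norml.
Qed.

(** Approximation does not pass easily to inverses, so the induction goes through smoothness: a
    direct Hoelder estimate for k = 0, then (1/h)' = - h'/h^2 and [reg_primitive]. *)
Lemma reg_inv k (h : R -> R) : (forall t, 0 < h t) -> reg (hrate beta k) (cpx h) ->
  reg (hrate beta k) (cpx (fun t => (h t)^-1)).
Proof.
move=> h0; elim: k => [|k IH] hh.
  have ph : periodic h.
    by move=> t; apply: complexI; exact: (tlim_periodic t (reg_tlim hh)).
  have ch := continuous_reg (hrate01 b01 0) hh.
  have [c c0 hc] := positive_lower_bound ch ph h0.
  have [K hK] := hoelder_of_reg b01 hh.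
  apply: (@reg_hoelder R beta b01 _ (K / c ^+ 2)) => [t|s t]; first by rewrite ph.
  have -> : (h s)^-1 - (h t)^-1 = (h t - h s) / (h s * h t).
    by field; rewrite !gt_eqF.
  rewrite normrM normfV (gtr0_norm (mulr_gt0 (h0 s) (h0 t))) distrC mulrAC.
  apply: ler_pM => //; first by rewrite invr_ge0 mulr_ge0 ?(ltW (h0 _)).
  by rewrite lef_pV2 ?posrE ?exprn_gt0 ?mulr_gt0 // expr2 ler_pM ?(ltW c0).
have /andP[q0 q1] := hrate01 b01 k.+1; have q01 := hrate01 b01 k.
have q01' := hrate01 b01 k.+1; have /andP[_ q2] := q01; rewrite hrateS in q2.
have hle : hrate beta k.+1 <= hrate beta k by rewrite [leRHS]hrateS; lra.
have rh := reg_rate q01' q01 hle hh.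
have ri := IH rh.
have [g [dg rg]] := reg_derive q0 q2 hh.
apply: (@reg_primitive R _ _ (fun t => - (g t * ((h t)^-1 * (h t)^-1)))) => //.
- move=> t; congr (_^-1); apply: complexI; exact: (tlim_periodic t (reg_tlim hh)).
- move=> t; apply: is_derive_eq; first exact: (is_deriveV (lt0r_neq0 (h0 t)) (dg t)).
  by rewrite /GRing.scale /= expr2 invfM; ring.
rewrite -hrateS in rg *.
rewrite (_ : cpx _ = fun t => (-1) * (cpx g t * (cpx (fun t => (h t)^-1) t * cpx (fun t => (h t)^-1) t))).
  by apply: regZ; apply: (regM q01) => //; exact: (regM q01).
by apply/funext => t; rewrite /cpx rmorphN !rmorphM mulN1r.
Qed.

Lemma reg_invC k (g : R -> C) : (forall t, g t != 0) -> reg (hrate beta k) g ->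
  reg (hrate beta k) (fun t => (g t)^-1).
Proof.
move=> g0 hg; have q01 := hrate01 b01 k.
pose h t := cabs (g t) ^+ 2.
have h0 t : 0 < h t.
  rewrite exprn_gt0 // lt_neqAle cabs_ge0 andbT eq_sym; apply: contra_neq (g0 t) => E.
  exact: cabs_eq0.
have hE t : cpx h t = g t * conjc (g t) by exact: cabs_sqr.
have rh : reg (hrate beta k) (cpx h).
  by rewrite (funext hE); apply: (regM q01) => //; exact: (reg_conj q01).
apply: eq_reg (regM q01 (reg_conj q01 hg) (reg_inv h0 rh)) => t /=.
have -> : cpx (fun t => (h t)^-1) t = (cpx h t)^-1 by exact: fmorphV.
rewrite hE invfM mulrCA mulfV ?mulr1 //.
by rewrite conjc_eq0.
Qed.

Section Matrices.
Context (k : nat).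
Local Notation q := (hrate beta k).
Let q01 := hrate01 b01 k.

Lemma reg_prod (I : Type) (r : seq I) (P : pred I) (F : I -> R -> C) :
  (forall i, P i -> reg q (F i)) -> reg q (fun t => \prod_(i <- r | P i) F i t).
Proof.
move=> hF; elim: r => [|i r IH].
  by under eq_fun do rewrite big_nil; exact: (reg_tp q01 (tp_cst 0 1)).
under eq_fun do rewrite big_cons.
by case Pi : (P i) => //; apply: regM => //; exact: hF.
Qed.

Lemma reg_det n (G : R -> 'M[C]_n) : (forall i j, reg q (fun t => G t i j)) ->
  reg q (fun t => \det (G t)).
Proof.
move=> hG; apply: (reg_sum q01) => s _; apply: regZ; apply: reg_prod => i _; exact: hG.
Qed.

Lemma reg_adj n (G : R -> 'M[C]_n) i j : (forall i j, reg q (fun t => G t i j)) ->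
  reg q (fun t => (\adj (G t)) i j).
Proof.
move=> hG; under eq_fun do rewrite mxE; apply: regZ; apply: reg_det => i' j'.
under eq_fun do rewrite !mxE; exact: hG.
Qed.

Lemma gram_unit m N (A : 'M[C]_(m, N)) : \rank A = m -> A *m (map_mx conjc A)^T \in unitmx.
Proof.
move=> rA; rewrite -row_free_unit -kermx_eq0; apply/rowV0P => v.
move/sub_kermxP; rewrite mulmxA; set w := v *m A => h.
have w0 : w = 0.
  have : (w *m (map_mx conjc w)^T) 0 0 = 0.
    by rewrite /w map_mxM trmx_mul mulmxA -/w h mul0mx mxE.
  rewrite mxE => E; apply/rowP => j; rewrite [RHS]mxE.
  have : \sum_j (cabs (w 0 j)) ^+ 2 = 0.
    apply: complexI; rewrite rmorph_sum; apply: etrans E; apply: eq_bigr => i _.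
    by rewrite /= cabs_sqr !mxE.
  move/eqP; rewrite psumr_eq0 => [/allP /(_ j (mem_index_enum j))|i _]; last exact: sqr_ge0.
  by rewrite /= expf_eq0 /= => /eqP /cabs_eq0.
have fA : row_free A by rewrite /row_free rA.
by apply: (row_free_inj fA); rewrite mul0mx.
Qed.

(** The conjugate transpose of A times the inverse of the Gram matrix; Cramer's formula reduces its
    regularity to that of the inverse of a determinant without zeros. *)
Lemma matrix_right_inverse m N (A : R -> 'M[C]_(m, N)) : (forall t, \rank (A t) = m) ->
  (forall l i, reg q (fun t => A t l i)) ->
  exists b : 'I_N -> 'I_m -> R -> C, (forall i j, reg q (b i j)) /\
    forall l j t, \sum_i A t l i * b i j t = (l == j)%:R.
Proof.
move=> rA hA; pose G t := A t *m (map_mx conjc (A t))^T.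
have hG i j : reg q (fun t => G t i j).
  under eq_fun do rewrite mxE; apply: (reg_sum q01) => l _.
  under eq_fun do rewrite !mxE; apply: (regM q01) => //; exact: (reg_conj q01).
have uG t : G t \in unitmx by exact: gram_unit.
have d0 t : \det (G t) != 0 by rewrite -unitfE -unitmxE.
pose B t := (map_mx conjc (A t))^T *m invmx (G t).
exists (fun i j t => B t i j); split=> [i j|l j t]; last first.
  have : (A t *m B t) l j = (1%:M : 'M[C]_m) l j by rewrite /B mulmxA -/(G t) mulmxV.
  by rewrite !mxE.
have E t : B t i j = \sum_l conjc (A t l i) * ((\det (G t))^-1 * (\adj (G t)) l j).
  by rewrite /B mxE; apply: eq_bigr => l _; rewrite !mxE /invmx uG !mxE.
rewrite (funext E); apply: (reg_sum q01) => l _; apply: (regM q01); first exact: (reg_conj q01).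
apply: (regM q01); last exact: reg_adj.
by apply: reg_invC => //; exact: reg_det.
Qed.

End Matrices.
End Beta.
End Inverse.

(** * Holomorphic functions on the disc *)

Section Goursat.
Context (R : realType).
Local Notation C := R[i].
Implicit Types (H : C -> C) (a b r s t : R).

(** The trapezoidal rule for the integral of H along the chord from u to v. *)
Definition edge H (u v : C) : C := 2%:R^-1 * (H u + H v) * (v - u).

Definition node a b n (k : nat) : R := a + (b - a) * (k%:R / (2 ^ n)%:R).

Definition psum H (g : R -> C) a b n : C :=
  \sum_(k < 2 ^ n) edge H (g (node a b n k)) (g (node a b n k.+1)).

Definition mid a b : R := (a + b) / 2.

Lemma psum_split H g a b n :
  psum H g a b n.+1 = psum H g a (mid a b) n + psum H g (mid a b) b n.
Proof.
have nn : (2 ^ n)%:R != 0 :> R by rewrite pnatr_eq0 expn_eq0.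
have e1 k : node a b n.+1 k = node a (mid a b) n k.
  by rewrite /node /mid expnS natrM; field.
have e2 k : node a b n.+1 (2 ^ n + k) = node (mid a b) b n k.
  by rewrite /node /mid expnS natrM natrD; field.
rewrite /psum -!(big_mkord xpredT (fun k => edge H (g (node _ _ _ k)) (g (node _ _ _ k.+1)))).
rewrite (@big_cat_nat _ _ _ (2 ^ n)) //=; last by rewrite leq_exp2l.
congr (_ + _); first by apply: eq_bigr => k _; rewrite !e1.
have e3 : (2 ^ n.+1 - 2 ^ n = 2 ^ n)%N by rewrite expnS mul2n -addnn addnK.
rewrite -{1}[(2 ^ n)%N]add0n big_addn e3.
by apply: eq_bigr => k _; rewrite addnC e2 -addnS e2.
Qed.

Lemma node0 a b n : node a b n 0 = a.
Proof. by rewrite /node mul0r mulr0 addr0. Qed.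

Lemma node_last a b n : node a b n (2 ^ n) = b.
Proof. by rewrite /node divff ?pnatr_eq0 ?expn_eq0 // mulr1 addrC subrK. Qed.

Lemma node_itv a b n k : a <= b -> (k <= 2 ^ n)%N -> a <= node a b n k <= b.
Proof.
move=> ab kn; have n0 : 0 < (2 ^ n)%:R :> R by rewrite ltr0n expn_gt0.
have h0 : 0 <= k%:R / (2 ^ n)%:R :> R by rewrite divr_ge0.
have h1 : k%:R / (2 ^ n)%:R <= 1 :> R by rewrite ler_pdivrMr // mul1r ler_nat.
by rewrite /node; apply/andP; split; nra.
Qed.

Lemma node_step a b n k : node a b n k.+1 - node a b n k = (b - a) / (2 ^ n)%:R.
Proof. by rewrite /node -(natr1 k); ring. Qed.

Lemma psum_affine (al be : C) H g a b n : (forall z, H z = al + be * z) ->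
  psum H g a b n = (al * g b + 2%:R^-1 * be * g b ^+ 2) - (al * g a + 2%:R^-1 * be * g a ^+ 2).
Proof.
move=> HE; pose Phi k := al * g (node a b n k) + 2%:R^-1 * be * g (node a b n k) ^+ 2.
transitivity (Phi (2 ^ n)%N - Phi 0%N); last by rewrite /Phi node0 node_last.
rewrite -(telescope_sumr _ (leq0n _)) big_mkord; apply: eq_bigr => k _.
by rewrite /edge !HE /Phi; field.
Qed.

Lemma psumB H K g a b n : psum (fun z => H z - K z) g a b n = psum H g a b n - psum K g a b n.
Proof. by rewrite /psum -sumrB; apply: eq_bigr => k _; rewrite /edge; ring. Qed.

Lemma psum_bound H g a b n (E L : R) : a <= b -> 0 <= E ->
  (forall s, a <= s <= b -> cabs (H (g s)) <= E) ->
  (forall s t, cabs (g s - g t) <= L * `|s - t|) ->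
  cabs (psum H g a b n) <= E * (L * (b - a)).
Proof.
move=> ab E0 HE gL; have n0 : 0 < (2 ^ n)%:R :> R by rewrite ltr0n expn_gt0.
have L0 : 0 <= L by have := le_trans (cabs_ge0 _) (gL 1 0); rewrite subr0 normr1 mulr1.
rewrite (le_trans (cabs_sum _ _ _)) //.
apply: (@le_trans _ _ (\sum_(k < 2 ^ n) E * (L * ((b - a) / (2 ^ n)%:R)))); last first.
  rewrite sumr_const card_ord -mulr_natr le_eqVlt; apply/orP; left; apply/eqP.
  by field; rewrite gt_eqF.
apply: ler_sum => k _; rewrite /edge cabsM; apply: ler_pM; rewrite ?cabs_ge0 //.
  have k1 := HE _ (node_itv ab (ltnW (ltn_ord k))).
  have k2 := HE _ (node_itv ab (ltn_ord k)).
  rewrite cabsM cabsV cabs_nat ler_pdivrMl // (le_trans (cabsD _ _)) //; lra.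
rewrite (le_trans (gL _ _)) // node_step ger0_norm //.
by rewrite divr_ge0 ?subr_ge0 // ltW.
Qed.

Definition polar r t : C := r%:C * ei t.

Lemma ei_lipschitz s t : cabs (ei s - ei t) <= 2 * `|s - t|.
Proof.
have c1 : `|cos s - cos t| <= 1 * `|s - t|.
  apply: (lipschitz_of_derive (f' := fun x => - sin x)) => x.
  by rewrite normrN ler_norml sin_geN1 sin_le1.
have c2 : `|sin s - sin t| <= 1 * `|s - t|.
  apply: (lipschitz_of_derive (f' := cos)) => x.
  by rewrite ler_norml cos_geN1 cos_le1.
by rewrite (le_trans (cabs_le_ReIm _)) // /ei /=; lra.
Qed.

Lemma polar_arc r s t : cabs (polar r s - polar r t) <= 2 * `|r| * `|s - t|.
Proof.
rewrite /polar -mulrBr cabsM cabs_real mulrAC mulrC ler_wpM2r //.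
exact: ei_lipschitz.
Qed.

Lemma polar_ray t r s : cabs (polar r t - polar s t) <= 1 * `|r - s|.
Proof. by rewrite /polar -mulrBl cabsM cabs_ei mulr1 -rmorphB cabs_real mul1r. Qed.

(** The discrete contour integral around a polar rectangle, with radii from a to b and angles from c
    to d. *)
Definition cont H (a b c d : R) n : C :=
  psum H (polar^~ c) a b n + psum H (polar b) c d n
  - psum H (polar^~ d) a b n - psum H (polar a) c d n.

Lemma cont_split H a b c d n : cont H a b c d n.+1 =
  cont H a (mid a b) c (mid c d) n + cont H (mid a b) b c (mid c d) n +
  (cont H a (mid a b) (mid c d) d n + cont H (mid a b) b (mid c d) d n).
Proof. by rewrite /cont !psum_split; ring. Qed.

Lemma cont_affine (al be : C) H a b c d n : (forall z, H z = al + be * z) ->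
  cont H a b c d n = 0.
Proof. by move=> HE; rewrite /cont !(psum_affine _ _ _ _ HE); ring. Qed.

(** Formulated without a limit, since the trapezoidal sums are not known to converge. *)
Definition bad H (x : R * R * (R * R)) (eta : R) := forall n0, exists n, (n0 <= n)%N /\
  eta < cabs (cont H x.1.1 x.1.2 x.2.1 x.2.2 n).

Lemma not_bad H x eta : ~ bad H x eta -> exists n0, forall n, (n0 <= n)%N ->
  cabs (cont H x.1.1 x.1.2 x.2.1 x.2.2 n) <= eta.
Proof.
move=> /existsNP[n0 h]; exists n0 => n nn; rewrite leNgt; apply/negP => lt.
by apply: h; exists n.
Qed.

Definition half (b : bool) (x : R * R) : R * R := if b then (x.1, mid x.1 x.2) else (mid x.1 x.2, x.2).

(** Level n + 1 on a rectangle is the sum of level n on its quarters, so if all four were eventually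
    at most eta / 4 the whole would be eventually at most eta. *)
Lemma bad_quarter H x eta : bad H x eta ->
  exists b b' : bool, bad H (half b x.1, half b' x.2) (eta / 4).
Proof.
move=> hb; apply: contrapT => /forallNP h.
have q (b b' : bool) : exists n0, forall n, (n0 <= n)%N ->
    cabs (cont H (half b x.1).1 (half b x.1).2 (half b' x.2).1 (half b' x.2).2 n) <= eta / 4.
  by apply: (@not_bad H (half b x.1, half b' x.2)) => hbb; apply: (h b); exists b'.
have [n1 h1] := q true true; have [n2 h2] := q false true.
have [n3 h3] := q true false; have [n4 h4] := q false false.
have [n [nn]] := hb (n1 + n2 + n3 + n4).+1.
case: n nn => // n nn; rewrite cont_split ltNge => /negP; apply.
have {}h1 := h1 n ltac:(lia); have {}h2 := h2 n ltac:(lia).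
have {}h3 := h3 n ltac:(lia); have {}h4 := h4 n ltac:(lia).
move: h1 h2 h3 h4; rewrite /half /=.
set u1 := cont _ _ _ _ _ n; set u2 := cont _ _ _ _ _ n; set u3 := cont _ _ _ _ _ n.
set u4 := cont _ _ _ _ _ n.
have := cabsD (u1 + u2) (u3 + u4); have := cabsD u1 u2; have := cabsD u3 u4; lra.
Qed.

Lemma nested_limit (x : nat -> R * R) (D : R) : 0 <= D ->
  (forall j, (x j).1 <= (x j).2) -> (forall j, exists b : bool, x j.+1 = half b (x j)) ->
  (x 0%N).2 - (x 0%N).1 = D ->
  (forall j, (x j).2 - (x j).1 = D * 2^-1 ^+ j) /\
  exists l, forall j, (x j).1 <= l <= (x j).2.
Proof.
move=> D0 xle xh x0.
have w j : (x j).2 - (x j).1 = D * 2^-1 ^+ j.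
  elim: j => [|j IH]; first by rewrite expr0 mulr1.
  have [b ->] := xh j; rewrite exprS mulrCA -IH.
  by case: b; rewrite /half /mid /=; lra.
split=> //.
have mono j i : (x j).1 <= (x (j + i)%N).1 /\ (x (j + i)%N).2 <= (x j).2.
  elim: i => [|i [h1 h2]]; first by rewrite addn0.
  rewrite addnS; have [b ->] := xh (j + i)%N; have := xle (j + i)%N.
  by case: b; rewrite /half /mid /=; split; lra.
have le12 i j : (x i).1 <= (x j).2.
  have [h1 _] := mono i j; have [_ h2] := mono j i.
  by rewrite (le_trans h1) // (le_trans (xle _)) // addnC.
pose S := [set (x i).1 | i in [set: nat]].
have supS : has_sup S.
  by split; [exists (x 0%N).1; exists 0%N|exists (x 0%N).2 => _ [i _ <-]].
exists (sup S) => j; apply/andP; split.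
  by apply: sup_upper_bound => //; exists j.
by apply: ge_sup; [exists (x 0%N).1; exists 0%N|move=> _ [i _ <-]].
Qed.

Definition cdiff H (z l : C) := forall e : R, 0 < e -> exists2 d : R, 0 < d &
  forall w, cabs (w - z) < d -> cabs (H w - H z - (w - z) * l) <= e * cabs (w - z).

(* Goursat's lemma for trapezoidal sums: they are additive under subdivision
   and vanish exactly on affine functions at every finite level. *)
Lemma goursat H a b : 0 < a -> a <= b ->
  (forall r t, a <= r <= b -> exists l, cdiff H (polar r t) l) ->
  forall eta : R, 0 < eta -> exists n0, forall n, (n0 <= n)%N ->
    cabs (cont H a b 0 (pi *+ 2) n) <= eta.
Proof.
move=> a0 ab dH eta eta0; have P := twopi_gt0 R.
apply: (@not_bad H ((a, b), (0, pi *+ 2)) eta) => hbad.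
have step (y : R * R * (R * R) * nat) : exists z : R * R * (R * R),
    (exists c c' : bool, z = (half c y.1.1, half c' y.1.2)) /\
    (bad H y.1 (eta / 4 ^+ y.2) -> bad H z (eta / 4 ^+ y.2.+1)).
  have [hb|hb] := pselect (bad H y.1 (eta / 4 ^+ y.2)).
    have [c [c' h]] := bad_quarter hb; exists (half c y.1.1, half c' y.1.2).
    split; first by exists c, c'.
    by move=> _; rewrite exprSr invfM mulrA.
  by exists (half true y.1.1, half true y.1.2); split=> //; exists true, true.
have [nxt hnxt] := choice step.
have [x [x0 xS xbad]] : exists x : nat -> R * R * (R * R),
  [/\ x 0%N = ((a, b), (0, pi *+ 2)),
      forall j, exists c c' : bool, x j.+1 = (half c (x j).1, half c' (x j).2) &
      forall j, bad H (x j) (eta / 4 ^+ j)].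
  pose x := fix x j := if j is i.+1 then nxt (x i, i) else ((a, b), (0, pi *+ 2)).
  exists x; split=> // j; first by have [[c [c' h]] _] := hnxt (x j, j); exists c, c'.
  elim: j => [|j IH]; first by rewrite expr0 divr1.
  by have [_ h] := hnxt (x j, j); exact: h.
have xle j : (x j).1.1 <= (x j).1.2 /\ (x j).2.1 <= (x j).2.2.
  elim: j => [|j [h1 h2]]; first by rewrite x0; split => //=; exact: ltW.
  by have [c [c' ->]] := xS j; case: c; case: c'; rewrite /half /mid /=; split; lra.
(* A common bound for the diameter of the initial region and the lengths of its sides; after j
   subdivisions both have been multiplied by 2^-j. *)
pose D := (b - a) + 2 * b * (pi *+ 2) + 1.
have [w1 [r hr]] : (forall j, (x j).1.2 - (x j).1.1 = (b - a) * 2^-1 ^+ j) /\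
    exists l, forall j, (x j).1.1 <= l <= (x j).1.2.
  apply: (@nested_limit (fun j => (x j).1)); rewrite ?x0 ?subr_ge0 //.
    by move=> j; have [] := xle j.
  by move=> j; have [c [c' ->]] := xS j; exists c.
have [w2 [t ht]] : (forall j, (x j).2.2 - (x j).2.1 = (pi *+ 2) * 2^-1 ^+ j) /\
    exists l, forall j, (x j).2.1 <= l <= (x j).2.2.
  apply: (@nested_limit (fun j => (x j).2)); rewrite ?x0 /= ?subr0 ?(ltW P) //.
    by move=> j; have [] := xle j.
  by move=> j; have [c [c' ->]] := xS j; exists c'.
have b0 : 0 < b by lra.
have sub j : a <= (x j).1.1 /\ (x j).1.2 <= b.
  elim: j => [|j [h1 h2]]; first by rewrite x0.
  by have [c [c' ->]] := xS j; have [h3 _] := xle j; case: c; rewrite /half /mid /=; split; lra.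
have D0 : 0 < D by rewrite /D; have : 0 <= 2 * b * (pi *+ 2); [rewrite !mulr_ge0 // ltW|lra].
have hr0 : a <= r <= b by have := hr 0%N; rewrite x0.
have [l hl] := dH r t hr0.
(* Each of the four sides will contribute at most e (D h)^2 with h = 2^-j, and eta / 4^j = 8 e (D
   h)^2, twice their total. *)
pose e := eta / (8 * D ^+ 2).
have e0 : 0 < e by rewrite divr_gt0 // mulr_gt0 // exprn_gt0.
have [d d0 hd] := hl e e0.
have h2 : 0 <= (2^-1 : R) < 1 by apply/andP; split; lra.
have d20 : 0 < d / 2 by rewrite divr_gt0.
have [j Hj] := geo_small D h2 d20.
have Hj' : D * 2^-1 ^+ j < d by lra.
set h := 2^-1 ^+ j in Hj Hj'; have hpos : 0 < h by rewrite exprn_gt0 // invr_gt0.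
pose z0 := polar r t.
pose psi z := H z - (H z0 - z0 * l + l * z).
have near s s' : (x j).1.1 <= s <= (x j).1.2 -> (x j).2.1 <= s' <= (x j).2.2 ->
    cabs (psi (polar s s')) <= e * (D * h).
  move=> hs hs'.
  have dist : cabs (polar s s' - z0) <= D * h.
    apply: (le_trans (cabs_tri (polar r s') _ _)).
    have := polar_ray s' s r; have := polar_arc r s' t.
    have rb : `|r| <= b.
      by case/andP: hr0 => r1 r2; rewrite ger0_norm; lra.
    have l1 : `|s - r| <= (b - a) * h.
      rewrite -w1 ler_norml; have := hr j => /andP[? ?]; case/andP: hs => ? ?.
      by apply/andP; split; lra.
    have l2 : `|s' - t| <= (pi *+ 2) * h.
      rewrite -w2 ler_norml; have := ht j => /andP[? ?]; case/andP: hs' => ? ?.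
      by apply/andP; split; lra.
    have : 2 * `|r| * `|s' - t| <= 2 * b * ((pi *+ 2) * h).
      by rewrite ler_pM // ?mulr_ge0 // ler_wpM2l.
    rewrite -/z0 /D; set T1 := cabs _; set T2 := cabs _; nra.
  have -> : psi (polar s s') = H (polar s s') - H z0 - (polar s s' - z0) * l.
    by rewrite /psi; ring.
  rewrite (le_trans (hd _ _)) ?ler_wpM2l ?(ltW e0) //.
  exact: le_lt_trans dist Hj'.
have contE n : cont H (x j).1.1 (x j).1.2 (x j).2.1 (x j).2.2 n =
    cont psi (x j).1.1 (x j).1.2 (x j).2.1 (x j).2.2 n.
  have A := @cont_affine (H z0 - z0 * l) l (fun z => H z0 - z0 * l + l * z)
    (x j).1.1 (x j).1.2 (x j).2.1 (x j).2.2 n (fun z => erefl).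
  by rewrite -[LHS]subr0 -A /cont /psi !psumB; ring.
have [x1 x2] := xle j; have [s1 s2] := sub j.
have eDh : 0 <= e * (D * h) by apply: mulr_ge0; [exact: ltW|apply: mulr_ge0; exact: ltW].
have sideR s : (x j).2.1 <= s <= (x j).2.2 -> forall n,
    cabs (psum psi (polar^~ s) (x j).1.1 (x j).1.2 n) <= e * (D * h) * (D * h).
  move=> hs n; have := @psum_bound psi (polar^~ s) _ _ n _ 1 x1 eDh (fun s' h' => near s' s h' hs) (polar_ray s).
  move=> /le_trans; apply; rewrite ler_wpM2l // mul1r w1 ler_wpM2r ?(ltW hpos) //.
  by rewrite /D; have : 0 <= 2 * b * (pi *+ 2); [rewrite !mulr_ge0 // ltW|lra].
have sideA s : (x j).1.1 <= s <= (x j).1.2 -> forall n,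
    cabs (psum psi (polar s) (x j).2.1 (x j).2.2 n) <= e * (D * h) * (D * h).
  move=> hs n.
  have := @psum_bound psi (polar s) _ _ n _ _ x2 eDh (fun s' h' => near s s' hs h') (polar_arc s).
  move=> /le_trans; apply; rewrite ler_wpM2l // w2 mulrA ler_wpM2r ?(ltW hpos) //.
  have : `|s| <= b by case/andP: hs => ? ?; rewrite ger0_norm; lra.
  move=> sb; have : 2 * `|s| * (pi *+ 2) <= 2 * b * (pi *+ 2).
    by rewrite ler_wpM2r ?(ltW P) // ler_wpM2l.
  by rewrite /D; lra.
have [n [_]] := xbad j 0%N; rewrite ltNge => /negP; apply; rewrite contE /cont.
have i1 : (x j).1.1 <= (x j).1.1 <= (x j).1.2 by rewrite lexx.
have i2 : (x j).1.1 <= (x j).1.2 <= (x j).1.2 by rewrite lexx andbT.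
have i3 : (x j).2.1 <= (x j).2.1 <= (x j).2.2 by rewrite lexx.
have i4 : (x j).2.1 <= (x j).2.2 <= (x j).2.2 by rewrite lexx andbT.
have := sideR _ i3 n; have := sideR _ i4 n; have := sideA _ i1 n; have := sideA _ i2 n.
set u1 := psum _ (polar^~ (x j).2.1) _ _ _; set u2 := psum _ (polar (x j).1.2) _ _ _.
set u3 := psum _ (polar^~ (x j).2.2) _ _ _; set u4 := psum _ (polar (x j).1.1) _ _ _.
move=> b2 b4 b3 b1.
have := cabsB (u1 + u2 - u3) u4; have := cabsB (u1 + u2) u3; have := cabsD u1 u2.
have -> : eta / 4 ^+ j = 8 * (e * (D * h) * (D * h)).
  have -> : 4 ^- j = h * h :> R by rewrite /h -exprMn -exprVn; congr (_ ^+ _); field.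
  by rewrite /e; field; exact: lt0r_neq0.
have : 0 <= e * (D * h) * (D * h) by apply: mulr_ge0 => //; apply: mulr_ge0; exact: ltW.
lra.
Qed.

End Goursat.

(** * The mean value property *)

Section MeanValue.
Context (R : realType).
Local Notation C := R[i].
Implicit Types (F G : C -> C) (z w l : C) (e d r s t : R).

Lemma cdiff_cst (c z : C) : cdiff (fun=> c) z 0.
Proof.
by move=> e e0; exists 1 => // w _; rewrite mulr0 subrr subr0 cabs0 mulr_ge0 ?cabs_ge0 // ltW.
Qed.

Lemma cdiff_id z : cdiff id z 1.
Proof.
by move=> e e0; exists 1 => // w _; rewrite mulr1 subrr cabs0 mulr_ge0 ?cabs_ge0 // ltW.
Qed.

Lemma cdiff_lip F z l : cdiff F z l -> exists2 d, 0 < d &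
  forall w, cabs (w - z) < d -> cabs (F w - F z) <= (cabs l + 1) * cabs (w - z).
Proof.
move=> h; have [d d0 hd] := h 1 ltr01; exists d => // w wz.
have -> : F w - F z = (F w - F z - (w - z) * l) + (w - z) * l by ring.
by rewrite (le_trans (cabsD _ _)) // (cabsM (w - z)); have := hd _ wz; lra.
Qed.

Lemma cdiffD F G z l l' : cdiff F z l -> cdiff G z l' -> cdiff (fun z => F z + G z) z (l + l').
Proof.
move=> hF hG e e0; have e2 : 0 < e / 2 by rewrite divr_gt0.
have [d d0 hd] := hF _ e2; have [d' d0' hd'] := hG _ e2.
exists (Num.min d d') => [|w]; first by rewrite lt_min d0.
rewrite lt_min => /andP[/hd h1 /hd' h2].
have -> : F w + G w - (F z + G z) - (w - z) * (l + l') =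
  (F w - F z - (w - z) * l) + (G w - G z - (w - z) * l') by ring.
by rewrite (le_trans (cabsD _ _)) //; lra.
Qed.

Lemma cdiffM F G z l l' : cdiff F z l -> cdiff G z l' ->
  cdiff (fun z => F z * G z) z (l * G z + F z * l').
Proof.
move=> hF hG e e0.
have [d1 d10 h1] := cdiff_lip hF; have [d2 d20 h2] := cdiff_lip hG.
pose K := cabs (F z) + cabs (G z) + (cabs l + 1) * (cabs l' + 1).
have gl := cabs_ge0 l; have gl' := cabs_ge0 l'; have gF := cabs_ge0 (F z); have gG := cabs_ge0 (G z).
have ll : 0 < (cabs l + 1) * (cabs l' + 1) by apply: mulr_gt0; lra.
have K0 : 0 < K by rewrite /K; lra.
pose e' := e / (3 * K).
have e'0 : 0 < e' by rewrite divr_gt0 // mulr_gt0.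
have e'K : e' * K = e / 3 by rewrite /e'; field; exact: lt0r_neq0.
have [d3 d30 h3] := hF _ e'0; have [d4 d40 h4] := hG _ e'0.
pose d := Num.min (Num.min d1 d2) (Num.min (Num.min d3 d4) e').
exists d => [|w]; first by rewrite !lt_min d10 d20 d30 d40.
rewrite !lt_min => /andP[/andP[/h1 {}h1 /h2 {}h2] /andP[/andP[/h3 {}h3 /h4 {}h4] we]].
have -> : F w * G w - F z * G z - (w - z) * (l * G z + F z * l') =
  (F w - F z - (w - z) * l) * G z + F z * (G w - G z - (w - z) * l') +
  (F w - F z) * (G w - G z) by ring.
set v := cabs (w - z) in h1 h2 h3 h4 we *; have v0 : 0 <= v := cabs_ge0 _.
have b1 : cabs ((F w - F z - (w - z) * l) * G z) <= e' * v * cabs (G z).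
  by rewrite cabsM ler_wpM2r.
have b2 : cabs (F z * (G w - G z - (w - z) * l')) <= e' * v * cabs (F z).
  by rewrite cabsM mulrC ler_wpM2r.
have b3 : cabs ((F w - F z) * (G w - G z)) <= e' * v * ((cabs l + 1) * (cabs l' + 1)).
  rewrite cabsM; apply: (@le_trans _ _ ((cabs l + 1) * v * ((cabs l' + 1) * v))).
    by rewrite ler_pM ?cabs_ge0.
  rewrite [leLHS](_ : _ = v * v * ((cabs l + 1) * (cabs l' + 1))); last by ring.
  by rewrite ler_wpM2r ?(ltW ll) // ler_wpM2r // ltW.
rewrite (le_trans (cabsD _ _)) //; apply: le_trans (lerD (le_trans (cabsD _ _) (lerD b1 b2)) b3) _.
rewrite [leLHS](_ : _ = e' * K * v); last by rewrite /K; ring.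
by rewrite e'K ler_wpM2r //; lra.
Qed.

Lemma cdiff_inv z : z != 0 -> cdiff (fun z => z^-1) z (- z ^- 2).
Proof.
move=> z0 e e0; have cz : 0 < cabs z.
  by rewrite lt_neqAle cabs_ge0 andbT eq_sym; apply: contra_neq z0; exact: cabs_eq0.
pose d := Num.min (cabs z / 2) (e * cabs z ^+ 3 / 2).
exists d => [|w]; first by rewrite lt_min !divr_gt0 // mulr_gt0 // exprn_gt0.
rewrite lt_min => /andP[w1 w2].
have cw : cabs z / 2 < cabs w.
  by have := cabs_tri w z 0; rewrite !subr0 cabsC; lra.
have cw0 : 0 < cabs w by lra.
have w0 : w != 0 by apply: contraTneq cw0 => ->; rewrite cabs0 ltxx.
have -> : w^-1 - z^-1 - (w - z) * - z ^- 2 = (w - z) ^+ 2 / (w * z ^+ 2).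
  by field; rewrite ?w0 ?z0.
rewrite cabsM cabsX cabsV (cabsM w) cabsX ler_pdivrMr; last by rewrite mulr_gt0 ?exprn_gt0.
have v0 := cabs_ge0 (w - z).
rewrite expr2 mulrAC ler_wpM2r // (le_trans (ltW w2)) //.
rewrite (_ : e * cabs z ^+ 3 / 2 = e * (cabs z / 2 * cabs z ^+ 2)); last by field.
by rewrite ler_pM2l // ler_wpM2r ?exprn_ge0 ?(ltW cz) // ltW.
Qed.

Lemma cdiff_comp F G z l l' : cdiff G z l -> cdiff F (G z) l' -> cdiff (F \o G) z (l * l').
Proof.
move=> hG hF e e0; have [d1 d10 h1] := cdiff_lip hG.
have gl := cabs_ge0 l; have gl' := cabs_ge0 l'.
pose e1 := e / (2 * (cabs l + 1)); have e10 : 0 < e1 by rewrite divr_gt0 // mulr_gt0 //; lra.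
pose e2 := e / (2 * (cabs l' + 1)); have e20 : 0 < e2 by rewrite divr_gt0 // mulr_gt0 //; lra.
have [d2 d20 h2] := hF _ e10; have [d3 d30 h3] := hG _ e20.
pose d := Num.min (Num.min d1 d3) (d2 / (cabs l + 1)).
have l1 : 0 < cabs l + 1 by lra.
exists d => [|w]; first by rewrite !lt_min d10 d30 divr_gt0.
rewrite !lt_min => /andP[/andP[/h1 {}h1 /h3 {}h3] wd].
have gd : cabs (G w - G z) < d2.
  by apply: le_lt_trans h1 _; rewrite mulrC -ltr_pdivlMr.
have {}h2 := h2 _ gd.
have -> : (F \o G) w - (F \o G) z - (w - z) * (l * l') =
  (F (G w) - F (G z) - (G w - G z) * l') + (G w - G z - (w - z) * l) * l' by rewrite /=; ring.
set v := cabs (w - z) in h1 h3 wd *; have v0 : 0 <= v := cabs_ge0 _.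
have b1 : e1 * cabs (G w - G z) <= e / 2 * v.
  apply: (@le_trans _ _ (e1 * ((cabs l + 1) * v))); first by rewrite ler_wpM2l // ltW.
  by rewrite mulrA /e1 le_eqVlt; apply/orP; left; apply/eqP; field; rewrite gt_eqF.
have b2 : cabs ((G w - G z - (w - z) * l) * l') <= e / 2 * v.
  rewrite cabsM; apply: (@le_trans _ _ (e2 * v * (cabs l' + 1))).
    by rewrite ler_pM ?cabs_ge0 //; lra.
  by rewrite /e2 le_eqVlt; apply/orP; left; apply/eqP; field; rewrite gt_eqF //; lra.
rewrite (le_trans (cabsD _ _)) //; lra.
Qed.

Definition disc_continuous F := forall z, cabs z <= 1 -> forall e, 0 < e ->
  exists2 d, 0 < d & forall w, cabs w <= 1 -> cabs (w - z) < d -> cabs (F w - F z) <= e.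

Definition disc_hol F :=
  disc_continuous F /\ (forall z, cabs z < 1 -> exists l, cdiff F z l).

(** Continuity is only known point by point on the closed disc; compactness of the interval of
    angles makes the radial limit uniform. *)
Lemma radial_uniform F e : disc_continuous F -> 0 < e -> exists2 d, 0 < d &
  forall s t, 0 <= s <= 1 -> 1 - d < s -> 0 <= t <= pi *+ 2 ->
    cabs (F (polar s t) - F (ei t)) <= e.
Proof.
move=> hF e0.
have := @segment_compact R 0 (pi *+ 2); move/compact_near_coveringP.
move=> /(_ R (nbhs (1 : R)) (fun s t => 0 <= s <= 1 -> cabs (F (polar s t) - F (ei t)) <= e) _).
case=> [x _|d /= d0 hd].
  have ex : cabs (ei x : C) <= 1 by rewrite cabs_ei.
  have [|d d0 hd] := hF (ei x) ex (e / 2); first by rewrite divr_gt0.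
  exists (ball x (d / 4), ball (1 : R) (d / 4)).
    by split; apply: nbhsx_ballx; rewrite divr_gt0.
  move=> [t s] /= [ht hs] s01.
  rewrite /ball /= in ht hs.
  have h1 : cabs (ei t - ei x) < d / 2.
    by apply: le_lt_trans (ei_lipschitz _ _) _; rewrite distrC; lra.
  have h2 : cabs (polar s t - ei x) < d.
    apply: le_lt_trans (cabs_tri (ei t) _ _) _.
    have := polar_ray t s 1; rewrite mul1r {2}/polar mul1r => h3.
    by rewrite (le_lt_trans (lerD h3 (lexx _))) // distrC; lra.
  have sle : cabs (polar s t) <= 1.
    by rewrite /polar cabsM cabs_ei mulr1 cabs_real ger0_norm; case/andP: s01.
  have h4 := hd _ sle h2; have h5 := hd (ei t) _ _.
  rewrite (le_trans (cabs_tri (F (ei x)) _ _)) //.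
  rewrite (cabsC (F (ei x))); have {}h5 : cabs (F (ei t) - F (ei x)) <= e / 2.
    by apply: h5; [rewrite cabs_ei|lra].
  lra.
exists d => // s t s01 sd ht; apply: (hd s); rewrite //=.
by rewrite /ball /= ger0_norm; case/andP: s01; lra.
Qed.

(** The discrete form of dz / z = i dt. The nodes are successive multiples by a root of unity om, so
    each edge is a combination of F at its two ends with constant coefficients, and cyclic summation
    leaves (om - conj om) / 2. *)
Lemma psum_arc F r n : 0 < r ->
  psum (fun z => F z / z) (polar r) 0 (pi *+ 2) n =
  'i%C * (sin (pi *+ 2 / (2 ^ n)%:R) * (2 ^ n)%:R)%:C * avg (2 ^ n) (fun t => F (polar r t)).
Proof.
move=> r0; have nn : (2 ^ n)%:R != 0 :> R by rewrite pnatr_eq0 expn_eq0.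
have rn : r%:C != 0 :> C by rewrite fmorph_eq0 gt_eqF.
pose om := ei (pi *+ 2 / (2 ^ n)%:R) : C.
pose z k := polar r (node 0 (pi *+ 2) n k).
have zn k : z k != 0 by rewrite /z /polar mulf_neq0 // ei_neq0.
have zS k : z k.+1 = om * z k.
  rewrite /z /polar mulrCA -eiD; congr (_ * ei _).
  by have := node_step 0 (pi *+ 2 : R) n k; rewrite subr0 => <-; rewrite subrK.
have on : om != 0 by exact: ei_neq0.
have zlast : z (2 ^ n)%N = z 0%N.
  by rewrite /z node_last node0 /polar ei2pi ei0.
have shift : \sum_(k < 2 ^ n) F (z k.+1) = \sum_(k < 2 ^ n) F (z k).
  apply/eqP; rewrite -subr_eq0 -sumrB.
  rewrite -(big_mkord xpredT (fun k => F (z k.+1) - F (z k))).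
  by rewrite (telescope_sumr (fun k => F (z k))) // zlast subrr.
have term k : edge (fun z => F z / z) (z k) (z k.+1) =
    2%:R^-1 * ((om - 1) * F (z k) + (1 - om^-1) * F (z k.+1)).
  by rewrite /edge zS; field; rewrite on zn.
rewrite [LHS](_ : _ = \sum_(k < 2 ^ n) 2%:R^-1 * ((om - 1) * F (z k) + (1 - om^-1) * F (z k.+1))).
  2: by apply: eq_bigr => k _; exact: term.
rewrite -mulr_sumr big_split /= -!mulr_sumr shift.
rewrite /avg; have -> : \sum_(s < 2 ^ n) F (polar r (s%:R * (pi *+ 2) / (2 ^ n)%:R)) =
    \sum_(k < 2 ^ n) F (z k).
  by apply: eq_bigr => k _; rewrite /z /node add0r subr0 mulrCA mulrA.
have -> : om^-1 = conjc om by rewrite -eiN eiNV.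
have -> : 2%:R^-1 * ((om - 1) * \sum_(k < 2 ^ n) F (z k) + (1 - conjc om) * \sum_(k < 2 ^ n) F (z k))
  = (2%:R^-1 * (om - conjc om)) * \sum_(k < 2 ^ n) F (z k) by ring.
have -> : 2%:R^-1 * (om - conjc om) = 'i%C * (sin (pi *+ 2 / (2 ^ n)%:R))%:C.
  apply: (mulfI (_ : 2%:R != 0 :> C)) => //; rewrite mulrA mulfV // mul1r.
  by rewrite /om /ei; apply/eqP; rewrite eq_complex /= mulr2n; apply/andP; split; apply/eqP; ring.
rewrite rmorphM rmorph_nat; field.
by rewrite pnatr_eq0 expn_eq0.
Qed.

(** [goursat] applied to F(z) / z on an annulus cut along a ray, whose two radial sides cancel. *)
Lemma avg_circles F r s e : 0 < r -> r <= s -> s < 1 -> disc_hol F -> 0 < e ->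
  exists n0, forall n, (n0 <= n)%N ->
  cabs (avg (2 ^ n) (fun t => F (polar s t)) - avg (2 ^ n) (fun t => F (polar r t))) <= e.
Proof.
move=> r0 rs s1 [_ dF] e0; have s0 : 0 < s by lra.
have dH q t : r <= q <= s -> exists l, cdiff (fun z => F z / z) (polar q t) l.
  move=> /andP[rq qs]; have q0 : 0 < q by lra.
  have zn : polar q t != 0 by rewrite /polar mulf_neq0 ?ei_neq0 // fmorph_eq0 gt_eqF.
  have [|l hl] := dF (polar q t); first by rewrite /polar cabsM cabs_ei mulr1 cabs_real ger0_norm; lra.
  by eexists; apply: cdiffM hl _; exact: cdiff_inv.
have [n0 h] := goursat r0 rs dH e0.
exists (n0 + 2)%N => n nn; have {}h := h n ltac:(lia).
have N0 : 0 < (2 ^ n)%:R :> R by rewrite ltr0n expn_gt0.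
have N4 : 4 <= (2 ^ n)%:R :> R by rewrite (ler_nat _ 4) (@leq_pexp2l 2 2) //; lia.
have pp := pi_ge2 R; have p0 := pi_gt0 R.
pose u : R := sin (pi *+ 2 / (2 ^ n)%:R) * (2 ^ n)%:R.
(* With N >= 4 the angle 2 pi / N lies in the range of [sin_ge_quarter], which gives u >= pi / 2. *)
have u1 : 1 <= u.
  have sn : pi *+ 2 / (2 ^ n)%:R / 4 <= sin (pi *+ 2 / (2 ^ n)%:R) :> R.
    apply: sin_ge_quarter; rewrite divr_ge0 ?(ltW N0) ?(ltW (twopi_gt0 R)) //=.
    by rewrite ler_pdivrMr // mulr2n; nra.
  apply: (@le_trans _ _ (pi *+ 2 / (2 ^ n)%:R / 4 * (2 ^ n)%:R)).
    by rewrite mulrAC divfK ?gt_eqF // mulr2n; lra.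
  by rewrite /u ler_wpM2r // ltW.
move: h; have -> : cont (fun z => F z / z) r s 0 (pi *+ 2) n = 'i%C * u%:C *
  (avg (2 ^ n) (fun t => F (polar s t)) - avg (2 ^ n) (fun t => F (polar r t))).
  rewrite /cont !psum_arc // -/u.
  rewrite (_ : (fun q : R => polar q (pi *+ 2)) = (fun q : R => polar q 0)); last first.
    by apply/funext => q; rewrite /polar ei2pi ei0.
  by ring.
rewrite cabsM; apply: le_trans; rewrite ler_peMl ?cabs_ge0 //.
have -> : cabs ('i%C * u%:C) = u.
  rewrite cabsM cabs_real ger0_norm; last by lra.
  by rewrite /cabs /= expr0n /= add0r expr1n sqrtr1 mul1r.
by [].
Qed.

Lemma mean_value F : disc_hol F -> is_clim (fun n => avg (2 ^ n) (fun t => F (ei t))) (F 0).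
Proof.
move=> hF e e0; have e3 : 0 < e / 3 by rewrite divr_gt0.
have [d d0 hd] := radial_uniform hF.1 e3.
have [|d' d0' hd'] := hF.1 0 _ _ e3; first by rewrite cabs0.
pose s := 1 - Num.min d 2^-1 / 2; pose r := Num.min d' 2^-1 / 2.
have m1 : 0 < Num.min d 2^-1 <= 2^-1 by rewrite lt_min d0 ge_min lexx orbT andbT /=; lra.
have m2 : 0 < Num.min d' 2^-1 <= 2^-1 by rewrite lt_min d0' ge_min lexx orbT andbT /=; lra.
have m3 : Num.min d 2^-1 <= d by rewrite ge_min lexx.
have m4 : Num.min d' 2^-1 <= d' by rewrite ge_min lexx.
have [n0 hn] : exists n0, forall n, (n0 <= n)%N ->
  cabs (avg (2 ^ n) (fun t => F (polar s t)) - avg (2 ^ n) (fun t => F (polar r t))) <= e / 3.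
  by apply: avg_circles => //; rewrite /r /s; case/andP: m1; case/andP: m2; lra.
exists n0 => n nn; have {}hn := hn n nn.
have N0 : (0 < 2 ^ n)%N by rewrite expn_gt0.
have N0' : 0 < (2 ^ n)%:R :> R by rewrite ltr0n.
have h1 : cabs (avg (2 ^ n) (fun t => F (ei t)) - avg (2 ^ n) (fun t => F (polar s t))) <= e / 3.
  rewrite /avg -mulrBr -sumrB cabsM cabsV cabs_nat ler_pdivrMl // (le_trans (cabs_sum _ _ _)) //.
  rewrite (le_trans (ler_sum (G := fun=> e / 3) _ _)) //; last by rewrite sumr_const card_ord -[leLHS]mulr_natl.
  move=> k _; rewrite cabsC; apply: hd.
  - by rewrite /s; case/andP: m1 => ? ?; apply/andP; split; lra.
  - by rewrite /s; case/andP: m1 => ? ?; lra.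
  - have P := twopi_gt0 R; rewrite !mulr_ge0 ?(ltW P) ?invr_ge0 ?(ltW N0') //=.
    by rewrite ler_pdivrMr // mulrC ler_wpM2l ?(ltW P) // ler_nat ltnW.
have h2 : cabs (avg (2 ^ n) (fun t => F (polar r t)) - F 0) <= e / 3.
  rewrite -(avg_cst (F 0) N0) /avg -mulrBr -sumrB cabsM cabsV cabs_nat ler_pdivrMl // (le_trans (cabs_sum _ _ _)) //.
  rewrite (le_trans (ler_sum (G := fun=> e / 3) _ _)) //; last by rewrite sumr_const card_ord -[leLHS]mulr_natl.
  move=> k _; have cr : cabs (polar r (k%:R * (pi *+ 2) / (2 ^ n)%:R)) = r.
    by rewrite /polar cabsM cabs_ei mulr1 cabs_real ger0_norm // /r; case/andP: m2; lra.
  by apply: hd'; rewrite ?subr0 cr /r; case/andP: m2; lra.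
apply: le_trans (cabs_tri (avg (2 ^ n) (fun t => F (polar s t))) _ _) _.
have := cabs_tri (avg (2 ^ n) (fun t => F (polar r t))) (avg (2 ^ n) (fun t => F (polar s t))) (F 0).
lra.
Qed.

End MeanValue.

(** * Maximum principle and extension from the circle to the disc *)

Section DiscFunctions.
Context (R : realType).
Local Notation C := R[i].
Implicit Types (F G : C -> C) (x z w l : C) (e d r s t : R).

Lemma is_clim_cst l : is_clim (fun=> l) l.
Proof. by move=> e e0; exists 0%N => j _; rewrite subrr cabs0 ltW. Qed.

Lemma cdiff_near F z l e : cdiff F z l -> 0 < e ->
  exists2 d, 0 < d & forall w, cabs (w - z) < d -> cabs (F w - F z) <= e.
Proof.
move=> /cdiff_lip[d d0 h] e0; have l1 : 0 < cabs l + 1 by have := cabs_ge0 l; lra.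
exists (Num.min d (e / (cabs l + 1))) => [|w]; first by rewrite lt_min d0 divr_gt0.
rewrite lt_min => /andP[/h h1 h2]; rewrite (le_trans h1) //.
by rewrite mulrC -ler_pdivlMr // ltW.
Qed.

Lemma disc_hol_cdiff F : (forall z, cabs z <= 1 -> exists l, cdiff F z l) -> disc_hol F.
Proof.
move=> h; split=> [z /h[l hl] e e0|z /ltW/h //].
by have [d d0 hd] := cdiff_near hl e0; exists d => // w _; exact: hd.
Qed.

Lemma disc_hol_cst (c : C) : disc_hol (fun=> c).
Proof. by apply: disc_hol_cdiff => z _; exists 0; exact: cdiff_cst. Qed.

Lemma disc_hol_id : disc_hol (@id C).
Proof. by apply: disc_hol_cdiff => z _; exists 1; exact: cdiff_id. Qed.

Lemma disc_holD F G : disc_hol F -> disc_hol G -> disc_hol (fun z => F z + G z).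
Proof.
move=> [cF dF] [cG dG]; split=> [z z1 e e0|z z1].
  have e2 : 0 < e / 2 by rewrite divr_gt0.
  have [d d0 h] := cF _ z1 _ e2; have [d' d0' h'] := cG _ z1 _ e2.
  exists (Num.min d d') => [|w w1]; first by rewrite lt_min d0.
  rewrite lt_min => /andP[/(h _ w1) h1 /(h' _ w1) h2].
  rewrite (_ : _ - _ = (F w - F z) + (G w - G z)); last by ring.
  by rewrite (le_trans (cabsD _ _)) //; lra.
have [l hl] := dF _ z1; have [l' hl'] := dG _ z1.
by eexists; exact: cdiffD hl hl'.
Qed.

Lemma disc_holM F G : disc_hol F -> disc_hol G -> disc_hol (fun z => F z * G z).
Proof.
move=> [cF dF] [cG dG]; split=> [z z1 e e0|z z1]; last first.
  have [l hl] := dF _ z1; have [l' hl'] := dG _ z1.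
  by eexists; exact: cdiffM hl hl'.
pose K := cabs (F z) + cabs (G z) + 1.
have gF := cabs_ge0 (F z); have gG := cabs_ge0 (G z).
have K0 : 0 < K by rewrite /K; lra.
pose e' := Num.min 1 (e / K).
have e'0 : 0 < e' by rewrite lt_min ltr01 divr_gt0.
have e'1 : e' <= 1 by rewrite ge_min lexx.
have e'K : e' * K <= e by rewrite -ler_pdivlMr // ge_min lexx orbT.
have [d d0 h] := cF _ z1 _ e'0; have [d' d0' h'] := cG _ z1 _ e'0.
exists (Num.min d d') => [|w w1]; first by rewrite lt_min d0.
rewrite lt_min => /andP[/(h _ w1) h1 /(h' _ w1) h2].
rewrite (_ : _ - _ = (F w - F z) * G z + F z * (G w - G z) + (F w - F z) * (G w - G z)); last by ring.
rewrite (le_trans (cabsD _ _)) //; apply: le_trans (lerD (cabsD _ _) (lexx _)) _.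
rewrite !cabsM; set u := cabs (F w - F z) in h1 *; set v := cabs (G w - G z) in h2 *.
have u0 : 0 <= u := cabs_ge0 _; have v0 : 0 <= v := cabs_ge0 _.
by rewrite /K in e'K; nra.
Qed.

Lemma disc_hol_sum (I : Type) (r : seq I) (P : pred I) (F : I -> C -> C) :
  (forall i, P i -> disc_hol (F i)) -> disc_hol (fun z => \sum_(i <- r | P i) F i z).
Proof.
move=> h; elim: r => [|i r IH].
  by under eq_fun do rewrite big_nil; exact: disc_hol_cst.
under eq_fun do rewrite big_cons.
by case Pi : (P i) => //; apply: disc_holD => //; exact: h.
Qed.

Lemma disc_holZ (c : C) F : disc_hol F -> disc_hol (fun z => c * F z).
Proof. by apply: disc_holM; exact: disc_hol_cst. Qed.

Lemma disc_holX n : disc_hol (fun z : C => z ^+ n).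
Proof.
elim: n => [|n IH]; first exact: disc_hol_cst.
by under eq_fun do rewrite exprS; apply: disc_holM => //; exact: disc_hol_id.
Qed.

Lemma disc_hol_poly (p : {poly C}) : disc_hol (fun z => p.[z]).
Proof.
under eq_fun do rewrite horner_coef.
by apply: disc_hol_sum => i _; apply: disc_holZ; exact: disc_holX.
Qed.

Definition moebius x z : C := (z + x) / (1 + conjc x * z).

Lemma moebius_den x z : cabs x < 1 -> cabs z <= 1 -> 1 + conjc x * z != 0.
Proof.
move=> x1 z1; apply/negP => /eqP h.
have : cabs (conjc x * z) < 1.
  rewrite cabsM cabs_conj; have := cabs_ge0 x; have := cabs_ge0 z; nra.
have -> : conjc x * z = - 1 by rewrite -[RHS]addr0 -h addKr.
by rewrite cabsN cabs1 ltxx.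
Qed.

Lemma moebius_cabs x z : cabs x < 1 -> cabs z <= 1 ->
  1 - cabs (moebius x z) ^+ 2 =
  (1 - cabs x ^+ 2) * (1 - cabs z ^+ 2) / cabs (1 + conjc x * z) ^+ 2.
Proof.
move=> x1 z1; have d := moebius_den x1 z1.
have cd : cabs (1 + conjc x * z) != 0 by apply: contra_neq d; exact: cabs_eq0.
rewrite /moebius cabsM cabsV expr_div_n; apply: (mulIf (_ : cabs (1 + conjc x * z) ^+ 2 != 0)).
  by rewrite expf_neq0.
rewrite mulrBl mul1r !divfK ?expf_neq0 //.
have rM (a b : R) : (a * b)%:C = a%:C * b%:C by rewrite rmorphM.
have rB (a b : R) : (a - b)%:C = a%:C - b%:C by rewrite rmorphB.
apply: complexI; rewrite [RHS]rM !rB !cabs_sqr.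
case: x {x1 d cd} => a b; case: z {z1} => c d.
by apply/eqP; rewrite eq_complex /=; apply/andP; split; apply/eqP; ring.
Qed.

Lemma cdiff_moebius x z : cabs x < 1 -> cabs z <= 1 -> exists l, cdiff (moebius x) z l.
Proof.
move=> x1 z1; eexists; apply: cdiffM; first by apply: cdiffD; [exact: cdiff_id|exact: cdiff_cst].
apply: (@cdiff_comp _ (fun z => z^-1) (fun z => 1 + conjc x * z)); last first.
  by apply: cdiff_inv; exact: moebius_den.
by apply: cdiffD; [exact: cdiff_cst|apply: cdiffM; [exact: cdiff_cst|exact: cdiff_id]].
Qed.

Lemma moebius_le x z : cabs x < 1 -> cabs z <= 1 -> cabs (moebius x z) <= 1.
Proof.
move=> x1 z1; rewrite -(@ler_pXn2r _ 2) ?nnegrE ?cabs_ge0 // expr1n -subr_ge0.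
rewrite moebius_cabs // divr_ge0 ?sqr_ge0 // mulr_ge0 // subr_ge0 exprn_ile1 ?cabs_ge0 //.
exact: ltW.
Qed.

Lemma moebius_lt x z : cabs x < 1 -> cabs z < 1 -> cabs (moebius x z) < 1.
Proof.
move=> x1 z1; rewrite -(@ltr_pXn2r _ 2) ?nnegrE ?cabs_ge0 // expr1n -subr_gt0.
have d := moebius_den x1 (ltW z1).
have cd : 0 < cabs (1 + conjc x * z).
  by rewrite lt_neqAle cabs_ge0 andbT eq_sym; apply: contra_neq d; exact: cabs_eq0.
rewrite moebius_cabs ?ltW // divr_gt0 ?exprn_gt0 // mulr_gt0 // subr_gt0 exprn_ilt1 ?cabs_ge0 //.
Qed.

Lemma moebius_circle x z : cabs x < 1 -> cabs z = 1 -> cabs (moebius x z) = 1.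
Proof.
move=> x1 z1; have h : 1 - cabs (moebius x z) ^+ 2 = 0.
  by rewrite moebius_cabs ?z1 // expr1n subrr mulr0 mul0r.
apply/eqP; rewrite -(@eqrXn2 _ 2) ?cabs_ge0 // expr1n eq_sym -subr_eq0; exact/eqP.
Qed.

Lemma disc_hol_moebius F x : cabs x < 1 -> disc_hol F -> disc_hol (F \o moebius x).
Proof.
move=> x1 [cF dF]; split=> [z z1 e e0|z z1].
  have [d d0 h] := cF _ (moebius_le x1 z1) _ e0.
  have [l hl] := cdiff_moebius x1 z1; have d2 : 0 < d / 2 by rewrite divr_gt0.
  have [d' d0' h'] := cdiff_near hl d2; exists d' => // w w1 /h' ww.
  by apply: h; [exact: moebius_le|apply: le_lt_trans ww _; lra].
have [l hl] := cdiff_moebius x1 (ltW z1); have [l' hl'] := dF _ (moebius_lt x1 z1).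
by eexists; exact: cdiff_comp hl hl'.
Qed.

(** The mean value property at 0 transported by the disc automorphism that sends 0 to x, which
    spares the Poisson kernel. *)
Lemma circle_mean F x : cabs x < 1 -> disc_hol F ->
  is_clim (fun n => avg (2 ^ n) (fun t => F (moebius x (ei t)))) (F x).
Proof.
move=> x1 hF; have := mean_value (disc_hol_moebius x1 hF).
by rewrite /= /moebius mulr0 addr0 divr1 add0r.
Qed.

Lemma max_principle F x (M : R) : cabs x <= 1 -> disc_hol F ->
  (forall z, cabs z = 1 -> cabs (F z) <= M) -> cabs (F x) <= M.
Proof.
move=> x1 hF hM; have [x1'|] := ltP (cabs x) 1; last by move=> x2; apply: hM; apply/eqP; rewrite eq_le x1.
apply: is_clim_bound (circle_mean x1' hF) _ => j.
apply: avg_bound => [|t]; first by rewrite expn_gt0.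
by apply: hM; apply: moebius_circle => //; exact: cabs_ei.
Qed.

Lemma disc_hol_unique F G : disc_hol F -> disc_hol G ->
  (forall z, cabs z = 1 -> F z = G z) -> forall x, cabs x <= 1 -> F x = G x.
Proof.
move=> hF hG FG x x1; apply/eqP; rewrite -subr_eq0; apply/eqP; apply: cabs_eq0.
apply/eqP; rewrite eq_le cabs_ge0 andbT -[F x - G x]/((fun z => F z - G z) x).
apply: max_principle => //.
  under eq_fun do rewrite -[- G _]mulN1r.
  by apply: disc_holD => //; exact: disc_holZ.
by move=> z z1 /=; rewrite FG // subrr cabs0.
Qed.

Lemma Re_circle0 F x : cabs x < 1 -> disc_hol F ->
  (forall z, cabs z = 1 -> complex.Re (F z) = 0) -> complex.Re (F x) = 0.
Proof.
move=> x1 hF h0; have cm := circle_mean x1 hF.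
have := is_climD cm (is_clim_conj cm).
have z n : avg (2 ^ n) (fun t => F (moebius x (ei t))) +
    conjc (avg (2 ^ n) (fun t => F (moebius x (ei t)))) = 0.
  rewrite -avg_conj -avgD -(avg_cst 0 (_ : (0 < 2 ^ n)%N)) ?expn_gt0 //.
  apply: eq_avg => t; have /eqP := h0 _ (moebius_circle x1 (cabs_ei t)).
  by case: (F _) => a b /= /eqP ->; rewrite /= ; apply/eqP; rewrite eq_complex /= addr0 subrr eqxx.
under eq_fun do rewrite z; move=> /(is_clim_unique (is_clim_cst 0)).
by case: (F x) => a b /= /eqP; rewrite eq_complex /= => /andP[/eqP h _]; lra.
Qed.

(** The mean value property of z^n F; the factor 0^n is 1 for n = 0 and 0 otherwise. *)
Lemma coef_disc_hol F n : disc_hol F -> tlim (fun t : R => F (ei t)) ->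
  coef (fun t => F (ei t)) (- n%:Z) = 0 ^+ n * F 0.
Proof.
move=> hF tF; apply: is_clim_unique (coef_is_clim _ tF) _.
have := mean_value (disc_holM (disc_holX n) hF).
have -> // : (fun j => avg (2 ^ j) (fun t : R => ei t ^+ n * F (ei t))) =
  (fun j => avg (2 ^ j) (fun t => F (ei t) * ek (- (- n%:Z)) t)).
by apply/funext => j; apply: eq_avg => t; rewrite opprK ek_nat mulrC.
Qed.

Lemma ei_surj z : cabs z = 1 -> exists t, z = ei t.
Proof.
case: z => a b z1; have ab : a ^+ 2 + b ^+ 2 = 1.
  have := cabs_sqr (a +i* b); rewrite z1 expr1n => /(congr1 (@complex.Re R)) /=; lra.
have a1 : -1 <= a <= 1 by apply/andP; split; nra.
have sa : sin (acos a) = `|b|.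
  by rewrite sin_acos // -(sqrtr_sqr b); congr (Num.sqrt _); lra.
have ca : cos (acos a) = a by apply: acosK; rewrite in_itv.
have [b0|b0] := leP 0 b; [exists (acos a)|exists (- acos a)].
  by rewrite /ei ca sa ger0_norm.
by rewrite /ei cosN sinN ca sa ltr0_norm // opprK.
Qed.

Lemma poly_taylor2 (p : {poly C}) x : exists s r : {poly C}, forall w,
  p.[w] = p.[x] + (w - x) * s.[w] /\ s.[w] = s.[x] + (w - x) * r.[w].
Proof.
have T (q : {poly C}) : exists s : {poly C}, forall w, q.[w] = q.[x] + (w - x) * s.[w].
  have : root (q - q.[x]%:P) x by rewrite rootE !hornerE subrr.
  move=> /factor_theorem[s hs]; exists s => w.
  have := congr1 (horner^~ w) hs; rewrite !hornerE => /eqP; rewrite subr_eq => /eqP ->.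
  by rewrite addrC mulrC.
by have [s hs] := T p; have [r hr] := T s; exists s, r.
Qed.

(** The maximum principle bounds both divided differences on the circle, where |z - x| >= 1 - |x|.
    This does the work of Cauchy's estimates: first and second order remainders at x are controlled
    by the size of p on the circle alone. *)
Lemma poly_remainder_bound (p s r : {poly C}) x (S : R) : cabs x < 1 ->
  (forall w, p.[w] = p.[x] + (w - x) * s.[w] /\ s.[w] = s.[x] + (w - x) * r.[w]) ->
  (forall w, cabs w = 1 -> cabs p.[w] <= S) ->
  cabs s.[x] <= 2 * S / (1 - cabs x) /\
  forall w, cabs w <= 1 -> cabs r.[w] <= 4 * S / (1 - cabs x) ^+ 2.
Proof.
move=> x1 hp pS; have r0 : 0 < 1 - cabs x by lra.
have dist w : cabs w = 1 -> 1 - cabs x <= cabs (w - x).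
  by move=> w1; have := cabs_tri x w 0; rewrite !subr0 w1; lra.
have sb w : cabs w <= 1 -> cabs s.[w] <= 2 * S / (1 - cabs x).
  move=> w1; apply: (max_principle w1 (disc_hol_poly s)) => z z1.
  have px : cabs p.[x] <= S by apply: (max_principle (ltW x1) (disc_hol_poly p)).
  have pz := pS _ z1; have [pe _] := hp z.
  have : cabs ((z - x) * s.[z]) <= 2 * S.
    by rewrite (_ : _ * _ = p.[z] - p.[x]) ?pe ?(le_trans (cabsB _ _)) ?pe //; [rewrite -pe; lra|ring].
  rewrite cabsM ler_pdivlMr // => h; rewrite mulrC; apply: le_trans h.
  by rewrite ler_wpM2r ?cabs_ge0 // dist.
split; first by apply: sb; exact: ltW.
move=> w w1; apply: (max_principle w1 (disc_hol_poly r)) => z z1.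
have [_ se] := hp z; have h1 := sb z ltac:(by rewrite z1); have h2 := sb x (ltW x1).
have : cabs ((z - x) * r.[z]) <= 4 * S / (1 - cabs x).
  rewrite (_ : _ * _ = s.[z] - s.[x]); last by rewrite se; ring.
  by rewrite (le_trans (cabsB _ _)) //; lra.
rewrite cabsM => h; rewrite expr2 invfM mulrA ler_pdivlMr // mulrC; apply: le_trans h.
by rewrite ler_wpM2r ?cabs_ge0 // dist.
Qed.

Lemma poly_disc_bounded (p : {poly C}) : exists2 M, 0 <= M & forall w, cabs w <= 1 -> cabs p.[w] <= M.
Proof.
exists (\sum_(i < size p) cabs p`_i) => [|w w1]; first by apply: sumr_ge0 => i _; exact: cabs_ge0.
rewrite horner_coef (le_trans (cabs_sum _ _ _)) //; apply: ler_sum => i _.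
by rewrite cabsM cabsX ler_piMr ?cabs_ge0 // exprn_ile1 ?cabs_ge0.
Qed.

(** Uniform convergence on the circle spreads to the closed disc by the maximum principle.
    Differentiability of the limit comes from convergence of the divided differences at x with a
    quadratic remainder uniform in n. *)
Lemma disc_hol_extension (g : R -> C) : (forall e, 0 < e -> exists p : {poly C},
    forall t, cabs (g t - p.[ei t]) <= e) ->
  exists2 F, disc_hol F & forall t, F (ei t) = g t.
Proof.
move=> hg; pose ep n : R := 2^-1 ^+ n.
have h2 : 0 <= (2^-1 : R) < 1 by apply/andP; split; lra.
have ep0 n : 0 < ep n by rewrite exprn_gt0 // invr_gt0.
have ep_le n m : (n <= m)%N -> ep m <= ep n.
  by move=> nm; apply: ler_wiXn2l => //; lra.
have ep1 n : ep n <= 1 by have := ep_le 0%N n (leq0n n); rewrite {2}/ep expr0.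
have small e : 0 < e -> exists J, forall j, (J <= j)%N -> ep j <= e.
  move=> e0; have [J HJ] := geo_small 1 h2 e0; exists J => j /ep_le /le_trans; apply.
  by rewrite mul1r in HJ.
have [p hp] := choice (fun n => hg _ (ep0 n)).
have ppE n m w : (p n - p m).[w] = (p n).[w] - (p m).[w] by rewrite hornerD hornerN.
have pp n m w : cabs w <= 1 -> cabs ((p n - p m).[w]) <= ep n + ep m.
  move=> w1; apply: (max_principle w1 (disc_hol_poly (p n - p m))) => z z1.
  have [t ->] := ei_surj z1; rewrite ppE (le_trans (cabs_tri (g t) _ _)) //.
  by rewrite (cabsC _ (g t)) lerD.
pose F w := clim (fun n => (p n).[w]).
have Fl w : cabs w <= 1 -> is_clim (fun n => (p n).[w]) (F w).
  move=> w1; have [l hl] : exists l, is_clim (fun n => (p n).[w]) l.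
    apply: cauchy_clim => e e0; have [|J HJ] := small (e / 2); first by rewrite divr_gt0.
    exists J => i j /HJ h /HJ h'; have := pp i j w w1; rewrite ppE => /le_trans; apply.
    lra.
  by rewrite /F (climP hl).
have Fb n w : cabs w <= 1 -> cabs (F w - (p n).[w]) <= 2 * ep n.
  move=> w1; have h := is_climD (Fl _ w1) (is_clim_cst (- (p n).[w])).
  apply: (is_clim_bound_near h); exists n => m nm.
  by have := pp m n w w1; rewrite ppE => /le_trans; apply; have := ep_le _ _ nm; lra.
exists F; last first.
  move=> t; have t1 : cabs (ei t : C) <= 1 by rewrite cabs_ei.
  apply: is_clim_unique (Fl _ t1) _ => e e0; have [J HJ] := small _ e0.
  by exists J => j /HJ; apply: le_trans; rewrite cabsC.
split=> [z z1 e e0|x x1].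
  have [|J /(_ J (leqnn _)) HJ] := small (e / 8); first by rewrite divr_gt0.
  have [|d d0 hd] := (disc_hol_poly (p J)).1 z z1 (e / 2); first by rewrite divr_gt0.
  exists d => // w w1 /(hd _ w1) h; have h1 := Fb J _ w1; have h3 := Fb J _ z1.
  rewrite (le_trans (cabs_tri (p J).[w] _ _)) //.
  have := cabs_tri (p J).[z] (p J).[w] (F z); rewrite (cabsC (p J).[z] (F z)); lra.
have r0 : 0 < 1 - cabs x by lra.
have [s hs] := choice (fun n => poly_taylor2 (p n) x).
have [r hr] := choice hs.
have rem n m S : (forall w, cabs w = 1 -> cabs ((p n - p m).[w]) <= S) ->
    cabs ((s n).[x] - (s m).[x]) <= 2 * S / (1 - cabs x) /\
    forall w, cabs w <= 1 -> cabs ((r n).[w] - (r m).[w]) <= 4 * S / (1 - cabs x) ^+ 2.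
  move=> hS; have [|h1 h2'] := @poly_remainder_bound (p n - p m) (s n - s m) (r n - r m) x S x1 _ hS.
    move=> w; rewrite !(hornerD, hornerN); have [e1 e2] := hr n w; have [e3 e4] := hr m w.
    by split; [rewrite e1 e3; ring|rewrite e2 e4; ring].
  split=> [|w w1]; first by move: h1; rewrite hornerD hornerN.
  by have := h2' w w1; rewrite hornerD hornerN.
have [l hl] : exists l, is_clim (fun n => (s n).[x]) l.
  apply: cauchy_clim => e e0; have [|J HJ] := small (e * (1 - cabs x) / 4).
    by rewrite !(divr_gt0, mulr_gt0).
  exists J => i j /HJ h /HJ h'.
  have [|h1 _] := rem i j (ep i + ep j); first by move=> w w1; apply: pp; rewrite w1.
  by rewrite (le_trans h1) // ler_pdivrMr //; lra.
have [M M0 hM] := poly_disc_bounded (r 0%N).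
pose K := 4 * 2 / (1 - cabs x) ^+ 2 + M.
have K0 : 0 <= K by rewrite addr_ge0 // divr_ge0 ?exprn_ge0 ?(ltW r0).
have key w : cabs w <= 1 -> cabs (F w - F x - (w - x) * l) <= K * cabs (w - x) ^+ 2.
  (* All remainders are compared with that of [p 0], whose bound is M; the differences [p n - p 0]
     are at most 2 on the circle. *)
  move=> w1; have h := is_climD (is_climD (Fl _ w1) (is_climZ (-1) (Fl _ (ltW x1)))) (is_climZ (- (w - x)) hl).
  rewrite mulN1r mulNr in h; apply: (is_clim_bound h) => n.
  have [e1 e2] := hr n w.
  rewrite (_ : _ + _ = (r n).[w] * (w - x) ^+ 2); last by rewrite e1 e2; ring.
  rewrite cabsM cabsX ler_wpM2r ?exprn_ge0 ?cabs_ge0 //.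
  have [|_ /(_ w w1) h1] := rem n 0%N 2.
    move=> z z1; apply: le_trans (pp _ _ _ _) _; first by rewrite z1.
    by have := ep1 n; have := ep1 0%N; lra.
  have := cabsD ((r n).[w] - (r 0%N).[w]) (r 0%N).[w]; rewrite subrK => /le_trans; apply.
  by rewrite lerD // hM.
exists l => e e0; exists (Num.min (1 - cabs x) (e / (K + 1))).
  by rewrite lt_min r0 divr_gt0 //; lra.
move=> w; rewrite lt_min => /andP[w1 w2].
have w3 : cabs w <= 1 by have := cabs_tri x w 0; rewrite !subr0; lra.
rewrite (le_trans (key _ w3)) // expr2 mulrA ler_wpM2r ?cabs_ge0 //.
have := cabs_ge0 (w - x); move: w2; rewrite ltr_pdivlMr; last by lra.
nra.
Qed.

Lemma analytic_poly_approx (g : R -> C) e : tlim g -> (forall k, k < 0 -> coef g k = 0) ->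
  0 < e -> exists p : {poly C}, forall t, cabs (g t - p.[ei t]) <= e.
Proof.
move=> tg g0 e0.
have [N hN] := vp_cvg tg e0; have {}hN := hN N.+1 (ltnSn N).
pose v := vp N.+1 g; have tv : tp (N.+1).*2 v := tp_vp _ _.
exists (\poly_(a < (N.+1).*2.+1) coef v a%:Z) => t.
rewrite (_ : _.[_] = v t) //; transitivity (pos (N.+1).*2 v t).
  by rewrite horner_poly; apply: eq_bigr => a _; rewrite ek_nat.
apply: (tp_ext (tp_pos _ _) tv) => k; rewrite coef_pos.
case: (ltP k 0) => k0; first by rewrite mul0r (coef_vp_lt _ g0).
case: (leP k (N.+1).*2%:Z) => kN; first by rewrite mul1r.
by rewrite mul0r (tp_coef0 tv) //; lia.
Qed.

Lemma analytic_extension (g : R -> C) : tlim g -> (forall k, k < 0 -> coef g k = 0) ->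
  exists2 F, disc_hol F & forall t, F (ei t) = g t.
Proof. by move=> tg g0; apply: disc_hol_extension => e; exact: analytic_poly_approx. Qed.

End DiscFunctions.

(** * Holomorphic extensions of boundary maps *)

Section HolomorphicExtension.
Context (R : realType).
Local Notation C := R[i].
Implicit Types (F G : C -> C) (x z w : C).

Lemma pos_complex (e : C) : 0 < e -> exists2 d : R, 0 < d & e = d%:C.
Proof.
case: e => a b; rewrite ltcE /= => /andP[/eqP b0 a0]; exists a => //.
by apply/eqP; rewrite eq_complex /= eqxx b0 eqxx.
Qed.

Lemma derivable_cdiff F z : derivable (F : C^o -> C^o) (z : C^o) 1 <-> exists l, cdiff F z l.
Proof.
split=> [/derivableP h|[l hl]].
  exists ('D_1 (F : C^o -> C^o) z) => e e0.
  have ec : 0 < e%:C :> C by rewrite ltcR.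
  have [d0 /pos_complex[d dp ->] hd] := derive_eps h ec.
  exists d => // w wz; have := hd (w - z); rewrite cabs_lt subrK => /(_ wz).
  by rewrite !cabsE -rmorphM lecR.
suff : is_derive (z : C^o) 1 (F : C^o -> C^o) l by case.
apply: is_derive_eps => e /pos_complex[e' e'0 ->].
have [d d0 hd] := hl _ e'0; exists d%:C; first by rewrite ltcR.
move=> x; rewrite cabs_lt => xd; have := hd (x + z); rewrite addrK => /(_ xd).
by rewrite !cabsE -rmorphM lecR.
Qed.

Lemma within_disc_continuous F :
  {within [set z : C^o | `|z| <= 1], continuous (F : C^o -> C^o)} <-> disc_continuous F.
Proof.
have nrm z : (`|z| <= 1) = (cabs z <= 1) by rewrite (cabs_le z 1).
split=> [/subspace_continuousP h z z1 e e0|h].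
  have /h /cvgrPdist_le : [set z : C^o | `|z| <= 1] z by rewrite /= nrm.
  have ec : 0 < e%:C :> C by rewrite ltcR.
  move=> /(_ _ ec); rewrite near_withinE => /nbhs_ballP[d0 /= /pos_complex[d dp ->] hd].
  exists d => // w w1 wz; rewrite cabsC in wz; have := hd w; rewrite /ball /= cabs_lt nrm => /(_ wz w1).
  by rewrite cabs_le cabsC.
apply/subspace_continuousP => z /=; rewrite nrm => z1.
apply/cvgrPdist_le => e /pos_complex[e' e'0 ->]; have [d d0 hd] := h _ z1 _ e'0.
rewrite near_withinE; apply/nbhs_ballP; exists d%:C; first by rewrite /= ltcR.
move=> w; rewrite /ball /= cabs_lt cabsC => wz; rewrite nrm => w1.
by rewrite cabs_le cabsC; exact: hd.
Qed.

Lemma disc_holP F : ({within [set z : C^o | `|z| <= 1], continuous (F : C^o -> C^o)} /\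
  forall z : C^o, `|z| < 1 -> derivable (F : C^o -> C^o) z 1) <-> disc_hol F.
Proof.
split=> [[/within_disc_continuous h1 h2]|[h1 h2]]; split=> //.
- by move=> z z1; apply/derivable_cdiff/h2; rewrite (cabs_lt z 1).
- exact/within_disc_continuous.
- by move=> z; rewrite (cabs_lt z 1) => /h2 /derivable_cdiff.
Qed.

Lemma circleP (z : circle R) : exists t, z = expi t.
Proof.
case: z => z hz; have [t zt] : exists t, z = ei t.
  by apply: ei_surj; move/eqP: (hz); rewrite cabsE => /complexI.
by exists t; apply: val_inj.
Qed.

Lemma sval_expi (t : R) : sval (expi t) = ei t.
Proof. by []. Qed.

Section Maps.
Context (p q : nat).
Implicit Types (f g : circle R -> 'M[C]_(p, q)) (H : C -> 'M[C]_(p, q)).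

Lemma is_hol_extensionE f H : is_hol_extension f H <->
  (forall t, H (ei t) = f (expi t)) /\ forall i j, disc_hol (fun z => H z i j).
Proof.
split=> [[h1 h2 h3]|[h1 h2]].
  split=> [t|i j]; first by rewrite -h1.
  by apply/disc_holP; split; [exact: h2|exact: h3].
split=> [z|i j|i j].
- by have [t ->] := circleP z; rewrite -h1.
- by have /disc_holP[] := h2 i j.
- by have /disc_holP[] := h2 i j.
Qed.

Lemma hol_extension_unique f H H' x : cabs x <= 1 ->
  is_hol_extension f H -> is_hol_extension f H' -> H x = H' x.
Proof.
move=> x1 /is_hol_extensionE[h1 h2] /is_hol_extensionE[h3 h4].
apply/matrixP => i j; apply: (disc_hol_unique (h2 i j) (h4 i j)) => // z.
by move=> /ei_surj[t ->]; rewrite h1 h3.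
Qed.

Lemma hol_valueE f H x : cabs x <= 1 -> is_hol_extension f H -> hol_value f x = H x.
Proof.
move=> x1 h; rewrite /hol_value; case: xgetP => [H' _ h'|/(_ H) //].
exact: hol_extension_unique h' h.
Qed.

Lemma hol_value_extension f : extends_hol f ->
  exists2 H, is_hol_extension f H & forall x, cabs x <= 1 -> hol_value f x = H x.
Proof. by move=> [H hH]; exists H => // x x1; exact: hol_valueE. Qed.

(** With [coef_of_extends] this turns holomorphic extension into the vanishing of negative Fourier
    coefficients, the form used by the Fredholm part. *)
Lemma extends_of_coef f : (forall i j, tlim (fun t => f (expi t) i j)) ->
  (forall i j k, k < 0 -> coef (fun t => f (expi t) i j) k = 0) -> extends_hol f.
Proof.
move=> ft f0.
have : forall ij : 'I_p * 'I_q, exists F, disc_hol F /\ forall t, F (ei t) = f (expi t) ij.1 ij.2.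
  move=> [i j]; have [F h1 h2] := analytic_extension (ft i j) (f0 i j); exists F; split => //.
move=> /choice[F hF]; exists (fun z => \matrix_(i, j) F (i, j) z); apply/is_hol_extensionE; split.
  by move=> t; apply/matrixP => i j; rewrite mxE; have [_ ->] := hF (i, j).
by move=> i j; under eq_fun do rewrite mxE; have [] := hF (i, j).
Qed.

Lemma coef_of_extends f i j k : tlim (fun t => f (expi t) i j) -> extends_hol f ->
  k <= 0 -> coef (fun t => f (expi t) i j) k = (k == 0)%:R * hol_value f 0 i j.
Proof.
move=> ft /hol_value_extension[H hH ->]; last by rewrite cabs0.
have /is_hol_extensionE[h1 h2] := hH.
have fE : (fun t => f (expi t) i j) = (fun t => H (ei t) i j).
  by apply/funext => t; rewrite h1.
move=> k0; have [n ->] : exists n : nat, k = - n%:Z by exists `|k|%N; lia.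
rewrite fE in ft *; rewrite (@coef_disc_hol _ (fun z => H z i j) n (h2 i j) ft).
by case: n {k0} => [|n]; rewrite ?expr0 ?eqxx // expr0n.
Qed.

End Maps.

Lemma hol_extension_mul p q s (f : circle R -> 'M[C]_(p, q)) (g : circle R -> 'M[C]_(q, s)) H K :
  is_hol_extension f H -> is_hol_extension g K ->
  is_hol_extension (fun z : circle R => f z *m g z) (fun z => H z *m K z).
Proof.
move=> /is_hol_extensionE[h1 h2] /is_hol_extensionE[h3 h4].
apply/is_hol_extensionE; split=> [t|i j]; first by rewrite h1 h3.
under eq_fun do rewrite mxE.
by apply: disc_hol_sum => l _; exact: disc_holM.
Qed.

Lemma hol_extension_scale p q (F : C -> C) (f : circle R -> 'M[C]_(p, q)) H :
  disc_hol F -> is_hol_extension f H ->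
  is_hol_extension (fun z : circle R => F (sval z) *: f z) (fun z => F z *: H z).
Proof.
move=> hF /is_hol_extensionE[h1 h2].
apply/is_hol_extensionE; split=> [t|i j]; first by rewrite h1.
by under eq_fun do rewrite mxE; exact: disc_holM.
Qed.

Lemma hol_extensionD p q (f g : circle R -> 'M[C]_(p, q)) H K :
  is_hol_extension f H -> is_hol_extension g K ->
  is_hol_extension (fun z : circle R => f z + g z) (fun z => H z + K z).
Proof.
move=> /is_hol_extensionE[h1 h2] /is_hol_extensionE[h3 h4].
apply/is_hol_extensionE; split=> [t|i j]; first by rewrite h1 h3.
by under eq_fun do rewrite mxE; exact: disc_holD.
Qed.

Lemma hol_extension_cst p q (c : 'M[C]_(p, q)) : is_hol_extension (fun=> c) (fun=> c).
Proof. by apply/is_hol_extensionE; split=> // i j; exact: disc_hol_cst. Qed.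

End HolomorphicExtension.

(** * The class C^alpha on the circle *)

Section Regularity.
Context (R : realType) (k : nat) (beta : R) (b01 : 0 < beta < 1).
Local Notation C := R[i].
Let q := hrate beta k.
Let q01 : 0 < q < 1 := hrate01 b01 k.

Lemma Calpha_reg (f : circle R -> R) : Calpha k beta f <-> reg q (cpx (f \o @expi R)).
Proof.
split=> [h|]; last exact: (Ck_of_reg b01).
apply: (reg_of_Ck b01) => // t /=; congr f; apply: val_inj => /=.
by rewrite cosD2pi sinD2pi.
Qed.

Lemma reg_ReIm (g : R -> C) : reg q g <->
  reg q (fun t => (complex.Re (g t))%:C) /\ reg q (fun t => (complex.Im (g t))%:C).
Proof.
split=> [h|[h1 h2]]; last first.
  apply: (eq_reg _ (regD h1 (regZ 'i%C h2))) => t.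
  by case: (g t) => a b; apply/eqP; rewrite eq_complex /=; apply/andP; split; apply/eqP; ring.
split; first exact: (reg_reC q01 h).
apply: (eq_reg _ (reg_reC q01 (regZ (- 'i%C) h))) => t; rewrite /reC.
by case: (g t) => a b /=; congr (_%:C); ring.
Qed.

Lemma Calpha_cmx_reg p s (f : circle R -> 'M[C]_(p, s)) : Calpha_cmx k beta f <->
  forall i j, reg q (fun t => f (expi t) i j).
Proof.
split=> [[h1 h2] i j|h].
  apply/reg_ReIm; have /Calpha_reg := h1 i j; have /Calpha_reg := h2 i j.
  rewrite /cpx /ReM /ImM /= => e1 e2; split; [apply: (eq_reg _ e2)|apply: (eq_reg _ e1)];
    by move=> t; rewrite mxE.
by split=> i j; apply/Calpha_reg; have /reg_ReIm[h1 h2] := h i j;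
  [apply: (eq_reg _ h1)|apply: (eq_reg _ h2)] => t; rewrite /cpx /= /ReM /ImM mxE.
Qed.

Lemma Calpha_rmx_reg p s (f : circle R -> 'M[R]_(p, s)) : Calpha_rmx k beta f <->
  forall i j, reg q (fun t => (f (expi t) i j)%:C).
Proof.
by split=> h i j; have := Calpha_reg (fun z => f z i j) => -[h1 h2];
  [exact: h1 (h i j)|exact: h2 (h i j)].
Qed.

End Regularity.

(** * Boundary values and the description of W *)

Section CauchyMean.
Context (R : realType).
Local Notation C := R[i].
Implicit Types (F G : C -> C) (x : C) (e t s : R).

Lemma tlim_ei (h : R -> C) s t : tlim h -> ei s = ei t -> h s = h t.
Proof.
move=> th est; apply/eqP; rewrite -subr_eq0; apply/eqP/cabs_tiny => e e0.
have [n [T [[c hc] hT]]] := th (e / 2) ltac:(by rewrite divr_gt0).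
have eks k : ek k s = ek k t.
  case: (leP 0 k) => [|/ltW]; [case: k => // k _|].
    by rewrite !ek_nat est.
  rewrite -oppr_ge0; have -> : k = - - k by rewrite opprK.
  by rewrite opprK; case: (- k) => // j _; rewrite !ekN !ek_nat est.
have TT : T s = T t by rewrite !hc; apply: eq_isum => k _; rewrite eks.
have h1 := hT s; have h2 := hT t.
by rewrite (le_trans (cabs_tri (T s) _ _)) // {2}TT (cabsC (T t)); lra.
Qed.

(** An angle is chosen for every point; the choice is harmless because a uniform limit of
    trigonometric polynomials depends on e^(it) only. *)
Lemma lift_circle p q (h : 'I_p -> 'I_q -> R -> C) : (forall i j, tlim (h i j)) ->
  exists f : circle R -> 'M[C]_(p, q), forall t i j, f (expi t) i j = h i j t.
Proof.
move=> th; have [ang hang] := choice (@circleP R).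
exists (fun z => \matrix_(i, j) h i j (ang z)) => t i j; rewrite mxE.
by apply: tlim_ei => //; have := congr1 sval (hang (expi t)).
Qed.

Lemma ei_sub_neq0 x t : cabs x < 1 -> ei t - x != 0.
Proof.
move=> x1; apply: contraTneq x1 => /eqP; rewrite subr_eq0 => /eqP <-.
by rewrite cabs_ei ltxx.
Qed.

(** The conjugate of the kernel is the boundary value of 1 / (1 - conj(x) z), holomorphic with value
    1 at 0. *)
Lemma coef_cauchy_kernel x : cabs x < 1 -> tlim (fun t => ei t / (ei t - x)) ->
  coef (fun t => ei t / (ei t - x)) 0 = 1.
Proof.
move=> x1 tw; pose F z := (1 + conjc (- x) * z)^-1.
have x1' : cabs (- x) < 1 by rewrite cabsN.
have hF : disc_hol F.
  apply: disc_hol_cdiff => z z1; eexists.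
  apply: (@cdiff_comp _ (fun z => z^-1) (fun z => 1 + conjc (- x) * z)); last first.
    by apply: cdiff_inv; exact: moebius_den.
  by apply: cdiffD; [exact: cdiff_cst|apply: cdiffM; [exact: cdiff_cst|exact: cdiff_id]].
have wE t : conjc (ei t / (ei t - x)) = F (ei t).
  have e0 := ei_neq0 t; have := ei_sub_neq0 t x1.
  have cM (a b : C) : conjc (a * b) = conjc a * conjc b by exact: rmorphM.
  have cB (a b : C) : conjc (a - b) = conjc a - conjc b by exact: rmorphB.
  have cN (a : C) : conjc (- a) = - conjc a by exact: rmorphN.
  rewrite /F cM conjc_inv cB -eiN eiNV cN => d0.
  rewrite -invfM; congr (_^-1); rewrite mulrBr mulfV //; ring.
have := coef_conj 0 tw; rewrite (_ : (fun t => conjc _) = fun t => F (ei t)); last exact/funext.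
have tF : tlim (fun t => F (ei t)).
  by rewrite (_ : (fun t => F (ei t)) = fun t => conjc (ei t / (ei t - x))); [exact: tlim_conj|apply/funext].
rewrite -[0 in LHS]oppr0 (@coef_disc_hol _ F 0%N hF tF) expr0 mul1r oppr0.
rewrite /F mulr0 addr0 invr1 => h.
by rewrite -[LHS]conjcK -h conjc1.
Qed.

Lemma tlim_poly (p : {poly C}) : tlim (fun t => p.[ei t]).
Proof.
under eq_fun do rewrite horner_coef.
apply: tlim_sum => i _; apply: tlimZ.
by under eq_fun do rewrite -ek_nat; exact: tlim_ek.
Qed.

(** Cauchy's formula, first for polynomials: p = p(x) + (z - x) s reduces it to the mean of the
    kernel and to the mean of z s, which is 0. The general case follows by uniform approximation on
    the circle. *)
Lemma cauchy_mean x (h : R -> C) F : cabs x < 1 -> tlim (fun t => ei t / (ei t - x)) ->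
  tlim h -> (forall k, k < 0 -> coef h k = 0) -> disc_hol F -> (forall t, F (ei t) = h t) ->
  coef (fun t => ei t / (ei t - x) * h t) 0 = F x.
Proof.
move=> x1 tw th h0 hF Fh; pose w t := ei t / (ei t - x).
have [K hK] := tlim_bounded tw; have K0 : 0 <= K by have := le_trans (cabs_ge0 _) (hK 0).
apply/eqP; rewrite -subr_eq0; apply/eqP/cabs_tiny => e e0.
have eK : 0 < e / (K + 1) by rewrite divr_gt0 //; lra.
have [p hp] := analytic_poly_approx th h0 eK.
have [s [r hs]] := poly_taylor2 p x.
have tp_ : tlim (fun t => p.[ei t]) by exact: tlim_poly.
have we t : w t * (ei t - x) = ei t by rewrite /w divfK // ei_sub_neq0.
have c1 : coef (fun t => w t * p.[ei t]) 0 = p.[x].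
  rewrite (_ : (fun t => _) = fun t => p.[x] * w t + ei t * s.[ei t]); last first.
    by apply/funext => t; have [-> _] := hs (ei t); rewrite mulrDr mulrA we mulrC.
  have ts : tlim (fun t => ei t * s.[ei t]).
    by have := tlim_poly ('X * s); under eq_fun do rewrite hornerM hornerX.
  rewrite coefD //; last exact: tlimZ.
  rewrite coefZ // coef_cauchy_kernel // mulr1.
  have := @coef_disc_hol R (fun z => z * s.[z]) 0%N (disc_holM (disc_hol_id R) (disc_hol_poly s)) ts.
  by rewrite mul0r mulr0 oppr0 => ->; rewrite addr0.
have px : cabs (p.[x] - F x) <= e / (K + 1).
  have hpF : disc_hol (fun z => p.[z] + -1 * F z) by apply: disc_holD; [exact: disc_hol_poly|exact: disc_holZ].
  rewrite -[F x]mul1r -mulNr; apply: (max_principle (ltW x1) hpF) => z /ei_surj[t ->].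
  by rewrite Fh mulN1r cabsC.
have c2 : cabs (coef (fun t => w t * h t) 0 - p.[x]) <= K * (e / (K + 1)).
  rewrite -c1 -coefB; [|exact: tlimM|exact: tlimM].
  apply: coef_bound => [|t]; first by apply: tlimB; exact: tlimM.
  by rewrite -mulrBr cabsM; apply: ler_pM; rewrite ?cabs_ge0 ?hp //; exact: hK.
rewrite (le_trans (cabs_tri p.[x] _ _)) // (le_trans (lerD c2 px)) //.
have -> : K * (e / (K + 1)) + e / (K + 1) = e by field; rewrite gt_eqF //; lra.
by [].
Qed.
End CauchyMean.

(** * Description of W by orthogonality *)

Section BoundaryValues.
Context (R : realType) (m N k : nat) (beta : R) (b01 : 0 < beta < 1).
Context (A : circle R -> 'M[R[i]]_(m, N)).
Context (A_smooth : Calpha_cmx k beta A) (A_rank : forall z : circle R, \rank (A z) = m).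
Local Notation C := R[i].
Local Notation q := (hrate beta k).
Implicit Types (g : circle R -> 'cV[R]_m) (d : circle R -> 'cV[C]_m) (x : C) (c : 'cV[C]_N).

Let q01 : 0 < q < 1 := hrate01 b01 k.

Let regA l i : reg q (fun t => A (expi t) l i).
Proof. by have /(Calpha_cmx_reg k b01) := A_smooth; apply. Qed.

Definition rowA d (z : circle R) : 'rV[C]_N := (d z)^T *m A z.

Lemma rowAE d z i : rowA d z 0 i = \sum_l d z l 0 * A z l i.
Proof. by rewrite /rowA mxE; apply: eq_bigr => l _; rewrite mxE. Qed.

Lemma reg_rowA d i : (forall l, reg q (fun t => d (expi t) l 0)) ->
  reg q (fun t => rowA d (expi t) 0 i).
Proof.
move=> hd; under eq_fun do rewrite rowAE.
by apply: (reg_sum q01) => l _; exact: regM.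
Qed.

Lemma cauchy_kernel_reg x : cabs x < 1 -> reg q (fun t => (ei t - x)^-1).
Proof.
move=> x1; apply: (reg_invC b01) => [t|]; first exact: ei_sub_neq0.
apply: regB; last exact: (reg_tp q01 (tp_cst 0 x)).
by apply: (eq_reg _ (reg_tp q01 (@tp_ek R 1 1 (leqnn 1)))) => t; rewrite (ek_nat 1) expr1.
Qed.

Lemma reg_ei : reg q (fun t : R => ei t).
Proof. by apply: (eq_reg _ (reg_tp q01 (@tp_ek R 1 1 (leqnn 1)))) => t; rewrite (ek_nat 1) expr1. Qed.

Lemma reg_ei_sub x : reg q (fun t : R => ei t - x).
Proof. by apply: regB; [exact: reg_ei|exact: (reg_tp q01 (tp_cst 0 x))]. Qed.

Lemma W_orthogonal x w g : cabs x < 1 -> LA k beta A w -> EA k beta A g ->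
  complex.Re ((Psi A x (cplx g) *m hol_value w x) 0 0) = 0.
Proof.
move=> x1 [[_ /hol_value_extension[H hH HE]] w0] [_ /hol_value_extension[G hG GE]].
rewrite /Psi GE ?HE ?ltW //.
have /is_hol_extensionE[h1 h2] := hol_extension_mul hG hH.
apply: (Re_circle0 x1 (h2 0 0)) => z /ei_surj[t ->].
rewrite h1 -mulmxA mxE raddf_sum big1 // => l _.
have := congr1 (fun M : 'cV[R]_m => M l 0) (w0 (expi t)); rewrite [LHS]mxE [RHS]mxE.
move: ((A (expi t) *m w (expi t)) l 0) => s h.
rewrite /cplx 2!mxE; case: s h => a b /= ->.
by rewrite mulr0 mul0r subr0.
Qed.

Lemma EA_of_extension g H : (forall l, reg q (fun t => (g (expi t) l 0)%:C)) ->
  is_hol_extension (rowA (cplx g)) H -> EA k beta A g.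
Proof.
move=> rg hH; split; last by exists H.
by apply/(Calpha_rmx_reg k b01) => i j; rewrite (ord1 j).
Qed.

Lemma lift_real (h : 'I_m -> R -> C) : (forall l, reg q (h l)) -> realf h ->
  exists g, forall t l, (g (expi t) l 0)%:C = h l t.
Proof.
move=> rh realh.
have [f hf] := @lift_circle R m 1 (fun l _ => h l) (fun l _ => reg_tlim (rh l)).
exists (fun z => map_mx (@complex.Re R) (f z)) => t l; rewrite mxE hf.
by have := realh l t; case: (h l t) => a b [] h2; congr (_ +i* _); lra.
Qed.

Lemma kernel_multiplier x (psi : 'I_m -> R -> C) : cabs x < 1 ->
  RHker q (fun l i t => (ei t - x) * A (expi t) l i) psi ->
  exists g (H : 'I_N -> C -> C), [/\ EA k beta A g, forall i, disc_hol (H i),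
    Psi A x (cplx g) = (1 - cabs x ^+ 2)%:C *: \row_i H i x &
    forall i, coef (fun t => \sum_l psi l t * A (expi t) l i) 0 = H i x].
Proof.
move=> x1 [rpsi realpsi psi0].
pose u i t := \sum_l psi l t * A (expi t) l i.
have ru i : reg q (u i) by apply: (reg_sum q01) => l _; exact: regM.
pose y i t := ek (-1) t * ((ei t - x) * u i t).
have ry i : reg q (y i).
  apply: (regM q01); first exact: (reg_tp q01 (@tp_ek R 1 (-1) isT)).
  by apply: (regM q01) => //; exact: reg_ei_sub.
have y0 i j : j < 0 -> coef (y i) j = 0.
  move=> j0; rewrite /y coef_shift opprK -(psi0 i (j + 1)); last by lia.
  by congr coef; apply/funext => t; rewrite /u mulr_sumr; apply: eq_bigr => l _; rewrite mulrCA.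
have ext i : exists F, disc_hol F /\ forall t, F (ei t) = y i t.
  by have [F h1 h2] := analytic_extension (reg_tlim (ry i)) (y0 i); exists F.
have [H hH] := choice ext.
have eiN1 t : ei t * ek (-1) t = 1 :> C.
  by have := ekVM 1 t; rewrite (ek_nat 1) expr1.
have cei t : conjc (ei t - x) = ek (-1) t - conjc x :> C.
  have cB (a b : C) : conjc (a - b) = conjc a - conjc b by exact: rmorphB.
  by rewrite cB -eiN /ek mulN1r.
have [|l t|g hg] := @lift_real (fun l t => (ei t - x) * conjc (ei t - x) * psi l t).
- move=> l; apply: (regM q01) => //; apply: (regM q01); first exact: reg_ei_sub.
  by apply: (reg_conj q01); exact: reg_ei_sub.
- have h := realpsi l t; rewrite -cabs_sqr.
  have cM (a b : C) : conjc (a * b) = conjc a * conjc b by exact: rmorphM.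
  by rewrite cM h; congr (_ * _); apply/eqP; rewrite eq_complex /= oppr0 !eqxx.
have rowg t i : rowA (cplx g) (expi t) 0 i = (1 - conjc x * ei t) * y i t.
  rewrite rowAE /cplx (eq_bigr (fun l => (ei t - x) * conjc (ei t - x) * (psi l t * A (expi t) l i))).
    by rewrite -mulr_sumr -/(u i t) cei /y; have := eiN1 t; set z := ei t; set v := ek _ t => h; ring: h.
  by move=> l _; rewrite mxE hg mulrA.
have Hg : is_hol_extension (rowA (cplx g)) (fun z => (1 - conjc x * z) *: \row_i H i z).
  apply/is_hol_extensionE; split=> [t|i j].
    by apply/matrixP => i j; rewrite (ord1 i) rowg !mxE; have [_ ->] := hH j.
  under eq_fun do rewrite !mxE.
  apply: disc_holM; last by have [] := hH j.
  under eq_fun do rewrite -mulNr.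
  by apply: disc_holD; [exact: disc_hol_cst|apply: disc_holZ; exact: disc_hol_id].
exists g, H; split.
- apply: (EA_of_extension _ Hg) => l.
  apply: (eq_reg (fun t => esym (hg t l))); apply: (regM q01) => //; apply: (regM q01); first exact: reg_ei_sub.
  by apply: (reg_conj q01); exact: reg_ei_sub.
- by move=> i; have [] := hH i.
- rewrite /Psi (hol_valueE (ltW x1) Hg); congr (_ *: _).
  by rewrite rmorphB rmorph1 /= cabs_sqr mulrC.
- move=> i; have [h1 h2] := hH i.
  have tw : tlim (fun t => ei t / (ei t - x)).
    by apply: (@reg_tlim _ q); apply: (regM q01); [exact: reg_ei|exact: cauchy_kernel_reg].
  rewrite -(cauchy_mean x1 tw (reg_tlim (ry i)) (y0 i) h1 h2); congr coef; apply/funext => t.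
  rewrite -/(u i t) /y; have n0 := ei_sub_neq0 t x1.
  rewrite mulrA [_ / _ * _]mulrAC eiN1 mul1r mulrA mulVf // mul1r //.
Qed.

Lemma W_full x c : cabs x < 1 ->
  (forall g, EA k beta A g -> complex.Re ((Psi A x (cplx g) *m c) 0 0) = 0) ->
  Wset k beta A x c.
Proof.
move=> x1 hc.
have [b [rb Ab]] : exists b : 'I_N -> 'I_m -> R -> C, (forall i j, reg q (b i j)) /\
    forall l j t, \sum_i A (expi t) l i * b i j t = (l == j)%:R.
  by apply: (matrix_right_inverse b01) => // t; exact: A_rank.
pose B l i t := (ei t - x) * A (expi t) l i.
pose bx i j t := b i j t / (ei t - x).
have rB l i : reg q (B l i) by apply: (regM q01) => //; exact: reg_ei_sub.
have rbx i j : reg q (bx i j) by apply: (regM q01) => //; exact: cauchy_kernel_reg.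
have Bbx l j t : \sum_i B l i t * bx i j t = (l == j)%:R.
  rewrite -(Ab l j t); apply: eq_bigr => i _; have n0 := ei_sub_neq0 t x1.
  by rewrite /B /bx; field.
pose Ac l t := \sum_i A (expi t) l i * c i 0.
have rAc l : reg q (Ac l).
  apply: (reg_sum q01) => i _; apply: (regM q01) => //.
  exact: (reg_tp q01 (tp_cst 0 (c i 0))).
pose f l := reC (fun t => - 1 * Ac l t).
have rf l : reg q (f l) by apply: (reg_reC q01); exact: regZ.
have realff : realf f by move=> l t; exact: conj_reC.
(* Any rate strictly between [q] and 1 serves as the auxiliary one. *)
have q'01 : 0 < (1 + q) / 2 < 1 by case/andP: q01 => ? ?; apply/andP; split; lra.
have qq' : q < (1 + q) / 2 by case/andP: q01 => ? ?; lra.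
have orth psi : RHker q B psi -> pair psi f = 0.
  move=> kpsi; have [rpsi realpsi _] := kpsi.
  have [g [H [gE hH PsiE Hx]]] := kernel_multiplier x1 kpsi.
  have := hc g gE; rewrite PsiE -scalemxAl mxE.
  set s := (_ *m c) 0 0; have -> : complex.Re ((1 - cabs x ^+ 2)%:C * s) = (1 - cabs x ^+ 2) * complex.Re s.
    by case: s => a e /=; rewrite mul0r subr0.
  move=> /eqP; rewrite mulf_eq0 => /orP[/eqP h|/eqP sre].
    by exfalso; have := cabs_ge0 x; nra.
  have sE : s = coef (fun t => \sum_l psi l t * Ac l t) 0.
    have rpA i : reg q (fun t => \sum_l psi l t * A (expi t) l i).
      by apply: (reg_sum q01) => l _; exact: regM.
    transitivity (\sum_i c i 0 * coef (fun t => \sum_l psi l t * A (expi t) l i) 0).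
      by rewrite /s mxE; apply: eq_bigr => i _; rewrite mxE Hx mulrC.
    rewrite (eq_bigr (fun i => coef (fun t => c i 0 * \sum_l psi l t * A (expi t) l i) 0)); last first.
      by move=> i _; rewrite coefZ //; exact: reg_tlim (rpA i).
    rewrite -coef_sum; last by move=> i _; apply: tlimZ; exact: reg_tlim (rpA i).
    congr coef; apply/funext => t; rewrite /Ac.
    under eq_bigr do rewrite mulr_sumr.
    rewrite exchange_big /=; apply: eq_bigr => l _; rewrite mulr_sumr; apply: eq_bigr => i _.
    by rewrite mulrC mulrA.
  rewrite /pair (eq_bigr (fun l => (complex.Re (- 1 * coef (fun t => psi l t * Ac l t) 0))%:C)).
    rewrite -rmorph_sum /= -raddf_sum /= -mulr_sumr -coef_sum.
      by rewrite -sE mulN1r raddfN /= sre oppr0.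
    by move=> l _; apply: tlimM; [exact: reg_tlim (rpsi l)|exact: reg_tlim (rAc l)].
  move=> l _; rewrite /f mean_reC; [|exact: reg_tlim (rpsi l)| |exact: realpsi]; last first.
    by apply: (@reg_tlim _ q); exact: regZ.
  congr ((complex.Re _)%:C); rewrite -coefZ; last first.
    by apply: tlimM; [exact: reg_tlim (rpsi l)|exact: reg_tlim (rAc l)].
  by congr coef; apply/funext => t; rewrite mulrCA.
have [v [av vE]] := RH_solvable q01 q'01 qq' rB rbx Bbx rf realff orth.
have rv i : reg q (v i) by have [] := av i.
have rw i : reg q (fun t => c i 0 + (ei t - x) * v i t).
  apply: regD; first exact: (reg_tp q01 (tp_cst 0 (c i 0))).
  by apply: (regM q01) => //; exact: reg_ei_sub.
have [w hw] := @lift_circle R N 1 (fun i _ t => c i 0 + (ei t - x) * v i t) (fun i _ => reg_tlim (rw i)).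
have ext i : exists F, disc_hol F /\ forall t, F (ei t) = v i t.
  have [_ v0] := av i; have [F h1 h2] := analytic_extension (reg_tlim (rv i)) v0; by exists F.
have [V hV] := choice ext.
have Hw : is_hol_extension w (fun z => \col_i (c i 0 + (z + - x) * V i z)).
  apply/is_hol_extensionE; split=> [t|i j].
    by apply/matrixP => i j; rewrite hw !mxE; have [_ ->] := hV i.
  under eq_fun do rewrite !mxE.
  apply: disc_holD; first exact: disc_hol_cst.
  apply: disc_holM; last by have [] := hV i.
  by apply: disc_holD; [exact: disc_hol_id|exact: disc_hol_cst].
exists w; last first.
  rewrite (hol_valueE (ltW x1) Hw); apply/matrixP => i j.
  by rewrite !mxE subrr mul0r addr0 (ord1 j).
split; first split.
- by apply/(Calpha_cmx_reg k b01) => i j; apply: (eq_reg _ (rw i)) => t; rewrite hw.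
- by eexists; exact: Hw.
move=> z; have [t ->] := circleP z; apply/matrixP => l j; rewrite (ord1 j) !mxE.
have := vE l t; rewrite /RHop /f /reC => /complexI; rewrite mulN1r raddfN /= => h.
rewrite (eq_bigr (fun i => A (expi t) l i * c i 0 + B l i t * v i t)); last first.
  by move=> i _; rewrite hw /B; ring.
by rewrite big_split raddfD /= h -/(Ac l t) addrN.
Qed.

Theorem WsetE x : cabs x < 1 -> Wset k beta A x = [set c | forall g, EA k beta A g ->
  complex.Re ((Psi A x (cplx g) *m c) 0 0) = 0].
Proof.
move=> x1; apply/seteqP; split=> c /=; last exact: W_full.
by move=> [w wL <-] g gE; exact: W_orthogonal.
Qed.

End BoundaryValues.

(** * Real and complex codimensions *)

Section LinearAlgebra.
Context (K : fieldType).

Lemma additive_sum (U V : lmodType K) (S : set U) (f : U -> V) : is_subspace S ->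
  (forall a u v, S u -> S v -> f (a *: u + v) = a *: f u + f v) ->
  forall n (a : 'I_n -> K) (e : 'I_n -> U), (forall i, S (e i)) ->
  S (\sum_i a i *: e i) /\ f (\sum_i a i *: e i) = \sum_i a i *: f (e i).
Proof.
move=> [S0 SD] flin n a e eS.
have f0 : f 0 = 0.
  have := flin (-1) 0 0 S0 S0; rewrite scaler0 addr0 scaleN1r addNr //.
elim: n a e eS => [|n IH] a e eS; first by rewrite !big_ord0.
rewrite !big_ord_recl; have [h1 h2] := IH (fun i => a (lift ord0 i)) (fun i => e (lift ord0 i)) (fun i => eS _).
by split; [exact: SD|rewrite flin // h2].
Qed.

Lemma setT_subspace (V : lmodType K) : is_subspace [set: V].
Proof. by []. Qed.

(** Function spaces come without a dimension here; a linear injection into row vectors yields a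
    basis, as preimages of a basis of the image. *)
Lemma basis_of_coordinates (V : lmodType K) (S : set V) p (T : V -> 'rV[K]_p) :
  is_subspace S ->
  (forall a u v, S u -> S v -> T (a *: u + v) = a *: T u + T v) ->
  (forall u, S u -> T u = 0 -> u = 0) ->
  exists d (g : 'I_d -> V), is_basis S g.
Proof.
move=> Ssub Tlin Tinj; have [S0 SD] := Ssub.
have T0 : T 0 = 0.
  by have := Tlin (-1) 0 0 S0 S0; rewrite scaler0 addr0 scaleN1r addNr.
have [|a _ _ [u Su <-] [v Sv <-]|B hB] :=
  @subspace_row_matrix K p (fun s => exists2 u, S u & T u = s).
- by exists 0.
- by exists (a *: u + v); [exact: SD|exact: Tlin].
have ex i : exists u, S u /\ T u = row i (row_base B).
  have /hB[u Su Tu] : (row i (row_base B) <= B)%MS.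
    by rewrite (submx_trans (row_sub _ _)) // eq_row_base.
  by exists u.
have [g hg] := choice ex.
have sumE a : S (\sum_i a i *: g i) /\ T (\sum_i a i *: g i) = (\row_i a i) *m row_base B.
  have [h1 ->] := additive_sum Ssub Tlin a (fun i => (hg i).1); split => //.
  by rewrite mulmx_sum_row; apply: eq_bigr => i _; rewrite mxE (hg i).2.
exists (\rank B), g; split=> [a a0 i|].
  have := (sumE a).2; rewrite a0 T0 => /esym/eqP.
  rewrite mulmx_free_eq0 ?row_base_free // => /eqP /rowP /(_ i).
  by rewrite !mxE.
apply/seteqP; split=> [u Su|_ [a _ <-]]; last by have [] := sumE a.
have : (T u <= row_base B)%MS by rewrite eq_row_base; apply/hB; exists u.
move=> /submxP[D hD]; exists (fun i => D 0 i) => //.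
have [h1 h2] := sumE (fun i => D 0 i).
have Su' : S (-1 *: u + \sum_i D 0 i *: g i) by exact: SD.
have : -1 *: u + \sum_i D 0 i *: g i = 0.
  apply: (Tinj _ Su'); rewrite Tlin // h2 hD (_ : \row_i D 0 i = D).
    by rewrite scaleN1r addNr.
  by apply/rowP => i; rewrite mxE.
by rewrite scaleN1r addrC => /eqP; rewrite subr_eq0 => /eqP.
Qed.

Section Coordinates.
Context (V : lmodType K) (n : nat) (f : V -> 'rV[K]_n) (f' : 'rV[K]_n -> V).
Context (flin : forall a u v, f (a *: u + v) = a *: f u + f v).
Context (fK : cancel f f') (f'K : cancel f' f).

Lemma coordinates_sum d (a : 'I_d -> K) (e : 'I_d -> V) :
  f (\sum_i a i *: e i) = (\row_i a i) *m (\matrix_i f (e i)).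
Proof.
have [_ ->] := @additive_sum _ _ [set: V] f (setT_subspace V) (fun a u v _ _ => flin a u v) d a e (fun i => I).
by rewrite mulmx_sum_row; apply: eq_bigr => i _; rewrite mxE rowK.
Qed.

Lemma coordinates0 : f 0 = 0.
Proof. by have := flin (-1) 0 0; rewrite scaler0 addr0 scaleN1r addNr. Qed.

Lemma has_dim_rank d l (M : 'M[K]_(d, n)) (S : set V) :
  (forall v, S v <-> (f v <= M)%MS) -> has_dim S l -> \rank M = l.
Proof.
move=> SM [e [ind Se]].
pose E := \matrix_i f (e i).
have freeE : row_free E.
  rewrite -kermx_eq0; apply/eqP/row_matrixP => i; rewrite row0.
  have : row i (kermx E) *m E = 0 by apply/sub_kermxP; exact: row_sub.
  set u := row i _; move=> uE; have := coordinates_sum (fun j => u 0 j) e.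
  rewrite (_ : \row_i u 0 i = u); last by apply/rowP => j; rewrite mxE.
  rewrite uE -coordinates0 => /(can_inj fK) u0.
  by apply/rowP => j; rewrite (ind _ u0) mxE.
apply/eqP; rewrite -(eqP freeE) eqn_leq !mxrankS //.
  apply/row_subP => i; rewrite rowK; apply/SM; rewrite Se.
  exists (fun j => (j == i)%:R) => //.
  by rewrite (bigD1 i) //= eqxx scale1r big1 ?addr0 // => j /negbTE ->; rewrite scale0r.
apply/row_subP => i; have : S (f' (row i M)) by apply/SM; rewrite f'K row_sub.
rewrite Se => -[a _ ae]; rewrite -[row i M]f'K -ae coordinates_sum.
exact: submxMl.
Qed.

(** Since [row_base M] is free, M may be replaced by [col_base M], which has a left inverse D. The
    rows of D give the representatives, and the coordinates of the class of v are read off as f v *m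
    col_base M. *)
Lemma has_codim_ker p (M : 'M[K]_(n, p)) : has_codim [set v | f v *m M = 0] (\rank M).
Proof.
split.
  split=> [/=|a u v /= hu hv]; first by rewrite coordinates0 mul0mx.
  by rewrite flin mulmxDl -scalemxAl hu hv scaler0 addr0.
pose r := \rank M.
have [D DC] : exists D : 'M[K]_(r, n), D *m col_base M = 1%:M.
  by apply/row_fullP; exact: col_base_full.
have ker v : f v *m M = 0 <-> f v *m col_base M = 0.
  rewrite -{1}(mulmx_base M) mulmxA; split=> [/eqP|->]; last by rewrite mul0mx.
  by rewrite mulmx_free_eq0 ?row_base_free // => /eqP.
exists (fun i => f' (row i D)) => v.
have key (a : 'rV[K]_r) : f (v - \sum_i a 0 i *: f' (row i D)) *m col_base M = f v *m col_base M - a.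
  rewrite -scaleN1r addrC flin coordinates_sum mulmxDl -scalemxAl scaleN1r addrC -mulmxA.
  rewrite (_ : \row_i a 0 i = a); last by apply/rowP => j; rewrite mxE.
  rewrite (_ : \matrix_i f (f' (row i D)) = D); last by apply/row_matrixP => i; rewrite rowK f'K.
  by rewrite DC mulmx1.
exists (f v *m col_base M); split=> [|a /= /ker]; rewrite /=.
  by apply/ker; rewrite key subrr.
by rewrite key => /eqP; rewrite subr_eq0 => /eqP.
Qed.
End Coordinates.

(** An injective phi carries the left kernel of M into that of M', and both matrices have d rows, so
    a larger kernel means a smaller rank. *)
Lemma ker_rank_le (V : lmodType K) n d (g : 'I_d -> V) (phi : V -> V) (M M' : 'M[K]_(d, n)) :
  (forall a, \sum_i a i *: g i = 0 -> forall i, a i = 0) ->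
  (forall a u v, phi (a *: u + v) = a *: phi u + phi v) -> (forall u, phi u = 0 -> u = 0) ->
  (forall a : 'rV_d, a *m M = 0 -> exists2 b : 'rV_d, b *m M' = 0 &
     phi (\sum_i a 0 i *: g i) = \sum_i b 0 i *: g i) ->
  (\rank M' <= \rank M)%N.
Proof.
move=> ind philin phi0 H; pose k := \rank (kermx M).
have rk : k = (d - \rank M)%N by rewrite /k mxrank_ker.
have ex (j : 'I_k) : exists b : 'rV_d, b *m M' = 0 /\
    phi (\sum_i row_base (kermx M) j i *: g i) = \sum_i b 0 i *: g i.
  have [|b b0 hb] := H (row j (row_base (kermx M))).
    by apply/sub_kermxP; rewrite (submx_trans (row_sub _ _)) // eq_row_base.
  by exists b; split=> //; rewrite -hb; congr phi; apply: eq_bigr => i _; rewrite [in RHS]mxE.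
have [b hb] := choice ex; pose Bm := \matrix_j b j.
have BmM : (Bm <= kermx M')%MS.
  by apply/sub_kermxP/row_matrixP => j; rewrite row_mul rowK row0 (hb j).1.
have freeB : row_free Bm.
  rewrite -kermx_eq0; apply/eqP/row_matrixP => j; rewrite row0.
  have : row j (kermx Bm) *m Bm = 0 by apply/sub_kermxP; exact: row_sub.
  set u := row j _; move=> uB.
  have : phi (\sum_i (u *m row_base (kermx M)) 0 i *: g i) = \sum_i (u *m Bm) 0 i *: g i.
    have [_ E] := @additive_sum _ _ [set: V] phi (setT_subspace V) (fun a u v _ _ => philin a u v)
      k (fun j => u 0 j) (fun j => \sum_i row_base (kermx M) j i *: g i) (fun i => I).
    transitivity (phi (\sum_j u 0 j *: \sum_i row_base (kermx M) j i *: g i)).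
      congr phi; under [RHS]eq_bigr do rewrite scaler_sumr; rewrite exchange_big.
      apply: eq_bigr => i _; rewrite mxE scaler_suml; apply: eq_bigr => a _.
      by rewrite scalerA.
    rewrite E; under eq_bigr do rewrite (hb _).2 scaler_sumr; rewrite exchange_big.
    apply: eq_bigr => i _; rewrite mxE scaler_suml; apply: eq_bigr => a _.
    by rewrite scalerA [Bm _ _]mxE.
  rewrite uB [X in _ = X]big1 => [|i _]; last by rewrite mxE scale0r.
  move=> /phi0/ind h; have : u *m row_base (kermx M) = 0.
    by apply/rowP => i; rewrite h mxE.
  by move/eqP; rewrite mulmx_free_eq0 ?row_base_free // => /eqP.
have := mxrankS BmM; rewrite (eqP freeB) mxrank_ker rk.
have := rank_leq_row M; have := rank_leq_row M'; lia.
Qed.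
End LinearAlgebra.

(** * Real and complex linear algebra of W, iW and W + iW *)

Section ComplexSubspaces.
Context (R : realType).
Local Notation C := R[i].
Local Notation rc := (map_mx (real_complex R)).
Local Notation ReX := (map_mx (@complex.Re R)).
Local Notation ImX := (map_mx (@complex.Im R)).
Local Notation I := ('i%C : C).

Lemma mx_ReIm p n (A : 'M[C]_(p, n)) : A = rc (ReX A) + I *: rc (ImX A).
Proof.
apply/matrixP => i j; rewrite !mxE; case: (A i j) => a b.
by apply/eqP; rewrite eq_complex /=; apply/andP; split; apply/eqP; ring.
Qed.

Lemma mx_real_eq p n (X Y X' Y' : 'M[R]_(p, n)) :
  rc X + I *: rc Y = rc X' + I *: rc Y' -> X = X' /\ Y = Y'.
Proof.
move=> /matrixP h; split; apply/matrixP => i j; have := h i j; rewrite !mxE => /eqP;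
  by rewrite eq_complex /= => /andP[/eqP h1 /eqP h2]; move: h1 h2; rewrite !mul0r !mul1r; lra.
Qed.

Lemma rcM p n s (X : 'M[R]_(p, n)) (Y : 'M[R]_(n, s)) : rc (X *m Y) = rc X *m rc Y.
Proof. exact: map_mxM. Qed.

Lemma ReX_mulr p n s (X : 'M[R]_(p, n)) (Y : 'M[C]_(n, s)) : ReX (rc X *m Y) = X *m ReX Y.
Proof.
have [] := @mx_real_eq _ _ (ReX (rc X *m Y)) (ImX (rc X *m Y)) (X *m ReX Y) (X *m ImX Y).
  by rewrite -mx_ReIm !rcM scalemxAr -mulmxDr -mx_ReIm.
by [].
Qed.

Lemma ReX_mul p n s (X : 'M[C]_(p, n)) (Y : 'M[C]_(n, s)) :
  ReX (X *m Y) = ReX X *m ReX Y - ImX X *m ImX Y.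
Proof.
have [] := @mx_real_eq _ _ (ReX (X *m Y)) (ImX (X *m Y)) (ReX X *m ReX Y - ImX X *m ImX Y)
  (ReX X *m ImX Y + ImX X *m ReX Y).
  rewrite -mx_ReIm {1}(mx_ReIm X) {1}(mx_ReIm Y) mulmxDl !mulmxDr.
  rewrite !(map_mxD (real_complex R)) (map_mxN (real_complex R)) !rcM scalerDr -!scalemxAl -!scalemxAr scalerA.
  have -> : I * I = -1 by rewrite -expr2 sqr_i.
  by rewrite scaleN1r -!addrA; congr (_ + _); rewrite [RHS]addrC addrA.
by [].
Qed.

Definition real_coord n (v : realified 'rV[C]_n) : 'rV[R]_(n + n) := row_mx (ReX v) (ImX v).
Definition of_real_coord n (u : 'rV[R]_(n + n)) : realified 'rV[C]_n :=
  rc (lsubmx u) + I *: rc (rsubmx u).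

Lemma real_coordK n : cancel (@real_coord n) (@of_real_coord n).
Proof. by move=> v; rewrite /of_real_coord row_mxKl row_mxKr -mx_ReIm. Qed.

Lemma of_real_coordK n : cancel (@of_real_coord n) (@real_coord n).
Proof.
move=> u; rewrite -[RHS]hsubmxK /real_coord.
have [|-> -> //] := @mx_real_eq _ _ (ReX (of_real_coord u)) (ImX (of_real_coord u)) (lsubmx u) (rsubmx u).
by rewrite -mx_ReIm.
Qed.

Lemma real_coord_linear n a (u v : realified 'rV[C]_n) :
  real_coord (a *: u + v) = a *: real_coord u + real_coord v.
Proof.
rewrite /real_coord scale_row_mx add_row_mx; congr row_mx; apply/rowP => i; rewrite !mxE /=.
  by case: (u 0 i) => ? ?; case: (v 0 i) => ? ? /=; rewrite mul0r subr0.
by case: (u 0 i) => ? ?; case: (v 0 i) => ? ? /=; rewrite mul0r addr0.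
Qed.

(* The sign on the imaginary part makes Re (P c) the product of the coordinates
   of c with the real matrix [Re P, Im P]. *)
Definition real_cocoord n (c : realified 'cV[C]_n) : 'rV[R]_(n + n) :=
  row_mx (ReX c)^T (- (ImX c)^T).
Definition of_real_cocoord n (u : 'rV[R]_(n + n)) : realified 'cV[C]_n :=
  rc (lsubmx u)^T - I *: rc (rsubmx u)^T.

Lemma of_real_cocoordK n : cancel (@of_real_cocoord n) (@real_cocoord n).
Proof.
move=> u; rewrite -[RHS]hsubmxK /real_cocoord.
have [|-> ->] := @mx_real_eq _ _ (ReX (of_real_cocoord u)) (ImX (of_real_cocoord u)) (lsubmx u)^T (- (rsubmx u)^T).
  by rewrite -mx_ReIm (map_mxN (real_complex R)) scalerN.
by rewrite linearN /= !trmxK opprK.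
Qed.

Lemma real_cocoord_linear n a (u v : realified 'cV[C]_n) :
  real_cocoord (a *: u + v) = a *: real_cocoord u + real_cocoord v.
Proof.
rewrite /real_cocoord scale_row_mx add_row_mx; congr row_mx; apply/rowP => i; rewrite !mxE /=.
  by case: (u i 0) => ? ?; case: (v i 0) => ? ? /=; rewrite mul0r subr0.
by case: (u i 0) => ? ?; case: (v i 0) => ? ? /=; rewrite mul0r addr0 mulrN -opprD.
Qed.

(** Its rows are the real coordinates of the rows of P, so its rank is the real dimension of their
    real span. *)
Definition realmx d n (P : 'M[C]_(d, n)) : 'M[R]_(d, n + n) := row_mx (ReX P) (ImX P).

Section Matrix.
Context (d n : nat) (P : 'M[C]_(d, n)).
Local Notation W := [set c : 'cV[C]_n | ReX (P *m c) = 0].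

Lemma real_codim_Re0 : real_codim W (\rank (realmx P)).
Proof.
have := has_codim_ker (@real_cocoord_linear n) (@of_real_cocoordK n) (realmx P)^T.
rewrite mxrank_tr; congr (has_codim _ _); apply/seteqP.
have E c : (real_cocoord c *m (realmx P)^T)^T = ReX (P *m c).
  by rewrite trmx_mul trmxK /realmx /real_cocoord tr_row_mx mul_row_col linearN /= !trmxK mulmxN ReX_mul.
split=> c /= h; first by rewrite -E h trmx0.
by rewrite -[LHS]trmxK E h trmx0.
Qed.

Lemma codim_ker : has_codim [set c : 'cV[C]_n | P *m c = 0] (\rank P).
Proof.
have lin a (u v : 'cV[C]_n) : (a *: u + v)^T = a *: u^T + v^T by rewrite linearP.
have := has_codim_ker lin (@trmxK _ 1 n) P^T.
rewrite mxrank_tr; congr (has_codim _ _); apply/seteqP.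
split=> c /= h; last by rewrite -trmx_mul h trmx0.
by apply: trmx_inj; rewrite trmx_mul h trmx0.
Qed.

Lemma mulI_Re p s (X : 'M[C]_(p, s)) : ReX (I *: X) = - ImX X.
Proof. by apply/matrixP => i j; rewrite !mxE; case: (X i j) => a b /=; ring. Qed.

Lemma mulI_Im p s (X : 'M[C]_(p, s)) : ImX (I *: X) = ReX X.
Proof. by apply/matrixP => i j; rewrite !mxE; case: (X i j) => a b /=; ring. Qed.

Lemma ReIm0 p s (X : 'M[C]_(p, s)) : ReX X = 0 -> ImX X = 0 -> X = 0.
Proof. by move=> h1 h2; rewrite (mx_ReIm X) h1 h2 !map_mx0 scaler0 addr0. Qed.

Lemma W_imul : W `&` imul W = [set c | P *m c = 0].
Proof.
apply/seteqP; split=> c /=.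
  move=> [h1 [v h2 hv]]; apply: ReIm0 => //.
  by rewrite -hv -scalemxAr mulI_Im.
move=> h; rewrite h map_mx0; split=> //; exists (- I *: c).
  by rewrite /= -scalemxAr h scaler0 map_mx0.
by rewrite scalerA mulrN -[_ * _]/(I * I) -expr2 sqr_i opprK scale1r.
Qed.
End Matrix.

Section SumCodimension.
Context (d n : nat) (P : 'M[C]_(d, n)).
Local Notation W := [set c : 'cV[C]_n | ReX (P *m c) = 0].
Let l := \rank (realmx P).
(* P = T E with T real and injective, so that E has R-independent rows. *)
Let T : 'M[C]_(d, l) := rc (col_base (realmx P)).
Let E : 'M[C]_(l, n) :=
  rc (lsubmx (row_base (realmx P))) + I *: rc (rsubmx (row_base (realmx P))).
Let Z := row_base (kermx E).
Let Zb := map_mx conjc Z.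

Let TE : P = T *m E.
Proof.
have hl : col_base (realmx P) *m lsubmx (row_base (realmx P)) = ReX P.
  by rewrite mulmx_lsub mulmx_base row_mxKl.
have hr : col_base (realmx P) *m rsubmx (row_base (realmx P)) = ImX P.
  by rewrite mulmx_rsub mulmx_base row_mxKr.
by rewrite /T /E mulmxDr -scalemxAr -!rcM hl hr -mx_ReIm.
Qed.

Let E_free p (y : 'M[R]_(p, l)) : rc y *m E = 0 -> y = 0.
Proof.
rewrite /E mulmxDr -scalemxAr -!rcM => h.
have [|h1 h2] := @mx_real_eq _ _ (y *m lsubmx (row_base (realmx P))) (y *m rsubmx (row_base (realmx P))) 0 0.
  by rewrite h !map_mx0 scaler0 addr0.
have : y *m row_base (realmx P) = 0.
  by rewrite -[row_base _]hsubmxK mul_mx_row h1 h2 row_mx0.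
by move/eqP; rewrite mulmx_free_eq0 ?row_base_free // => /eqP.
Qed.

Let T_inv : exists D : 'M[R]_(l, d), rc D *m T = 1%:M.
Proof.
have /row_fullP[D hD] := col_base_full (realmx P).
by exists D; rewrite /T -rcM hD map_mx1.
Qed.

Let rank_E : \rank E = \rank P.
Proof.
have [D hD] := T_inv; apply/eqP; rewrite eqn_leq {2}TE mxrankM_maxr andbT.
by rewrite -[E]mul1mx -hD -mulmxA -TE mxrankM_maxr.
Qed.

Let W_E c : W c <-> ReX (E *m c) = 0.
Proof.
rewrite /= TE -mulmxA ReX_mulr; have /row_fullP[D hD] := col_base_full (realmx P).
split=> [h|->]; last exact: mulmx0.
by rewrite -[LHS]mul1mx -hD -mulmxA h mulmx0.
Qed.

Let conjM p s t (X : 'M[C]_(p, s)) (Y : 'M[C]_(s, t)) :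
  map_mx conjc (X *m Y) = map_mx conjc X *m map_mx conjc Y.
Proof. exact: map_mxM. Qed.

Let conj_rc p s (X : 'M[R]_(p, s)) : map_mx conjc (rc X) = rc X.
Proof. by apply/matrixP => i j; rewrite !mxE; apply/eqP; rewrite eq_complex /= oppr0 !eqxx. Qed.

Let conjK p s (X : 'M[C]_(p, s)) : map_mx conjc (map_mx conjc X) = X.
Proof. by apply/matrixP => i j; rewrite !mxE conjcK. Qed.

Let conj_Re p s (X : 'M[C]_(p, s)) : X + map_mx conjc X = 2%:R *: rc (ReX X).
Proof.
apply/matrixP => i j; rewrite !mxE; case: (X i j) => a b.
by apply/eqP; rewrite eq_complex /=; apply/andP; split; apply/eqP; ring.
Qed.

Let conj_Im p s (X : 'M[C]_(p, s)) : X - map_mx conjc X = (2%:R * I) *: rc (ImX X).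
Proof.
apply/matrixP => i j; rewrite !mxE; case: (X i j) => a b.
by apply/eqP; rewrite eq_complex /=; apply/andP; split; apply/eqP; ring.
Qed.

Let conj0 p s : map_mx conjc (0 : 'M[C]_(p, s)) = 0.
Proof. by apply/matrixP => i j; rewrite !mxE conjc0. Qed.

Let ZE : Z *m E = 0.
Proof. by apply/sub_kermxP; rewrite /Z eq_row_base. Qed.

Let rank_Z : \rank (kermx E) = (l - \rank P)%N.
Proof. by rewrite mxrank_ker rank_E. Qed.

Let conj_split p s t (X : 'M[C]_(p, s)) (Y : 'M[C]_(s, t)) :
  X *m Y = 0 -> map_mx conjc X *m Y = 0 -> rc (ReX X) *m Y = 0 /\ rc (ImX X) *m Y = 0.
Proof.
move=> h1 h2; have n2 : 2%:R != 0 :> C by rewrite pnatr_eq0.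
have nI : 2%:R * I != 0 :> C by rewrite mulf_neq0 // eq_complex /= oner_eq0 andbF.
split.
  have : (2%:R *: rc (ReX X)) *m Y = 0 by rewrite -conj_Re mulmxDl h1 h2 addr0.
  by rewrite -scalemxAl => /eqP; rewrite scaler_eq0 (negbTE n2) => /eqP.
have : ((2%:R * I) *: rc (ImX X)) *m Y = 0 by rewrite -conj_Im mulmxBl h1 h2 subr0.
by rewrite -scalemxAl => /eqP; rewrite scaler_eq0 (negbTE nI) => /eqP.
Qed.

(** If y Zb annihilates E on the left, so does its conjugate, which is a combination of the rows of
    Z. Then its real and imaginary parts do too, and they vanish because E has rows independent over
    the reals. *)
Let ZbE_free : row_free (Zb *m E).
Proof.
rewrite -kermx_eq0; apply/eqP/row_matrixP => i; rewrite row0.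
have : row i (kermx (Zb *m E)) *m (Zb *m E) = 0 by apply/sub_kermxP; exact: row_sub.
move: (row i _) => y; rewrite mulmxA => yE.
have yc : map_mx conjc (y *m Zb) *m E = 0 by rewrite conjM /Zb conjK -mulmxA ZE mulmx0.
have [/E_free h1 /E_free h2] := conj_split yE yc.
have : map_mx conjc y *m Z = 0.
  by rewrite -[Z]conjK -/Zb -conjM (ReIm0 h1 h2) conj0.
move=> /eqP; rewrite mulmx_free_eq0 ?row_base_free // => /eqP h.
by rewrite -[y]conjK h conj0.
Qed.

(** The column space of E lies in the kernel of Z, and both have dimension rank P. *)
Let image_E (x : 'cV[C]_l) : Z *m x = 0 -> exists b, E *m b = x.
Proof.
move=> Zx; have s1 : (E^T <= kermx Z^T)%MS by apply/sub_kermxP; rewrite -trmx_mul ZE trmx0.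
have s2 : (x^T <= kermx Z^T)%MS by apply/sub_kermxP; rewrite -trmx_mul Zx trmx0.
have rk : \rank E^T = \rank (kermx Z^T).
  rewrite mxrank_ker !mxrank_tr /Z (eqP (row_base_free _)) rank_Z rank_E.
  by rewrite subKn // -rank_E rank_leq_row.
have s3 : (kermx Z^T <= E^T)%MS by have [_ <-] := mxrank_leqif_sup s1; rewrite rk.
have /submxP[D hD] := submx_trans s2 s3.
by exists D^T; apply: trmx_inj; rewrite trmx_mul trmxK -hD.
Qed.

(** For u in W the vector E u is imaginary, so Zb E u is, up to sign, the conjugate of Z E u = 0.
    Conversely, if Zb annihilates y = E c, then Z annihilates y and its conjugate, hence Re y, and
    Re y = E a for some a; then c - a and -i a lie in W, and c is the sum of c - a and i (-i a). *)
Let sumE : sumset W (imul W) = [set c | (Zb *m E) *m c = 0].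
Proof.
apply/seteqP; split=> c /=.
  have Q u : W u -> Zb *m E *m u = 0.
    move=> /W_E Wu; rewrite -mulmxA (mx_ReIm (E *m u)) Wu map_mx0 add0r -scalemxAr.
    have -> : Zb *m rc (ImX (E *m u)) = map_mx conjc (Z *m rc (ImX (E *m u))) by rewrite conjM conj_rc.
    have -> : rc (ImX (E *m u)) = - I *: (E *m u).
      rewrite {2}(mx_ReIm (E *m u)) Wu map_mx0 add0r scalerA mulNr.
      by rewrite -expr2 sqr_i opprK scale1r.
    by rewrite -scalemxAr mulmxA ZE mul0mx scaler0 conj0 scaler0.
  move=> [u Wu [_ [v Wv <-] <-]].
  by rewrite mulmxDr -scalemxAr !Q // scaler0 addr0.
rewrite -mulmxA => hc; set y := E *m c in hc.
have Zy : Z *m y = 0 by rewrite /y mulmxA ZE mul0mx.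
have Zcy : Z *m map_mx conjc y = 0 by rewrite -[Z]conjK -/Zb -conjM hc conj0.
have n2 : 2%:R != 0 :> C by rewrite pnatr_eq0.
have nI : 2%:R * I != 0 :> C by rewrite mulf_neq0 // eq_complex /= oner_eq0 andbF.
have Za : Z *m rc (ReX y) = 0.
  have : Z *m (2%:R *: rc (ReX y)) = 0 by rewrite -conj_Re mulmxDr Zy Zcy addr0.
  by rewrite -scalemxAr => /eqP; rewrite scaler_eq0 (negbTE n2) => /eqP.
have Zi : Z *m rc (ImX y) = 0.
  have : Z *m ((2%:R * I) *: rc (ImX y)) = 0 by rewrite -conj_Im mulmxBr Zy Zcy subr0.
  by rewrite -scalemxAr => /eqP; rewrite scaler_eq0 (negbTE nI) => /eqP.
have [a ha] := image_E Za; have [b hb] := image_E Zi.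
have Rei p s (X : 'M[R]_(p, s)) : ReX (I *: rc X) = 0.
  by apply/matrixP => i j; rewrite !mxE /=; ring.
pose v := - I *: a.
have Iv : I *: v = a by rewrite /v scalerA mulrN -expr2 sqr_i opprK scale1r.
have Wv : W v by apply/W_E; rewrite /v -scalemxAr ha scaleNr raddfN /= Rei oppr0.
exists (c - a); last first.
  by exists (I *: v); [exists v|rewrite Iv subrK].
by apply/W_E; rewrite mulmxBr ha -/y {1}(mx_ReIm y) addrAC subrr add0r Rei.
Qed.

Lemma codim_sumset : (\rank P <= \rank (realmx P))%N /\
  has_codim (sumset W (imul W)) (\rank (realmx P) - \rank P).
Proof.
split; first by rewrite -rank_E rank_leq_row.
have e : \rank (Zb *m E) = (l - \rank P)%N by rewrite (eqP ZbE_free) rank_Z.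
rewrite -/l sumE -e; exact: codim_ker.
Qed.

End SumCodimension.

End ComplexSubspaces.

(** * Independence of the ranks from the base point *)

Section Annihilators.
Context (R : realType) (m N k : nat) (beta : R) (b01 : 0 < beta < 1).
Context (A : circle R -> 'M[R[i]]_(m, N)).
Context (A_smooth : Calpha_cmx k beta A) (A_rank : forall z : circle R, \rank (A z) = m).
Local Notation C := R[i].
Local Notation q := (hrate beta k).
Local Notation EA := (EA k beta A).
Local Notation EAC := (EAC k beta A).
Local Notation row d := (rowA A d).
Implicit Types (g : circle R -> 'cV[R]_m) (d : circle R -> 'cV[C]_m) (x y : C)
  (f : circle R -> 'rV[C]_N) (u : circle R -> C) (F : C -> C).

Let q01 : 0 < q < 1 := hrate01 b01 k.

Definition reg_row f := forall i, reg q (fun t => f (expi t) 0 i).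
Definition reg_col d := forall l, reg q (fun t => d (expi t) l 0).

Lemma reg_row_rowA d : reg_col d -> reg_row (row d).
Proof. by move=> hd i; exact: reg_rowA. Qed.

Lemma extends_row f : reg_row f ->
  (forall i j, j < 0 -> coef (fun t => f (expi t) 0 i) j = 0) -> extends_hol f.
Proof.
move=> rf f0; apply: extends_of_coef => i j; first by rewrite (ord1 i); exact: reg_tlim (rf j).
by rewrite (ord1 i); exact: f0.
Qed.

Lemma hol_value_lin x p s (a : C) (f g : circle R -> 'M[C]_(p, s)) : cabs x <= 1 ->
  extends_hol f -> extends_hol g ->
  extends_hol (fun z => a *: f z + g z) /\
  hol_value (fun z => a *: f z + g z) x = a *: hol_value f x + hol_value g x.
Proof.
move=> x1 [F hF] [G hG].
have h := hol_extensionD (hol_extension_scale (disc_hol_cst a) hF) hG.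
split; first by eexists; exact: h.
by rewrite (hol_valueE x1 h) (hol_valueE x1 hF) (hol_valueE x1 hG).
Qed.

Lemma hol_value_scale x p s F (f : circle R -> 'M[C]_(p, s)) : cabs x <= 1 -> disc_hol F ->
  extends_hol f -> extends_hol (fun z => F (sval z) *: f z) /\
  hol_value (fun z => F (sval z) *: f z) x = F x *: hol_value f x.
Proof.
move=> x1 hF [G hG]; have h := hol_extension_scale hF hG.
split; first by eexists; exact: h.
by rewrite (hol_valueE x1 h) (hol_valueE x1 hG).
Qed.

(* A multiplier moves a zero of the holomorphic extension from x to y. *)
Definition multiplier u x y := [/\ reg q (u \o @expi R), forall z, u z != 0,
  exists2 F, disc_hol F & forall t, F (ei t) = conjc (u (expi t)) &
  forall f, reg_row f -> extends_hol f -> hol_value f x = 0 ->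
    extends_hol (fun z => u z *: f z) /\ hol_value (fun z => u z *: f z) y = 0].

Lemma disc_hol_sub x : disc_hol (fun z => z - x).
Proof. by apply: disc_holD; [exact: disc_hol_id|exact: disc_hol_cst]. Qed.

Lemma factor_ei x t : 1 - x * conjc (ei t) = conjc (ei t) * (ei t - x).
Proof. by rewrite -eiN eiNV; have := ei_neq0 t; set v := ei t => h; field. Qed.

Lemma factor_neq0 x (z : circle R) : cabs x < 1 -> 1 - x * conjc (sval z) != 0.
Proof.
move=> x1; have [t ->] := circleP z; rewrite sval_expi factor_ei mulf_neq0 ?ei_sub_neq0 //.
by rewrite -eiN ei_neq0.
Qed.

Lemma reg_conj_ei : reg q (fun t : R => conjc (ei t)).
Proof. by apply: (reg_conj q01); exact: reg_ei. Qed.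

Lemma reg_factor x : reg q (fun t : R => 1 - x * conjc (ei t)).
Proof.
by apply: regB; [exact: (reg_tp q01 (tp_cst 0 1))|apply: regZ; exact: reg_conj_ei].
Qed.

Lemma disc_hol_factor x : disc_hol (fun z => 1 + conjc (- x) * z).
Proof. by apply: disc_holD; [exact: disc_hol_cst|apply: disc_holZ; exact: disc_hol_id]. Qed.

Lemma conj_factor x t : conjc (1 - x * conjc (ei t)) = 1 + conjc (- x) * ei t.
Proof.
have cB (a b : C) : conjc (a - b) = conjc a - conjc b by exact: rmorphB.
have cM (a b : C) : conjc (a * b) = conjc a * conjc b by exact: rmorphM.
have cN (a : C) : conjc (- a) = - conjc a by exact: rmorphN.
by rewrite cB cM cN conjcK conjc1 mulNr.
Qed.

(** On the circle 1 - x conj(zeta) = conj(zeta) (zeta - x): the first factor uses up the zero at 0,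
    the second creates one at x. *)
Lemma multiplier_up x : cabs x < 1 -> multiplier (fun z => 1 - x * conjc (sval z)) 0 x.
Proof.
move=> x1; split=> [|z||f rf ef f0].
- exact: reg_factor.
- exact: factor_neq0.
- by exists (fun z => 1 + conjc (- x) * z); [exact: disc_hol_factor|move=> t; rewrite /= conj_factor].
have [|e h] := @hol_value_scale x _ _ (fun z => z - x) (fun z => conjc (sval z) *: f z) (ltW x1) (disc_hol_sub x).
  apply: extends_row => [i|i j j0].
    apply: (eq_reg _ (regM q01 reg_conj_ei (rf i))) => t; by rewrite mxE.
  rewrite (_ : (fun t => _) = fun t => ek (-1) t * f (expi t) 0 i); last first.
    by apply/funext => t; rewrite mxE sval_expi ekN (ek_nat 1) expr1.
  rewrite coef_shift (@coef_of_extends _ _ _ f 0 i) ?f0 ?mxE ?mulr0 //; last by lia.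
  exact: reg_tlim (rf i).
rewrite (_ : (fun z => (1 - x * _) *: f z) = fun z => (sval z - x) *: (conjc (sval z) *: f z)); last first.
  apply/funext => z; have [t ->] := circleP z.
  by rewrite sval_expi factor_ei scalerA mulrC.
by split=> //; rewrite h subrr scale0r.
Qed.

(** The inverse multiplier is zeta / (zeta - x). The coefficient of f / (zeta - x) at -(n + 1) is
    the Cauchy mean of zeta^n f, equal to x^n f(x) = 0, so the quotient extends; the factor zeta
    then creates the zero at 0. *)
Lemma multiplier_down x : cabs x < 1 -> multiplier (fun z => (1 - x * conjc (sval z))^-1) x 0.
Proof.
move=> x1; have rinv : reg q (fun t : R => (1 - x * conjc (ei t))^-1).
  apply: (reg_invC b01 _ (reg_factor x)) => t; exact: (@factor_neq0 x (expi t) x1).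
split=> [//|z||f rf ef fx].
- by rewrite invr_neq0 // factor_neq0.
- exists (fun z => (1 + conjc (- x) * z)^-1); last first.
    by move=> t; rewrite conjc_inv sval_expi conj_factor.
  apply: disc_hol_cdiff => z z1; eexists.
  apply: (@cdiff_comp _ (fun z => z^-1) (fun z => 1 + conjc (- x) * z)); last first.
    by apply: cdiff_inv; apply: moebius_den => //; rewrite cabsN.
  by apply: cdiffD; [exact: cdiff_cst|apply: cdiffM; [exact: cdiff_cst|exact: cdiff_id]].
have z1 : cabs (0 : C) <= 1 by rewrite cabs0.
have [H hH HE] := hol_value_extension ef; have /is_hol_extensionE[h1 h2] := hH.
have [|e h] := @hol_value_scale 0 _ _ id (fun z => (sval z - x)^-1 *: f z) z1 (disc_hol_id R).
  apply: extends_row => [i|i j j0].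
    by apply: (eq_reg _ (regM q01 (cauchy_kernel_reg k b01 x1) (rf i))) => t; rewrite mxE.
  have [n jn] : exists n : nat, j = - n.+1%:Z by exists `|j|.-1%N; lia.
  have -> : j = 0 - n.+1%:Z by rewrite jn sub0r.
  rewrite -coef_shift.
  rewrite (_ : (fun t => _) = fun t => ei t / (ei t - x) * (ek n t * f (expi t) 0 i)); last first.
    by apply/funext => t; rewrite mxE sval_expi !ek_nat exprS; ring.
  rewrite (@cauchy_mean _ x _ (fun z => z ^+ n * H z 0 i)) //.
  - by rewrite -HE ?ltW // fx mxE mulr0.
  - by apply: (@reg_tlim _ q); apply: (regM q01); [exact: reg_ei|exact: cauchy_kernel_reg].
  - by apply: tlimM; [exact: tlim_ek|exact: reg_tlim (rf i)].
  - move=> a a0; rewrite coef_shift (@coef_of_extends _ _ _ f 0 i); [|exact: reg_tlim (rf i)|by []|by lia].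
    by rewrite (_ : (a - n%:Z == 0) = false) ?mul0r //; lia.
  - by apply: disc_holM; [exact: disc_holX|exact: h2].
  - by move=> t; rewrite h1 ek_nat.
rewrite (_ : (fun z => _^-1 *: f z) = fun z => sval z *: ((sval z - x)^-1 *: f z)); last first.
  apply/funext => z; have [t ->] := circleP z.
  rewrite sval_expi factor_ei scalerA -eiN eiNV; congr (_ *: _).
  by rewrite invfM invrK.
by split=> //; rewrite h scale0r.
Qed.

End Annihilators.

(** * The spaces E_A and E_A^C, their bases and ranks *)

Section AnnihilatorSpaces.
Context (R : realType) (m N k : nat) (beta : R) (b01 : 0 < beta < 1).
Context (A : circle R -> 'M[R[i]]_(m, N)).
Context (A_smooth : Calpha_cmx k beta A) (A_rank : forall z : circle R, \rank (A z) = m).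
Local Notation C := R[i].
Local Notation q := (hrate beta k).
Local Notation EA := (EA k beta A).
Local Notation EAC := (EAC k beta A).
Local Notation row d := (rowA A d).
Implicit Types (g : circle R -> 'cV[R]_m) (d : circle R -> 'cV[C]_m) (x y : C)
  (f : circle R -> 'rV[C]_N) (u : circle R -> C) (F : C -> C).

Let q01 : 0 < q < 1 := hrate01 b01 k.
Let c01 : cabs (0 : C) <= 1. Proof. by rewrite cabs0. Qed.

Definition conjd d : circle R -> 'cV[C]_m := fun z => map_mx conjc (d z).

Lemma EA_P g : EA g <-> reg_col k beta (cplx g) /\ extends_hol (row (cplx g)).
Proof.
split=> [[h1 h2]|[h1 h2]]; split=> //.
  by move=> l; have /(Calpha_rmx_reg k b01) h := h1; apply: (eq_reg _ (h l 0)) => t; rewrite /cplx mxE.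
apply/(Calpha_rmx_reg k b01) => i j; rewrite (ord1 j).
by apply: (eq_reg _ (h1 i)) => t; rewrite /cplx mxE.
Qed.

Lemma rowA_lin (a : C) d d' : row (a *: d + d') = fun z => a *: row d z + row d' z.
Proof.
by apply/funext => z; rewrite /rowA /= !fctE linearP mulmxDl -scalemxAl.
Qed.

Lemma conjd_cplx g : conjd (cplx g) = cplx g.
Proof.
by apply/funext => z; apply/matrixP => i j; rewrite !mxE; apply/eqP; rewrite eq_complex /= oppr0 !eqxx.
Qed.

Lemma cplx_ReM d : cplx (Defs.ReM d) = 2%:R^-1 *: d + 2%:R^-1 *: conjd d.
Proof.
apply/funext => z; apply/matrixP => i j; rewrite !fctE !mxE.
have n2 : 2%:R != 0 :> C by rewrite pnatr_eq0.
apply: (mulfI n2); rewrite mulrDr !mulrA !mulfV // !mul1r.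
by case: (d z i j) => a b; apply/eqP; rewrite eq_complex /=; apply/andP; split; apply/eqP; ring.
Qed.

Lemma cplx_ImM d : cplx (Defs.ImM d) = (- (2%:R^-1 * 'i%C)) *: d + (2%:R^-1 * 'i%C) *: conjd d.
Proof.
apply/funext => z; apply/matrixP => i j; rewrite !fctE !mxE.
have n2 : 2%:R != 0 :> C by rewrite pnatr_eq0.
apply: (mulfI n2); rewrite mulrDr mulNr mulrN !mulrA !mulfV // !mul1r.
by case: (d z i j) => a b; apply/eqP; rewrite eq_complex /=; apply/andP; split; apply/eqP; ring.
Qed.

Lemma cplx_split d : d = 'i%C *: cplx (Defs.ImM d) + cplx (Defs.ReM d).
Proof.
apply/funext => z; apply/matrixP => i j; rewrite !fctE !mxE.
by case: (d z i j) => a b; apply/eqP; rewrite eq_complex /=; apply/andP; split; apply/eqP; ring.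
Qed.

Lemma conjd_split d : conjd d = (- 'i%C) *: cplx (Defs.ImM d) + cplx (Defs.ReM d).
Proof.
apply/funext => z; apply/matrixP => i j; rewrite !fctE !mxE.
by case: (d z i j) => a b; apply/eqP; rewrite eq_complex /=; apply/andP; split; apply/eqP; ring.
Qed.

Lemma extends_lin (a b : C) d d' : extends_hol (row d) -> extends_hol (row d') ->
  extends_hol (row (a *: d + b *: d')).
Proof.
move=> h h'; rewrite rowA_lin.
have [] // := hol_value_lin a c01 h (_ : extends_hol (row (b *: d'))).
have [e0 _] := hol_value_scale c01 (disc_hol_cst 0) h.
have := (hol_value_lin b c01 h' e0).1.
by congr extends_hol; apply/funext => z; rewrite scale0r addr0 /rowA !fctE linearZ -scalemxAl.
Qed.

(* Unlike the definition, this makes E_A^C visibly stable under multiplication by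
   suitable non-real functions. *)
Lemma EAC_P d : EAC d <-> [/\ reg_col k beta d, extends_hol (row d) & extends_hol (row (conjd d))].
Proof.
split=> [[h1 /EA_P[h2 h3] /EA_P[h4 h5]]|[h1 h2 h3]].
  split; first by move=> l; have /(Calpha_cmx_reg k b01) := h1; apply.
    by rewrite (cplx_split d) -[cplx (Defs.ReM d)]scale1r; exact: extends_lin.
  by rewrite (conjd_split d) -[cplx (Defs.ReM d)]scale1r; exact: extends_lin.
have cd : Calpha_cmx k beta d.
  by apply/(Calpha_cmx_reg k b01) => i j; rewrite (ord1 j).
by split=> //; split; [exact: cd.1|rewrite -/(row _) cplx_ReM; exact: extends_lin
  |exact: cd.2|rewrite -/(row _) cplx_ImM; exact: extends_lin].
Qed.

Lemma EAC_cplx g : EA g -> EAC (cplx g).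
Proof. by move=> /EA_P[h1 h2]; apply/EAC_P; rewrite conjd_cplx. Qed.

Lemma reg_col_lin (a b : C) d d' : reg_col k beta d -> reg_col k beta d' ->
  reg_col k beta (a *: d + b *: d').
Proof.
move=> h h' l; apply: (eq_reg _ (regD (regZ a (h l)) (regZ b (h' l)))) => t.
by rewrite !fctE !mxE.
Qed.

Lemma conjd_lin (a b : C) d d' : conjd (a *: d + b *: d') = conjc a *: conjd d + conjc b *: conjd d'.
Proof.
apply/funext => z; apply/matrixP => i j; rewrite !fctE !mxE.
by rewrite rmorphD !rmorphM.
Qed.

Lemma zero_extends : extends_hol (row (0 : circle R -> 'cV[C]_m)).
Proof.
exists (fun=> 0); have -> : row (0 : circle R -> 'cV[C]_m) = fun=> 0.
  by apply/funext => z; rewrite /rowA -[_ z]/(0 : 'cV[C]_m) trmx0 mul0mx.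
exact: hol_extension_cst.
Qed.

Lemma zero_reg_col : reg_col k beta (0 : circle R -> 'cV[C]_m).
Proof. by move=> l; apply: (eq_reg _ (reg_tp q01 (tp0 _ 0))) => t; rewrite -[_ (expi t)]/(0 : 'cV[C]_m) mxE. Qed.

Lemma EAC_subspace : is_subspace EAC.
Proof.
split.
  apply/EAC_P; rewrite (_ : conjd 0 = 0); last first.
    by apply/funext => z; apply/matrixP => i j; rewrite !mxE conjc0.
  by split; [exact: zero_reg_col|exact: zero_extends|exact: zero_extends].
move=> a d d' /EAC_P[h1 h2 h3] /EAC_P[h4 h5 h6]; rewrite -[d']scale1r.
by apply/EAC_P; rewrite conjd_lin; split; [exact: reg_col_lin|exact: extends_lin|exact: extends_lin].
Qed.

Lemma cplx_lin (a : R) g g' : cplx (a *: g + g') = a%:C *: cplx g + cplx g'.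
Proof.
apply/funext => z; apply/matrixP => i j; rewrite !fctE !mxE.
by rewrite rmorphD rmorphM.
Qed.

Lemma EA_subspace : is_subspace EA.
Proof.
split.
  apply/EA_P; rewrite (_ : cplx 0 = 0); last by apply/funext => z; apply/matrixP => i j; rewrite !mxE.
  by split; [exact: zero_reg_col|exact: zero_extends].
move=> a g g' /EA_P[h1 h2] /EA_P[h3 h4]; apply/EA_P; rewrite cplx_lin -[cplx g']scale1r.
by split; [exact: reg_col_lin|exact: extends_lin].
Qed.

Lemma Psi_lin x (a : C) d d' : cabs x <= 1 -> EAC d -> EAC d' ->
  Psi A x (a *: d + d') = a *: Psi A x d + Psi A x d'.
Proof.
move=> x1 /EAC_P[_ h _] /EAC_P[_ h' _].
by have [_ <-] := hol_value_lin a x1 h h'; rewrite /Psi -rowA_lin.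
Qed.

(** The row of u d extends because of the zero at x. The row of its conjugate acquires the factor
    conj(u), itself the boundary value of a holomorphic function, so no zero is required there. *)
Lemma multiplier_EAC u x y d : multiplier N k beta u x y -> EAC d -> Psi A x d = 0 ->
  EAC (fun z => u z *: d z) /\ Psi A y (fun z => u z *: d z) = 0.
Proof.
move=> [ru u0 [F hF Fu] hu] /EAC_P[h1 h2 h3] Pd.
have rowu d' : row (fun z => u z *: d' z) = fun z => u z *: row d' z.
  by apply/funext => z; rewrite /rowA linearZ -scalemxAl.
have [e1 e2] := hu (row d) (reg_row_rowA b01 A_smooth h1) h2 Pd.
split; last by rewrite /Psi -[hol_value _ _]/(hol_value (row _) _) rowu.
apply/EAC_P; rewrite rowu; split=> //.
  by move=> l; apply: (eq_reg _ (regM q01 ru (h1 l))) => t; rewrite mxE.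
have [e3 _] := hol_value_scale c01 hF h3.
rewrite (_ : row _ = fun z => F (sval z) *: row (conjd d) z) //.
apply/funext => z; have [t ->] := circleP z.
rewrite sval_expi Fu /rowA /conjd; rewrite (_ : map_mx _ _ = conjc (u (expi t)) *: map_mx conjc (d (expi t))).
  by rewrite linearZ -scalemxAl.
by apply/matrixP => i j; rewrite !mxE rmorphM.
Qed.

(** The real multiplier |u|^2 is conj(u) times u: the factor u moves the zero as in
    [multiplier_EAC], and conj(u) is holomorphic inside. *)
Lemma multiplier_EA u x y g : cabs y <= 1 -> multiplier N k beta u x y -> EA g -> Psi A x (cplx g) = 0 ->
  EA (fun z => cabs (u z) ^+ 2 *: g z) /\ Psi A y (cplx (fun z => cabs (u z) ^+ 2 *: g z)) = 0.
Proof.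
move=> y1 mu gE Pg; have [ru u0 [F hF Fu] hu] := mu.
have [/EAC_P[h1 h2 h3] Pu] := multiplier_EAC mu (EAC_cplx gE) Pg.
have E : row (cplx (fun z => cabs (u z) ^+ 2 *: g z)) =
    fun z => F (sval z) *: row (fun z => u z *: cplx g z) z.
  apply/funext => z; have [t ->] := circleP z.
  rewrite sval_expi Fu /rowA scalemxAl -linearZ scalerA; congr (_^T *m _).
  by apply/matrixP => i j; rewrite !mxE rmorphM /= cabs_sqr [_ * conjc _]mulrC.
have [e1 e2] := hol_value_scale y1 hF h2.
split; last by rewrite /Psi -[hol_value _ _]/(hol_value (row _) _) E e2 -[hol_value _ _]/(Psi A y _) Pu scaler0.
apply/EA_P; rewrite E; split=> // l.
apply: (eq_reg _ (regM q01 (reg_conj q01 ru) (h1 l))) => t.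
by rewrite !mxE rmorphM /= cabs_sqr /=; ring.
Qed.

Lemma Psi_sum x n (a : 'I_n -> C) (e : 'I_n -> circle R -> 'cV[C]_m) : cabs x <= 1 ->
  (forall i, EAC (e i)) -> EAC (\sum_i a i *: e i) /\
  Psi A x (\sum_i a i *: e i) = \sum_i a i *: Psi A x (e i).
Proof.
move=> x1 eE; apply: (additive_sum EAC_subspace) => // b d d'; exact: Psi_lin.
Qed.

Lemma cplx_sum n (a : 'I_n -> R) (g : 'I_n -> circle R -> 'cV[R]_m) :
  cplx (\sum_i a i *: g i) = \sum_i (a i)%:C *: cplx (g i).
Proof.
have c0 : cplx (0 : circle R -> 'cV[R]_m) = 0.
  by apply/funext => z; apply/matrixP => i j; rewrite !mxE.
elim: n a g => [|n IH] a g; first by rewrite !big_ord0.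
by rewrite !big_ord_recl cplx_lin IH.
Qed.

Section Basis.
Context (n : nat) (g : 'I_n -> circle R -> 'cV[R]_m) (gB : is_basis EA g).

Let gE i : EA (g i).
Proof.
have [_ ->] := gB; exists (fun j => (j == i)%:R) => //.
by rewrite (bigD1 i) //= eqxx scale1r big1 ?addr0 // => j /negbTE ->; rewrite scale0r.
Qed.

Let gEC i : EAC (cplx (g i)). Proof. exact: EAC_cplx. Qed.

Lemma Psi_combination x (a : 'rV[C]_n) : cabs x <= 1 ->
  Psi A x (\sum_i a 0 i *: cplx (g i)) = a *m Pmx A g x.
Proof.
move=> x1; have [_ ->] := Psi_sum (fun i => a 0 i) x1 gEC.
by rewrite mulmx_sum_row; apply: eq_bigr => i _; rewrite rowK.
Qed.

Lemma Psi_real_combination x (a : 'rV[R]_n) : cabs x <= 1 ->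
  Psi A x (cplx (\sum_i a 0 i *: g i)) = map_mx (real_complex R) a *m Pmx A g x.
Proof.
move=> x1; rewrite -Psi_combination // cplx_sum; congr (Psi _ _ _).
by apply: eq_bigr => i _; rewrite mxE.
Qed.

Lemma complex_combination (a : 'I_n -> C) : \sum_i a i *: cplx (g i) =
  cplx (\sum_i complex.Re (a i) *: g i) + 'i%C *: cplx (\sum_i complex.Im (a i) *: g i).
Proof.
rewrite !cplx_sum scaler_sumr -big_split; apply: eq_bigr => i _ /=.
rewrite scalerA -scalerDl; congr (_ *: _).
by case: (a i) => b c; apply/eqP; rewrite eq_complex /=; apply/andP; split; apply/eqP; ring.
Qed.

Lemma cplx_free (a : 'I_n -> C) : \sum_i a i *: cplx (g i) = 0 -> forall i, a i = 0.
Proof.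
rewrite complex_combination; set X := \sum_i _; set Y := \sum_i _ => h.
have XY z : X z = 0 /\ Y z = 0.
  apply: mx_real_eq; rewrite !map_mx0 scaler0 addr0.
  by have := congr1 (fun f : circle R -> 'cV[C]_m => f z) h.
have X0 : X = 0 by apply/funext => z; have [] := XY z.
have Y0 : Y = 0 by apply/funext => z; have [] := XY z.
have [ind _] := gB; have h1 := ind _ X0; have h2 := ind _ Y0 => i.
by case: (a i) (h1 i) (h2 i) => b c /= -> ->.
Qed.

Lemma EAC_span d : EAC d <-> exists a : 'rV[C]_n, d = \sum_i a 0 i *: cplx (g i).
Proof.
split=> [[_ h1 h2]|[a ->]]; last by have [] := Psi_sum (fun i => a 0 i) c01 gEC.
have [_ gS] := gB; move: h1 h2; rewrite gS => -[a _ ha] [b _ hb].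
exists (\row_i (a i +i* b i)); rewrite complex_combination (cplx_split d) addrC -ha -hb.
by congr (cplx _ + 'i%C *: cplx _); apply: eq_bigr => i _; rewrite mxE.
Qed.

Lemma PsiEC_row x v : cabs x <= 1 -> PsiEC k beta A x v <-> (v <= Pmx A g x)%MS.
Proof.
move=> x1; split=> [[d /EAC_span[a ->] <-]|/submxP[a ->]].
  by rewrite Psi_combination // submxMl.
by exists (\sum_i a 0 i *: cplx (g i)); [apply/EAC_span; exists a|rewrite Psi_combination].
Qed.

Lemma real_coord_mul (a : 'rV[R]_n) (P : 'M[C]_(n, N)) :
  real_coord (map_mx (real_complex R) a *m P) = a *m realmx P.
Proof.
rewrite /real_coord /realmx mul_mx_row ReX_mulr; congr row_mx.
have := ReX_mulr a (- 'i%C *: P); rewrite -scalemxAr scaleNr raddfN /= mulI_Re opprK => ->.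
by rewrite scaleNr raddfN /= mulI_Re opprK.
Qed.

Lemma PsiE_row x v : cabs x <= 1 -> PsiE k beta A x v <-> (real_coord v <= realmx (Pmx A g x))%MS.
Proof.
move=> x1; have [_ gS] := gB; split=> [[h]|/submxP[a]].
  rewrite gS => -[a _ <-] <-.
  have -> : \sum_i a i *: g i = \sum_i (\row_j a j) 0 i *: g i by apply: eq_bigr => i _; rewrite mxE.
  by rewrite Psi_real_combination // real_coord_mul submxMl.
rewrite -real_coord_mul -Psi_real_combination // => /(can_inj (@real_coordK R N)) ->.
by exists (\sum_i a 0 i *: g i) => //; rewrite gS; exists (fun i => a 0 i).
Qed.

Lemma rank_Pmx_le u x y : cabs x <= 1 -> cabs y <= 1 -> multiplier N k beta u x y ->
  (\rank (Pmx A g y) <= \rank (Pmx A g x))%N.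
Proof.
move=> x1 y1 mu; have [_ u0 _ _] := mu.
apply: (@ker_rank_le _ _ _ _ (fun i => cplx (g i)) (fun d z => u z *: d z)).
- exact: cplx_free.
- by move=> a d d'; apply/funext => z; rewrite !fctE scalerDr !scalerA mulrC.
- move=> d h; apply/funext => z; have := congr1 (fun f : circle R -> 'cV[C]_m => f z) h => /eqP.
  by rewrite scaler_eq0 (negbTE (u0 z)) => /eqP.
move=> a ha; have aE : EAC (\sum_i a 0 i *: cplx (g i)) by apply/EAC_span; exists a.
have Pa : Psi A x (\sum_i a 0 i *: cplx (g i)) = 0 by rewrite Psi_combination.
have [/EAC_span[b hb] Pb] := multiplier_EAC mu aE Pa.
by exists b; rewrite // -Psi_combination // -hb.
Qed.

Lemma rank_realmx_le u x y : cabs x <= 1 -> cabs y <= 1 -> multiplier N k beta u x y ->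
  (\rank (realmx (Pmx A g y)) <= \rank (realmx (Pmx A g x)))%N.
Proof.
move=> x1 y1 mu; have [_ u0 _ _] := mu; have [ind gS] := gB.
have rc0 : real_coord (0 : 'rV[C]_N) = 0 by exact: (coordinates0 (@real_coord_linear R N)).
apply: (@ker_rank_le R _ (N + N) n g (fun (d : circle R -> 'cV[R]_m) z => cabs (u z) ^+ 2 *: d z)).
- exact: ind.
- by move=> a d d'; apply/funext => z; rewrite !fctE scalerDr !scalerA mulrC.
- move=> d h; apply/funext => z; have := congr1 (fun f : circle R -> 'cV[R]_m => f z) h => /eqP.
  rewrite scaler_eq0 expf_eq0 /= => /orP[/eqP /cabs_eq0 h0|/eqP //].
  by have := u0 z; rewrite h0 eqxx.
move=> a ha; have aE : EA (\sum_i a 0 i *: g i) by rewrite gS; exists (fun i => a 0 i).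
have Pa : Psi A x (cplx (\sum_i a 0 i *: g i)) = 0.
  rewrite Psi_real_combination //; apply: (can_inj (@real_coordK R N)).
  by rewrite real_coord_mul ha rc0.
have [] := multiplier_EA y1 mu aE Pa.
rewrite {1}gS => -[b _ hb] Pb.
have bE : \sum_i b i *: g i = \sum_i (\row_j b j) 0 i *: g i by apply: eq_bigr => i _; rewrite mxE.
exists (\row_j b j); last by rewrite -bE -hb.
by rewrite -real_coord_mul -Psi_real_combination // -bE hb Pb rc0.
Qed.

Lemma rank_Pmx x : cabs x < 1 -> \rank (Pmx A g x) = \rank (Pmx A g 0).
Proof.
move=> x1; apply/eqP; rewrite eqn_leq.
by rewrite (rank_Pmx_le c01 (ltW x1) (multiplier_up N k b01 x1)) (rank_Pmx_le (ltW x1) c01 (multiplier_down N k b01 x1)).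
Qed.

Lemma rank_realmx_Pmx x : cabs x < 1 -> \rank (realmx (Pmx A g x)) = \rank (realmx (Pmx A g 0)).
Proof.
move=> x1; apply/eqP; rewrite eqn_leq.
by rewrite (rank_realmx_le c01 (ltW x1) (multiplier_up N k b01 x1)) (rank_realmx_le (ltW x1) c01 (multiplier_down N k b01 x1)).
Qed.

Lemma annihilator_Pmx x (c : 'cV[C]_N) : cabs x <= 1 ->
  (forall h, EA h -> complex.Re ((Psi A x (cplx h) *m c) 0 0) = 0) <->
  map_mx (@complex.Re R) (Pmx A g x *m c) = 0.
Proof.
move=> x1; split=> [H|H h].
  apply/matrixP => i j; rewrite (ord1 j) !mxE -(H _ (gE i)) mxE.
  by congr complex.Re; apply: eq_bigr => l _; rewrite !mxE.
have [_ gS] := gB; rewrite gS => -[a _ <-].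
have -> : \sum_i a i *: g i = \sum_i (\row_j a j) 0 i *: g i by apply: eq_bigr => i _; rewrite mxE.
rewrite Psi_real_combination // -mulmxA.
have := ReX_mulr (\row_j a j) (Pmx A g x *m c); rewrite H mulmx0 => /matrixP /(_ 0 0).
by rewrite [LHS]mxE [RHS]mxE.
Qed.

End Basis.

(** If the value at 0 of the extension of g^t A vanishes, g^t A has only positive frequencies and g
    belongs to [RHker] with B = A; [RHker_finite] then detects g by finitely many pairings. The
    value at 0 and these pairings are the coordinates. *)
Lemma EA_basis :
  exists n (g : 'I_n -> circle R -> 'cV[R]_m), is_basis EA g.
Proof.
have [b [rb Ab]] : exists b : 'I_N -> 'I_m -> R -> C, (forall i j, reg q (b i j)) /\
    forall l j t, \sum_i A (expi t) l i * b i j t = (l == j)%:R.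
  apply: (matrix_right_inverse b01) => [t|i j]; first exact: A_rank.
  by have /(Calpha_cmx_reg k b01) := A_smooth; apply.
have rA i j : reg q (fun t => A (expi t) i j).
  by have /(Calpha_cmx_reg k b01) := A_smooth; apply.
have q'01 : 0 < (1 + q) / 2 < 1 by case/andP: q01 => ? ?; apply/andP; split; lra.
have qq' : q < (1 + q) / 2 by case/andP: q01 => ? ?; lra.
have [I [e [re reale dete]]] := RHker_finite q01 q'01 qq' rA rb Ab.
pose ga g : 'I_m -> R -> C := fun l t => cplx g (expi t) l 0.
pose T g : 'rV[R]_((N + N) + (#|I| + #|I|)) :=
  row_mx (real_coord (Psi A 0 (cplx g))) (real_coord (\row_i pair (ga g) (e (enum_val i)))).
apply: (@basis_of_coordinates _ _ _ _ T); first exact: EA_subspace.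
  move=> a g h gE hE; rewrite /T scale_row_mx add_row_mx cplx_lin (Psi_lin _ c01 (EAC_cplx gE) (EAC_cplx hE)).
  congr row_mx; first exact: real_coord_linear.
  have /EA_P[rg _] := gE; have /EA_P[rh _] := hE.
  rewrite -[RHS](real_coord_linear a); congr real_coord; apply/rowP => i; rewrite !mxE.
  rewrite /pair mulr_sumr -big_split; apply: eq_bigr => l' _ /=.
  rewrite -coefZ -?coefD; first last.
  - by apply: tlimM; [exact: reg_tlim (rg l')|exact: reg_tlim (re _ l')].
  - by apply: tlimM; [exact: reg_tlim (rh l')|exact: reg_tlim (re _ l')].
  - by apply: tlimZ; apply: tlimM; [exact: reg_tlim (rg l')|exact: reg_tlim (re _ l')].
  by congr coef; apply/funext => t; rewrite /ga cplx_lin !fctE !mxE; ring.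
move=> g gE; rewrite /T -row_mx0 => /eq_row_mx[P0 e0].
have /EA_P[rg eg] := gE.
have rc0 p : real_coord (0 : 'rV[C]_p) = 0 by exact: (coordinates0 (@real_coord_linear R p)).
have {}P0 : Psi A 0 (cplx g) = 0.
  by apply: (can_inj (@real_coordK R N)); rewrite P0 rc0.
have {}e0 i : pair (ga g) (e i) = 0.
  have : (\row_i pair (ga g) (e (enum_val i)) : 'rV[C]_#|I|) = 0.
    by apply: (can_inj (@real_coordK R #|I|)); rewrite e0 rc0.
  by move=> /rowP /(_ (enum_rank i)); rewrite !mxE enum_rankK.
have ker : RHker q (fun i j t => A (expi t) i j) (ga g).
  split=> [|l' t|i j j0]; first exact: rg.
    by rewrite /ga /cplx mxE; apply/eqP; rewrite eq_complex /= oppr0 !eqxx.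
  rewrite (_ : (fun t => _) = fun t => row (cplx g) (expi t) 0 i); last first.
    by apply/funext => t; rewrite rowAE.
  rewrite coef_of_extends //; last by apply: (reg_tlim (reg_row_rowA b01 A_smooth rg i)).
  by rewrite -[hol_value _ _]/(Psi A 0 (cplx g)) P0 mxE mulr0.
have h := dete _ ker e0.
apply/funext => z; have [t ->] := circleP z; apply/matrixP => i j; rewrite (ord1 j).
by have := h i t; rewrite /ga /cplx mxE => /complexI ->; rewrite mxE.
Qed.

End AnnihilatorSpaces.

Unset Implicit Arguments.

Theorem theorem4p1 (R : realType) (m N k : nat) (beta : R)
    (m_ge1 : (1 <= m)%N) (m_leN : (m <= N)%N)
    (beta_bounds : 2^-1 < beta < 1)
    (A : circle R -> 'M[R[i]]_(m, N))
    (A_smooth : Calpha_cmx k beta A)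
    (A_rank : forall z : circle R, \rank (A z) = m)
    (l r : nat)
    (l_def : real_dim (PsiE k beta A 0) l)
    (r_def : has_dim (PsiEC k beta A 0) r)
    (x : R[i]) (x_in : `|x| < 1) :
  let W := Wset k beta A x in
  [/\ W = [set c | forall g, EA k beta A g ->
                     complex.Re ((Psi A x (cplx g) *m c) 0 0) = 0],
      forall (d : nat) (g : 'I_d -> circle R -> 'cV[R]_m),
        is_basis (EA k beta A) g ->
        W = [set c | map_mx (@complex.Re R) (Pmx A g x *m c) = 0] /\
        W `&` imul W = [set c | Pmx A g x *m c = 0],
      real_codim W l,
      has_codim (W `&` imul W) r
    & (r <= l)%N /\ has_codim (sumset W (imul W)) (l - r)].
Proof.
move=> W; have b01 : 0 < beta < 1 by case/andP: beta_bounds => ? ?; apply/andP; split; lra.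
have x1 : cabs x < 1 by rewrite -(cabs_lt x 1).
have xle := ltW x1; have c01 : cabs (0 : R[i]) <= 1 by rewrite cabs0.
have WE := WsetE b01 A_smooth A_rank x1.
have WP n (g : 'I_n -> circle R -> 'cV[R]_m) : is_basis (EA k beta A) g ->
    W = [set c | map_mx (@complex.Re R) (Pmx A g x *m c) = 0].
  move=> gB; rewrite /W WE; apply/seteqP.
  by split=> c /=; have [h1 h2] := annihilator_Pmx b01 gB c xle.
have [n [g gB]] := EA_basis b01 A_smooth A_rank.
(* The numbers l and r are defined at 0 and identified there with ranks; the multipliers carry these
   ranks to x. *)
have rkl : \rank (realmx (Pmx A g x)) = l.
  rewrite (rank_realmx_Pmx b01 A_smooth gB x1).
  apply: (has_dim_rank (@real_coord_linear R N) (@real_coordK R N) (@of_real_coordK R N) _ l_def).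
  by move=> v; exact: (PsiE_row b01 gB v c01).
have rkr : \rank (Pmx A g x) = r.
  rewrite (rank_Pmx b01 A_smooth gB x1).
  apply: (@has_dim_rank _ 'rV[R[i]]_N N id id _ (fun=> erefl) (fun=> erefl) _ _ _ _ _ r_def) => //.
  by move=> v; exact: (PsiEC_row b01 gB v c01).
split.
- exact: WE.
- by move=> d h hB; rewrite (WP _ _ hB); split=> //; exact: W_imul.
- by rewrite (WP _ _ gB) -rkl; exact: real_codim_Re0.
- by rewrite (WP _ _ gB) W_imul -rkr; exact: codim_ker.
- by rewrite (WP _ _ gB) -rkl -rkr; exact: codim_sumset.
Qed.
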